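(* Let $\Gamma\subseteq\partial\Omega$, let $r>0$ be arbitrary sufficiently small, and let $\omega_r=D_r\cap\Omega_2$, where $$D_r=\bigcup_{z\in\Gamma}B(z,r),\qquad \Omega_2=\bigcup_{z_b\in H^{1/2}(\Gamma)}\mathrm{Supp}\,(Tp_\Gamma^*z_b).$$ If the system $${}_0D_t^{\alpha}z(t)=Az(t)+Bu(t),\ t\in[0,b],\qquad \lim_{t\to0^+}{}_0I_t^{1-\alpha}z(t)=z_0,$$ is exactly (respectively, approximately) regionally controllable on $\omega_r$ at time $b$, then it is also exactly (respectively, approximately) regionally boundary controllable on $\Gamma$ at time $b$.
   Context: Setting: $\Omega\subseteq\mathbf{R}^n$ is an open bounded set with smooth boundary $\partial\Omega$, $b>0$, $\alpha\in(0,1]$, $p\in\mathbf{N}$, $Z:=H^1(\Omega)$. The operator $A$ generates a strongly continuous semigroup $\{\Phi(t)\}_{t\ge0}$ on $Z$. $z_0\in Z$, $B:\mathbf{R}^p\to Z$ is the (linear) control operator, $u\in L^2(0,b;\mathbf{R}^p)$. The Riemann–Liouville integral and derivative are ${}_0I_t^{\alpha}z(t)=\frac1{\Gamma(\alpha)}\int_0^t(t-s)^{\alpha-1}z(s)\,ds$ ($\alpha>0$) and ${}_0D_t^{\alpha}z(t)=\frac{d}{dt}{}_0I_t^{1-\alpha}z(t)$ ($\alpha\in(0,1]$), where $\Gamma(\cdot)$ with a numerical argument is the Gamma function. Mild solution: the state $z(\cdot,u)$ is by definition $$z(t,u)=K_\alpha(t)z_0+\int_0^t(t-s)^{\alpha-1}K_\alpha(t-s)Bu(s)\,ds,\qquad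 K_\alpha(t)=\alpha\int_0^\infty\theta\phi_\alpha(\theta)\Phi(t^\alpha\theta)\,d\theta,$$ with $\phi_\alpha(\theta)=\frac1\alpha\theta^{-1-1/\alpha}\psi_\alpha(\theta^{-1/\alpha})$ and $\psi_\alpha(\theta)=\frac1\pi\sum_{n=1}^\infty(-1)^{n-1}\theta^{-\alpha n-1}\frac{\Gamma(n\alpha+1)}{n!}\sin(n\pi\alpha)$, $\theta>0$ (for $\alpha=1$, $K_1(t)=\Phi(t)$). It is assumed that $z(b,u)\in Z$. $\gamma:H^1(\Omega)\to H^{1/2}(\partial\Omega)$ is the trace operator of order zero (linear, continuous, surjective); $p_\Gamma:H^{1/2}(\partial\Omega)\to H^{1/2}(\Gamma)$ is restriction, $p_\Gamma z=z|_\Gamma$; for $\bar z\in H^{1/2}(\Gamma)$, $p_\Gamma^*\bar z$ is its extension equal to $\bar z$ on $\Gamma$ and $0$ on $\partial\Omega\setminus\Gamma$, taken to be an element of $H^{1/2}(\partial\Omega)$. $T:H^{1/2}(\partial\Omega)\to H^1(\Omega)$ is a linear continuous operator with $\gamma Tg=g$ for all $g\in H^{1/2}(\partial\Omega)$. $B(z,r)$ is the ball of radius $r$ centred at $z$. For a region $\omega\subseteq\Omega$ of positive Lebesgue measure, $p_\omega:H^1(\Omega)\to H^1(\omega)$ is the restriction map. Definitions: the system is exactly (respectively, approximately) regionally controllable on $\omega$ at time $b$ if for every $y_b\in H^1(\omega)$ (and every $\varepsilon>0$) there exists $u\in L^2(0,b;\mathbf{R}^p)$ such that $p_\omega z(b,u)=y_b$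 (respectively, $\|p_\omega z(b,u)-y_b\|_{H^1(\omega)}\le\varepsilon$). It is exactly (respectively, approximately) regionally boundary controllable on $\Gamma$ at time $b$ if for every $z_b\in H^{1/2}(\Gamma)$ (and every $\varepsilon>0$) there exists $u\in L^2(0,b;\mathbf{R}^p)$ such that $p_\Gamma(\gamma z(b,u))=z_b$ (respectively, $\|p_\Gamma(\gamma z(b,u))-z_b\|_{H^{1/2}(\Gamma)}\le\varepsilon$). *)

(* Defs.v *)
From HB Require Import structures.
From mathcomp Require Import all_boot all_order all_algebra.
From mathcomp Require Import all_classical all_reals all_analysis.
Set Implicit Arguments.
Unset Strict Implicit.
Unset Printing Implicit Defensive.

Import Order.TTheory GRing.Theory Num.Theory numFieldNormedType.Exports.
Local Open Scope classical_set_scope. Local Open Scope ring_scope.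

(* R^n is 'rV[R]_n, whose topology is that of the sup norm; the Euclidean norm is
   [enorm]. The sigma-algebra is the one generated by the coordinates. *)
Section measurable_row.
Context {d : measure_display} {T : sigmaRingType d} (n : nat).
Let coord (i : 'I_n) (x : 'rV[T]_n) : T := x ord0 i.
HB.instance Definition _ :=
  @isMeasurable.Build (measure_tuple_display d) 'rV[T]_n
    (g_sigma_preimage coord) (@sigma_algebra0 _ _ _) (@sigma_algebraC _ _ )
    (@sigma_algebra_bigcup _ _ _).

Lemma measurable_row_coord (i : 'I_n) :
  measurable_fun [set: 'rV[T]_n] (fun x : 'rV[T]_n => x ord0 i).
Proof.
move=> _ Y mY; rewrite setTI; apply: sub_sigma_algebra => /=.
rewrite -bigcup_seq/=; exists i => /=; first by rewrite mem_index_enum.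
by exists Y => //; rewrite setTI.
Qed.

Lemma measurable_row d' (S : measurableType d') (f : S -> 'rV[T]_n) :
  (forall i, measurable_fun [set: S] (fun s => f s ord0 i)) ->
  measurable_fun [set: S] f.
Proof.
move=> mf _ Y mY; rewrite setTI.
have : preimage_set_system [set: S] f (g_sigma_preimage coord) `<=` measurable.
  rewrite -g_sigma_preimage_comp; apply: smallest_sub.
    exact: sigma_algebra_measurable.
  rewrite -bigcup_seq/=; apply: bigcup_sub => i _ A [B mB <-].
  by apply: mf.
by apply; exists Y => //; rewrite setTI.
Qed.
End measurable_row.

Section lebesgue_row.
Context {R : realType}.

Section step.
Variables (n : nat) (mu : {sigma_finite_measure set 'rV[R]_n -> \bar R}).
Definition row_cons (p : measurableTypeR R * 'rV[R]_n) : 'rV[R]_n.+1 :=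
  row_mx (p.1%:M : 'M[R]_1) p.2.

Lemma measurable_row_cons : measurable_fun [set: measurableTypeR R * 'rV[R]_n] row_cons.
Proof.
apply: measurable_row => i; rewrite /row_cons.
case: (split_ordP (i : 'I_(1 + n))) => j ->.
  rewrite (_ : (fun _ => _) = fst); first exact: measurable_fst.
  apply/funext => p; apply: etrans (row_mxEl _ _ _ _) _.
  by rewrite mxE (ord1 j) eqxx mulr1n.
rewrite (_ : (fun _ => _) = fun p : R * 'rV[R]_n => p.2 ord0 j).
  exact: (measurableT_comp (measurable_row_coord j) measurable_snd).
by apply/funext => p; apply: etrans (row_mxEr _ _ _ _) _.
Qed.

Definition lebesgue_step : set 'rV[R]_n.+1 -> \bar R :=
  pushforward (lebesgue_measure \x mu)%E row_cons.

Let step0 : lebesgue_step set0 = 0%E.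
Proof. by rewrite /lebesgue_step /pushforward preimage_set0 measure0. Qed.
Let step_ge0 A : (0 <= lebesgue_step A)%E.
Proof. by rewrite /lebesgue_step /pushforward measure_ge0. Qed.
Let step_sigma_additive : semi_sigma_additive lebesgue_step.
Proof.
have mpre A : measurable A -> measurable (row_cons @^-1` A).
  by move=> mA; rewrite -[X in measurable X]setTI; exact: measurable_row_cons.
move=> F mF tF mUF; rewrite /lebesgue_step /pushforward preimage_bigcup.
apply: measure_semi_sigma_additive => [k||].
- exact: mpre.
- apply/trivIsetP => /= i j _ _ ij; rewrite -preimage_setI.
  by move/trivIsetP : tF => /(_ _ _ _ _ ij) ->//; rewrite preimage_set0.
- by rewrite -preimage_bigcup; exact: mpre.
Qed.
HB.instance Definition _ := isMeasure.Build _ _ _ lebesgue_step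
  step0 step_ge0 step_sigma_additive.

Let uncons (x : 'rV[R]_n.+1) : measurableTypeR R * 'rV[R]_n :=
  (x ord0 ord0, rsubmx (x : 'rV[R]_(1 + n))).
Let measurable_uncons : measurable_fun [set: 'rV[R]_n.+1] uncons.
Proof.
apply/measurable_fun_pairP; split => /=.
  exact: measurable_row_coord.
apply: measurable_row => i /=; rewrite /uncons/=.
under eq_fun do rewrite mxE.
exact: measurable_row_coord.
Qed.
Let row_consK : cancel row_cons uncons.
Proof.
move=> [a v]; rewrite /uncons /row_cons/= row_mxKr; congr pair.
rewrite (_ : ord0 = lshift n ord0 :> 'I_(1 + n)); last exact/val_inj.
by apply: etrans (row_mxEl _ _ _ _) _; rewrite mxE eqxx.
Qed.

Let sigma_finite_step : sigma_finite setT lebesgue_step.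
Proof.
have /sigma_finiteP[F [TF ndF Foo]] :=
  sigma_finiteT (@lebesgue_measure R : {sigma_finite_measure set _ -> \bar R}).
have /sigma_finiteP[G [TG ndG Goo]] := sigma_finiteT mu.
exists (fun k => uncons @^-1` (F k `*` G k)) => [|k].
  rewrite -preimage_bigcup -[LHS](preimage_setT uncons); congr (_ @^-1` _).
  rewrite -setXTT TF TG predeqE => -[x y]; split.
    move=> [/= [i _ Fix_] [k _ Gky]]; exists (maxn i k) => //; split.
    - by move: x Fix_; exact/subsetPset/ndF/leq_maxl.
    - by move: y Gky; exact/subsetPset/ndG/leq_maxr.
  by move=> [i _ []/= ? ?]; split; exists i.
have [mF Fk] := Foo k; have [mG Gk] := Goo k; split.
  rewrite -[X in measurable X]setTI.
  by apply: measurable_uncons => //; exact: measurableX.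
rewrite /lebesgue_step /pushforward.
rewrite (_ : _ @^-1` _ = F k `*` G k); last first.
  apply/seteqP; split => p; first by move=> h; rewrite -(row_consK p).
  by move=> h; rewrite -(row_consK p) in h.
by rewrite product_measure1E// lte_mul_pinfty// ge0_fin_numE.
Qed.
HB.instance Definition _ := Measure_isSigmaFinite.Build _ _ _ lebesgue_step
  sigma_finite_step.
End step.

Fixpoint lebesgue_row (n : nat) : {sigma_finite_measure set 'rV[R]_n -> \bar R} :=
  if n is m.+1 then lebesgue_step (lebesgue_row m) else \d_(0 : 'rV[R]_0).
End lebesgue_row.

Section hausdorff.
Context {R : realType}.
Local Open Scope ereal_scope.

Section cover_outer.
Variables (T : pointedType) (c : set T -> \bar R).
Hypotheses (c0 : c set0 = 0) (c_ge0 : forall A, 0 <= c A).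

Definition cover_outer (X : set T) : \bar R :=
  ereal_inf [set \sum_(k <oo) c (F k) |
             F in [set F : (set T)^nat | X `<=` \bigcup_k F k]].

Let cover_outerE X :
  cover_outer X = @mu_ext _ (g_sigma_algebraType [set: set T]) R c X.
Proof.
congr ereal_inf; congr image; apply/seteqP; split => F /=; last by case.
by move=> XF; split => // i; exact: sub_sigma_algebra.
Qed.

Lemma cover_outer0 : cover_outer set0 = 0.
Proof. by rewrite cover_outerE; exact: (@mu_ext0 _ (g_sigma_algebraType [set: set T]) R c). Qed.

Lemma cover_outer_ge0 X : 0 <= cover_outer X.
Proof. by rewrite cover_outerE; exact: (@mu_ext_ge0 _ (g_sigma_algebraType [set: set T]) R c). Qed.

Lemma le_cover_outer : {homo cover_outer : A B / A `<=` B >-> A <= B}.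
Proof. by move=> A B AB; rewrite !cover_outerE; exact: le_mu_ext. Qed.

Lemma cover_outer_sigma_subadditive : sigma_subadditive cover_outer.
Proof.
have -> : cover_outer = @mu_ext _ (g_sigma_algebraType [set: set T]) R c.
  exact/funext/cover_outerE.
exact: (@mu_ext_sigma_subadditive _ (g_sigma_algebraType [set: set T]) R c).
Qed.
End cover_outer.

Definition gamma_fun (x : R) : R :=
  (\int[lebesgue_measure]_(t in `]0, +oo[) (t `^ (x - 1) * expR (- t)))%R.

Definition enorm (n : nat) (x : 'rV[R]_n) : R :=
  Num.sqrt (\sum_(i < n) (x ord0 i) ^+ 2)%R.

Variable n : nat.
Implicit Type A : set 'rV[R]_n.

Definition ediam A : \bar R :=
  ereal_sup [set (enorm (x - y))%:E | x in A & y in A].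

(* the volume of the unit ball of R^s, so that [hausdorff (n - 1)] is the surface
   area on a smooth hypersurface of R^n *)
Definition hausdorff_const (s : nat) : R :=
  (pi `^ (s%:R / 2) / gamma_fun (s%:R / 2 + 1))%R.

Definition hausdorff_cost (s : nat) (delta : R) A : \bar R :=
  if A == set0 then 0
  else if ediam A <= delta%:E
  then (hausdorff_const s * (fine (ediam A) / 2) ^+ s)%:E
  else +oo.

Lemma hausdorff_cost0 s delta : hausdorff_cost s delta set0 = 0.
Proof. by rewrite /hausdorff_cost eqxx. Qed.

Lemma hausdorff_cost_ge0 s delta A : 0 <= hausdorff_cost s delta A.
Proof.
rewrite /hausdorff_cost; case: ifPn => // /set0P[x Ax]; case: ifPn => // _.
rewrite lee_fin mulr_ge0//.
  rewrite divr_ge0 ?powR_ge0//; apply: fine_ge0; apply: integral_ge0 => t _.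
  by rewrite lee_fin mulr_ge0 ?powR_ge0 ?expR_ge0.
rewrite exprn_ge0// divr_ge0//; apply: fine_ge0.
apply: le_trans (ereal_sup_ubound _) => /=; last first.
  by exists x => //; exists x.
by rewrite lee_fin sqrtr_ge0.
Qed.

Definition hausdorff (s : nat) A : \bar R :=
  ereal_sup [set cover_outer (hausdorff_cost s delta) A |
             delta in [set delta : R | (0 < delta)%R]].

Let hausdorff0 s : hausdorff s set0 = 0.
Proof.
apply/eqP; rewrite eq_le; apply/andP; split.
  apply: ge_ereal_sup => _ [delta _ <-].
  rewrite cover_outer0//; first exact: hausdorff_cost0.
  exact: hausdorff_cost_ge0.
apply: le_trans (ereal_sup_ubound _) => /=; last by exists 1%R.
exact/cover_outer_ge0/hausdorff_cost_ge0.
Qed.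

Let hausdorff_ge0 s A : 0 <= hausdorff s A.
Proof.
apply: le_trans (ereal_sup_ubound _) => /=; last by exists 1%R.
exact/cover_outer_ge0/hausdorff_cost_ge0.
Qed.

Let le_hausdorff s : {homo hausdorff s : A B / A `<=` B >-> A <= B}.
Proof.
move=> A B AB; apply: ge_ereal_sup => _ [delta d0 <-].
apply: le_trans (ereal_sup_ubound _) => /=; last by exists delta.
exact: le_cover_outer.
Qed.

Let hausdorff_sigma_subadditive s : sigma_subadditive (hausdorff s).
Proof.
move=> F; apply: ge_ereal_sup => _ [delta d0 <-].
apply: le_trans.
  by apply: cover_outer_sigma_subadditive; exact: hausdorff_cost_ge0.
apply: lee_nneseries => [k _|k _].
  by move=> _; exact/cover_outer_ge0/hausdorff_cost_ge0.
by apply: ereal_sup_ubound; exists delta.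
Qed.

HB.instance Definition _ (s : nat) := isOuterMeasure.Build R 'rV[R]_n
  (hausdorff s) (hausdorff0 s) (hausdorff_ge0 s) (@le_hausdorff s)
  (@hausdorff_sigma_subadditive s).
End hausdorff.

Section surface.
Context {R : realType} (n : nat).
(* Measurability for the surface measure is Caratheodory measurability. *)
Definition surface_outer : {outer_measure set 'rV[R]_n -> \bar R} :=
  @hausdorff R n n.-1.
Definition surface_space := caratheodory_type surface_outer.
HB.instance Definition _ := Measurable.on surface_space.
Definition surface_measure : {measure set surface_space -> \bar R} :=
  (surface_outer : set (caratheodory_type surface_outer) -> \bar R).
End surface.

Section spaces.
Context {R : realType}.

(* A seminormed space of representatives: the normed space meant is the
   quotient of [snspace_set] by the vectors of seminorm zero, so that a Sobolev
   space is a set of functions and equality in it is [eqn]. *)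
Record snspace (V : lmodType R) := SNSpace {
  snspace_set :> V -> Prop ;
  snorm : V -> R }.

Definition eqn (V : lmodType R) (X : snspace V) (x y : V) : Prop :=
  X (x - y) /\ snorm X (x - y) = 0.

Definition linear_op (V W : lmodType R) (X : snspace V) (Y : snspace W)
    (F : V -> W) : Prop :=
  (forall x, X x -> Y (F x)) /\
  (forall (a : R) x y, X x -> X y -> eqn Y (F (a *: x + y)) (a *: F x + F y)).

Definition bounded_linear_op (V W : lmodType R) (X : snspace V)
    (Y : snspace W) (F : V -> W) : Prop :=
  linear_op X Y F /\
  exists C : R, forall x, X x -> snorm Y (F x) <= C * snorm X x.

Definition euclidean (p : nat) : snspace 'rV[R]_p :=
  SNSpace setT (@enorm R p).

Section bochner.
Variables (V : lmodType R) (X : snspace V) (D : set R).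

(* the simple function \sum_i 1_(simple_set i) * simple_val i *)
Record simple_fun := SimpleFun {
  simple_size : nat ;
  simple_set : 'I_simple_size -> set R ;
  simple_val : 'I_simple_size -> V }.
Arguments simple_set : clear implicits.
Arguments simple_val : clear implicits.

Definition is_simple (S : simple_fun) : Prop :=
  forall i, [/\ measurable (simple_set S i),
    (lebesgue_measure (simple_set S i `&` D) < +oo)%E & X (simple_val S i)].

Definition simple_eval (S : simple_fun) (t : R) : V :=
  \sum_(i < simple_size S) \1_(simple_set S i) t *: simple_val S i.

Definition simple_integral (S : simple_fun) : V :=
  \sum_(i < simple_size S)
    fine (lebesgue_measure (simple_set S i `&` D)) *: simple_val S i.

Definition is_bochner_integral (F : R -> V) (I : V) : Prop :=
  [/\ forall t, D t -> X (F t), X I &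
    exists S : nat -> simple_fun,
      [/\ forall k, is_simple (S k),
          forall k, measurable_fun D (fun t => snorm X (F t - simple_eval (S k) t)),
          (\int[lebesgue_measure]_(t in D)
             (snorm X (F t - simple_eval (S k) t))%:E)%E @[k --> \oo] --> 0%E &
          snorm X (I - simple_integral (S k)) @[k --> \oo] --> 0]].
End bochner.

Section semigroup.
Variables (V : lmodType R) (Z : snspace V).

Definition c0_semigroup (Phi : R -> V -> V) : Prop :=
  [/\ forall t, 0 <= t -> bounded_linear_op Z Z (Phi t),
      forall x, Z x -> eqn Z (Phi 0 x) x,
      forall s t x, 0 <= s -> 0 <= t -> Z x ->
        eqn Z (Phi (s + t) x) (Phi s (Phi t x)) &
      forall x, Z x -> snorm Z (Phi t x - x) @[t --> 0^'+] --> 0].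

(* [domA] is the domain of the unbounded operator [A]. *)
Definition is_generator (domA : set V) (A : V -> V) (Phi : R -> V -> V) : Prop :=
  (forall x, domA x -> Z x /\ Z (A x) /\
     snorm Z (h^-1 *: (Phi h x - x) - A x) @[h --> 0^'+] --> 0) /\
  (forall x y, Z x -> Z y ->
     snorm Z (h^-1 *: (Phi h x - x) - y) @[h --> 0^'+] --> 0 -> domA x).

(* the index of the series is m = k + 1 *)
Definition psi_alpha (alpha theta : R) : R :=
  pi^-1 * limn (series (fun k : nat => let m : R := k.+1%:R in
    (-1) ^+ k * theta `^ (- alpha * m - 1)
      * (gamma_fun (m * alpha + 1) / (k.+1)`!%:R) * sin (m * pi * alpha))).

Definition phi_alpha (alpha theta : R) : R :=
  alpha^-1 * theta `^ (- 1 - alpha^-1) * psi_alpha alpha (theta `^ (- alpha^-1)).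

(* [K t] is K_alpha(t) *)
Definition is_fractional_family (alpha : R) (Phi K : R -> V -> V) : Prop :=
  forall t x, 0 <= t -> Z x ->
    if alpha == 1 then eqn Z (K t x) (Phi t x)
    else exists2 J, is_bochner_integral Z `]0, +oo[
           (fun theta => (theta * phi_alpha alpha theta) *: Phi (t `^ alpha * theta) x) J
         & eqn Z (K t x) (alpha *: J).

Variable p : nat.

Definition L2_control (b : R) (u : R -> 'rV[R]_p) : Prop :=
  measurable_fun `[0, b] u /\
  (\int[lebesgue_measure]_(s in `[0%R, b]) (enorm (u s) ^+ 2)%:E < +oo)%E.

(* [z] is the value at time [t] of the mild solution of the system
   0D^alpha z = A z + B u, lim_(t -> 0+) 0I^(1 - alpha) z(t) = z0;
   the operator A enters through K only. *)
Definition mild_state (alpha : R) (K : R -> V -> V) (B : 'rV[R]_p -> V) (z0 : V)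
    (u : R -> 'rV[R]_p) (t : R) (z : V) : Prop :=
  Z z /\
  exists2 J, is_bochner_integral Z `]0, t[
      (fun s => (t - s) `^ (alpha - 1) *: K (t - s) (B (u s))) J
    & eqn Z z (K t z0 + J).
End semigroup.

Variable n : nat.
Local Notation pt := 'rV[R]_n.
Implicit Types (Om om Gam E : set pt) (u v w g : pt -> R).

Definition partial (i : 'I_n) (f : pt -> R) : pt -> R := fun x => 'D_('e_i) f x.

Definition smooth (f : pt -> R) : Prop :=
  forall s : seq 'I_n, let g := foldr partial f s in
    continuous g /\ forall i x, derivable g x 'e_i.

Definition test_function Om (phi : pt -> R) : Prop :=
  [/\ smooth phi, compact (closure [set x | phi x != 0]) &
      closure [set x | phi x != 0] `<=` Om].

Definition eball (x : pt) (r : R) : set pt := [set y | enorm (y - x) < r].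

Definition boundary Om : set pt := closure Om `\` Om°.

(* Near each boundary point, up to the choice of a coordinate [i] and of its
   orientation, [Om] is the set of points strictly above the graph of a smooth
   function of the other coordinates. *)
Definition smooth_boundary Om : Prop :=
  forall x0, boundary Om x0 ->
  exists (r : R) (i : 'I_n) (sgn : bool) (zeta : pt -> R),
    [/\ 0 < r, smooth zeta,
        forall x (t : R), zeta (x + t *: 'e_i) = zeta x &
        forall x, eball x0 r x -> (Om x <-> zeta x < (-1) ^+ sgn * x ord0 i)].

Definition L2 Om u : Prop :=
  measurable_fun Om u /\
  (\int[@lebesgue_row R n]_(x in Om) (u x ^+ 2)%:E < +oo)%E.

Definition is_weak_partial Om (i : 'I_n) u w : Prop :=
  forall phi, test_function Om phi ->
    \int[@lebesgue_row R n]_(x in Om) (u x * partial i phi x) =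
    - \int[@lebesgue_row R n]_(x in Om) (w x * phi x).

Definition weak_partial Om (i : 'I_n) u : pt -> R :=
  get [set w | L2 Om w /\ is_weak_partial Om i u w].

(* H^1 of an open set; the values of the functions outside it are irrelevant. *)
Definition H1 Om : snspace (pt -> R) :=
  SNSpace
    [set u | L2 Om u /\ forall i, exists w, L2 Om w /\ is_weak_partial Om i u w]
    (fun u => Num.sqrt (\int[@lebesgue_row R n]_(x in Om) (u x ^+ 2) +
       \sum_(i < n) \int[@lebesgue_row R n]_(x in Om) (weak_partial Om i u x ^+ 2))).

(* H^(1/2) of a measurable subset E of an (n-1)-dimensional hypersurface, with
   the Sobolev-Slobodeckij norm: the exponent of |x - y| is (n-1) + 2 * (1/2). *)
Definition slobodeckij E g : \bar R :=
  (\int[@surface_measure R n]_(x in E) \int[@surface_measure R n]_(y in E)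
     (`|g x - g y| ^+ 2 / enorm (x - y) ^+ n)%:E)%E.

Definition Hhalf E : snspace (pt -> R) :=
  SNSpace
    [set g | [/\ measurable_fun (E : set (@surface_space R n))
                   (g : @surface_space R n -> R),
                 (\int[@surface_measure R n]_(x in E) (g x ^+ 2)%:E < +oo)%E &
                 (slobodeckij E g < +oo)%E]]
    (fun g => Num.sqrt (\int[@surface_measure R n]_(x in E) (g x ^+ 2) +
                        fine (slobodeckij E g))).

(* The restriction maps p_om and p_Gam and the extension by zero p_Gam^* all
   act on representatives as f |-> f on the set, 0 elsewhere. *)
Definition p_restr E (f : pt -> R) : pt -> R := f \_ E.
Definition p_ext0 E (f : pt -> R) : pt -> R := f \_ E.

(* The trace of order zero: the continuous linear map which is the restriction
   to the boundary on the functions of H^1 continuous up to the boundary. *)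
Definition is_trace Om (gamma : (pt -> R) -> pt -> R) : Prop :=
  [/\ bounded_linear_op (H1 Om) (Hhalf (boundary Om)) gamma,
      (forall g, Hhalf (boundary Om) g ->
         exists2 u, H1 Om u & eqn (Hhalf (boundary Om)) (gamma u) g) &
      forall u, H1 Om u -> {within closure Om, continuous u} ->
        eqn (Hhalf (boundary Om)) (gamma u) u].

Definition is_trace_lifting Om (gamma T : (pt -> R) -> pt -> R) : Prop :=
  bounded_linear_op (Hhalf (boundary Om)) (H1 Om) T /\
  forall g, Hhalf (boundary Om) g -> eqn (Hhalf (boundary Om)) (gamma (T g)) g.

(* the points of Om having no neighbourhood on which u vanishes a.e. *)
Definition Supp Om u : set pt :=
  [set x | Om x /\ forall U, open U -> U x ->
     ~ {ae @lebesgue_row R n, forall y, (U `&` Om) y -> u y = 0}].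

Definition D_r Gam (r : R) : set pt := \bigcup_(z in Gam) eball z r.

Definition Omega_2 Om Gam (T : (pt -> R) -> pt -> R) : set pt :=
  \bigcup_(zb in (Hhalf Gam : set (pt -> R))) Supp Om (T (p_ext0 Gam zb)).

Definition omega_r Om Gam (T : (pt -> R) -> pt -> R) (r : R) : set pt :=
  D_r Gam r `&` Omega_2 Om Gam T.

Definition is_region Om om : Prop :=
  [/\ open om, om `<=` Om & (0 < @lebesgue_row R n om)%E].

Section controllability.
Variables (p : nat) (b : R).
(* the state z(t, u) *)
Variable z : R -> (R -> 'rV[R]_p) -> pt -> R.

Definition exactly_regionally_controllable om : Prop :=
  forall yb, H1 om yb ->
  exists2 u, L2_control b u & eqn (H1 om) (p_restr om (z b u)) yb.

Definition approximately_regionally_controllable om : Prop :=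
  forall yb, H1 om yb -> forall eps : R, 0 < eps ->
  exists2 u, L2_control b u & snorm (H1 om) (p_restr om (z b u) - yb) <= eps.

Variable gamma : (pt -> R) -> pt -> R.

Definition exactly_boundary_controllable Gam : Prop :=
  forall zb, Hhalf Gam zb ->
  exists2 u, L2_control b u & eqn (Hhalf Gam) (p_restr Gam (gamma (z b u))) zb.

Definition approximately_boundary_controllable Gam : Prop :=
  forall zb, Hhalf Gam zb -> forall eps : R, 0 < eps ->
  exists2 u, L2_control b u &
    snorm (Hhalf Gam) (p_restr Gam (gamma (z b u)) - zb) <= eps.
End controllability.
End spaces.

(* Main.v *)
(** Both claims follow from the estimate
    |gamma w|_{H^{1/2}(Gam)} <= C |w|_{H^1(omega_r)} for w in H^1(Om), applied to
    w = z(b,u) - T p_Gam^* z_b, where u steers the restriction to omega_r of the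
    state to (or near) that of T p_Gam^* z_b.

    To prove the estimate, put S w := T (p_Gam^* (gamma w)), which vanishes off
    Omega_2, and let eta be a cutoff supported in D_r around a piece of Gam. In a
    boundary chart with transverse direction nu, the forms
      I_j(F, G) = int_Om (d_nu F d_j G - d_j F d_nu G)   (j <> nu),
      J(F, G)   = int_Om (F d_nu G + G d_nu F)
    are boundary terms, so they only depend on the traces of F and G. As A and
    eta S w have the same product of traces as S A and eta w, the forms agree on
    these two pairs, and the second value only involves w on omega_r. For fixed A
    it is thus bounded in terms of |w|_{H^1(omega_r)}; uniform boundedness gives
      |I_j(A, eta S w)| + |J(A, eta S w)| <= C |A|_{H^1(Om)} |w|_{H^1(omega_r)}.
    Taking for A a truncated dyadic Hilbert transform of eta S w in a direction
    j, the left-hand side becomes coercive: it controls the energy of an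
    extension U of the trace of eta S w built from averages, at scale 2^-q, of
    that trace at distance 2^-q from the boundary. Summing over the charts,
      |U|^2 <= C |S w| |w|_{H^1(omega_r)}
    with gamma U = p_Gam^* (gamma w), while |S w| <= C |U| because T and gamma
    are continuous. Hence |U| <= C |w|_{H^1(omega_r)}. *)

From HB Require Import structures.
From mathcomp Require Import all_boot all_order all_algebra.
From mathcomp Require Import all_classical all_reals all_analysis.
From mathcomp Require Import fingroup perm measurable_realfun ring lra zify.
Require Import Defs.
Set Implicit Arguments.
Unset Strict Implicit.
Unset Printing Implicit Defensive.
Import Order.TTheory GRing.Theory Num.Theory numFieldNormedType.Exports.
Local Open Scope classical_set_scope.
Local Open Scope ring_scope.

(** [omega_r] is merely an open set: nothing is known of its shape near [Gam], so neither a trace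
    theorem nor an extension theorem is at hand on it. It enters in one way: in a form with
    arguments [S A] and eta w, the first vanishes off [Omega_2], the second lives in [D_r], and the
    overlap is [omega_r]. Extension by zero is only assumed to land in H^(1/2) of the whole
    boundary, without any bound on its norm. Hence [S] is not known to be bounded, the bound for a
    fixed A has a constant depending on [S A], and this is what uniform boundedness repairs. I_j is
    antisymmetric in the derivatives so that the slopes of a chart cancel: the shear that flattens
    the boundary turns it into the same form of the half space, up to sign. Its boundary value pairs
    one trace with a tangential derivative of the other, so that for rough traces it is not clear
    that it vanishes when the product of the traces does; [flat_null] settles this with difference
    quotients. J supplies the L2 norm of the trace. Functions stay representatives under
    semidefinite forms, and a Sobolev function is a jet carrying its weak gradient. *)

Lemma quarter_identity (R : realType) (V : lmodType R) (y a b : V) :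
  y - 2^-1 *: (2^-1 *: (y + a) + 2^-1 *: (a + b)) = - 4^-1 *: (b - a + 3 *: (a - y)).
Proof.
set h : R := 2^-1; rewrite -[X in _ *: X]scalerDr scalerA.
rewrite (_ : h * h = 4^-1); last by rewrite /h; field.
rewrite [X in X - _](_ : y = 4^-1 *: (y *+ 4)); last first.
  by rewrite -scalerMnr scalerMnl -mulr_natr mulVf ?scale1r// pnatr_eq0.
rewrite -scalerBr scaleNr -scalerN; congr (_ *: _); rewrite scaler_nat.
rewrite (opprD (b - a)) -mulNrn !opprB (_ : y *+ 4 = y + y + (y + y)); last by rewrite -!mulr2n -mulrnA.
rewrite (opprD (y + a)) (opprD y) (opprD a) addrACA (addrACA y y (- y)) subrr add0r.
rewrite (addrACA y y (- a)) -(subrKA a y (- b)); move: (y - a) (a - b) => d e.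
by rewrite mulrS mulr2n [RHS]addrC -!addrA.
Qed.

(** * Dyadic averages of isometries *)

Section prehilbert.
Context {R : realType}.

(* a positive semidefinite form, bilinear on the vectors satisfying [dom] only *)
Record form (V : lmodType R) := Form {
  fdom : V -> Prop ;
  fip : V -> V -> R ;
  dom0 : fdom 0 ;
  domP : forall a x y, fdom x -> fdom y -> fdom (a *: x + y) ;
  ipC : forall x y, fip x y = fip y x ;
  ipP : forall a x y z, fdom x -> fdom y -> fdom z ->
    fip (a *: x + y) z = a * fip x z + fip y z ;
  ip_ge0 : forall x, 0 <= fip x x }.

Definition fnrm (V : lmodType R) (F : form V) x := Num.sqrt (fip F x x).

Variables (V : lmodType R) (F : form V).
Local Notation dom := (fdom F).
Local Notation ip := (fip F).
Local Notation nrm := (fnrm F).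

Lemma domD x y : dom x -> dom y -> dom (x + y).
Proof. by move=> dx dy; rewrite -[x]scale1r; exact: domP. Qed.
Lemma domZ a x : dom x -> dom (a *: x).
Proof. by move=> dx; rewrite -[_ *: _]addr0; apply: domP => //; exact: dom0. Qed.
Lemma domN x : dom x -> dom (- x).
Proof. by move=> dx; rewrite -scaleN1r; exact: domZ. Qed.
Lemma domB x y : dom x -> dom y -> dom (x - y).
Proof. by move=> dx dy; apply: domD => //; exact: domN. Qed.
Lemma dom_sum I (r : seq I) (P : pred I) (f : I -> V) :
  (forall i, P i -> dom (f i)) -> dom (\sum_(i <- r | P i) f i).
Proof. by move=> h; apply: big_ind => //; [exact: dom0|exact: domD]. Qed.

Lemma ipDl x y z : dom x -> dom y -> dom z -> ip (x + y) z = ip x z + ip y z.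
Proof. by move=> dx dy dz; rewrite -[x in LHS]scale1r ipP// mul1r. Qed.
Lemma ip0l z : dom z -> ip 0 z = 0.
Proof.
move=> dz; have d0 := dom0 F.
by have /eqP := ipDl d0 d0 dz; rewrite addr0 addrC -subr_eq subrr => /eqP.
Qed.
Lemma ipZl a x z : dom x -> dom z -> ip (a *: x) z = a * ip x z.
Proof.
move=> dx dz; rewrite -[X in ip X]addr0 ipP// ?ip0l ?addr0//; exact: dom0.
Qed.
Lemma ipDr x y z : dom x -> dom y -> dom z -> ip z (x + y) = ip z x + ip z y.
Proof. by move=> *; rewrite ipC ipDl// !(ipC F z). Qed.
Lemma ipZr a x z : dom x -> dom z -> ip z (a *: x) = a * ip z x.
Proof. by move=> *; rewrite ipC ipZl// ipC. Qed.
Lemma ipNl x z : dom x -> dom z -> ip (- x) z = - ip x z.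
Proof. by move=> *; rewrite -scaleN1r ipZl// mulN1r. Qed.
Lemma ipBl x y z : dom x -> dom y -> dom z -> ip (x - y) z = ip x z - ip y z.
Proof. by move=> *; rewrite ipDl ?ipNl//; exact: domN. Qed.
Lemma ipBr x y z : dom x -> dom y -> dom z -> ip z (x - y) = ip z x - ip z y.
Proof. by move=> *; rewrite ipC ipBl// !(ipC F z). Qed.
Lemma ip_suml I (r : seq I) (f : I -> V) z :
  (forall i, dom (f i)) -> dom z -> ip (\sum_(i <- r) f i) z = \sum_(i <- r) ip (f i) z.
Proof.
move=> df dz; elim: r => [|i r ih]; first by rewrite !big_nil ip0l.
by rewrite !big_cons ipDl ?ih//; exact: dom_sum.
Qed.

Lemma nrm_ge0 x : 0 <= nrm x. Proof. exact: sqrtr_ge0. Qed.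
Lemma sqr_nrm x : nrm x ^+ 2 = ip x x.
Proof. by rewrite sqr_sqrtr ?ip_ge0. Qed.
Lemma ip_nrm2 x : ip x x = nrm x ^+ 2. Proof. by rewrite sqr_nrm. Qed.

Lemma ip_sqr_le x y : dom x -> dom y -> ip x y ^+ 2 <= ip x x * ip y y.
Proof.
move=> dx dy.
have ge0 s : 0 <= ip x x - 2 * s * ip x y + s ^+ 2 * ip y y.
  have := ip_ge0 F (x - s *: y).
  have dsy : dom (s *: y) by exact: domZ.
  rewrite ipBl// ?ipBr// ?ipZl// ?ipZr//; last exact: domB.
  by rewrite (ipC F y x) => h; lra.
have [y0|y0] := eqVneq (ip y y) 0.
  rewrite y0 mulr0; have [->|xy0] := eqVneq (ip x y) 0; first by rewrite expr0n.
  (* The form is only semidefinite, so a vector y of norm zero must still be shown orthogonal to x: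
     for this [s] the quadratic would take the value -1. *)
  have := ge0 ((ip x x + 1) / (2 * ip x y)); rewrite y0 mulr0 addr0.
  rewrite (_ : _ - _ = -1) ?ler0N1//.
  by field.
have yp : 0 < ip y y by rewrite lt_def y0 ip_ge0.
have := ge0 (ip x y / ip y y).
rewrite (_ : _ + _ = (ip x x * ip y y - ip x y ^+ 2) / ip y y); last by field.
by rewrite pmulr_lge0 ?invr_gt0// subr_ge0.
Qed.

Lemma cauchy_schwarz x y : dom x -> dom y -> `|ip x y| <= nrm x * nrm y.
Proof.
move=> dx dy; rewrite -(@ler_pXn2r _ 2)// ?nnegrE ?mulr_ge0 ?nrm_ge0//.
by rewrite real_normK ?num_real// exprMn !sqr_nrm; exact: ip_sqr_le.
Qed.
Lemma ip_le x y : dom x -> dom y -> ip x y <= nrm x * nrm y.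
Proof. by move=> dx dy; apply: le_trans (ler_norm _) _; exact: cauchy_schwarz. Qed.

Lemma nrmD x y : dom x -> dom y -> nrm (x + y) <= nrm x + nrm y.
Proof.
move=> dx dy; rewrite -(@ler_pXn2r _ 2)// ?nnegrE ?addr_ge0 ?nrm_ge0//.
rewrite sqr_nrm sqrrD ipDl// ?ipDr// ?(ipC F y x) ?sqr_nrm; last exact: domD.
by have := ip_le dx dy; lra.
Qed.
Lemma nrmZ a x : dom x -> nrm (a *: x) = `|a| * nrm x.
Proof.
move=> dx; apply/eqP; rewrite -(@eqrXn2 _ 2)// ?mulr_ge0 ?nrm_ge0//.
rewrite exprMn !sqr_nrm real_normK ?num_real//.
by rewrite ipZl ?ipZr ?mulrA//; exact: domZ.
Qed.
Lemma nrmN x : dom x -> nrm (- x) = nrm x.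
Proof. by move=> dx; rewrite -scaleN1r nrmZ// normrN1 mul1r. Qed.
Lemma nrmB x y : dom x -> dom y -> nrm (x - y) <= nrm x + nrm y.
Proof. by move=> dx dy; rewrite -(nrmN dy); apply: nrmD => //; exact: domN. Qed.
Lemma nrm0 : nrm 0 = 0.
Proof. by rewrite /fnrm ip0l ?sqrtr0//; exact: dom0. Qed.
Lemma nrm_sum I (r : seq I) (f : I -> V) : (forall i, dom (f i)) ->
  nrm (\sum_(i <- r) f i) <= \sum_(i <- r) nrm (f i).
Proof.
move=> df; elim: r => [|i r ih]; first by rewrite !big_nil nrm0.
rewrite !big_cons; apply: le_trans (nrmD _ _) _ => //; first exact: dom_sum.
by rewrite lerD2l.
Qed.
Lemma nrm_distC x y : dom x -> dom y -> nrm (x - y) = nrm (y - x).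
Proof. by move=> dx dy; rewrite -nrmN ?opprB//; exact: domB. Qed.
Lemma nrm_subD x y z : dom x -> dom y -> dom z ->
  nrm (x - z) <= nrm (x - y) + nrm (y - z).
Proof.
move=> dx dy dz; rewrite -[x - z](subrKA y) //.
by apply: nrmD; exact: domB.
Qed.

End prehilbert.

Section dyadic.
Context {R : realType} (V : lmodType R) (F : form V).
Local Notation dom := (fdom F).
Local Notation ip := (fip F).
Local Notation nrm := (fnrm F).

(** [dyT t i] is t^(2^i), [dyD t i] is t^(2^i) - 1, and [dyB t i] is the mean of the powers t^m over
    m < 2^i, written as the product of the factors (1 + t^(2^k)) / 2 over k < i. *)
Fixpoint dyT (t : V -> V) (i : nat) : V -> V :=
  if i is k.+1 then dyT t k \o dyT t k else t.
Definition dyD (t : V -> V) (i : nat) (x : V) := dyT t i x - x.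
Fixpoint dyB (t : V -> V) (i : nat) : V -> V :=
  if i is k.+1 then fun x => 2^-1 *: (dyB t k x + dyT t k (dyB t k x)) else id.

Definition isometry_on (t : V -> V) :=
  [/\ linear t, forall x, dom x -> dom (t x) &
      forall x y, dom x -> dom y -> ip (t x) (t y) = ip x y].

Section one.
Variable t : V -> V.
Hypothesis iso : isometry_on t.

Lemma dyT_iso i : isometry_on (dyT t i).
Proof.
elim: i => [//|i [l d e]]; split => /= [a x y|x dx|x y dx dy].
- by rewrite /= l l.
- by apply: (d); apply: (d).
- by rewrite !e//; apply: d.
Qed.

Lemma linearD_of (s : V -> V) (l : linear s) x y : s (x + y) = s x + s y.
Proof. by rewrite -[x in LHS]scale1r l scale1r. Qed.
Lemma linear0_of (s : V -> V) (l : linear s) : s 0 = 0.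
Proof. by have := l (-1) 0 0; rewrite scaleN1r oppr0 addr0 scaleN1r addNr. Qed.
Lemma linearZ_of (s : V -> V) (l : linear s) a x : s (a *: x) = a *: s x.
Proof. by rewrite -[a *: x]addr0 l (linear0_of l) addr0. Qed.
Lemma linearB_of (s : V -> V) (l : linear s) x y : s (x - y) = s x - s y.
Proof. by rewrite addrC -scaleN1r l scaleN1r addrC. Qed.

Lemma dyB_linear i : linear (dyB t i).
Proof.
elim: i => [//|i ih] a x y /=; have [l _ _] := dyT_iso i.
by rewrite ih l addrACA -scalerDr [LHS]scalerDr !scalerA (mulrC a).
Qed.
Lemma dyB_dom i x : dom x -> dom (dyB t i x).
Proof.
elim: i x => [//|i ih] x dx /=; have [_ d _] := dyT_iso i.
by apply: domZ; apply: domD; [exact: ih|apply: d; exact: ih].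
Qed.
Lemma dyD_dom i x : dom x -> dom (dyD t i x).
Proof. by move=> dx; have [_ d _] := dyT_iso i; apply: domB => //; exact: d. Qed.

Lemma dyT_comm (s : V -> V) i : (forall x, s (t x) = t (s x)) ->
  forall x, s (dyT t i x) = dyT t i (s x).
Proof. by move=> st; elim: i => //= i ih x; rewrite !ih. Qed.
Lemma dyB_comm (s : V -> V) i : linear s -> (forall x, s (t x) = t (s x)) ->
  forall x, s (dyB t i x) = dyB t i (s x).
Proof.
move=> l st; elim: i => //= i ih x.
by rewrite linearZ_of// linearD_of// dyT_comm// ih.
Qed.
Lemma dyBT i j x : dyB t i (dyT t j x) = dyT t j (dyB t i x).
Proof.
apply: dyT_comm => y; apply/esym; apply: dyB_comm => //; first by have [] := iso.
Qed.
Lemma dyB_exch i j x : dyB t i (dyB t j x) = dyB t j (dyB t i x).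
Proof.
apply: dyB_comm; first exact: dyB_linear.
by move=> y; apply: (dyBT _ 0).
Qed.
Lemma dyBD i j x : dyB t i (dyD t j x) = dyD t j (dyB t i x).
Proof. by rewrite /dyD linearB_of ?dyBT//; exact: dyB_linear. Qed.

(** Telescoping of the sum of the t^m, m < 2^i, against t - 1. An average of length 2^i turns the
    finest difference into the difference at scale i, up to the factor 2^-i. *)
Lemma dyB_dyD0 i x : (2 ^+ i) *: dyB t i (dyD t 0 x) = dyD t i x.
Proof.
elim: i x => [|i ih] x; first by rewrite expr0 scale1r.
have [l _ _] := dyT_iso i.
rewrite /= scalerA exprS mulrAC mulfV ?pnatr_eq0// mul1r scalerDr.
rewrite -(linearZ_of l) ih /dyD /= linearB_of// addrC.
by rewrite addrA subrK.
Qed.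

Lemma nrmT i x : dom x -> nrm (dyT t i x) = nrm x.
Proof. by move=> dx; rewrite /fnrm; have [_ _ ->] := dyT_iso i. Qed.

(** Parallelogram law for y = [dyB t i x] and its isometric image T y: half of y + T y is the next
    average, and |T y| = |y|. *)
Lemma dyB_telescope i x : dom x ->
  nrm (dyD t i (dyB t i x)) ^+ 2 = 4 * (nrm (dyB t i x) ^+ 2 - nrm (dyB t i.+1 x) ^+ 2).
Proof.
move=> dx; have [_ d e] := dyT_iso i; have db := dyB_dom i dx.
set y := dyB t i x in db *; rewrite !sqr_nrm /= /dyD -/y.
have dty := d _ db.
have ds : dom (y + dyT t i y) by exact: domD.
rewrite ipBl// ?ipBr// ?ipZl ?ipZr ?ipDl ?ipDr ?e ?(ipC F y (dyT t i y))//; last 2 first.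
- exact: domZ.
- exact: domB.
by field.
Qed.

Lemma nrm_dyB i x : dom x -> nrm (dyB t i x) <= nrm x.
Proof.
move=> dx; elim: i => [//|i ih]; apply: le_trans ih.
rewrite -(@ler_pXn2r _ 2)// ?nnegrE ?nrm_ge0//.
by have := sqr_ge0 (nrm (dyD t i (dyB t i x))); rewrite dyB_telescope//; lra.
Qed.

Lemma sum_dyD N x : dom x ->
  \sum_(i < N) nrm (dyD t i (dyB t i x)) ^+ 2 <= 4 * nrm x ^+ 2.
Proof.
move=> dx.
suff -> : \sum_(i < N) nrm (dyD t i (dyB t i x)) ^+ 2 =
    4 * (nrm x ^+ 2 - nrm (dyB t N x) ^+ 2).
  by have := sqr_ge0 (nrm (dyB t N x)); lra.
elim: N => [|N ih]; first by rewrite big_ord0 /= subrr mulr0.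
by rewrite big_ord_recr /= ih dyB_telescope//=; ring.
Qed.

(** With T = [dyT t i], the operator 1 - ((1 + T) / 2)^2 equals -(T + 3)(T - 1) / 4, and (T + 3) / 4
    does not increase norms. It is applied to a double average, one factor of which is then dropped
    by contraction. *)
Lemma nrm_dyB2S i x : dom x ->
  nrm (dyB t i (dyB t i x) - dyB t i.+1 (dyB t i.+1 x)) <= nrm (dyD t i (dyB t i x)).
Proof.
move=> dx; have [l d e] := dyT_iso i.
have lb := @dyB_linear i.
set y := dyB t i (dyB t i x).
have dy : dom y by do 2 apply: dyB_dom.
have -> : y - dyB t i.+1 (dyB t i.+1 x) =
    - 4^-1 *: (dyT t i (dyD t i y) + 3 *: dyD t i y).
  rewrite /= /dyD (linearB_of l) !(linearZ_of lb) !(linearD_of lb).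
  rewrite !(linearZ_of l) !(linearD_of l) !dyBT -/y.
  set a := dyT t i y; set b := dyT t i a.
  exact: quarter_identity.
have dD : dom (dyD t i y) by exact: dyD_dom.
have dTD : dom (dyT t i (dyD t i y)) by exact: d.
rewrite nrmZ; last by apply: domD => //; exact: domZ.
have : nrm (dyT t i (dyD t i y) + 3 *: dyD t i y) <= 4 * nrm (dyD t i y).
  apply: le_trans (nrmD _ _) _ => //; first exact: domZ.
  by rewrite nrmT// nrmZ// ger0_norm//; lra.
have : nrm (dyD t i y) <= nrm (dyD t i (dyB t i x)).
  by rewrite /y -dyBD; apply: nrm_dyB; apply: dyD_dom; exact: dyB_dom.
rewrite normrN ger0_norm ?invr_ge0//; lra.
Qed.

End one.

Section pair.
Variables t t' : V -> V.
Hypotheses (iso : isometry_on t) (iso' : isometry_on t').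
Hypotheses (tK : cancel t t') (t'K : cancel t' t).

Lemma dyTK i x : dyT t i (dyT t' i x) = x.
Proof. by elim: i x => /= [//|i ih] x; rewrite !ih. Qed.

Lemma dyT_adj i x y : dom x -> dom y -> ip (dyT t' i x) y = ip x (dyT t i y).
Proof.
move=> dx dy; have [_ d e] := dyT_iso iso i; have [_ d' _] := dyT_iso iso' i.
by rewrite -[LHS]e ?dyTK//; exact: d'.
Qed.
Lemma dyB_adj i x y : dom x -> dom y -> ip (dyB t' i x) y = ip x (dyB t i y).
Proof.
elim: i x y => //= i ih x y dx dy.
have [_ d e] := dyT_iso iso i; have [_ d' _] := dyT_iso iso' i.
have db := dyB_dom iso i dy; have db' := dyB_dom iso' i dx.
have dT : dom (dyT t i (dyB t i y)) by exact: d.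
have dT' : dom (dyT t' i (dyB t' i x)) by exact: d'.
rewrite ipZl//; last exact: domD.
rewrite ipZr//; last exact: domD.
rewrite ipDl// ipDr// dyT_adj// !ih//; last exact: d.
by rewrite dyBT.
Qed.

Lemma dyB_exch' i j x : dyB t i (dyB t' j x) = dyB t' j (dyB t i x).
Proof.
apply: dyB_comm; first exact: dyB_linear.
move=> y; apply/esym; apply: dyB_comm; first by have [] := iso'.
by move=> z; rewrite tK t'K.
Qed.

(* smoothed scale-by-scale truncation of a Hilbert transform in the direction of t *)
Definition dyX i x := dyB t' i (dyB t' i (dyB t i (dyD t i x))).
Definition dyK N x := \sum_(i < N) dyX i x.

Lemma dyX_dom i x : dom x -> dom (dyX i x).
Proof.
move=> dx; do 2 apply: (dyB_dom iso'); apply: (dyB_dom iso).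
exact: (dyD_dom iso).
Qed.
Lemma dyK_dom N x : dom x -> dom (dyK N x).
Proof. by move=> dx; apply: dom_sum => i _; exact: dyX_dom. Qed.

(** Coercivity at one scale. The two averages by t' pass to the other side as averages by t; there
    one of them turns [dyD t 0] into 2^-i times [dyD t i], and the other matches the average
    contained in [dyX]. *)
Lemma ip_dyX_dyD i x : dom x ->
  ip (dyX i x) (dyD t 0 x) = nrm (dyD t i (dyB t i x)) ^+ 2 / 2 ^+ i.
Proof.
move=> dx; have dD := dyD_dom iso 0 dx; have dDi := dyD_dom iso i dx.
have dB := dyB_dom iso i.
rewrite /dyX !dyB_adj//; try by do ?[apply: (dyB_dom iso') || apply: (dB)].
rewrite sqr_nrm -!dyBD// -[dyD t i x in X in _ = ip _ X / _](dyB_dyD0 iso).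
rewrite (linearZ_of (dyB_linear iso _)) ipZr; try by do ?apply: (dB).
by rewrite mulrAC mulfV ?mul1r// expf_neq0.
Qed.

(** Almost orthogonality of the scales. Since t and its inverse commute, the pairing is 2^i 2^l
    times the squared norm of B_l^2 B_i^2 y, where y = [dyD t 0 x]; dropping the averages of scale l
    leaves a factor that decays when l < i. *)
Lemma ip_dyX_le i l x : dom x ->
  ip (dyX i x) (dyX l x) <= 2 ^+ l / 2 ^+ i * nrm (dyD t i (dyB t i x)) ^+ 2.
Proof.
move=> dx; set y := dyD t 0 x.
have dy : dom y by exact: (dyD_dom iso).
have dB j z : dom z -> dom (dyB t j z) by exact: (dyB_dom iso).
have dB' j z : dom z -> dom (dyB t' j z) by exact: (dyB_dom iso').
have XE j : dyX j x = 2 ^+ j *: dyB t' j (dyB t' j (dyB t j (dyB t j y))).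
  rewrite /dyX -(dyB_dyD0 iso) (linearZ_of (dyB_linear iso _)).
  by rewrite !(linearZ_of (dyB_linear iso' _)).
rewrite !XE ipZl ?ipZr//; try by do ?[apply: domZ || apply: (dB') || apply: (dB)].
rewrite !dyB_adj//; try by do ?[apply: (dB') || apply: (dB)].
rewrite !dyB_exch' ipC !dyB_adj//; try by do ?[apply: (dB') || apply: (dB)].
rewrite (_ : ip _ _ = nrm (dyB t l (dyB t l (dyB t i (dyB t i y)))) ^+ 2); last first.
  by rewrite sqr_nrm; congr ip; rewrite !(dyB_exch iso i l).
have le1 : nrm (dyB t l (dyB t l (dyB t i (dyB t i y)))) <= nrm (dyB t i (dyB t i y)).
  by do 2 (apply: le_trans (nrm_dyB iso _ _) _; first by do ?apply: (dB)).
have -> : nrm (dyD t i (dyB t i x)) = 2 ^+ i * nrm (dyB t i (dyB t i y)).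
  rewrite -dyBD// -(dyB_dyD0 iso) (linearZ_of (dyB_linear iso _)) nrmZ ?ger0_norm//.
  by do ?apply: (dB).
rewrite exprMn [leRHS](_ : _ = 2 ^+ i * (2 ^+ l * nrm (dyB t i (dyB t i y)) ^+ 2)).
  by rewrite !ler_pM2l ?exprn_gt0// ler_pXn2r// ?nnegrE ?nrm_ge0.
by field; rewrite expf_neq0.
Qed.

(** Induction on the number of scales: scale N adds its own square and twice the cross terms, whose
    factors 2^i / 2^N sum to less than 1. This gives the constant 3, and 3 * 4 <= 4^2 by [sum_dyD].
    The bound does not depend on N. *)
Lemma nrm_dyK N x : dom x -> nrm (dyK N x) <= 4 * nrm x.
Proof.
move=> dx; have dX i := dyX_dom i dx.
suff h : nrm (dyK N x) ^+ 2 <= 3 * \sum_(i < N) nrm (dyD t i (dyB t i x)) ^+ 2.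
  rewrite -(@ler_pXn2r _ 2)// ?nnegrE ?mulr_ge0 ?nrm_ge0//.
  by have := sum_dyD iso N dx; have := sqr_ge0 (nrm x); rewrite exprMn; lra.
elim: N => [|N ih]; first by rewrite /dyK !big_ord0 nrm0 expr0n mulr0.
rewrite {1}/dyK !big_ord_recr /= -/(dyK N x) sqr_nrm.
have dK := dyK_dom N dx.
rewrite ipDl// ?ipDr// ?(ipC F (dyX N x)) -?sqr_nrm; last exact: domD.
set d := nrm (dyD t N (dyB t N x)).
have h1 : nrm (dyX N x) ^+ 2 <= d ^+ 2.
  by rewrite sqr_nrm; apply: le_trans (ip_dyX_le N N dx) _; rewrite mulfV ?mul1r// expf_neq0.
have h2 : ip (dyK N x) (dyX N x) <= d ^+ 2.
  rewrite ip_suml//.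
  apply: (@le_trans _ _ (\sum_(i < N) (2 ^+ i / 2 ^+ N * d ^+ 2))).
    by apply: ler_sum => i _; rewrite ipC; exact: ip_dyX_le.
  rewrite -!mulr_suml; apply: ler_piMl; rewrite ?sqr_ge0// ler_pdivrMr ?exprn_gt0// mul1r.
  have -> : \sum_(i < N) 2 ^+ i = 2 ^+ N - 1 :> R.
    by rewrite subrX1 (_ : 2 - 1 = 1) ?mul1r//; ring.
  lra.
move: ih; lra.
Qed.

End pair.
End dyadic.

(** * L2 spaces as semidefinite forms on functions *)

Section L2_form.
Context {R : realType} d (T : measurableType d) (mu : {measure set T -> \bar R}).
Variables (D : set T).

Definition L2on (f : T -> R) : Prop :=
  measurable_fun D f /\ (\int[mu]_(x in D) (f x ^+ 2)%:E < +oo)%E.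

Hypothesis mD : measurable D.

Lemma L2on_integrableM (f g : T -> R) : L2on f -> L2on g ->
  mu.-integrable D (EFin \o (fun x => f x * g x)).
Proof.
move=> [mf f2] [mg g2].
have sq (h : T -> R) : measurable_fun D h -> measurable_fun D (EFin \o (fun x => h x ^+ 2)).
  by move=> mh; apply/measurable_EFinP; exact: measurable_funX.
apply/integrableP; split; first by apply/measurable_EFinP; exact: measurable_funM.
apply: (@le_lt_trans _ _ (\int[mu]_(x in D) ((f x ^+ 2)%:E + (g x ^+ 2)%:E)))%E.
  apply: ge0_le_integral => //.
  - do 2 apply: measurableT_comp => //; exact: measurable_funM.
  - by apply: emeasurable_funD; exact: sq.
  - move=> x _ /=; rewrite -EFinD lee_fin normrM.
    have := sqr_ge0 (`|f x| - `|g x|); have := sqr_ge0 (`|f x| + `|g x|).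
    have := real_normK (num_real (f x)); have := real_normK (num_real (g x)).
    nra.
rewrite ge0_integralD//; last 2 first.
- by move=> x _; rewrite lee_fin sqr_ge0.
- exact: sq.
- exact: lte_add_pinfty.
- by move=> x _; rewrite lee_fin sqr_ge0.
- exact: sq.
Qed.

Lemma L2on_integrable2 (f : T -> R) : L2on f ->
  mu.-integrable D (EFin \o (fun x => f x ^+ 2)).
Proof. by move=> h; under eq_fun do rewrite expr2; exact: L2on_integrableM. Qed.

Lemma integrable2_L2on (f : T -> R) : measurable_fun D f ->
  mu.-integrable D (EFin \o (fun x => f x ^+ 2)) -> L2on f.
Proof.
move=> mf /integrableP[_]; split=> //.
by under eq_integral do rewrite -[(_ ^+ 2)%:E]gee0_abs ?lee_fin ?sqr_ge0//.
Qed.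

Lemma L2on0 : L2on 0.
Proof.
split; first exact: measurable_cst.
by under eq_integral do rewrite expr0n; rewrite integral0.
Qed.

Lemma L2onP a f g : L2on f -> L2on g -> L2on (a *: f + g).
Proof.
move=> hf hg; have [mf _] := hf; have [mg _] := hg.
apply: integrable2_L2on.
  by apply: measurable_funD => //; exact: measurable_funM.
rewrite (_ : EFin \o _ = ((fun x => (a ^+ 2)%:E * (f x ^+ 2)%:E) \+
   ((fun x => (2 * a)%:E * (f x * g x)%:E) \+ (fun x => (g x ^+ 2)%:E)))%E); last first.
  apply/funext => x /=; rewrite -!EFinM -!EFinD; congr EFin.
  rewrite !fctE /GRing.scale /=; ring.
apply: integrableD => //.
  by apply: integrableZl => //; exact: L2on_integrable2.
apply: integrableD => //; last exact: L2on_integrable2.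
by apply: integrableZl => //; exact: L2on_integrableM.
Qed.

Definition L2_ip (f g : T -> R) : R := \int[mu]_(x in D) (f x * g x).

Lemma L2_ipC f g : L2_ip f g = L2_ip g f.
Proof. by apply: eq_Rintegral => x _; rewrite mulrC. Qed.

Lemma L2_ipP a f g h : L2on f -> L2on g -> L2on h ->
  L2_ip (a *: f + g) h = a * L2_ip f h + L2_ip g h.
Proof.
move=> hf hg hh; rewrite /L2_ip -RintegralZl//; last exact: L2on_integrableM.
rewrite -RintegralD//.
- by apply: eq_Rintegral => x _; rewrite !fctE /GRing.scale /=; ring.
- rewrite (_ : EFin \o _ = (fun x => a%:E * (f x * h x)%:E)%E)//.
  by apply: integrableZl => //; exact: L2on_integrableM.
- exact: L2on_integrableM.
Qed.

Lemma L2_ip_ge0 f : 0 <= L2_ip f f.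
Proof. by apply: Rintegral_ge0 => x _; rewrite -expr2 sqr_ge0. Qed.

(** Symmetry and positivity hold for all functions, an infinite integral being read as 0; square
    integrability enters in bilinearity, which is why it is the domain of the form. *)
Definition L2_form : form (T -> R) := Form L2on0 L2onP L2_ipC L2_ipP L2_ip_ge0.

Lemma L2_ipE f : L2_ip f f = \int[mu]_(x in D) (f x ^+ 2).
Proof. by apply: eq_Rintegral => x _; rewrite expr2. Qed.

Lemma EFin_L2_ip f : L2on f -> (\int[mu]_(x in D) (f x ^+ 2)%:E)%E = (L2_ip f f)%:E.
Proof.
move=> hf; rewrite L2_ipE /Rintegral fineK//.
by apply: integrable_fin_num => //; exact: L2on_integrable2.
Qed.

Lemma L2on_abs f : L2on f -> L2on (fun x => `|f x|).
Proof.
move=> [mf f2]; split; first exact: measurableT_comp.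
by under eq_integral do rewrite real_normK ?num_real//.
Qed.

End L2_form.

Lemma L2on_sub {R : realType} d (T : measurableType d) (mu : {measure set T -> \bar R})
  (D E : set T) (f : T -> R) : measurable D -> measurable E -> E `<=` D ->
  L2on mu D f -> L2on mu E f.
Proof.
move=> mD mE ED [mf f2]; split; first exact: measurable_funS mf.
apply: le_lt_trans f2; apply: ge0_subset_integral => //.
  by apply/measurable_EFinP; exact: measurable_funX.
by move=> x _; rewrite lee_fin sqr_ge0.
Qed.

Lemma L2_ip_sub {R : realType} d (T : measurableType d) (mu : {measure set T -> \bar R})
  (D E : set T) (f : T -> R) : measurable D -> measurable E -> E `<=` D ->
  L2on mu D f -> L2_ip mu E f f <= L2_ip mu D f f.
Proof.
move=> mD mE ED hf; have hE := L2on_sub mD mE ED hf.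
rewrite -lee_fin -!EFin_L2_ip//; apply: ge0_subset_integral => //.
  by apply/measurable_EFinP; apply: measurable_funX; have [] := hf.
by move=> x _; rewrite lee_fin sqr_ge0.
Qed.

(** * Lebesgue measure on rows *)

Section row_boxes.
Context {R : realType}.

Lemma row_cons0 n (p : measurableTypeR R * 'rV[R]_n) : row_cons p ord0 ord0 = p.1.
Proof.
rewrite /row_cons (_ : ord0 = lshift n ord0 :> 'I_(1 + n)); last exact/val_inj.
by apply: etrans (row_mxEl _ _ _ _) _; rewrite mxE eqxx.
Qed.

Lemma row_consS n (p : measurableTypeR R * 'rV[R]_n) j :
  row_cons p ord0 (lift ord0 j) = p.2 ord0 j.
Proof.
rewrite /row_cons (_ : lift ord0 j = rshift 1 j :> 'I_(1 + n)); last exact/val_inj.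
by apply: etrans (row_mxEr _ _ _ _) _.
Qed.

Definition row_box n (a b : 'rV[R]_n) : set 'rV[R]_n :=
  [set x | forall i, a ord0 i < x ord0 i <= b ord0 i].

Definition row_tail n (x : 'rV[R]_n.+1) : 'rV[R]_n := \row_j x ord0 (lift ord0 j).

Lemma preimage_row_cons_box n (a b : 'rV[R]_n.+1) :
  @row_cons R n @^-1` row_box a b =
  `]a ord0 ord0, b ord0 ord0]%classic `*` row_box (row_tail a) (row_tail b).
Proof.
apply/seteqP; split => -[t x] /=.
  move=> h; split => /=.
    by have := h ord0; rewrite row_cons0 /= in_itv.
  by move=> j; have := h (lift ord0 j); rewrite row_consS !mxE.
move=> [/= h1 h2] i; case: (unliftP ord0 i) => [j|] ->.
  by have := h2 j; rewrite row_consS !mxE.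
by rewrite row_cons0; move: h1; rewrite in_itv.
Qed.

Lemma measurable_row_box n (a b : 'rV[R]_n) : measurable (row_box a b).
Proof.
rewrite (_ : row_box a b =
    \bigcap_(i in [set: 'I_n]) ((fun x : 'rV[R]_n => x ord0 i) @^-1` `]a ord0 i, b ord0 i]%classic)).
  apply: fin_bigcap_measurable => // i _.
  by rewrite -[X in measurable X]setTI; exact: measurable_row_coord.
apply/seteqP; split => x /=.
  by move=> h i _; rewrite /= in_itv/=; exact: h.
by move=> h i; have := h i I; rewrite /= in_itv.
Qed.

Definition box_vol n (a b : 'rV[R]_n) : R := \prod_(i < n) Num.max 0 (b ord0 i - a ord0 i).

Lemma lebesgue_row_box n (a b : 'rV[R]_n) :
  lebesgue_row n (row_box a b) = (box_vol a b)%:E.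
Proof.
elim: n a b => [|n ih] a b.
  rewrite /box_vol big_ord0 /=.
  by rewrite diracE mem_set// => -[].
rewrite /= /lebesgue_step /pushforward preimage_row_cons_box product_measure1E//; last first.
  exact: measurable_row_box.
rewrite ih [X in (X * _)%E](lebesgue_measure_itv `]a ord0 ord0, b ord0 ord0]) /= lte_fin.
rewrite /box_vol big_ord_recl.
rewrite EFinM; congr (_ * _)%E; last first.
  by congr EFin; apply: eq_bigr => j _; rewrite !mxE.
case: ltP => h; first by rewrite -EFinD max_r// subr_ge0 ltW.
by rewrite max_l// subr_le0.
Qed.

Lemma row_boxI n (a b a' b' : 'rV[R]_n) : row_box a b `&` row_box a' b' =
  row_box (\row_i Num.max (a ord0 i) (a' ord0 i)) (\row_i Num.min (b ord0 i) (b' ord0 i)).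
Proof.
apply/seteqP; split => x /=.
  move=> [h1 h2] i; rewrite !mxE gt_max le_min.
  by have /andP[-> ->] := h1 i; have /andP[-> ->] := h2 i.
move=> h; split => i; have := h i; rewrite !mxE gt_max le_min.
  by move=> /andP[/andP[-> _] /andP[-> _]].
by move=> /andP[/andP[_ ->] /andP[_ ->]].
Qed.

Definition row_boxes n : set (set 'rV[R]_n) := [set A | exists a b, A = row_box a b].

Definition row_cube n (k : nat) : set 'rV[R]_n := row_box (const_mx (- k%:R)) (const_mx k%:R).

Lemma bigcup_row_cube n : \bigcup_k @row_cube n k = [set: 'rV[R]_n].
Proof.
apply/seteqP; split => // x _.
pose M := \big[Num.max/0]_(i < n) `|x ord0 i|.
exists (Num.truncn M).+1 => // i; rewrite !mxE.
have h : `|x ord0 i| < (Num.truncn M).+1%:R.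
  by apply: le_lt_trans (truncnS_gt M); rewrite /M; exact: le_bigmax.
by have := h; rewrite ltr_norml => /andP[-> /ltW ->].
Qed.

(** A slice a < x_i <= b is the union of the boxes whose other sides are those of growing cubes, so
    the coordinates generate no more than the boxes. *)
Lemma measurable_rowE n : @measurable _ 'rV[R]_n = <<s @row_boxes n >>.
Proof.
apply/seteqP; split; last first.
  apply: smallest_sub; first exact: sigma_algebra_measurable.
  by move=> _ [a [b ->]]; exact: measurable_row_box.
apply: smallest_sub; first exact: smallest_sigma_algebra.
rewrite -bigcup_seq/=; apply: bigcup_sub => i _ A [B mB <-]; rewrite setTI.
have : preimage_set_system [set: 'rV[R]_n] (fun x => x ord0 i) measurable `<=` <<s @row_boxes n >>.
  rewrite (_ : @measurable _ R = <<s R.-ocitv.-measurable >>)//.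
  rewrite -g_sigma_preimageE.
  apply: smallest_sub; first exact: smallest_sigma_algebra.
  move=> _ [C /ocitvP mC <-]; rewrite setTI.
  case: mC => [->|[[a b] /= ab ->]].
    by rewrite preimage_set0; exact: sigma_algebra0.
  rewrite (_ : _ @^-1` _ = \bigcup_k (row_box
     (\row_j if j == i then a else - k%:R) (\row_j if j == i then b else k%:R))).
    apply: sigma_algebra_bigcup.
    by move=> k; apply: sub_sigma_algebra; do 2 eexists.
  apply/seteqP; split => x /=; last first.
    by move=> [k _ /(_ i)]; rewrite !mxE eqxx in_itv.
  have := bigcup_row_cube n => /seteqP[_ /(_ x I)][k _ kx]; rewrite in_itv /= => abx.
  exists k => // j; rewrite !mxE; case: ifPn => [/eqP ->//|_].
  by have := kx j; rewrite !mxE.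
by apply; exists B => //; rewrite setTI.
Qed.

(** The boxes are a generating family stable under intersection, and the cubes exhaust the space
    with finite measure. Invariance under translations and permutations then reduces to preimages of
    boxes. *)
Lemma lebesgue_row_unique n (mu : {measure set 'rV[R]_n -> \bar R}) :
  (forall a b, mu (row_box a b) = (box_vol a b)%:E) ->
  forall A, measurable A -> mu A = lebesgue_row n A.
Proof.
move=> h A mA; apply/esym.
apply: (measure_unique (@row_boxes n) (@row_cube n)) => //.
- exact: measurable_rowE.
- by move=> _ _ [a [b ->]] [a' [b' ->]]; rewrite row_boxI; do 2 eexists.
- by move=> k; do 2 eexists.
- exact: bigcup_row_cube.
- by move=> _ [a [b ->]]; rewrite h; exact: lebesgue_row_box.
- move=> k; have := ltry (box_vol (const_mx (- k%:R) : 'rV[R]_n) (const_mx k%:R)).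
  by rewrite -lebesgue_row_box.
Qed.

End row_boxes.

Section row_topology.
Context {R : realType} (n : nat).
Local Notation pt := 'rV[R]_n.
Implicit Types x y : pt.

Lemma row_coord_le x i : `|x ord0 i| <= `|x|.
Proof.
have /mapP[j Hj ->] : `|x ord0 i| \in [seq `|x y.1 y.2| | y : 'I_1 * 'I_n].
  by apply/mapP; exists (ord0, i) => //=; rewrite mem_enum.
by rewrite [leRHS]/Num.norm /= mx_normrE; apply/bigmax_geP; right => /=; exists j.
Qed.

Lemma row_norm_le x e : 0 <= e -> (forall i, `|x ord0 i| <= e) -> `|x| <= e.
Proof.
move=> e0 h; rewrite [leLHS]/Num.norm /= mx_normrE; apply/bigmax_leP; split => //=.
by move=> -[i j] _ /=; rewrite (ord1 i).
Qed.

Lemma row_norm_lt x e : 0 < e -> (forall i, `|x ord0 i| < e) -> `|x| < e.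
Proof.
move=> e0 h; rewrite [ltLHS]/Num.norm /= mx_normrE; apply/bigmax_ltP; split => //=.
by move=> -[i j] _ /=; rewrite (ord1 i).
Qed.

(** The topology comes from the sup norm and the sigma-algebra from the coordinates; the countably
    many rational boxes link the two. *)
Lemma open_row_measurable (A : set pt) : open A -> measurable A.
Proof.
move=> oA.
pose bx (q : 'rV[rat]_n * 'rV[rat]_n) : set pt :=
  row_box (map_mx ratr q.1) (map_mx ratr q.2).
have -> : A = \bigcup_q (if `[< bx q `<=` A >] then bx q else set0).
  apply/seteqP; split => [x Ax|x [q _]]; last first.
    by case: ifPn => // /asboolP; exact.
  have /nbhs_ballP[e /= e0 eA] : nbhs x A by exact: open_nbhs_nbhs.
  have hq i : exists q : rat * rat,
      x ord0 i - e < ratr q.1 < x ord0 i /\ x ord0 i < ratr q.2 < x ord0 i + e.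
    have [q1] := @rat_in_itvoo R (x ord0 i - e) (x ord0 i) ltac:(rewrite ltrBlDr ltrDl//).
    have [q2] := @rat_in_itvoo R (x ord0 i) (x ord0 i + e) ltac:(rewrite ltrDl//).
    by rewrite !in_itv /= => h2 h1; exists (q1, q2).
  have [f hf] := choice hq.
  pose q := (\row_i (f i).1, \row_i (f i).2).
  have qA : bx q `<=` A.
    move=> y yq; apply: eA; rewrite -ball_normE /ball_ /=.
    apply: row_norm_lt => // i; rewrite !mxE.
    have := yq i; rewrite /q !mxE; have [/andP[h1 h2] /andP[h3 h4]] := hf i.
    by move=> /andP[h5 h6]; rewrite ltr_norml; lra.
  exists q => //; rewrite ifT; last exact/asboolP.
  by move=> i; rewrite /q !mxE; have [/andP[_ ->] /andP[/ltW -> _]] := hf i.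
apply: countable_bigcupT_measurable; first exact: countableP.
by move=> q; case: ifPn => // _; exact: measurable_row_box.
Qed.

Lemma closed_row_measurable (A : set pt) : closed A -> measurable A.
Proof.
move=> cA; rewrite -[A]setCK; apply: measurableC; apply: open_row_measurable.
exact: closed_openC.
Qed.

Lemma continuous_row_measurable (f : pt -> R) (D : set pt) :
  continuous f -> measurable_fun D f.
Proof.
move=> cf; apply: (@measurable_funS _ _ _ _ setT) => //.
apply: (measurability _ (RGenOpens.measurableE R)).
move=> _ [_ [a [b ->]] <-]; rewrite setTI; apply: open_row_measurable.
by apply: open_comp => // x _; exact: cf.
Qed.

End row_topology.

(** * Measure-preserving maps: translations, permutations, shears *)

Section row_invariance.
Context {R : realType}.
Local Notation lebesgue_row := (@lebesgue_row R).

Lemma lebesgue_row_preimage n (phi : 'rV[R]_n -> 'rV[R]_n) :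
  measurable_fun setT phi ->
  (forall a b, lebesgue_row n (phi @^-1` row_box a b) = (box_vol a b)%:E) ->
  forall A, measurable A -> lebesgue_row n (phi @^-1` A) = lebesgue_row n A.
Proof.
move=> mphi h A mA.
pose mfT := isMeasurableFun.Build _ _ _ _ phi mphi.
pose F : {mfun 'rV[R]_n >-> 'rV[R]_n} := HB.pack phi mfT.
exact: (@lebesgue_row_unique _ _ (pushforward (lebesgue_row n) F)).
Qed.

Lemma measurable_row_translation n (v : 'rV[R]_n) :
  measurable_fun setT (fun x : 'rV[R]_n => x + v).
Proof.
apply: measurable_row => i; under eq_fun do rewrite mxE.
by apply: measurable_funD => //; exact: measurable_row_coord.
Qed.

Lemma lebesgue_row_translation n (v : 'rV[R]_n) A : measurable A ->
  lebesgue_row n ((fun x => x + v) @^-1` A) = lebesgue_row n A.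
Proof.
apply: lebesgue_row_preimage; first exact: measurable_row_translation.
move=> a b; rewrite (_ : _ @^-1` _ = row_box (a - v) (b - v)).
  rewrite lebesgue_row_box; congr EFin; apply: eq_bigr => i _.
  by rewrite !mxE opprB addrA subrK.
by apply/seteqP; split => x h i; have := h i; rewrite /= !mxE ltrBlDr lerBrDr.
Qed.

Definition row_permute n (s : {perm 'I_n}) (x : 'rV[R]_n) : 'rV[R]_n := \row_j x ord0 (s j).

Lemma measurable_row_permute n (s : {perm 'I_n}) : measurable_fun setT (row_permute s).
Proof.
apply: measurable_row => i; under eq_fun do rewrite mxE.
exact: measurable_row_coord.
Qed.

Lemma lebesgue_row_permute n (s : {perm 'I_n}) A : measurable A ->
  lebesgue_row n (row_permute s @^-1` A) = lebesgue_row n A.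
Proof.
apply: lebesgue_row_preimage; first exact: measurable_row_permute.
move=> a b; rewrite (_ : _ @^-1` _ = row_box (row_permute (s^-1)%g a) (row_permute (s^-1)%g b)).
  rewrite lebesgue_row_box; congr EFin; rewrite /box_vol (reindex_inj (@perm_inj _ s)).
  by apply: eq_bigr => i _; rewrite !mxE permK.
apply/seteqP; split => x h i.
  by have := h ((s^-1)%g i); rewrite !mxE permKV.
by have := h (s i); rewrite !mxE permK.
Qed.

Definition flip (s : bool) : R := (-1) ^+ s.

Lemma flipK s x : flip s * (flip s * x) = x.
Proof. by rewrite mulrA /flip -exprD addnn -muln2 exprM sqrr_sign mul1r. Qed.

Lemma measurable_flip s (c : R) : measurable_fun setT (fun t : R => flip s * (t + c)).
Proof.
apply: measurable_funM => //; apply: measurable_funD => //.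
Qed.

Lemma lebesgue_flip s (c : R) (A : set (measurableTypeR R)) : measurable A ->
  lebesgue_measure ((fun t : measurableTypeR R => flip s * (t + c) : measurableTypeR R) @^-1` A) =
  lebesgue_measure A.
Proof.
move=> mA; apply/esym.
pose phi (t : measurableTypeR R) : measurableTypeR R := flip s * (t + c).
pose mfT := isMeasurableFun.Build _ _ _ _ phi (measurable_flip s c).
pose F : {mfun (measurableTypeR R) >-> (measurableTypeR R)} := HB.pack phi mfT.
apply: (@lebesgue_measure_unique _ (pushforward lebesgue_measure F)) => // X.
move=> /ocitvP[->|[[a b] /= ab ->]].
  by rewrite !measure0.
rewrite /pushforward.
rewrite (_ : F @^-1` _ = if s then [set` `[- b - c, - a - c[%R] else [set` `]a - c, b - c]%R]).
  rewrite (lebesgue_measure_itv `]a, b]); case: s @phi mfT F.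
    by move=> phi mfT F; rewrite (lebesgue_measure_itv `[- b - c, - a - c[) /= !lte_fin ab (_ : - b - c < - a - c); last (by lra); rewrite -?EFinN -!EFinD; congr EFin; lra.
  by move=> phi mfT F; rewrite (lebesgue_measure_itv `]a - c, b - c]) /= !lte_fin ab (_ : a - c < b - c); last (by lra); rewrite -?EFinN -!EFinD; congr EFin; lra.
rewrite predeqE => t; rewrite /= /phi /flip {F mfT phi}.
by case: s; rewrite /= !in_itv /= ?expr1 ?expr0; split => /andP[? ?]; apply/andP; split; lra.
Qed.

End row_invariance.

Section shear.
Context {R : realType}.
Local Notation lebesgue_row := (@lebesgue_row R).

Section pair.
Variables (n : nat) (s : bool) (c : 'rV[R]_n -> R).
Hypothesis mc : measurable_fun setT c.

Definition shear_pair (p : measurableTypeR R * 'rV[R]_n) : measurableTypeR R * 'rV[R]_n :=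
  (flip s * (p.1 + c p.2) : R, p.2).

Lemma measurable_shear_pair : measurable_fun setT shear_pair.
Proof.
apply/measurable_fun_pairP; split => /=; last exact: measurable_snd.
apply: measurable_funM => //; apply: measurable_funD.
  exact: measurable_fst.
exact: (measurableT_comp mc measurable_snd).
Qed.

(** [product_measure2] integrates the measures of the sections with the second coordinate fixed.
    Such a section is a translate of C, possibly reflected, hence has the measure of C. *)
Lemma shear_pair_invariant (A : set (measurableTypeR R * 'rV[R]_n)) : measurable A ->
  (lebesgue_measure \x lebesgue_row n)%E (shear_pair @^-1` A) =
  (lebesgue_measure \x lebesgue_row n)%E A.
Proof.
move=> mA; apply/esym.
have m1 : forall X : set (measurableTypeR R * 'rV[R]_n), measurable X ->
    (lebesgue_measure \x lebesgue_row n)%E X = (lebesgue_measure \x^ lebesgue_row n)%E X.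
  by apply: product_measure_unique => C D mC mD; exact: product_measure2E.
pose mfT := isMeasurableFun.Build _ _ _ _ shear_pair measurable_shear_pair.
pose F : {mfun (measurableTypeR R * 'rV[R]_n)%type >-> (measurableTypeR R * 'rV[R]_n)%type} :=
  HB.pack shear_pair mfT.
apply: (@product_measure_unique _ _ _ _ _ _ _ (pushforward (lebesgue_measure \x lebesgue_row n)%E F)) => // C D mC mD.
have mp : measurable (shear_pair @^-1` (C `*` D)).
  by rewrite -[X in measurable X]setTI; apply: measurable_shear_pair => //; exact: measurableX.
apply: (etrans (m1 _ mp)).
rewrite /product_measure2.
rewrite (eq_integral (fun y => lebesgue_measure C * (\1_D y)%:E)%E).
  rewrite ge0_integralZl ?integral_indic ?setIT//.
  exact: measurableT_comp.
move=> y _ /=; rewrite /ysection indicE.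
have [yD|yD] := boolP (y \in D).
  rewrite mule1 -(lebesgue_flip s (c y) mC); congr lebesgue_measure.
  apply/seteqP; split => t.
    by move=> /set_mem[].
  by move=> ?; apply/mem_set; split => //=; exact: set_mem yD.
rewrite mule0 [X in lebesgue_measure X](_ : _ = set0) ?measure0//.
apply/seteqP; split => t //; move=> /set_mem[_ /= yD'].
by move/negP : yD; apply; exact: mem_set.
Qed.
End pair.

Variables (n : nat) (nu : 'I_n) (s : bool) (c : 'rV[R]_n -> R).
Local Notation pt := 'rV[R]_n.

(** The map that straightens a chart: it sends the half space y_nu > 0 to the side of the graph of
    [c] where [c x] is below the signed coordinate x_nu. As [c] ignores that coordinate, the
    Jacobian is 1 or -1. *)
Definition shear (y : pt) : pt :=
  \row_i if i == nu then flip s * (y ord0 nu + c y) else y ord0 i.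
Definition unshear (x : pt) : pt :=
  \row_i if i == nu then flip s * x ord0 nu - c x else x ord0 i.

Definition indep (f : pt -> R) := forall y t, f (y + t *: 'e_nu) = f y.

Lemma row_eE t i : (t *: 'e_nu : pt) ord0 i = if i == nu then t else 0.
Proof. by rewrite !mxE eqxx /=; case: eqP => _; rewrite ?mulr1 ?mulr0. Qed.

Lemma indep_eq f (x y : pt) : indep f -> (forall i, i != nu -> x ord0 i = y ord0 i) -> f x = f y.
Proof.
move=> h xy; rewrite -(h y (x ord0 nu - y ord0 nu)); congr f.
apply/rowP => i; rewrite mxE row_eE; case: eqP => [->|/eqP /xy ->].
  by rewrite addrC subrK.
by rewrite addr0.
Qed.

Hypothesis ci : indep c.

Lemma shearK : cancel shear unshear.
Proof.
move=> y; apply/rowP => i; rewrite !mxE eqxx flipK.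
rewrite (@indep_eq _ (shear y) y ci); last by move=> j jn; rewrite mxE (negbTE jn).
by case: eqP => [->|//]; rewrite addrK.
Qed.
Lemma unshearK : cancel unshear shear.
Proof.
move=> x; apply/rowP => i; rewrite !mxE eqxx.
rewrite (@indep_eq _ (unshear x) x ci); last by move=> j jn; rewrite mxE (negbTE jn).
by rewrite subrK flipK; case: eqP => [->|].
Qed.

Hypothesis mc : measurable_fun setT c.

Lemma measurable_shear : measurable_fun setT shear.
Proof.
apply: measurable_row => i; under eq_fun do rewrite mxE; case: eqP => _.
  apply: measurable_funM => //; apply: measurable_funD => //.
  exact: measurable_row_coord.
exact: measurable_row_coord.
Qed.

End shear.

Lemma lebesgue_row_shear0 {R : realType} (n : nat) (s : bool) (c : 'rV[R]_n.+1 -> R) :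
  indep ord0 c -> measurable_fun setT c -> forall A, measurable A ->
  lebesgue_row n.+1 (shear ord0 s c @^-1` A) = lebesgue_row n.+1 A.
Proof.
move=> ci mc A mA.
pose c' (x : 'rV[R]_n) := c (row_cons ((0 : R), x)).
have mc' : measurable_fun setT c'.
  apply: (measurableT_comp mc); apply: measurableT_comp; first exact: measurable_row_cons.
  exact: measurable_pair1.
have E p : shear ord0 s c (row_cons p) = row_cons (shear_pair s c' p).
  apply/rowP => i /=.
  rewrite mxE; case: (unliftP ord0 i) => [j|] ->.
    by rewrite eq_sym (negbTE (neq_lift _ _)) !row_consS.
  rewrite eqxx !row_cons0 /=; congr (_ * (_ + _)).
  apply: (indep_eq ci) => j; case: (unliftP ord0 j) => [k|] ->; last by rewrite eqxx.
  by rewrite !row_consS.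
have mA' : measurable (@row_cons R n @^-1` A).
  by rewrite -[X in measurable X]setTI; exact: measurable_row_cons.
rewrite /= /lebesgue_step /pushforward -(shear_pair_invariant s mc' mA').
congr (_ _); apply/seteqP; split => p /=; by rewrite E.
Qed.

(** Conjugation by the transposition of [ord0] and [nu] moves the sheared coordinate to the first
    place, the one split off by [row_cons]. *)
Lemma lebesgue_row_shear {R : realType} (n : nat) (nu : 'I_n) (s : bool) (c : 'rV[R]_n -> R) :
  indep nu c -> measurable_fun setT c -> forall A, measurable A ->
  lebesgue_row n (shear nu s c @^-1` A) = lebesgue_row n A.
Proof.
case: n nu c => [[]//|n] nu c ci mc A mA.
pose t := tperm ord0 nu.
pose P : 'rV[R]_n.+1 -> 'rV[R]_n.+1 := row_permute t.
have tt i : t (t i) = i by rewrite /t tpermK.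
have PK x : P (P x) = x by apply/rowP => i; rewrite !mxE tt.
have mP : measurable_fun setT P by exact: measurable_row_permute.
have ti i : (t i == ord0) = (i == nu).
  by apply/eqP/eqP => [e|->]; [rewrite -(tt i) e /t tpermL|rewrite /t tpermR].
pose c' x := c (P x).
have c'i : indep ord0 c'.
  move=> y u; apply: (indep_eq ci) => i inu; rewrite !mxE eqxx /=.
  by rewrite ti (negbTE inu) mulr0 addr0.
have mc' : measurable_fun setT c' by exact: (measurableT_comp mc).
have E x : P (shear ord0 s c' (P x)) = shear nu s c x.
  apply/rowP => i; rewrite !mxE ti /c' PK tt; case: eqP => // _.
  by rewrite /t tpermL.
have mPA : measurable (P @^-1` A) by rewrite -[X in measurable X]setTI; exact: mP.
have mS : measurable (shear ord0 s c' @^-1` (P @^-1` A)).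
  by rewrite -[X in measurable X]setTI; apply: measurable_shear.
rewrite -[RHS](lebesgue_row_permute t mA) -[RHS](lebesgue_row_shear0 s c'i mc' mPA).
rewrite -[RHS](lebesgue_row_permute t mS); congr (_ _).
by apply/seteqP; split => x /=; rewrite -E.
Qed.

Section measure_preserving.
Context {R : realType} (n : nat).
Local Notation pt := 'rV[R]_n.
Local Notation mu := (lebesgue_row n : {measure set pt -> \bar R}).

Definition mpres (phi : pt -> pt) : Prop :=
  measurable_fun setT phi /\
  forall A, measurable A -> lebesgue_row n (phi @^-1` A) = lebesgue_row n A.

Lemma mpres_translation v : mpres (fun x => x + v).
Proof.
by split; [exact: measurable_row_translation|exact: lebesgue_row_translation].
Qed.

Lemma mpres_shear nu s c : indep nu c -> measurable_fun setT c -> mpres (shear nu s c).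
Proof. by move=> ? ?; split; [exact: measurable_shear|exact: lebesgue_row_shear]. Qed.

Variable phi : pt -> pt.
Hypothesis hphi : mpres phi.

Lemma mpres_measurable A : measurable A -> measurable (phi @^-1` A).
Proof. by move=> mA; rewrite -[X in measurable X]setTI; exact: hphi.1. Qed.

Lemma mpres_measurable_fun d (S : measurableType d) (D : set pt) (f : pt -> S) : measurable D ->
  measurable_fun D f -> measurable_fun (phi @^-1` D) (f \o phi).
Proof.
move=> mD mf; apply: (@measurable_comp _ _ _ _ _ _ D) => //.
  by move=> _ [x /= ? <-].
by apply: (@measurable_funS _ _ _ _ setT) => //; exact: hphi.1.
Qed.

Lemma mpres_ge0_integral (D : set pt) (f : pt -> \bar R) : measurable D ->
  measurable_fun D f -> (forall x, D x -> 0 <= f x)%E ->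
  (\int[mu]_(x in phi @^-1` D) f (phi x) = \int[mu]_(x in D) f x)%E.
Proof.
move=> mD mf f0.
pose mfT := isMeasurableFun.Build _ _ _ _ phi hphi.1.
pose F : {mfun pt >-> pt} := HB.pack phi mfT.
rewrite -(@ge0_integral_pushforward _ _ _ _ _ phi hphi.1 mu D f mD mf); last first.
  by move=> x /set_mem; exact: f0.
by apply: (@eq_measure_integral _ _ _ _ mu (pushforward mu F)) => A mA _; rewrite /pushforward /=; exact: hphi.2.
Qed.

Lemma mpres_integral (D : set pt) (f : pt -> R) : measurable D -> measurable_fun D f ->
  \int[mu]_(x in phi @^-1` D) f (phi x) = \int[mu]_(x in D) f x.
Proof.
move=> mD mf; rewrite /Rintegral; congr fine; rewrite [LHS]integralE [RHS]integralE.
have mf' : measurable_fun D (EFin \o f) by exact/measurable_EFinP.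
congr (_ - _)%E.
  rewrite -(mpres_ge0_integral mD (measurable_funepos mf') (fun x _ => funepos_ge0 _ x)).
  by apply: eq_integral => x _; rewrite (_ : (fun y => (f (phi y))%:E) = (EFin \o f) \o phi)// funepos_comp.
rewrite -(mpres_ge0_integral mD (measurable_funeneg mf') (fun x _ => funeneg_ge0 _ x)).
by apply: eq_integral => x _; rewrite (_ : (fun y => (f (phi y))%:E) = (EFin \o f) \o phi)// funeneg_comp.
Qed.

Lemma mpres_L2on (D : set pt) (f : pt -> R) : measurable D ->
  L2on mu D f -> L2on mu (phi @^-1` D) (f \o phi).
Proof.
move=> mD [mf f2]; split; first exact: mpres_measurable_fun.
rewrite (@mpres_ge0_integral D (fun x => (f x ^+ 2)%:E))//.
  by apply/measurable_EFinP; exact: measurable_funX.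
by move=> x _; rewrite lee_fin sqr_ge0.
Qed.

Lemma mpres_L2_ip (D : set pt) (f g : pt -> R) : measurable D ->
  L2on mu D f -> L2on mu D g ->
  L2_ip mu (phi @^-1` D) (f \o phi) (g \o phi) = L2_ip mu D f g.
Proof.
move=> mD [mf _] [mg _].
by apply: (@mpres_integral D (fun x => f x * g x)) => //; exact: measurable_funM.
Qed.

Lemma mpres_isometry (D : set pt) (mD : measurable D) : phi @^-1` D = D ->
  isometry_on (L2_form mu mD) (fun f => f \o phi).
Proof.
move=> pD; split => [a f g //|f|f g df dg] /=.
  by rewrite -{2}pD; exact: mpres_L2on.
by rewrite -{1}pD mpres_L2_ip.
Qed.

End measure_preserving.

(** * Differential calculus in the half space *)

Section gradient.
Context {R : realType} (n : nat).
Local Notation pt := 'rV[R]_n.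
Implicit Types (x y : pt) (f g : pt -> R) (gf gg : 'I_n -> pt -> R).

Lemma is_deriveP (V : normedModType R) (x v : V) (f : V -> R) (d : R) :
  is_derive x v f d <-> h^-1 * (f (x + h *: v) - f x) @[h --> 0^'] --> d.
Proof.
have E : (fun h => h^-1 *: ((f \o shift x) (h *: v) - f x)) =
    (fun h => h^-1 * (f (x + h *: v) - f x)).
  by apply/funext => h; rewrite /= /shift /= (addrC _ x).
split=> [[hd <-]|h]; first by rewrite -E; exact: hd.
have hd : derivable f x v by rewrite /derivable E; apply/cvg_ex; exists d.
by apply: DeriveDef => //; rewrite /derive E; apply/cvg_lim.
Qed.

Definition is_grad f gf : Prop :=
  [/\ continuous f, forall i, continuous (gf i) & forall i x, is_derive x 'e_i f (gf i x)].

Lemma is_grad_partial f gf i : is_grad f gf -> partial i f = gf i.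
Proof. by move=> [_ _ h]; apply/funext => x; rewrite /partial; have [_ ->] := h i x. Qed.

Lemma smooth_is_grad f : smooth f -> is_grad f (fun i => partial i f).
Proof.
move=> h; split; first by have [] := h [::].
- by move=> i; have [] := h [:: i].
- by move=> i x; have [_ /(_ i x) d] := h [::]; exact: DeriveDef.
Qed.

Lemma smooth_partial f i : smooth f -> smooth (partial i f).
Proof. by move=> h s; have := h (rcons s i); rewrite foldr_rcons. Qed.

Lemma is_grad_cst (a : R) : is_grad (fun=> a) (fun _ _ => 0).
Proof.
by split => [||i x]; [exact: cst_continuous|move=> i; exact: cst_continuous|exact: is_derive_cst].
Qed.

Lemma is_gradD f gf g gg : is_grad f gf -> is_grad g gg ->
  is_grad (fun x => f x + g x) (fun i x => gf i x + gg i x).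
Proof.
move=> [cf cgf df] [cg cgg dg]; split.
- by move=> x; exact: (cvgD (cf x) (cg x)).
- by move=> i x; exact: (cvgD (cgf i x) (cgg i x)).
- by move=> i x; apply: is_deriveD.
Qed.

Lemma is_gradM f gf g gg : is_grad f gf -> is_grad g gg ->
  is_grad (fun x => f x * g x) (fun i x => f x * gg i x + g x * gf i x).
Proof.
move=> [cf cgf df] [cg cgg dg]; split.
- by move=> x; exact: (cvgM (cf x) (cg x)).
- by move=> i x; exact: (cvgD (cvgM (cf x) (cgg i x)) (cvgM (cg x) (cgf i x))).
- by move=> i x; apply: is_deriveM.
Qed.

Lemma is_gradZ a f gf : is_grad f gf -> is_grad (fun x => a * f x) (fun i x => a * gf i x).
Proof.
move=> hf; have := is_gradM (is_grad_cst a) hf; congr is_grad.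
by apply/funext => i; apply/funext => x; rewrite mulr0 addr0.
Qed.

Lemma is_gradN f gf : is_grad f gf -> is_grad (fun x => - f x) (fun i x => - gf i x).
Proof.
move=> hf; have := is_gradZ (-1) hf; congr is_grad.
  by apply/funext => x; rewrite mulN1r.
by apply/funext => i; apply/funext => x; rewrite mulN1r.
Qed.

Lemma is_gradB f gf g gg : is_grad f gf -> is_grad g gg ->
  is_grad (fun x => f x - g x) (fun i x => gf i x - gg i x).
Proof. by move=> hf hg; apply: is_gradD hf (is_gradN hg). Qed.

Lemma is_grad_sum I (r : seq I) (F : I -> pt -> R) F' : (forall k, is_grad (F k) (F' k)) ->
  is_grad (fun x => \sum_(k <- r) F k x) (fun i x => \sum_(k <- r) F' k i x).
Proof.
move=> h; elim: r => [|k r ih].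
  have := is_grad_cst 0; congr is_grad; first by apply/funext => x; rewrite big_nil.
  by apply/funext => i; apply/funext => x; rewrite big_nil.
have := is_gradD (h k) ih; congr is_grad; first by apply/funext => x; rewrite big_cons.
by apply/funext => i; apply/funext => x; rewrite big_cons.
Qed.

Lemma is_grad_coord (h h' : R -> R) j : continuous h -> continuous h' ->
  (forall t : R, is_derive t 1 h (h' t)) ->
  is_grad (fun x => h (x ord0 j)) (fun i x => if i == j then h' (x ord0 j) else 0).
Proof.
move=> ch ch' dh; split.
- by move=> x; apply: (@continuous_comp _ _ _ (fun x : pt => x ord0 j) h); [exact: coord_continuous|exact: ch].
- move=> i x; case: eqP => _; last exact: cst_continuous.
  by apply: (@continuous_comp _ _ _ (fun x : pt => x ord0 j) h'); [exact: coord_continuous|exact: ch'].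
- move=> i x; apply/is_deriveP.
  have E t : (x + t *: 'e_i) ord0 j = x ord0 j + (if i == j then t else 0).
    by rewrite mxE row_eE eq_sym.
  under eq_fun do rewrite E.
  case: eqP => _.
    have /is_deriveP := dh (x ord0 j).
    by under eq_fun do rewrite -[_ *: _]/(_ * _) mulr1.
  under eq_fun do rewrite addr0 subrr mulr0; exact: cvg_cst.
Qed.

Lemma is_grad_translation f gf v : is_grad f gf ->
  is_grad (fun x => f (x + v)) (fun i x => gf i (x + v)).
Proof.
have cv : continuous (fun x => x + v) by move=> x; exact: (cvgD cvg_id (cvg_cst v)).
move=> [cf cgf df]; split.
- by move=> x; apply: (@continuous_comp _ _ _ (fun x => x + v) f); [exact: cv|exact: cf].
- by move=> i x; apply: (@continuous_comp _ _ _ (fun x => x + v) (gf i)); [exact: cv|exact: cgf].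
- move=> i x; apply/is_deriveP; have /is_deriveP := df i (x + v).
  by under eq_fun do rewrite addrAC.
Qed.

Lemma line_derive f gf x i (t : R) : is_grad f gf ->
  is_derive t 1 (fun s : R => f (x + s *: 'e_i)) (gf i (x + t *: 'e_i)).
Proof.
move=> [_ _ df]; apply/is_deriveP; have /is_deriveP := df i (x + t *: 'e_i).
by under eq_fun do rewrite -addrA -scalerDl; under [in X in _ -> X]eq_fun do rewrite -[_ *: 1]/(_ * 1) mulr1.
Qed.

(** The intermediate point is a fraction [th] of the step, so that both signs of t are covered at
    once. *)
Lemma grad_mvt f gf x i t : is_grad f gf -> exists th, 0 <= th <= 1 /\
  f (x + t *: 'e_i) - f x = t * gf i (x + (th * t) *: 'e_i).
Proof.
move=> hf; pose F s := f (x + (s * t) *: 'e_i); pose F' s := t * gf i (x + (s * t) *: 'e_i).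
have dF (s : R) : is_derive s 1 F (F' s).
  have dl := @line_derive f gf x i (s * t) hf.
  have dm : is_derive s 1 (fun s : R => s * t) t.
    apply/is_deriveP; apply: cvg_near_cst.
    near=> h; rewrite /GRing.scale /= mulr1 mulrDl addrAC subrr add0r mulKf//.
    by near: h; exact: nbhs_dnbhs_neq.
  have := @is_derive1_comp R (fun s : R => f (x + s *: 'e_i)) (fun s : R => s * t) s _ _ dl dm.
  by rewrite /F /F' mulrC.
have cF : {within `[0, 1], continuous F}.
  apply: derivable_within_continuous => s _; by have [] := dF s.
have [c] := @MVT R F F' 0 1 ltr01 (fun s _ => dF s) cF.
rewrite in_itv /= /F mul1r mul0r scale0r addr0 subr0 mulr1 => /andP[c0 c1 ->].
by exists c; rewrite !ltW.
Unshelve. all: by end_near. Qed.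

End gradient.

Section update.
Context {R : realType} (n : nat).
Local Notation pt := 'rV[R]_n.
Implicit Types (x y : pt) (f g h : pt -> R) (gf gg gh : 'I_n -> pt -> R).

Lemma continuous_row (T : topologicalType) (F : T -> pt) :
  (forall i, continuous (fun u => F u ord0 i)) -> continuous F.
Proof.
move=> cF u; apply/cvg_ballP => e e0.
have : \forall w \near u, forall i, `|F u ord0 i - F w ord0 i| < e.
  apply: filter_forall => i.
  have /cvgrPdist_lt := cF i u; exact.
apply: filterS => w h; rewrite -ball_normE /ball_ /=.
by apply: row_norm_lt => // i; rewrite !mxE.
Qed.

Variable nu : 'I_n.

Definition upd h (x : pt) : pt := \row_i if i == nu then h x else x ord0 i.

Lemma continuous_upd h : continuous h -> continuous (upd h).
Proof.
move=> ch; apply: continuous_row => i; under eq_fun do rewrite mxE.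
by case: eqP => _ //; exact: coord_continuous.
Qed.

Lemma upd_step h x j t :
  upd h (x + t *: 'e_j) = (upd h x + (if j == nu then 0 else t) *: 'e_j)
     + (h (x + t *: 'e_j) - h x) *: 'e_nu.
Proof.
apply/rowP => i; rewrite !mxE eqxx /=.
case: (eqVneq i nu) => [->|inu] /=; case: (eqVneq j nu) => [->|jnu] //=;
  rewrite ?eqxx /=; rewrite ?(eq_sym nu) ?(negbTE jnu) ?(negbTE inu) /= ?mulr0 ?mulr1 ?addr0 ?mul0r ?addr0 //;
  by rewrite addrC subrK.
Qed.

(** Chain rule from partial derivatives alone. The increment is a step along e_j, whose quotient
    tends to a partial derivative, followed by a step along e_nu of size [k t], where the mean value
    theorem and the continuity of [gf nu] apply. *)
Lemma is_grad_upd f gf h gh : is_grad f gf -> is_grad h gh ->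
  is_grad (fun x => f (upd h x))
    (fun j x => (if j == nu then 0 else gf j (upd h x)) + gh j x * gf nu (upd h x)).
Proof.
move=> hf hh; have [cf cgf df] := hf; have [ch cgh dh] := hh.
have cU := continuous_upd ch.
have cfU i : continuous (fun x => gf i (upd h x)).
  by move=> x; apply: (@continuous_comp _ _ _ (upd h) (gf i)); [exact: cU|exact: cgf].
split.
- by move=> x; apply: (@continuous_comp _ _ _ (upd h) f); [exact: cU|exact: cf].
- move=> j x.
  have c1 : continuous (fun x => if j == nu then 0 else gf j (upd h x)).
    by case: eqP => _; [exact: cst_continuous|exact: cfU].
  exact: (cvgD (c1 x) (cvgM (cgh j x) (cfU nu x))).
move=> j x; apply/is_deriveP.
pose k t := h (x + t *: 'e_j) - h x.
pose q t := upd h x + (if j == nu then 0 else t) *: 'e_j.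
have hth t := grad_mvt (q t) nu (k t) hf.
have [th thP] := choice hth.
have cx : (x + t *: 'e_j) @[t --> (0:R)^'] --> x.
  rewrite -[X in _ --> X]addr0 -[X in _ --> x + X](scale0r ('e_j : pt)).
  apply: cvgD; first exact: cvg_cst.
  by apply: cvgZr_tmp; exact: nbhs_dnbhs.
have ck : k t @[t --> (0:R)^'] --> (0 : R).
  have := cvgB (cvg_comp _ h cx (ch x)) (cvg_cst (h x)); rewrite subrr; exact.
have cthk : th t * k t @[t --> (0:R)^'] --> (0 : R).
  apply/cvgr0Pnorm_lt => e e0; have /cvgr0Pnorm_lt/(_ e e0) := ck.
  apply: filterS => t; apply: le_lt_trans; rewrite normrM ler_piMl//.
  by have [/andP[t0 t1] _] := thP t; rewrite ger0_norm.
have cq : q t + (th t * k t) *: 'e_nu @[t --> (0:R)^'] --> upd h x.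
  have c1 : (if j == nu then 0 else t) @[t --> (0:R)^'] --> (0 : R).
    by case: eqP => _; [exact: cvg_cst|exact: nbhs_dnbhs].
  have := cvgD (cvgD (cvg_cst (upd h x)) (@cvgZr_tmp _ _ _ _ _ _ _ ('e_j : pt) c1))
    (@cvgZr_tmp _ _ _ _ _ _ _ ('e_nu : pt) cthk).
  by rewrite !scale0r !addr0; exact.
have E t : t^-1 * (f (upd h (x + t *: 'e_j)) - f (upd h x)) =
   t^-1 * (f (q t) - f (upd h x)) + (t^-1 * k t) * gf nu (q t + (th t * k t) *: 'e_nu).
  rewrite upd_step -/(q t) -/(k t).
  by have [_ e] := thP t; rewrite -mulrA -e; ring.
under eq_fun do rewrite E.
apply: cvgD; last first.
  apply: cvgM; first by have /is_deriveP := dh j x.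
  exact: (cvg_comp _ (gf nu) cq (cgf nu _)).
rewrite /q; case: eqP => jnu.
  by under eq_fun do rewrite scale0r addr0 subrr mulr0; exact: cvg_cst.
by have /is_deriveP := df j (upd h x).
Qed.

End update.

Section bounded_support.
Context {R : realType} (n : nat).
Local Notation pt := 'rV[R]_n.
Local Notation mu := (lebesgue_row n : {measure set pt -> \bar R}).
Implicit Types (x y v : pt) (f g : pt -> R) (gf gg : 'I_n -> pt -> R) (D E : set pt).

Definition bsupp (M : R) f := forall x, M < `|x| -> f x = 0.

Lemma bsupp_le M M' f : M <= M' -> bsupp M f -> bsupp M' f.
Proof. by move=> MM' h x hx; apply: h; exact: le_lt_trans hx. Qed.

Lemma bsupp_translation M f v : bsupp M f -> bsupp (M + `|v|) (fun x => f (x + v)).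
Proof.
move=> h x hx; apply: h; have := ler_normB (x + v) v; rewrite addrK; lra.
Qed.

Lemma compact_row_ball (M : R) : compact [set x : pt | `|x| <= M].
Proof.
apply: bounded_closed_compact.
  by exists M; split; rewrite ?num_real// => N MN x /=; move/le_trans; apply; exact: ltW.
apply: (@preimage_closed _ _ (fun x : pt => `|x|) [set r | r <= M]); last exact: closed_le.
by move=> x _; exact: norm_continuous.
Qed.

Lemma unif_continuous_bsupp f M : continuous f -> bsupp M f ->
  forall e, 0 < e -> exists2 d, 0 < d & forall x y, `|x - y| < d -> `|f x - f y| < e.
Proof.
move=> cf sf e e0; apply: contrapT => /forall2NP h.
have {}h k : exists xy : pt * pt, `|xy.1 - xy.2| < k.+1%:R^-1 /\ e <= `|f xy.1 - f xy.2|.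
  have [|/existsNP[x /existsNP[y /not_implyP[hd /negP he]]]] := h k.+1%:R^-1.
    by rewrite invr_gt0.
  by exists (x, y); split => //; rewrite leNgt.
have [u uP] := choice h.
have k1 k : (k.+1%:R^-1 : R) <= 1 by rewrite invf_le1// ler1n.
have uM k : `|(u k).1| <= M + 1.
  have [//|h1] := lerP `|(u k).1| (M + 1); have [h2 h3] := uP k.
  have h5 := lt_le_trans h2 (k1 k); have := ler_normD ((u k).1 - (u k).2) (u k).2; rewrite subrK => h4.
  have f1 : f (u k).1 = 0 by apply: sf; lra.
  have f2 : f (u k).2 = 0 by apply: sf; lra.
  by move: h3; rewrite f1 f2 subrr normr0 leNgt e0.
have [|p [pM pc]] := @compact_row_ball (M + 1) ((fun k => (u k).1) @ \oo) _.
  by exists 0%N => // k _ /=; exact: uM.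
have /cvgrPdist_lt/(_ (e / 2)) := cf p; rewrite divr_gt0// => /(_ isT) /nbhs_ballP[d /= d0 hd].
have [N _ hN] : \forall k \near \oo, (k.+1%:R^-1 : R) < d / 2.
  have /cvgr0Pnorm_lt := @cvg_harmonic R; move=> /(_ (d / 2)); rewrite divr_gt0// => /(_ isT).
  by apply: filterS => k /=; rewrite ger0_norm// invr_ge0.
have [] := pc [set (u k).1 | k in [set k | (N <= k)%N]] (ball p (d / 2)) _ _.
- by exists N => // k /= Nk; exists k.
- by apply: nbhsx_ballx; rewrite divr_gt0.
move=> _ [[k /= Nk <-]]; rewrite -ball_normE /ball_ /= => hk.
have [h2 h3] := uP k; have h4 := lt_trans h2 (hN _ Nk).
have hf x : `|p - x| < d -> `|f p - f x| < e / 2 by move=> hx; apply: hd; rewrite -ball_normE.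
have := hf (u k).1; have := hf (u k).2.
have := ler_normD (p - (u k).1) ((u k).1 - (u k).2); rewrite subrKA => h5 h6 h7.
have {}h6 : `|f p - f (u k).2| < e / 2 by apply: h6; lra.
have {}h7 : `|f p - f (u k).1| < e / 2 by apply: h7; lra.
have := ler_normB (f p - f (u k).2) (f p - f (u k).1).
rewrite (_ : _ - _ = f (u k).1 - f (u k).2); last by ring.
by lra.
Qed.

Lemma bsupp_bounded f M : continuous f -> bsupp M f -> exists2 C, 0 <= C & forall x, `|f x| <= C.
Proof.
move=> cf sf.
have /compact_bounded[C [Creal hC]] : compact (f @` [set x | `|x| <= M]).
  by apply: continuous_compact; [exact: continuous_subspaceT|exact: compact_row_ball].
exists (`|C| + 1) => [|x]; first by rewrite addr_ge0.
have [xM|xM] := leP `|x| M; last by rewrite sf// normr0 addr_ge0.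
by apply: hC; [have := ler_norm C; lra|exists x].
Qed.

Lemma is_grad_bsupp f gf M i : is_grad f gf -> bsupp M f -> bsupp M (gf i).
Proof.
move=> [cf cgf df] sf x xM; have /is_deriveP h := df i x.
apply: (@cvg_unique _ (@Rhausdorff R) _ _ _ _ h); apply: cvg_near_cst.
have /nbhs_ballP[d /= d0 hd] : \forall y \near x, M < `|y|.
  by have := @norm_continuous _ _ x => /cvgr_gt; apply.
have : \forall t \near (0:R)^', `|t| < d.
  apply: nbhs_dnbhs; apply/nbhs_ballP; exists d => // t.
  by rewrite -ball_normE /ball_ /= sub0r normrN.
apply: filterS => t td; rewrite !sf ?subrr ?mulr0//.
apply: hd; rewrite -ball_normE /ball_ /= opprD addrA subrr add0r normrN.
apply: row_norm_lt => // j; rewrite row_eE; case: eqP => // _; by rewrite normr0.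
Qed.

(** Bounded on D and zero off some cube: a class stable under sums, products and restriction, and
    contained in both L1 and L2, which discharges the integrability conditions below. *)
Definition nice D f := measurable_fun D f /\
  exists C k, forall x, D x -> `|f x| <= C /\ (~ row_cube k x -> f x = 0).

Lemma nice_sub D E f : measurable D -> E `<=` D -> nice D f -> nice E f.
Proof.
move=> mD ED [mf [C [k h]]]; split; first exact: measurable_funS mf.
by exists C, k => x /ED; exact: h.
Qed.

Lemma row_cube_mono k l : (k <= l)%N -> @row_cube R n k `<=` row_cube l.
Proof.
move=> kl x h i; have := h i; rewrite !mxE => /andP[h1 h2].
have kl' : (k%:R : R) <= l%:R by rewrite ler_nat.
by apply/andP; split; lra.
Qed.

Lemma niceD D f g : measurable D -> nice D f -> nice D g -> nice D (fun x => f x + g x).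
Proof.
move=> mD [mf [C [k hf]]] [mg [C' [k' hg]]]; split; first exact: measurable_funD.
exists (C + C'), (maxn k k') => x Dx; have [f1 f2] := hf _ Dx; have [g1 g2] := hg _ Dx.
split; first by apply: le_trans (ler_normD _ _) _; exact: lerD.
by move=> h; rewrite f2 ?g2 ?addr0// => h'; apply: h; apply: row_cube_mono h';
  [exact: leq_maxr|exact: leq_maxl].
Qed.

Lemma niceZ D a f : measurable D -> nice D f -> nice D (fun x => a * f x).
Proof.
move=> mD [mf [C [k hf]]]; split; first exact: measurable_funM.
exists (`|a| * C), k => x Dx; have [f1 f2] := hf _ Dx.
by split=> [|h]; [rewrite normrM ler_wpM2l|rewrite f2 ?mulr0].
Qed.

Lemma niceB D f g : measurable D -> nice D f -> nice D g -> nice D (fun x => f x - g x).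
Proof.
move=> mD hf hg; have := niceD mD hf (niceZ (-1) mD hg).
by congr nice; apply/funext => x; rewrite mulN1r.
Qed.

Lemma niceM D f g : measurable D -> nice D f -> nice D g -> nice D (fun x => f x * g x).
Proof.
move=> mD [mf [C [k hf]]] [mg [C' [k' hg]]]; split; first exact: measurable_funM.
exists (C * C'), k => x Dx; have [f1 f2] := hf _ Dx; have [g1 g2] := hg _ Dx.
by split=> [|h]; [rewrite normrM ler_pM|rewrite f2 ?mul0r].
Qed.

Lemma bsupp_nice D f M : continuous f -> bsupp M f -> nice D f.
Proof.
move=> cf sf; split; first exact: continuous_row_measurable.
have [C C0 hC] := bsupp_bounded cf sf.
exists C, (Num.truncn M).+1 => x Dx; split => // h; apply: sf.
rewrite ltNge; apply/negP => xM; apply: h => i; rewrite !mxE.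
have : `|x ord0 i| < (Num.truncn M).+1%:R.
  by apply: le_lt_trans (truncnS_gt M); apply: le_trans xM; exact: row_coord_le.
by rewrite ltr_norml => /andP[-> /ltW ->].
Qed.

Lemma lebesgue_row_cube k : mu (@row_cube R n k) = ((2 * k%:R) ^+ n)%:E.
Proof.
rewrite -[LHS]/(lebesgue_row n _) /row_cube lebesgue_row_box; congr EFin.
rewrite /box_vol (eq_bigr (fun=> 2 * k%:R)) ?prodr_const ?card_ord// => i _.
by rewrite !mxE opprK max_r; [ring|rewrite addr_ge0].
Qed.

Lemma measurable_row_cube k : measurable (@row_cube R n k).
Proof. exact: measurable_row_box. Qed.

Lemma nice_L2on D f : measurable D -> nice D f -> L2on mu D f.
Proof.
move=> mD [mf [C [k h]]]; split => //.
pose Q := D `&` @row_cube R n k.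
have mQ : measurable Q by apply: measurableI => //; exact: measurable_row_cube.
apply: (@le_lt_trans _ _ (\int[mu]_(x in D) ((C ^+ 2)%:E * (\1_Q x)%:E))%E).
  apply: ge0_le_integral => //.
  - by move=> x _; rewrite lee_fin sqr_ge0.
  - by apply/measurable_EFinP; exact: measurable_funX.
  - by apply: measurable_funeM; apply/measurable_EFinP; apply: measurable_funTS; exact: measurable_indic.
  - move=> x Dx; have [h1 h2] := h _ Dx; rewrite -EFinM lee_fin indicE.
    have [xQ|xQ] := boolP (x \in Q).
      by rewrite mulr1 -(real_normK (num_real (f x))) ler_pXn2r// ?nnegrE//; exact: le_trans h1.
    rewrite h2 ?expr0n ?mulr0// => xk; move/negP: xQ; apply; apply/mem_set; split => //.
rewrite ge0_integralZl//; last 2 first.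
- by apply/measurable_EFinP; apply: measurable_funTS; exact: measurable_indic.
- by rewrite lee_fin sqr_ge0.
rewrite integral_indic// (_ : Q `&` D = Q); last by apply/seteqP; split => x; [case|case=> ? ?; split].
apply: (@le_lt_trans _ _ ((C ^+ 2)%:E * mu (@row_cube R n k))%E).
  apply: lee_wpmul2l; first by rewrite lee_fin sqr_ge0.
  apply: le_measure; [exact: mem_set|apply: mem_set; exact: measurable_row_cube|by move=> x []].
by rewrite lebesgue_row_cube -EFinM ltry.
Qed.

Lemma nice_integrable D f : measurable D -> nice D f -> mu.-integrable D (EFin \o f).
Proof.
move=> mD hf; have [mf [C [k h]]] := hf.
pose g x := \1_(@row_cube R n k) x : R.
have hg : nice D g.
  split; first by apply: measurable_indic; exact: measurable_row_cube.
  exists 1, k => x _; rewrite /g indicE; split; first by case: (_ \in _); rewrite ?normr1 ?normr0.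
  by move=> h'; rewrite memNset.
have := L2on_integrableM mD (nice_L2on mD hf) (nice_L2on mD hg).
apply: eq_integrable => // x Dx /=; rewrite /g indicE.
have [h1 h2] := h _ (set_mem Dx).
have [_|xk] := boolP (x \in _); first by rewrite mulr1.
by rewrite h2 ?mul0r// => h'; move/negP : xk; apply; exact: mem_set.
Qed.

Lemma nice_integral_le D f e k : measurable D -> nice D f -> 0 <= e ->
  (forall x, D x -> `|f x| <= e * \1_(@row_cube R n k) x) ->
  `|\int[mu]_(x in D) f x| <= e * (2 * k%:R) ^+ n.
Proof.
move=> mD hf e0 h; have mk := @measurable_row_cube k.
have intf := nice_integrable mD hf.
apply: le_trans (le_normr_Rintegral _ _) _ => //.
rewrite -lee_fin fineK; last by apply: integrable_fin_num => //; exact: integrable_norm.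
apply: (@le_trans _ _ (\int[mu]_(x in D) (e%:E * (\1_(row_cube k) x)%:E))%E).
  apply: ge0_le_integral => //.
  - by apply/measurable_EFinP; apply: measurableT_comp => //; exact: hf.1.
  - by apply: measurable_funeM; apply/measurable_EFinP; apply: measurable_funTS; exact: measurable_indic.
rewrite ge0_integralZl//; last by apply/measurable_EFinP; exact: measurable_indic.
rewrite integral_indic// EFinM lee_wpmul2l ?lee_fin// -lebesgue_row_cube.
by apply: le_measure; [apply: mem_set; exact: measurableI|exact: mem_set|move=> x []].
Qed.

End bounded_support.

Section difference_quotient.
Context {R : realType} (n : nat).
Local Notation pt := 'rV[R]_n.
Local Notation mu := (lebesgue_row n : {measure set pt -> \bar R}).
Implicit Types (x y v : pt) (f g : pt -> R) (gf gg : 'I_n -> pt -> R) (D E : set pt) (e h t : R).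

Definition dq (h : R) (j : 'I_n) f x := h^-1 * (f (x + h *: 'e_j) - f x).

Lemma norm_row_e (t : R) (j : 'I_n) : `|t *: 'e_j : pt| <= `|t|.
Proof.
apply: row_norm_le => // i; rewrite row_eE; case: eqP => _ //.
by rewrite normr0.
Qed.

Lemma dq_unif f gf M j e : is_grad f gf -> bsupp M f -> 0 < e ->
  exists2 d, 0 < d & forall h, h != 0 -> `|h| < d -> forall x, `|dq h j f x - gf j x| <= e.
Proof.
move=> hf sf e0; have [cf cgf df] := hf.
have [d d0 hd] := unif_continuous_bsupp (cgf j) (is_grad_bsupp j hf sf) e0.
exists d => // h h0 hh x; rewrite /dq.
have [th [/andP[t0 t1] ->]] := grad_mvt x j h hf.
rewrite mulKf//; apply/ltW/hd; rewrite addrC addKr.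
apply: le_lt_trans (norm_row_e _ _) _; apply: le_lt_trans hh.
by rewrite normrM ler_piMl// ger0_norm.
Qed.

Lemma continuous_translate f v : continuous f -> continuous (fun x => f (x + v)).
Proof.
move=> cf x; apply: (@continuous_comp _ _ _ (fun x => x + v) f); last exact: cf.
exact: (cvgD cvg_id (cvg_cst v)).
Qed.

Lemma continuous_dq h j f : continuous f -> continuous (dq h j f).
Proof.
move=> cf x.
exact: (cvgM (cvg_cst h^-1) (cvgB (@continuous_translate f (h *: 'e_j) cf x) (cf x))).
Qed.

Lemma bsupp_dq h j f M : `|h| <= 1 -> bsupp M f -> bsupp (M + 1) (dq h j f).
Proof.
move=> h1 sf x xM; rewrite /dq sf ?sf ?subrr ?mulr0//; first by lra.
have := @bsupp_translation _ _ M f (h *: 'e_j) sf x.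
have := norm_row_e h j => h2.
have h3 := ler_normB (x + h *: 'e_j) (h *: 'e_j); move: h3; rewrite addrK => h3 _.
by lra.
Qed.

Lemma ex_cube (M : R) : exists k : nat, M <= k%:R /\ forall x, `|x| <= M -> @row_cube R n k x.
Proof.
exists (Num.truncn M).+1; split; first exact/ltW/truncnS_gt.
move=> x xM i; rewrite !mxE.
have : `|x ord0 i| < (Num.truncn M).+1%:R.
  by apply: le_lt_trans (truncnS_gt M); apply: le_trans xM; exact: row_coord_le.
by rewrite ltr_norml => /andP[-> /ltW ->].
Qed.

Lemma bsupp_le_indic M k f e : bsupp M f -> (forall x, `|x| <= M -> @row_cube R n k x) ->
  0 <= e -> (forall x, `|f x| <= e) -> forall x, `|f x| <= e * \1_(@row_cube R n k) x.
Proof.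
move=> sf hk e0 h x; have [xM|xM] := leP `|x| M.
  by rewrite indicE mem_set ?mulr1//; exact: hk.
by rewrite sf// normr0 mulr_ge0// indicE.
Qed.

Lemma small_L2 (k : nat) (e : R) : 0 < e -> exists2 e', 0 < e' &
  forall D (mD : measurable D) f M, continuous f -> bsupp M f ->
  (forall x, `|x| <= M -> @row_cube R n k x) -> (forall x, `|f x| <= e') ->
  fnrm (L2_form mu mD) f <= e.
Proof.
move=> e0; pose V : R := (2 * k%:R) ^+ n; have V0 : 0 <= V by rewrite exprn_ge0.
exists (e / (V + 1)); first by rewrite divr_gt0// ltr_wpDl.
move=> D mD f M cf sf hk h.
have V1 : 0 < V + 1 by rewrite ltr_wpDl.
have e'0 : 0 <= e / (V + 1) by rewrite ltW// divr_gt0.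
have nf : nice D f by exact: bsupp_nice sf.
rewrite -(@ler_pXn2r _ 2)// ?nnegrE; [|exact: nrm_ge0|exact: ltW].
rewrite sqr_nrm /= /L2_ip; apply: le_trans (ler_norm _) _.
apply: (@le_trans _ _ ((e / (V + 1)) ^+ 2 * V)).
  apply: nice_integral_le => //; first exact: niceM.
  - by rewrite exprn_ge0.
  - move=> x Dx; have := bsupp_le_indic sf hk e'0 h x; rewrite indicE.
    case: (_ \in _); rewrite ?mulr1 ?mulr0 normrM -expr2 => hx.
      by rewrite ler_pXn2r// nnegrE.
    by rewrite expr2; have := normr_ge0 (f x); nra.
rewrite expr_div_n -mulrA ler_piMr ?sqr_ge0// ler_pdivrMl ?exprn_gt0// mulr1.
by have := V0; nra.
Qed.

Lemma dq_L2 f gf M j e : is_grad f gf -> bsupp M f -> 0 < e ->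
  exists2 d, 0 < d & forall h, h != 0 -> `|h| < d -> forall D (mD : measurable D),
    fnrm (L2_form mu mD) (dq h j f - gf j) <= e.
Proof.
move=> hf sf e0; have [cf cgf df] := hf.
have [k [_ hk]] := ex_cube (M + 1).
have [e' e'0 he'] := @small_L2 k e e0.
have [d d0 hd] := dq_unif j hf sf e'0.
exists (Num.min d 1) => [|h h0]; first by rewrite lt_min d0 ltr01.
rewrite lt_min => /andP[hhd hh1] D mD.
apply: (he' D mD _ (M + 1)) => //.
- by move=> x; exact: (cvgB (@continuous_dq h j f cf x) (cgf j x)).
- move=> x xM; rewrite !fctE (bsupp_dq _ _ sf)// ?ltW// (is_grad_bsupp j hf sf) ?subrr//; lra.
- by move=> x; exact: hd.
Qed.

End difference_quotient.

Section halfspace.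
Context {R : realType} (n : nat) (nu : 'I_n).
Local Notation pt := 'rV[R]_n.
Local Notation mu := (lebesgue_row n : {measure set pt -> \bar R}).
Implicit Types (x y v : pt) (f g : pt -> R) (gf gg : 'I_n -> pt -> R) (D E : set pt) (e h t : R).

Definition hsp (t : R) : set pt := [set x | t < x ord0 nu].
Definition slab (t : R) : set pt := [set x | 0 < x ord0 nu <= t].
(** The trace on y_nu = 0 is kept as a function on the whole space, constant along e_nu. Its
    integral over the slab of width 1 is then the integral over the hyperplane, and no measure of
    lower dimension is involved in the half space. *)
Definition trc f x := f (upd nu (fun=> 0) x).

Lemma measurable_hsp t : measurable (hsp t).
Proof.
rewrite (_ : hsp t = (fun x => x ord0 nu) @^-1` `]t, +oo[%classic).
  by rewrite -[X in measurable X]setTI; exact: measurable_row_coord.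
by apply/seteqP; split => x; rewrite /hsp /= in_itv /= andbT.
Qed.
Lemma measurable_slab t : measurable (slab t).
Proof.
rewrite (_ : slab t = (fun x => x ord0 nu) @^-1` `]0, t]%classic).
  by rewrite -[X in measurable X]setTI; exact: measurable_row_coord.
by apply/seteqP; split => x; rewrite /slab /= in_itv.
Qed.

Lemma trc_indep f : indep nu (trc f).
Proof.
move=> y t; rewrite /trc; congr f; apply/rowP => i; rewrite !mxE.
by case: eqP => [//|_]; rewrite eqxx /= mulr0 addr0.
Qed.

Lemma slab_double (g : pt -> R) t : indep nu g -> 0 < t -> nice (slab (t + t)) g ->
  \int[mu]_(x in slab (t + t)) g x = 2 * \int[mu]_(x in slab t) g x.
Proof.
move=> gi t0 ng.
pose S2 : set pt := [set x | t < x ord0 nu <= t + t].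
have mS2 : measurable S2.
  rewrite (_ : S2 = (fun x => x ord0 nu) @^-1` `]t, t + t]%classic).
    by rewrite -[X in measurable X]setTI; exact: measurable_row_coord.
  by apply/seteqP; split => x; rewrite /S2 /= in_itv.
have SU : slab (t + t) = slab t `|` S2.
  apply/seteqP; split => x; rewrite /slab /S2 /=.
    by case: (ltP t (x ord0 nu)) => h /andP[h1 h2]; [right|left]; apply/andP.
  by move=> [] /andP[h1 h2]; apply/andP; split; lra.
have mS := measurable_slab.
have ng1 : nice (slab t) g by apply: nice_sub ng => //; rewrite SU; left.
have ng2 : nice S2 g by apply: nice_sub ng => //; rewrite SU; right.
rewrite SU Rintegral_setU//; last 2 first.
- by rewrite -SU; exact: nice_integrable.
- by apply/disj_setPS => x []; rewrite /slab /S2 /= => /andP[_ h1] /andP[h2 _]; lra.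
rewrite mulr2n mulrDl mul1r; congr (_ + _).
have /(mpres_integral (mpres_translation (t *: 'e_nu))) <-// : measurable_fun S2 g by case: ng2.
rewrite (_ : _ @^-1` _ = slab t); first by apply: eq_Rintegral => x _; rewrite gi.
apply/seteqP; split => x; rewrite /S2 /slab /= mxE row_eE eqxx => /andP[h1 h2]; apply/andP; split; lra.
Qed.

Lemma slab_dyadic (g : pt -> R) q : indep nu g -> nice (slab 1) g ->
  \int[mu]_(x in slab (2 ^- q)) g x = 2 ^- q * \int[mu]_(x in slab 1) g x.
Proof.
move=> gi ng; elim: q => [|q ih]; first by rewrite expr0 invr1 mul1r.
have e2 : 2 ^- q = 2 ^- q.+1 + 2 ^- q.+1 :> R.
  by rewrite exprS invfM -mulrDl; rewrite (_ : 2^-1 + 2^-1 = 1) ?mul1r//; field.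
have := @slab_double g (2 ^- q.+1) gi _ _; rewrite -e2 ih => h.
have /h : 0 < 2 ^- q.+1 :> R by rewrite invr_gt0 exprn_gt0.
have ng' : nice (slab (2 ^- q)) g.
  apply: nice_sub ng; first exact: measurable_slab.
  move=> x /andP[h1 h2]; apply/andP; split => //; apply: le_trans h2 _.
  by rewrite invf_le1 ?exprn_gt0// exprn_ege1// ler1n.
have e4 : 2 * 2 ^- q.+1 = 2 ^- q :> R by rewrite [RHS]e2; ring.
by move=> /(_ ng') h'; apply: (@mulfI _ (2 : R)) => //; rewrite -h' mulrA e4.
Qed.

Lemma nice_trc M f : continuous f -> bsupp M f -> nice (slab 1) (trc f).
Proof.
move=> cf sf; split.
  apply: continuous_row_measurable => x.
  apply: (@continuous_comp _ _ _ (upd nu (fun=> 0)) f); last exact: cf.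
  by apply: continuous_upd; exact: cst_continuous.
have [C C0 hC] := bsupp_bounded cf sf.
have [k [_ hk]] := @ex_cube R n (Num.max M 1).
exists C, k => x /andP[x0 x1]; split; first exact: hC.
move=> xk; apply: sf; rewrite ltNge; apply/negP => h; apply: xk; apply: hk.
apply: row_norm_le; first by rewrite le_max ler01 orbT.
move=> i; rewrite le_max; have [->|inu] := eqVneq i nu.
  by rewrite ger0_norm ?x1 ?orbT// ltW.
have := row_coord_le (upd nu (fun=> 0) x) i; rewrite !mxE (negbTE inu) => h'.
by rewrite (le_trans h').
Qed.

End halfspace.

Lemma real_le0_small {R : realType} (a C : R) : 0 <= C ->
  (forall e, 0 < e -> `|a| <= C * e) -> a = 0.
Proof.
move=> C0 h; apply/eqP; rewrite -normr_le0; apply/ler_addgt0Pr => e e0.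
have C1 : 0 < C + 1 by rewrite ltr_wpDl.
apply: le_trans (h (e / (C + 1)) _) _; first by rewrite divr_gt0.
rewrite add0r mulrA ler_pdivrMr// mulrC ler_pM2l//; lra.
Qed.

Lemma exp2_small {R : realType} (d : R) : 0 < d -> exists q : nat, (2 ^- q : R) < d.
Proof.
move=> d0; exists (Num.truncn d^-1).+1.
have h : d^-1 < (Num.truncn d^-1).+1%:R := truncnS_gt _.
rewrite invf_plt ?posrE ?exprn_gt0//; apply: lt_le_trans h _.
by rewrite -natrX ler_nat; apply: ltnW; exact: ltn_expl.
Qed.

Section divergence.
Context {R : realType} (n : nat).
Local Notation pt := 'rV[R]_n.
Local Notation mu := (lebesgue_row n : {measure set pt -> \bar R}).
Implicit Types (x y v : pt) (f g : pt -> R) (gf gg : 'I_n -> pt -> R) (D E : set pt) (e h t d : R).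

Lemma Rintegral_eq_dq D h j f M : measurable D -> continuous f -> bsupp M f ->
  \int[mu]_(x in D) dq h j f x =
  h^-1 * (\int[mu]_(x in D) f (x + h *: 'e_j) - \int[mu]_(x in D) f x).
Proof.
move=> mD cf sf.
have i1 : mu.-integrable D (EFin \o f) by apply: nice_integrable => //; exact: bsupp_nice sf.
have i2 : mu.-integrable D (EFin \o (fun x => f (x + h *: 'e_j))).
  apply: nice_integrable => //.
  apply: (@bsupp_nice _ _ _ _ (M + `|h *: 'e_j : pt|)); first exact: continuous_translate.
  exact: bsupp_translation.
rewrite -RintegralB// -RintegralZl//.
have := integrableB mD i2 i1; congr (_.-integrable _ _).
Unshelve. all: by [].
Qed.

Lemma int_dq_small f gf M j e : is_grad f gf -> bsupp M f -> 0 < e ->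
  exists2 d, 0 < d & forall h, h != 0 -> `|h| < d -> forall D, measurable D ->
    `|\int[mu]_(x in D) gf j x - \int[mu]_(x in D) dq h j f x| <= e.
Proof.
move=> hf sf e0; have [cf cgf df] := hf.
have [k [_ hk]] := @ex_cube R n (M + 1).
pose V : R := (2 * k%:R) ^+ n; have V0 : 0 <= V by rewrite exprn_ge0.
have V1 : 0 < V + 1 by rewrite ltr_wpDl.
have e'0 : 0 < e / (V + 1) by rewrite divr_gt0.
have [d d0 hd] := dq_unif j hf sf e'0.
exists (Num.min d 1) => [|h h0]; first by rewrite lt_min d0 ltr01.
rewrite lt_min => /andP[hhd hh1] D mD.
have cg := @continuous_dq _ _ h j f cf.
have sdq : bsupp (M + 1) (dq h j f) by apply: bsupp_dq => //; exact: ltW.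
have sg : bsupp (M + 1) (gf j) by apply: bsupp_le (is_grad_bsupp j hf sf); rewrite lerDl.
have n1 : nice D (dq h j f) by apply: bsupp_nice sdq.
have n2 : nice D (gf j) by apply: bsupp_nice sg.
rewrite -RintegralB//; try exact: nice_integrable.
apply: (@le_trans _ _ (e / (V + 1) * V)); last first.
  by rewrite mulrAC ler_pdivrMr// ler_pM2l//; lra.
apply: nice_integral_le => //; [exact: niceB|exact: ltW|].
move=> x _; apply: (@bsupp_le_indic _ _ (M + 1) k (fun x => gf j x - dq h j f x) (e / (V + 1)) _ hk (ltW e'0)).
  by move=> y yM; rewrite /= sg// sdq// subrr.
by move=> y; rewrite distrC; exact: hd.
Qed.

(** The integral of a difference quotient over the whole space is zero by translation invariance,
    and difference quotients converge uniformly to the derivative with controlled support. *)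
Lemma int_grad0 f gf M j : is_grad f gf -> bsupp M f -> \int[mu]_x gf j x = 0.
Proof.
move=> hf sf; have [cf cgf df] := hf.
apply: (@real_le0_small _ _ 1) => // e e0; rewrite mul1r.
have [d d0 hd] := int_dq_small j hf sf e0.
have := hd (d / 2) _ _ setT measurableT; rewrite (@Rintegral_eq_dq _ _ _ _ M)//.
have <- : \int[mu]_(x in setT) f (x + (d / 2) *: 'e_j) = \int[mu]_x f x.
  have /(mpres_integral (mpres_translation ((d / 2) *: 'e_j)) measurableT) <- // :
    measurable_fun setT f by exact: continuous_row_measurable.
rewrite subrr mulr0 subr0; apply; first by rewrite gt_eqF// divr_gt0.
rewrite ger0_norm ?divr_ge0 ?ltW//; lra.
Qed.

Variable nu : 'I_n.

(** Translation by h along e_nu removes the slab of width h from the half space, so the difference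
    quotient integrates to minus the mean of f over that slab. As h tends to 0 this mean tends to
    the integral of the trace. *)
Lemma int_half_grad f gf M : is_grad f gf -> bsupp M f ->
  \int[mu]_(x in hsp nu 0) gf nu x = - \int[mu]_(x in slab nu 1) trc nu f x.
Proof.
move=> hf sf; have [cf cgf df] := hf.
apply/eqP; rewrite -addr_eq0; apply/eqP.
have [k [k1 hk]] := @ex_cube R n (Num.max M 1 + 1).
have kM : M <= Num.max M 1 by rewrite le_max lexx.
have kl : 1 <= Num.max M 1 by rewrite le_max lexx orbT.
pose V : R := (2 * k%:R) ^+ n; have V0 : 0 <= V by rewrite exprn_ge0.
apply: (@real_le0_small _ _ (1 + V)) => [|e e0]; first by rewrite addr_ge0.
have [d d0 hd] := int_dq_small nu hf sf e0.
have [d' d'0 hd'] := unif_continuous_bsupp cf sf e0.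
(* A dyadic width, so that [slab_dyadic] compares the slab of width h with the slab of width 1. *)
have [q] := @exp2_small R (Num.min d (Num.min d' 1)) ltac:(by rewrite !lt_min d0 d'0 ltr01).
rewrite !lt_min => /and3P[hqd hqd' hq1].
set h := 2 ^- q in hqd hqd' hq1 *.
have h0 : 0 < h by rewrite invr_gt0 exprn_gt0.
have mP t := measurable_hsp nu t; have mS t := measurable_slab nu t.
have hn0 : h != 0 by rewrite gt_eqF.
have hnd : `|h| < d by rewrite ger0_norm// ltW.
have := hd h hn0 hnd _ (mP 0).
rewrite (@Rintegral_eq_dq _ _ _ _ M)//.
have nfP t : nice (hsp nu t) f by exact: bsupp_nice sf.
have nfS t : nice (slab nu t) f by exact: bsupp_nice sf.
have -> : \int[mu]_(x in hsp nu 0) f (x + h *: 'e_nu) = \int[mu]_(x in hsp nu h) f x.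
  have mf : measurable_fun (hsp nu h) f by exact: continuous_row_measurable.
  rewrite -(mpres_integral (mpres_translation (h *: 'e_nu)) (mP h) mf); congr (Rintegral mu _ _).
  by apply/seteqP; split => x; rewrite /hsp /= mxE row_eE eqxx; lra.
have PU : hsp nu 0 = slab nu h `|` hsp nu h.
  apply/seteqP; split => x; rewrite /hsp /slab /=.
    by case: (ltP h (x ord0 nu)) => hx x0; [right|left; apply/andP].
  by move=> [/andP[]//|]; exact: lt_trans.
rewrite [in X in h^-1 * (_ - X)]PU Rintegral_setU//; last 2 first.
- by rewrite -PU; exact: nice_integrable.
- by apply/disj_setPS => x []; rewrite /slab /hsp /= => /andP[_ h1] h2; lra.
set A := \int[mu]_(x in hsp nu 0) gf nu x.
rewrite opprD addrCA subrr addr0 mulrN opprK => hA.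
have nt : nice (slab nu 1) (trc nu f) by exact: nice_trc sf.
have sub1 : slab nu h `<=` slab nu 1.
  by move=> x /andP[h1 h2]; apply/andP; split => //; apply: le_trans h2 _; exact: ltW.
have nth : nice (slab nu h) (trc nu f) by exact: nice_sub nt.
have eT : \int[mu]_(x in slab nu 1) trc nu f x = h^-1 * \int[mu]_(x in slab nu h) trc nu f x.
  by rewrite /h (slab_dyadic q (@trc_indep _ _ nu f) nt) mulKf.
(* A cylinder along e_nu which, inside the slab, contains the supports of f and of its trace. Its
   indicator is constant along e_nu, so the error integral is of order h and survives the division
   by h. *)
pose Ck : set pt := [set x | forall i, i != nu -> - k%:R < x ord0 i <= k%:R].
have mCk : measurable Ck.
  rewrite (_ : Ck = \bigcap_(i in [set i | i != nu]) ((fun x : pt => x ord0 i) @^-1` `]- k%:R, k%:R]%classic)).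
    apply: fin_bigcap_measurable => [|i _].
      by apply: (@sub_finite_set _ _ setT) => //; exact: finite_finset.
    by rewrite -[X in measurable X]setTI; exact: measurable_row_coord.
  by apply/seteqP; split => x hx i inu; have := hx i inu; rewrite /= in_itv.
have iCk : indep nu (\1_Ck : pt -> R).
  move=> y t; rewrite !indicE; congr (_%:R); congr nat_of_bool; apply/idP/idP => /set_mem hy;
    apply/mem_set => i inu; have := hy i inu; by rewrite mxE row_eE (negbTE inu) addr0.
have sCk : slab nu 1 `&` Ck `<=` @row_cube R n k.
  move=> x [/andP[x0 x1] hx] i; rewrite !mxE; have [->|inu] := eqVneq i nu; last exact: hx.
  have : 1 <= k%:R :> R by lra.
  by move=> k1'; apply/andP; split; lra.
have nCk : nice (slab nu 1) (\1_Ck : pt -> R).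
  split; first exact: measurable_indic.
  exists 1, k => x Sx; rewrite indicE; split; first by case: (_ \in _); rewrite ?normr1 ?normr0.
  by move=> xk; rewrite memNset// => xC; apply: xk; exact: sCk.
have nCkh : nice (slab nu h) (\1_Ck : pt -> R) by exact: nice_sub nCk.
have hB : `|\int[mu]_(x in slab nu h) f x - \int[mu]_(x in slab nu h) trc nu f x| <= e * (h * V).
  have nB : nice (slab nu h) (fun x => f x - trc nu f x) by exact: niceB.
  rewrite -RintegralB//; try exact: nice_integrable.
  apply: le_trans (le_normr_Rintegral _ _) _ => //; first exact: nice_integrable.
  apply: (@le_trans _ _ (\int[mu]_(x in slab nu h) (e * \1_Ck x))).
    apply: le_Rintegral => //.
    - by have := nice_integrable (mS h) nB => /integrable_norm.
    - by apply: nice_integrable => //; exact: niceZ.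
    - move=> x /andP[x0 xh]; rewrite indicE; have [xC|xC] := boolP (x \in Ck).
        rewrite mulr1; apply/ltW/hd'; apply: le_lt_trans hqd'.
        apply: row_norm_le; first exact: ltW.
        move=> i; rewrite !mxE; case: eqP => [->|_]; last by rewrite subrr normr0 ltW.
        by rewrite subr0 ger0_norm// ltW.
      have [i [inu hi]] : exists i, i != nu /\ ~~ (- k%:R < x ord0 i <= k%:R).
        apply/not_existsP => hx; move/negP : xC; apply; apply/mem_set => i inu.
        by have := hx i; move=> /not_andP[//|/negP]; rewrite negbK.
      have xik : M < `|x ord0 i|.
        rewrite ltNge; apply/negP => hx; move/negP : hi; apply.
        have : `|x ord0 i| < k%:R.
          by apply: le_lt_trans hx _; lra.
        by rewrite ltr_norml => /andP[-> /ltW ->].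
      rewrite mulr0 sf; last exact: lt_le_trans xik (row_coord_le _ _).
      rewrite sub0r normrN /trc sf ?normr0//.
      apply: lt_le_trans (row_coord_le _ i); by rewrite !mxE (negbTE inu).
  rewrite RintegralZl//; last exact: nice_integrable.
  rewrite ler_pM2l// slab_dyadic// ler_pM2l//.
  apply: le_trans (ler_norm _) _; rewrite -[leRHS]mul1r; apply: nice_integral_le => // x Sx.
  rewrite mul1r !indicE; have [xC|] := boolP (x \in Ck); last by rewrite normr0 ler0n.
  by rewrite normr1 mem_set//; apply: sCk; split => //; exact: set_mem.
rewrite eT.
have -> : A + h^-1 * \int[mu]_(x in slab nu h) trc nu f x =
  (A + h^-1 * \int[mu]_(x in slab nu h) f x) -
  h^-1 * (\int[mu]_(x in slab nu h) f x - \int[mu]_(x in slab nu h) trc nu f x) by ring.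
apply: le_trans (ler_normB _ _) _; rewrite mulrDl mul1r; apply: lerD => //.
rewrite normrM normfV (ger0_norm (ltW h0)) ler_pdivrMl//.
by apply: le_trans hB _; rewrite le_eqVlt; apply/orP; left; apply/eqP; ring.
Qed.

End divergence.

(** * Boundary forms in the half space *)

Section flat.
Context {R : realType} (n : nat) (nu : 'I_n).
Local Notation pt := 'rV[R]_n.
Local Notation mu := (lebesgue_row n : {measure set pt -> \bar R}).
Local Notation P := (hsp nu (0 : R)).
Local Notation S := (slab nu (1 : R)).
Implicit Types (x y v : pt) (a b f g : pt -> R) (ga gb gf gg : 'I_n -> pt -> R)
  (D E : set pt) (e h t d : R) (j : 'I_n).

Definition C1c f gf := is_grad f gf /\ exists M, bsupp M f.

Lemma small_nice (k : nat) e : 0 < e -> exists2 e', 0 < e' &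
  forall D (mD : measurable D) f, measurable_fun D f ->
  (forall x, D x -> `|f x| <= e' * \1_(@row_cube R n k) x) -> fnrm (L2_form mu mD) f <= e.
Proof.
move=> e0; pose V : R := (2 * k%:R) ^+ n; have V0 : 0 <= V by rewrite exprn_ge0.
exists (e / (V + 1)); first by rewrite divr_gt0// ltr_wpDl.
move=> D mD f mf h.
have V1 : 0 < V + 1 by rewrite ltr_wpDl.
have e'0 : 0 <= e / (V + 1) by rewrite ltW// divr_gt0.
have nf : nice D f.
  split => //; exists (e / (V + 1)), k => x Dx; have := h x Dx; rewrite indicE.
  have [xk|xk] := boolP (x \in _).
    by rewrite mulr1; split => // nx; case: nx; exact: set_mem.
  by rewrite mulr0 normr_le0 => /eqP ->; rewrite normr0.
rewrite -(@ler_pXn2r _ 2)// ?nnegrE; [|exact: nrm_ge0|exact: ltW].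
rewrite sqr_nrm /= /L2_ip; apply: le_trans (ler_norm _) _.
apply: (@le_trans _ _ ((e / (V + 1)) ^+ 2 * V)).
  apply: nice_integral_le => //; first exact: niceM.
  - by rewrite exprn_ge0.
  - move=> x Dx; have := h x Dx; rewrite indicE.
    case: (_ \in _); rewrite ?mulr1 ?mulr0 normrM -expr2 => hx.
      by rewrite ler_pXn2r// nnegrE.
    by rewrite expr2; have := normr_ge0 (f x); nra.
rewrite expr_div_n -mulrA ler_piMr ?sqr_ge0// ler_pdivrMl ?exprn_gt0// mulr1.
by have := V0; nra.
Qed.

Lemma C1c_nice f gf D : C1c f gf -> nice D f.
Proof. by move=> [[cf _ _] [M sf]]; exact: bsupp_nice sf. Qed.
Lemma C1c_nice_grad f gf D j : C1c f gf -> nice D (gf j).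
Proof. by move=> [hf [M sf]]; apply: bsupp_nice (is_grad_bsupp j hf sf); have [] := hf. Qed.
Lemma C1c_L2 f gf D : measurable D -> C1c f gf -> L2on mu D f.
Proof. by move=> mD hf; apply: nice_L2on => //; exact: C1c_nice hf. Qed.
Lemma C1c_L2_grad f gf D j : measurable D -> C1c f gf -> L2on mu D (gf j).
Proof. by move=> mD hf; apply: nice_L2on => //; exact: C1c_nice_grad hf. Qed.
Lemma C1cD f gf g gg : C1c f gf -> C1c g gg -> C1c (fun x => f x + g x) (fun i x => gf i x + gg i x).
Proof.
move=> [hf [M sf]] [hg [N sg]]; split; first exact: is_gradD.
exists (Num.max M N) => x; rewrite gt_max => /andP[h1 h2].
by rewrite sf ?sg ?addr0.
Qed.
Lemma C1cZ t f gf : C1c f gf -> C1c (fun x => t * f x) (fun i x => t * gf i x).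
Proof.
move=> [hf [M sf]]; split; first exact: is_gradZ.
by exists M => x h; rewrite sf ?mulr0.
Qed.
Lemma C1cB f gf g gg : C1c f gf -> C1c g gg -> C1c (fun x => f x - g x) (fun i x => gf i x - gg i x).
Proof.
move=> hf hg; have := C1cD hf (C1cZ (-1) hg); congr C1c.
  by apply/funext => x; rewrite mulN1r.
by apply/funext => i; apply/funext => x; rewrite mulN1r.
Qed.
Lemma C1cM f gf g gg : C1c f gf -> is_grad g gg ->
  C1c (fun x => f x * g x) (fun i x => f x * gg i x + g x * gf i x).
Proof.
move=> [hf [M sf]] hg; split; first exact: is_gradM.
by exists M => x h; rewrite sf ?mul0r.
Qed.
Lemma C1c_translation f gf v : C1c f gf -> C1c (fun x => f (x + v)) (fun i x => gf i (x + v)).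
Proof.
move=> [hf [M sf]]; split; first exact: is_grad_translation.
by exists (M + `|v|); exact: bsupp_translation.
Qed.
Lemma C1c_dq f gf h j : C1c f gf -> C1c (dq h j f) (fun i => dq h j (gf i)).
Proof. by move=> hf; apply: C1cZ; apply: C1cB => //; exact: C1c_translation. Qed.

Lemma trc_translation f v : v ord0 nu = 0 ->
  trc nu (fun x => f (x + v)) = (fun x => trc nu f (x + v)).
Proof.
move=> v0; apply/funext => x; rewrite /trc; congr f; apply/rowP => i; rewrite !mxE.
by case: eqP => [->|//]; rewrite v0 addr0.
Qed.

Lemma C1c_nice_trc f gf : C1c f gf -> nice S (trc nu f).
Proof. by move=> [[cf _ _] [M sf]]; exact: nice_trc sf. Qed.
Lemma C1c_nice_trc_grad f gf j : C1c f gf -> nice S (trc nu (gf j)).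
Proof. by move=> [hf [M sf]]; apply: nice_trc (is_grad_bsupp j hf sf); have [] := hf. Qed.
Lemma C1c_trc_L2 f gf : C1c f gf -> L2on mu S (trc nu f).
Proof. by move=> hf; apply: nice_L2on (C1c_nice_trc hf); exact: measurable_slab. Qed.
Lemma C1c_trc_L2_grad f gf j : C1c f gf -> L2on mu S (trc nu (gf j)).
Proof. by move=> hf; apply: nice_L2on (C1c_nice_trc_grad j hf); exact: measurable_slab. Qed.

Local Notation FP := (L2_form mu (measurable_hsp nu 0)).
Local Notation FS := (L2_form mu (measurable_slab nu 1)).

Lemma flat_J a ga b gb : C1c a ga -> C1c b gb ->
  fip FP a (gb nu) + fip FP b (ga nu) = - fip FS (trc nu a) (trc nu b).
Proof.
move=> ha hb; have hab := C1cM ha hb.1; have [hg [M sM]] := hab.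
have mP := measurable_hsp nu (0:R).
rewrite /= /L2_ip -RintegralD//; last 2 first.
- by apply: L2on_integrableM => //; [exact: C1c_L2 ha|exact: C1c_L2_grad hb].
- by apply: L2on_integrableM => //; [exact: C1c_L2 hb|exact: C1c_L2_grad ha].
exact: int_half_grad hg sM.
Qed.

Section tangential.
Variable j : 'I_n.
Hypothesis jnu : j != nu.

Lemma row_e_nu t : (t *: 'e_j : pt) ord0 nu = 0.
Proof. by rewrite row_eE eq_sym (negbTE jnu). Qed.

Definition tau t (f : pt -> R) : pt -> R := f \o (fun x => x + t *: 'e_j).

Lemma tau_isoP t : isometry_on FP (tau t).
Proof.
apply: (mpres_isometry (mpres_translation (t *: 'e_j))).
by apply/seteqP; split => x; rewrite /hsp /= mxE row_e_nu addr0.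
Qed.
Lemma tau_isoS t : isometry_on FS (tau t).
Proof.
apply: (mpres_isometry (mpres_translation (t *: 'e_j))).
by apply/seteqP; split => x; rewrite /slab /= mxE row_e_nu addr0.
Qed.
Lemma tauK t : cancel (tau t) (tau (- t)).
Proof. by move=> f; apply/funext => x; rewrite /tau /= -addrA -scalerDl addNr scale0r addr0. Qed.

Lemma trc_tau t f : trc nu (tau t f) = tau t (trc nu f).
Proof. by rewrite /tau trc_translation//= row_e_nu. Qed.
Lemma trc_dq h f : trc nu (dq h j f) = dq h j (trc nu f).
Proof.
apply/funext => x; rewrite /dq /trc; congr (_ * (f _ - _)); apply/rowP => i; rewrite !mxE.
case: (eqVneq i nu) => [->|//]; by rewrite eq_sym (negbTE jnu) andbF mulr0 addr0.
Qed.

Lemma dqE h f : dq h j f = h^-1 *: (tau h f - f).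
Proof. by []. Qed.

Lemma dq_mul h (L : nat) f : dq (h * L%:R) j f = L%:R^-1 *: \sum_(i < L) tau (h * i%:R) (dq h j f).
Proof.
case: L => [|L]; first by rewrite big_ord0 scaler0 dqE mulr0 invr0 scale0r.
have [->|h0] := eqVneq h 0.
  have d0 : dq 0 j f = 0 by rewrite dqE invr0 scale0r.
  by rewrite mul0r d0 big1 ?scaler0.
have : \sum_(i < L.+1) tau (h * i%:R) (dq h j f) = h^-1 *: (tau (h * L.+1%:R) f - f).
  elim: L => [|L ih].
    rewrite big_ord1 mulr0 mulr1 dqE; apply/funext => x; by rewrite /tau /= scale0r addr0.
  rewrite big_ord_recr /= ih dqE; apply/funext => x; rewrite /tau !fctE /= /GRing.scale /=.
  rewrite -addrA -scalerDl (_ : h * L.+1%:R + h = h * L.+2%:R); last by rewrite -[in RHS]natr1; ring.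
  by ring.
by move=> ->; rewrite dqE scalerA invfM (mulrC h^-1).
Qed.

(** The step is cut into L equal pieces so small that each quotient is close to the derivative. By
    [dq_mul] the quotient of step h is the mean of L translates of a small-step quotient, and
    translations preserve the norm. *)
Lemma dq_le h f gf : C1c f gf -> fnrm FP (dq h j f) <= fnrm FP (gf j).
Proof.
move=> hf; have [hg [M sM]] := hf.
have mP := measurable_hsp nu (0:R).
have dqd t : fdom FP (dq t j f) by apply: C1c_L2 (C1c_dq t j hf).
have dg : fdom FP (gf j) by exact: C1c_L2_grad hf.
have [->|h0] := eqVneq h 0.
  by rewrite dqE invr0 scale0r nrm0 nrm_ge0.
apply/ler_addgt0Pr => e e0.
have [d d0 hd] := dq_L2 j hg sM e0.
pose L := (Num.truncn (`|h| / d)).+1.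
have L0 : 0 < L%:R :> R by rewrite ltr0n.
have -> : h = h / L%:R * L%:R by rewrite mulfVK// gt_eqF.
rewrite dq_mul nrmZ; last first.
  by apply: dom_sum => i _; have [_ h1 _] := tau_isoP (h / L%:R * i%:R); apply: h1.
apply: (@le_trans _ _ (fnrm FP (dq (h / L%:R) j f))).
  rewrite normfV (ger0_norm (ltW L0)) ler_pdivrMl//.
  apply: le_trans (nrm_sum _ _) _ => [i|].
    by have [_ h1 _] := tau_isoP (h / L%:R * i%:R); apply: h1.
  rewrite (eq_bigr (fun=> fnrm FP (dq (h / L%:R) j f))) ?sumr_const ?card_ord.
    by rewrite mulr_natl.
  by move=> i _; rewrite (nrmT (tau_isoP (h / L%:R * i%:R)) 0).
have hh0 : h / L%:R != 0 by rewrite mulf_neq0// invr_eq0 gt_eqF.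
have hhd : `|h / L%:R| < d.
  rewrite normrM normfV (ger0_norm (ltW L0)) ltr_pdivrMr// mulrC -ltr_pdivrMr//.
  exact: truncnS_gt.
have := hd _ hh0 hhd _ mP => h1.
rewrite -[dq _ _ _](subrK (gf j)) addrC.
apply: le_trans (nrmD _ _) _ => //; first exact: domB.
by rewrite lerD2l.
Qed.

(** [flat_J] for a and [dq h j b], where the quotient is moved onto a by invariance under tangential
    translations. A finite h avoids the mixed second derivatives that a direct integration by parts
    of [flat_I] would call for. *)
Lemma flat_Ih h a ga b gb : C1c a ga -> C1c b gb ->
  fip FP (ga nu) (dq h j b) - fip FP (dq (- h) j a) (gb nu) = - fip FS (trc nu a) (dq h j (trc nu b)).
Proof.
move=> ha hb; rewrite -trc_dq -(flat_J ha (C1c_dq h j hb)) addrC (ipC FP (ga nu)); congr (_ + _).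
have mP := measurable_hsp nu (0:R).
have da : fdom FP a by exact: C1c_L2 ha.
have db : fdom FP (gb nu) by exact: C1c_L2_grad hb.
have [l h1 h2] := tau_isoP h; have [l' h1' h2'] := tau_isoP (- h).
have dta : fdom FP (tau (- h) a) by exact: h1'.
have dtb : fdom FP (tau h (gb nu)) by exact: h1.
rewrite !dqE ipZl//; last exact: domB.
rewrite ipZr//; last exact: domB.
rewrite ipBl// ipBr// -(h2' a (tau h (gb nu)) da dtb) tauK.
by rewrite invrN mulNr opprK.
Qed.

Lemma flat_I a ga b gb : C1c a ga -> C1c b gb ->
  fip FP (ga nu) (gb j) - fip FP (ga j) (gb nu) = - fip FS (trc nu a) (trc nu (gb j)).
Proof.
move=> ha hb; apply/eqP; rewrite -addr_eq0; apply/eqP.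
have mP := measurable_hsp nu (0:R); have mS := measurable_slab nu (1:R).
have [ca [M sM]] := ha; have [cb [N sN]] := hb; have [cfb cgb _] := cb.
have da i : fdom FP (ga i) by exact: C1c_L2_grad ha.
have db i : fdom FP (gb i) by exact: C1c_L2_grad hb.
have dta : fdom FS (trc nu a) by exact: C1c_trc_L2 ha.
have dtb : fdom FS (trc nu (gb j)) by exact: C1c_trc_L2_grad hb.
apply: (@real_le0_small _ _ (fnrm FP (ga nu) + fnrm FP (gb nu) + fnrm FS (trc nu a))).
  by rewrite !addr_ge0 ?nrm_ge0.
move=> e e0.
have [d1 d10 hd1] := dq_L2 j ca sM e0.
have [d2 d20 hd2] := dq_L2 j cb sN e0.
have [k [_ hk]] := @ex_cube R n (Num.max (N + 1) 1).
have [e' e'0 he'] := small_nice k e0.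
have [d3 d30 hd3] := dq_unif j cb sN e'0.
pose h := Num.min (Num.min d1 d2) (Num.min d3 1) / 2.
have h0 : 0 < h by rewrite divr_gt0// !lt_min d10 d20 d30 ltr01.
have hlt : h < Num.min (Num.min d1 d2) (Num.min d3 1).
  by rewrite /h; move: h0; rewrite /h; lra.
move: hlt; rewrite !lt_min => /andP[/andP[l1 l2] /andP[l3 l4]].
have hn0 : h != 0 by rewrite gt_eqF.
have Hh : `|h| = h by rewrite ger0_norm// ltW.
have E := flat_Ih h ha hb.
have dqa : fdom FP (dq (- h) j a) by apply: C1c_L2 (C1c_dq (- h) j ha).
have dqb : fdom FP (dq h j b) by apply: C1c_L2 (C1c_dq h j hb).
have dqtb : fdom FS (dq h j (trc nu b)) by rewrite -trc_dq; apply: C1c_trc_L2 (C1c_dq h j hb).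
have b1 : fnrm FP (dq (- h) j a - ga j) <= e by apply: hd1; rewrite ?oppr_eq0// normrN Hh.
have b2 : fnrm FP (dq h j b - gb j) <= e by apply: hd2; rewrite ?Hh.
have b3 : fnrm FS (dq h j (trc nu b) - trc nu (gb j)) <= e.
  apply: he'.
    by apply: measurable_funB; [have [] := dqtb|have [] := dtb].
  move=> x /andP[x0 x1]; rewrite indicE; have [xk|xk] := boolP (x \in _).
    rewrite mulr1 -trc_dq; apply: hd3 => //; by rewrite Hh.
  have xl : N + 1 < `|upd nu (fun=> 0) x|.
    rewrite ltNge; apply/negP => hx; move/negP : xk; apply; apply/mem_set/hk.
    apply: row_norm_le; first by rewrite le_max ler01 orbT.
    move=> i; have [->|inu] := eqVneq i nu; first by rewrite (ger0_norm (ltW x0)) le_max x1 orbT.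
    have := row_coord_le (upd nu (fun=> 0) x) i; rewrite !mxE (negbTE inu) => h'.
    by rewrite le_max (le_trans h').
  rewrite mulr0 -trc_dq normr_le0 !fctE /trc (bsupp_dq _ _ sN)//; last by rewrite Hh ltW.
  by rewrite (is_grad_bsupp j cb sN) ?subrr//; lra.
have -> : fip FP (ga nu) (gb j) - fip FP (ga j) (gb nu) + fip FS (trc nu a) (trc nu (gb j)) =
  - fip FP (ga nu) (dq h j b - gb j) + fip FP (dq (- h) j a - ga j) (gb nu)
  - fip FS (trc nu a) (dq h j (trc nu b) - trc nu (gb j)).
  rewrite (ipBr dqb (db j) (da nu)) (ipBl dqa (da j) (db nu)) (ipBr dqtb dtb dta).
  have -> : fip FP (ga nu) (dq h j b) = fip FP (dq (- h) j a) (gb nu) - fip FS (trc nu a) (dq h j (trc nu b)).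
    by rewrite -E addrC subrK.
  by ring.
rewrite !mulrDl; apply: le_trans (ler_normB _ _) _; apply: lerD; last first.
  apply: le_trans (cauchy_schwarz _ _) _ => //; first exact: domB.
  by rewrite ler_wpM2l// nrm_ge0.
apply: le_trans (ler_normD _ _) _; rewrite normrN; apply: lerD.
  apply: le_trans (cauchy_schwarz _ _) _ => //; first exact: domB.
  by rewrite ler_wpM2l// nrm_ge0.
apply: le_trans (cauchy_schwarz _ _) _ => //; first exact: domB.
by rewrite mulrC ler_wpM2l// nrm_ge0.
Qed.

(** [flat_J] for the increment of b paired with itself. The squared increment of the trace is O(h)
    times the increment of the normal derivative, and the latter is small by continuity of
    translations: in all o(h), which is what [flat_null] lives on. *)
Lemma flat_slab_sqr h b gb : C1c b gb ->
  fnrm FS (tau h (trc nu b) - trc nu b) ^+ 2 <=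
  2 * (`|h| * fnrm FP (gb j)) * fnrm FP (tau h (gb nu) - gb nu).
Proof.
move=> hb; have mP := measurable_hsp nu (0:R).
have hd : C1c (tau h b - b) (fun i => tau h (gb i) - gb i).
  by apply: C1cB => //; exact: C1c_translation.
have := flat_J hd hd => /eqP; rewrite -addr_eq0 => /eqP E.
have -> : tau h (trc nu b) - trc nu b = trc nu (tau h b - b) by rewrite -trc_tau.
rewrite sqr_nrm.
have -> : fip FS (trc nu (tau h b - b)) (trc nu (tau h b - b)) =
   - (fip FP (tau h b - b) (tau h (gb nu) - gb nu) *+ 2).
  by apply/eqP; rewrite -addr_eq0 addrC mulr2n E.
have d1 : fdom FP (tau h b - b) by exact: C1c_L2 hd.
have d2 : fdom FP (tau h (gb nu) - gb nu) by exact: (@C1c_L2_grad _ _ P nu _ hd).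
have := cauchy_schwarz d1 d2.
have b1 : fnrm FP (tau h b - b) <= `|h| * fnrm FP (gb j).
  have [->|h0] := eqVneq h 0.
    rewrite normr0 mul0r (_ : tau 0 b - b = 0) ?nrm0//.
    by apply/funext => x; rewrite /tau !fctE /= scale0r addr0 subrr.
  rewrite (_ : tau h b - b = h *: dq h j b); last by rewrite dqE scalerA divff// scale1r.
  rewrite nrmZ; last by apply: C1c_L2 (C1c_dq h j hb).
  by rewrite ler_wpM2l//; exact: dq_le.
have := nrm_ge0 FP (tau h (gb nu) - gb nu).
rewrite mulr2n ler_norml => n0 /andP[h1 h2].
have := ler_wpM2r n0 b1; lra.
Qed.

End tangential.
End flat.

(** * The tangential form vanishes with the product of the traces *)

Section flat_null.
Context {R : realType} (n : nat) (nu j : 'I_n).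
Hypothesis jnu : j != nu.
Local Notation pt := 'rV[R]_n.
Local Notation mu := (lebesgue_row n : {measure set pt -> \bar R}).
Local Notation P := (hsp nu (0 : R)).
Local Notation S := (slab nu (1 : R)).
Local Notation FP := (L2_form mu (measurable_hsp nu 0)).
Local Notation FS := (L2_form mu (measurable_slab nu 1)).
Implicit Types (f g : pt -> R) (e h t d : R).

Definition absf f : pt -> R := fun x => `|f x|.

(** If |p| <= 2 |p'| or |q'| <= 2 |q|, an uncrossed product dominates; otherwise each of |p|, |q'|
    is at most twice the corresponding increment. *)
Lemma crossed_product (p q p' q' : R) :
  `|p| * `|q'| <= 4 * (`|p' - p| * `|q' - q|) + 2 * (`|p| * `|q|) + 2 * (`|p'| * `|q'|).
Proof.
have [h1|h1] := lerP (`|p|) (2 * `|p'|).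
  have := ler_wpM2r (normr_ge0 q') h1.
  have := mulr_ge0 (normr_ge0 p) (normr_ge0 q); have := mulr_ge0 (normr_ge0 (p' - p)) (normr_ge0 (q' - q)); lra.
have [h2|h2] := lerP (`|q'|) (2 * `|q|).
  have := ler_wpM2l (normr_ge0 p) h2.
  have := mulr_ge0 (normr_ge0 p') (normr_ge0 q'); have := mulr_ge0 (normr_ge0 (p' - p)) (normr_ge0 (q' - q)); lra.
have h3 : `|p| <= 2 * `|p' - p|.
  by have := ler_normB p' (p' - p); rewrite opprB addrCA subrr addr0; lra.
have h4 : `|q'| <= 2 * `|q' - q|.
  by have := ler_normD (q' - q) q; rewrite subrK; lra.
have := ler_pM (normr_ge0 _) (normr_ge0 _) h3 h4.
have := mulr_ge0 (normr_ge0 p) (normr_ge0 q); have := mulr_ge0 (normr_ge0 p') (normr_ge0 q'); lra.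
Qed.

Section generic.
Context (disp : measure_display) (T : measurableType disp) (m : {measure set T -> \bar R}) (D : set T) (mD : measurable D).
Local Notation F := (L2_form m mD).
Implicit Types (a b : T -> R).

Lemma absf_nrm a : fnrm F (fun x => `|a x|) = fnrm F a.
Proof.
rewrite /fnrm; congr Num.sqrt; rewrite /= !L2_ipE; apply: eq_Rintegral => x _.
by rewrite real_normK ?num_real.
Qed.

Lemma fip_abs a b : fdom F a -> fdom F b -> `|fip F a b| <= fip F (fun x => `|a x|) (fun x => `|b x|).
Proof.
move=> da db; apply: le_trans (le_normr_Rintegral _ _) _ => //.
  exact: L2on_integrableM.
by rewrite le_eqVlt; apply/orP; left; apply/eqP; apply: eq_Rintegral => x _; rewrite normrM.
Qed.

Lemma fip_le a b a' b' : fdom F a -> fdom F b -> fdom F a' -> fdom F b' ->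
  (forall x, D x -> a x * b x <= a' x * b' x) -> fip F a b <= fip F a' b'.
Proof.
move=> da db da' db' h; apply: le_Rintegral => //; exact: L2on_integrableM.
Qed.
End generic.

Lemma crossed_integral h f g : fdom FS f -> fdom FS g ->
  fip FS (absf f) (absf (tau j h g)) <=
  4 * (fnrm FS (tau j h f - f) * fnrm FS (tau j h g - g)) + 4 * fip FS (absf f) (absf g).
Proof.
move=> df dg; have [l iso1 iso2] := tau_isoS jnu h.
have mS := measurable_slab nu (1:R).
have dabs u : fdom FS u -> fdom FS (absf u) by exact: L2on_abs.
have dtf := iso1 _ df; have dtg := iso1 _ dg.
have ddf : fdom FS (tau j h f - f) by exact: domB.
have ddg : fdom FS (tau j h g - g) by exact: domB.
have intM u v : fdom FS u -> fdom FS v -> mu.-integrable S (EFin \o (fun x => absf u x * absf v x)).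
  by move=> du dv; apply: L2on_integrableM => //; exact: dabs.
apply: (@le_trans _ _ (4 * fip FS (absf (tau j h f - f)) (absf (tau j h g - g))
   + 2 * fip FS (absf f) (absf g) + 2 * fip FS (absf (tau j h f)) (absf (tau j h g)))); last first.
  have -> : fip FS (absf (tau j h f)) (absf (tau j h g)) = fip FS (absf f) (absf g).
    by rewrite -(iso2 _ _ (dabs _ df) (dabs _ dg)).
  rewrite -addrA -mulrDl (_ : 2 + 2 = 4 :> R); last by ring.
  rewrite lerD2r ler_pM2l//.
  apply: le_trans (ip_le _ _) _; [exact: dabs|exact: dabs|].
  by rewrite !absf_nrm.
rewrite /= /L2_ip.
have iZ (c : R) u v : fdom FS u -> fdom FS v ->
    mu.-integrable S (EFin \o (fun x => c * (absf u x * absf v x))).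
  by move=> du dv; apply: (integrableZl mS c (intM _ _ du dv)).
rewrite -!RintegralZl//; try exact: intM.
rewrite -RintegralD//; try exact: iZ.
rewrite -RintegralD//; try exact: iZ; last first.
  by apply: (integrableD mS (iZ _ _ _ ddf ddg) (iZ _ _ _ df dg)).
apply: le_Rintegral => //; first exact: intM.
  by apply: (integrableD mS (integrableD mS (iZ _ _ _ ddf ddg) (iZ _ _ _ df dg)) (iZ _ _ _ dtf dtg)).
by move=> x _; exact: crossed_product.
Qed.

Lemma tau_small f M e : continuous f -> bsupp M f -> 0 < e -> exists2 d, 0 < d &
  forall h, `|h| < d -> fnrm FP (tau j h f - f) <= e.
Proof.
move=> cf sf e0; have [k [_ hk]] := @ex_cube R n (M + 1).
have [e' e'0 he'] := @small_L2 R n k e e0.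
have [d d0 hd] := unif_continuous_bsupp cf sf e'0.
exists (Num.min d 1); first by rewrite lt_min d0 ltr01.
move=> h; rewrite lt_min => /andP[h1 h2].
have h3 := le_lt_trans (norm_row_e h j) h1; have h4 := le_lt_trans (norm_row_e h j) h2.
apply: (he' _ _ _ (M + 1)) => //.
- by move=> x; exact: (cvgB (@continuous_translate _ _ f (h *: 'e_j) cf x) (cf x)).
- move=> x hx; rewrite !fctE /tau /= (@bsupp_translation _ _ _ _ (h *: 'e_j) sf)//; last by lra.
  by rewrite sf ?subrr//; lra.
- by move=> x; apply/ltW; rewrite !fctE /tau /=; apply: hd; rewrite addrC addKr.
Qed.

Variables (a b : nat -> pt -> R) (ga gb : nat -> 'I_n -> pt -> R) (C : R).
Hypotheses (ha : forall m, C1c (a m) (ga m)) (hb : forall m, C1c (b m) (gb m)).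
Hypotheses (Ca : forall m i, fnrm FP (ga m i) <= C) (Cb : forall m i, fnrm FP (gb m i) <= C).
Hypothesis cauchy_ab : forall e, 0 < e -> exists N, forall m, (N <= m)%N -> forall i,
  fnrm FP (ga m i - ga N i) <= e /\ fnrm FP (gb m i - gb N i) <= e.
Hypothesis trace0 : forall e, 0 < e -> exists N, forall m, (N <= m)%N ->
  fip FS (absf (trc nu (a m))) (absf (trc nu (b m))) <= e.

(** By [flat_Ih] the form is close to a boundary pairing of one trace with the difference quotient
    of step h of the other. [crossed_integral] bounds this by 1/h times the product of the two trace
    increments, which is o(1) by [flat_slab_sqr], plus 1/h times the integral of the product of the
    traces, which tends to 0 once h is fixed. *)
Lemma flat_null e : 0 < e -> exists N, forall m, (N <= m)%N ->
  `|fip FP (ga m nu) (gb m j) - fip FP (ga m j) (gb m nu)| <= e.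
Proof.
move=> e0; have mP := measurable_hsp nu (0:R).
have C0 : 0 <= C by apply: le_trans (Ca 0 nu); exact: nrm_ge0.
have dga m i : fdom FP (ga m i) by exact: C1c_L2_grad (ha m).
have dgb m i : fdom FP (gb m i) by exact: C1c_L2_grad (hb m).
(* The losses below add up to 30 C q + q: twice 3 C q from the difference quotients, 24 C q + q from
   the boundary term. *)
pose q := e / (31 * C + 1).
have q0 : 0 < q by rewrite divr_gt0//; lra.
have [N hN] := cauchy_ab q0.
have [haN [MA sA]] := ha N; have [hbN [MB sB]] := hb N.
have [caN cgaN _] := haN; have [cbN cgbN _] := hbN.
have [d1 d10 hd1] := dq_L2 j haN sA q0.
have [d2 d20 hd2] := dq_L2 j hbN sB q0.
have [d3 d30 hd3] := tau_small (cgaN nu) (is_grad_bsupp nu haN sA) q0.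
have [d4 d40 hd4] := tau_small (cgbN nu) (is_grad_bsupp nu hbN sB) q0.
(* h is fixed from the N-th terms only; the Cauchy property makes it suitable for every later m, and
   m is then taken large depending on h. *)
pose h := Num.min (Num.min d1 d2) (Num.min d3 d4) / 2.
have h0 : 0 < h by rewrite divr_gt0// !lt_min d10 d20 d30 d40.
have hlt : h < Num.min (Num.min d1 d2) (Num.min d3 d4).
  by rewrite /h; move: h0; rewrite /h; lra.
move: hlt; rewrite !lt_min => /andP[/andP[l1 l2] /andP[l3 l4]].
have hn0 : h != 0 by rewrite gt_eqF.
have Hh : `|h| = h by rewrite ger0_norm// ltW.
(* The uncrossed product occurs five times: four in [crossed_integral], once in the difference
   quotient itself. *)
have hq5 : 0 < h * q / 5 by rewrite divr_gt0// mulr_gt0.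
have [N' hN'] := trace0 hq5.
exists (maxn N N') => m; rewrite geq_max => /andP[mN mN'].
have {}hN i := hN m mN i; have {}hN' := hN' m mN'.
have dqd t f gf : C1c f gf -> fdom FP (dq t j f) by move=> hf; apply: C1c_L2 (C1c_dq t j hf).
have close t f gf f' gf' : C1c f gf -> C1c f' gf' -> fnrm FP (gf' j - gf j) <= q ->
    fnrm FP (dq t j f - gf j) <= q -> fnrm FP (dq t j f' - gf' j) <= 3 * q.
  move=> hf hf' c1 c2.
  have dB : fdom FP (dq t j (f' - f)) by apply: (dqd _ _ _ (C1cB hf' hf)).
  have df : fdom FP (gf j) by exact: C1c_L2_grad hf.
  have df' : fdom FP (gf' j) by exact: C1c_L2_grad hf'.
  have e1 : dq t j f' - gf' j = dq t j (f' - f) + (dq t j f - gf j) - (gf' j - gf j).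
    by apply/funext => x; rewrite /dq !fctE; ring.
  rewrite e1; apply: le_trans (nrmB _ _) _; [|exact: domB|].
    by apply: domD => //; apply: domB => //; exact: dqd hf.
  apply: le_trans (lerD (nrmD dB (domB (dqd _ _ _ hf) df)) (lexx _)) _.
  have := @dq_le _ _ nu j jnu t _ _ (C1cB hf' hf) => h'.
  by have := le_trans h' c1; lra.
have closet t f f' : fdom FP f -> fdom FP f' -> fnrm FP (f' - f) <= q ->
    fnrm FP (tau j t f - f) <= q -> fnrm FP (tau j t f' - f') <= 3 * q.
  move=> df df' c1 c2; have [l i1 i2] := tau_isoP jnu t.
  have -> : tau j t f' - f' = tau j t (f' - f) + (tau j t f - f) - (f' - f).
    by apply/funext => x; rewrite /tau !fctE /=; ring.
  have d1' := i1 _ (domB df' df); have d2' := domB (i1 _ df) df.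
  apply: le_trans (nrmB _ _) _; [exact: domD|exact: domB|].
  apply: le_trans (lerD (nrmD d1' d2') (lexx _)) _.
  by rewrite (nrmT (tau_isoP jnu t) 0 (domB df' df)); lra.
have b1 : fnrm FP (dq (- h) j (a m) - ga m j) <= 3 * q.
  apply: close (ha N) (ha m) (hN j).1 _; apply: hd1; by rewrite ?oppr_eq0// normrN Hh.
have b2 : fnrm FP (dq h j (b m) - gb m j) <= 3 * q.
  by apply: close (hb N) (hb m) (hN j).2 _; apply: hd2; rewrite ?Hh.
have b3 : fnrm FP (tau j h (ga m nu) - ga m nu) <= 3 * q.
  by apply: closet (dga N nu) (dga m nu) (hN nu).1 _; apply: hd3; rewrite Hh.
have b4 : fnrm FP (tau j h (gb m nu) - gb m nu) <= 3 * q.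
  by apply: closet (dgb N nu) (dgb m nu) (hN nu).2 _; apply: hd4; rewrite Hh.
have dqa := dqd (- h) _ _ (ha m); have dqb := dqd h _ _ (hb m).
have E := @flat_Ih _ _ nu j jnu h _ _ _ _ (ha m) (hb m).
have -> : fip FP (ga m nu) (gb m j) - fip FP (ga m j) (gb m nu) =
   fip FP (dq (- h) j (a m) - ga m j) (gb m nu) - fip FP (ga m nu) (dq h j (b m) - gb m j)
   - fip FS (trc nu (a m)) (dq h j (trc nu (b m))).
  rewrite (ipBr dqb (dgb m j) (dga m nu)) (ipBl dqa (dga m j) (dgb m nu)) -[X in _ = _ + X]E.
  by ring.
set al := trc nu (a m) in hN' *; set be := trc nu (b m) in hN' *.
have dal : fdom FS al by exact: C1c_trc_L2 (ha m).
have dbe : fdom FS be by exact: C1c_trc_L2 (hb m).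
have [lS iS1 iS2] := tau_isoS jnu h.
have bI : `|fip FS al (dq h j be)| <= h^-1 * (4 * (6 * C * q * h) + h * q).
  rewrite dqE ipZr//; last by apply: domB => //; exact: iS1.
  rewrite normrM normfV Hh ler_pM2l ?invr_gt0// ipBr//; last exact: iS1.
  apply: le_trans (ler_normB _ _) _.
  apply: le_trans (lerD (fip_abs dal (iS1 _ dbe)) (fip_abs dal dbe)) _.
  apply: le_trans (lerD (crossed_integral h dal dbe) (lexx _)) _.
  have s1 := @flat_slab_sqr _ _ nu j jnu h _ _ (ha m).
  have s2 := @flat_slab_sqr _ _ nu j jnu h _ _ (hb m).
  have n1 := nrm_ge0 FS (tau j h al - al); have n2 := nrm_ge0 FS (tau j h be - be).
  have s3 (f gf : pt -> R) : fnrm FP gf <= C -> fnrm FP f <= 3 * q ->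
      2 * (`|h| * fnrm FP gf) * fnrm FP f <= 6 * C * q * h.
    move=> c1 c2; rewrite Hh.
    have c3 := ler_pM (nrm_ge0 FP gf) (nrm_ge0 FP f) c1 c2.
    rewrite [leRHS](_ : _ = 2 * h * (C * (3 * q))); last by ring.
    by rewrite (mulrA 2) -(mulrA (2 * h)); apply: ler_wpM2l c3; rewrite mulr_ge0 ?(ltW h0).
  have {}s1 := le_trans s1 (s3 _ _ (Ca m j) b3).
  have {}s2 := le_trans s2 (s3 _ _ (Cb m j) b4).
  have s4 : fnrm FS (tau j h al - al) * fnrm FS (tau j h be - be) <= 6 * C * q * h.
    have := sqr_ge0 (fnrm FS (tau j h al - al) - fnrm FS (tau j h be - be)).
    by move: s1 s2; rewrite -/al -/be; clear; nra.
  rewrite -/(absf al) -/(absf be).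
  have : 5 * fip FS (absf al) (absf be) <= h * q.
    by move: hN'; rewrite ler_pdivlMr// mulrC.
  by move=> s5; clear -s4 s5; lra.
apply: le_trans (ler_normB _ _) _.
apply: le_trans (lerD (ler_normB _ _) bI) _.
have i1 := cauchy_schwarz (domB dqa (dga m j)) (dgb m nu).
have i2 := cauchy_schwarz (dga m nu) (domB dqb (dgb m j)).
have i3 := ler_pM (nrm_ge0 _ _) (nrm_ge0 _ _) b1 (Cb m nu).
have i4 := ler_pM (nrm_ge0 _ _) (nrm_ge0 _ _) (Ca m nu) b2.
have -> : h^-1 * (4 * (6 * C * q * h) + h * q) = 24 * C * q + q by field.
have qe : (31 * C + 1) * q = e by rewrite mulrC mulfVK// gt_eqF// ltr_wpDl// mulr_ge0.
have Cq : 0 <= C * q by rewrite mulr_ge0// ltW.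
by clear -i1 i2 i3 i4 qe Cq; lra.
Qed.

End flat_null.

(** * Averages in several commuting directions *)

Section commuting_dyadic.
Context {R : realType} (V : lmodType R) (F : form V).
Local Notation dom := (fdom F).
Local Notation nrm := (fnrm F).
Variables (I : eqType) (t : I -> V -> V) (pr : pred I).
Hypothesis iso : forall j, pr j -> isometry_on F (t j).
Hypothesis tC : forall i j x, t i (t j x) = t j (t i x).

(** Two averages per direction: one turns a fine difference into [dyD] at scale k, the other stays
    to form [dyD k] of [dyB k x], the quantity whose squares are summed over the scales. *)
Definition dyB2 (j : I) k x := dyB (t j) k (dyB (t j) k x).
Definition dyBB (s : seq I) k x := foldr (fun j x => dyB2 j k x) x s.

Lemma dyBC i j k l x : pr i -> pr j -> dyB (t i) k (dyB (t j) l x) = dyB (t j) l (dyB (t i) k x).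
Proof.
move=> pi pj; apply: dyB_comm => [|y]; first by apply: (dyB_linear (iso pi)).
apply/esym; apply: dyB_comm; first by have [] := iso pj.
by move=> z; exact: tC.
Qed.

Lemma dyB2_linear j k : pr j -> linear (dyB2 j k).
Proof. by move=> pj a x y; rewrite /dyB2 !(dyB_linear (iso pj)). Qed.
Lemma dyB2_dom j k x : pr j -> dom x -> dom (dyB2 j k x).
Proof. by move=> pj dx; do 2 apply: (dyB_dom (iso pj)). Qed.
Lemma nrm_dyB2 j k x : pr j -> dom x -> nrm (dyB2 j k x) <= nrm x.
Proof.
move=> pj dx; apply: le_trans (nrm_dyB (iso pj) k _) _; first exact: (dyB_dom (iso pj)).
exact: (nrm_dyB (iso pj)).
Qed.

Lemma dyBB_linear s k : all pr s -> linear (dyBB s k).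
Proof.
elim: s => [//|j s ih] /= /andP[pj ps] a x y.
by rewrite /= (ih ps) (dyB2_linear k pj).
Qed.
Lemma dyBB_dom s k x : all pr s -> dom x -> dom (dyBB s k x).
Proof. by elim: s => [//|j s ih] /= /andP[pj ps] dx; apply: dyB2_dom => //; exact: ih. Qed.
Lemma nrm_dyBB s k x : all pr s -> dom x -> nrm (dyBB s k x) <= nrm x.
Proof.
elim: s => [//|j s ih] /= /andP[pj ps] dx.
by apply: le_trans (nrm_dyB2 _ pj _) (ih ps dx); exact: dyBB_dom.
Qed.
Lemma dyBB_dyB2 s k j l x : all pr s -> pr j -> dyB2 j l (dyBB s k x) = dyBB s k (dyB2 j l x).
Proof.
elim: s => [//|i s ih] /= /andP[pi ps] pj; rewrite -ih//.
by rewrite /dyB2 !(fun y => @dyBC j i l k y pj pi).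
Qed.
Lemma nrm_dyBB_le s k j x : all pr s -> j \in s -> dom x -> nrm (dyBB s k x) <= nrm (dyB2 j k x).
Proof.
elim: s => [//|i s ih] /= /andP[pi ps]; rewrite inE => /orP[/eqP ->|js] dx.
  by rewrite dyBB_dyB2//; apply: nrm_dyBB => //; exact: dyB2_dom.
by apply: le_trans (nrm_dyB2 _ pi _) (ih ps js dx); exact: dyBB_dom.
Qed.
(** The directions pass from scale k to scale k + 1 one after the other: [nrm_dyB2S] bounds each
    change, and the averages in the other directions contract. *)
Lemma nrm_dyBBS s k x : all pr s -> dom x ->
  nrm (dyBB s k x - dyBB s k.+1 x) <= \sum_(j <- s) nrm (dyD (t j) k (dyB (t j) k x)).
Proof.
elim: s => [|j s ih] /=; first by rewrite big_nil subrr nrm0.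
move=> /andP[pj ps] dx; rewrite big_cons.
set y := dyBB s k x; set y' := dyBB s k.+1 x.
have dy : dom y by exact: dyBB_dom.
have dy' : dom y' by exact: dyBB_dom.
have -> : dyB2 j k y - dyB2 j k.+1 y' =
   (dyB2 j k y - dyB2 j k.+1 y) + dyB2 j k.+1 (y - y').
  by rewrite (linearB_of (dyB2_linear k.+1 pj)) addrA subrK.
apply: le_trans (nrmD _ _) _.
- by apply: domB; exact: dyB2_dom.
- by apply: dyB2_dom => //; exact: domB.
apply: lerD; last by apply: le_trans (nrm_dyB2 _ pj _) (ih ps dx); exact: domB.
have -> : dyB2 j k y - dyB2 j k.+1 y = dyBB s k (dyB2 j k x - dyB2 j k.+1 x).
  by rewrite (linearB_of (dyBB_linear k ps)) !dyBB_dyB2.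
apply: le_trans (nrm_dyBB _ ps _) _; first by apply: domB; exact: dyB2_dom.
exact: (nrm_dyB2S (iso pj)).
Qed.

End commuting_dyadic.

(** * Extension from the boundary of the half space *)

Section plateau.
Context {R : realType}.
Implicit Types (s t : R).

(** A C^1 step from 1 to 0 across [0, 1]. With P(s) = max(0, s)^2, it is P(1 - P(s)), so its
    derivative is explicit. *)
Definition plateau s : R := Num.max 0 (1 - Num.max 0 s ^+ 2) ^+ 2.
Definition plateau' s : R := - (4 * Num.max 0 s * Num.max 0 (1 - Num.max 0 s ^+ 2)).

Lemma continuous_max0 : continuous (fun s : R => Num.max 0 s).
Proof.
move=> s; have -> : (fun s : R => Num.max 0 s) = (fun s => (s + `|s|) / 2).
  by apply/funext => u; case: (lerP 0 u) => h; rewrite ?(ger0_norm h) ?(ltr0_norm h); lra.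
by apply: cvgM; [apply: cvgD; [exact: cvg_id|apply: norm_continuous]|exact: cvg_cst].
Qed.

Lemma is_derive_sqr_pos s : is_derive s 1 (fun s : R => Num.max 0 s ^+ 2) (2 * Num.max 0 s).
Proof.
apply/is_deriveP; apply/cvgrPdist_le => e e0; near=> h.
have h0 : h != 0 by near: h; exact: nbhs_dnbhs_neq.
have he : `|h| <= e by near: h; apply: dnbhs0_le.
have hn : 0 < `|h| by rewrite normr_gt0.
have -> : s + h *: 1 = s + h by rewrite /GRing.scale /= mulr1.
have -> : 2 * Num.max 0 s - h^-1 * (Num.max 0 (s + h) ^+ 2 - Num.max 0 s ^+ 2) =
   h^-1 * (2 * Num.max 0 s * h - Num.max 0 (s + h) ^+ 2 + Num.max 0 s ^+ 2) by field.
rewrite normrM normfV ler_pdivrMl//; apply: (@le_trans _ _ (`|h| * `|h|)); last by rewrite ler_pM2l.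
rewrite -normrM -expr2 (ger0_norm (sqr_ge0 h)) ler_norml.
case: (lerP 0 s) => h1; case: (lerP 0 (s + h)) => h2; apply/andP; split; nra.
Unshelve. all: by end_near. Qed.

Lemma is_derive_plateau s : is_derive s 1 plateau (plateau' s).
Proof.
pose f s : R := 1 - Num.max 0 s ^+ 2.
have df : is_derive s 1 f (- (2 * Num.max 0 s)).
  have h := is_derive_sqr_pos s.
  have := is_deriveB (is_derive_cst (1 : R) s 1) h; rewrite sub0r; exact.
have dg := is_derive_sqr_pos (f s).
have := @is_derive1_comp R (fun s : R => Num.max 0 s ^+ 2) f s _ _ dg df.
rewrite (_ : 2 * Num.max 0 (f s) * - (2 * Num.max 0 s) = plateau' s)//.
by rewrite /plateau' /f; ring.
Qed.

Lemma continuous_plateau : continuous plateau.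
Proof.
move=> s; have h := is_derive_plateau s; apply: differentiable_continuous.
by apply/derivable1_diffP; have [] := h.
Qed.

Lemma continuous_plateau' : continuous plateau'.
Proof.
move=> s; apply: cvgN; apply: cvgM; first by apply: cvgM; [exact: cvg_cst|exact: continuous_max0].
apply: (@continuous_comp _ _ _ (fun s : R => 1 - Num.max 0 s ^+ 2) (fun s => Num.max 0 s)).
  by apply: cvgB; [exact: cvg_cst|apply: cvgM; exact: continuous_max0].
exact: continuous_max0.
Qed.

Lemma plateau1 s : s <= 0 -> plateau s = 1.
Proof. by move=> s0; rewrite /plateau (max_l s0) expr0n subr0 max_r// expr1n. Qed.
Lemma plateau0 s : 1 <= s -> plateau s = 0.
Proof.
move=> s1; rewrite /plateau (_ : Num.max 0 s = s); last by rewrite max_r//; lra.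
by rewrite max_l ?expr0n//; nra.
Qed.
Lemma plateau'1 s : s <= 0 -> plateau' s = 0.
Proof. by move=> s0; rewrite /plateau' (max_l s0) mulr0 mul0r oppr0. Qed.
Lemma plateau'0 s : 1 <= s -> plateau' s = 0.
Proof.
move=> s1; rewrite /plateau' (_ : Num.max 0 s = s); last by rewrite max_r//; lra.
by rewrite max_l ?mulr0 ?oppr0//; nra.
Qed.
Lemma plateau_ge0 s : 0 <= plateau s. Proof. exact: sqr_ge0. Qed.
Lemma plateau_le1 s : plateau s <= 1.
Proof.
rewrite /plateau; set m := Num.max 0 s; have := sqr_ge0 m => m0.
case: (lerP 0 (1 - m ^+ 2)) => h; nra.
Qed.
Lemma plateau_mono s t : s <= t -> plateau t <= plateau s.
Proof.
move=> st; rewrite /plateau.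
have m1 : Num.max 0 s <= Num.max 0 t by case: (lerP 0 s); case: (lerP 0 t); lra.
have m0 : 0 <= Num.max 0 s by rewrite le_max lexx.
have m2 : Num.max 0 s ^+ 2 <= Num.max 0 t ^+ 2 by rewrite ler_pXn2r// nnegrE// (le_trans m0).
have m3 : Num.max 0 (1 - Num.max 0 t ^+ 2) <= Num.max 0 (1 - Num.max 0 s ^+ 2).
  by move: m2; set p := (X in X <= _ -> _); set q := (X in _ <= X -> _) => m2; case: (lerP 0 (1 - q)); case: (lerP 0 (1 - p)); lra.
by rewrite ler_pXn2r// nnegrE le_max lexx.
Qed.
Lemma plateau'_le s : `|plateau' s| <= 4.
Proof.
case: (lerP s 0) => h0; first by rewrite plateau'1// normr0.
case: (lerP 1 s) => h1; first by rewrite plateau'0// normr0.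
rewrite /plateau' normrN (max_r (ltW h0)) max_r; last by nra.
rewrite ger0_norm; nra.
Qed.

End plateau.

(** Jensen's inequality for weights of total mass at most 1, from the nonnegative sum of the w_i
    (x_i - m)^2, where m is the weighted sum itself. *)
Lemma convex_sqr {R : realType} (I : Type) (r : seq I) (w x : I -> R) :
  (forall i, 0 <= w i) -> \sum_(i <- r) w i <= 1 ->
  (\sum_(i <- r) w i * x i) ^+ 2 <= \sum_(i <- r) w i * x i ^+ 2.
Proof.
move=> w0 w1; have [m hm] : exists m, m = \sum_(i <- r) w i * x i by eexists.
rewrite -hm.
have : 0 <= \sum_(i <- r) w i * (x i - m) ^+ 2.
  by apply: sumr_ge0 => i _; rewrite mulr_ge0// sqr_ge0.
have -> : \sum_(i <- r) w i * (x i - m) ^+ 2 =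
    \sum_(i <- r) w i * x i ^+ 2 - 2 * m * m + m ^+ 2 * \sum_(i <- r) w i.
  have e2 : 2 * m * m = \sum_(i <- r) (2 * m * (w i * x i)) by rewrite -mulr_sumr -hm.
  rewrite e2 mulr_sumr -sumrB -big_split /=; apply: eq_bigr => i _; ring.
have : m ^+ 2 * \sum_(i <- r) w i <= m ^+ 2 by rewrite ler_piMr// sqr_ge0.
by rewrite (expr2 m); lra.
Qed.

Lemma sqr_sum_le {R : realType} (I : Type) (r : seq I) (x : I -> R) :
  (\sum_(i <- r) x i) ^+ 2 <= (size r)%:R * \sum_(i <- r) x i ^+ 2.
Proof.
have [/size0nil ->|r0] := eqVneq (size r) 0%N.
  by rewrite !big_nil expr0n mulr0.
have r1 : 0 < (size r)%:R :> R by rewrite ltr0n lt0n.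
have s1 : \sum_(i <- r) (size r)%:R^-1 <= 1 :> R.
  by rewrite big_const_seq count_predT iter_addr_0 -(mulr_natr (size r)%:R^-1) mulVf// gt_eqF.
have := @convex_sqr _ _ r (fun=> (size r)%:R^-1) x (fun=> ltac:(by rewrite invr_ge0 ltW)) s1.
rewrite -!mulr_sumr exprMn expr2 -mulrA ler_pM2l ?invr_gt0// ler_pdivrMl//.
Qed.

Lemma sum_pow2 {R : realType} (N : nat) : \sum_(q < N) (2 ^- q : R) <= 2.
Proof.
suff -> : \sum_(q < N) (2 ^- q : R) = 2 - 2 * 2 ^- N.
  by rewrite gerBl mulr_ge0// invr_ge0 exprn_ge0.
elim: N => [|N ih]; first by rewrite big_ord0 expr0 invr1; lra.
rewrite big_ord_recr /= ih exprS invfM; field; by rewrite expf_neq0.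
Qed.

Lemma abel_sum {R : realType} (c g : nat -> R) N :
  \sum_(q < N) (c q - c q.+1) * g q + c N * g N =
  c 0%N * g 0%N + \sum_(q < N) c q.+1 * (g q.+1 - g q).
Proof.
elim: N => [|N ih]; first by rewrite !big_ord0 add0r addr0.
rewrite !big_ord_recr /= addrA -ih; ring.
Qed.

Section profile.
Context {R : realType} (n : nat) (nu : 'I_n).
Local Notation pt := 'rV[R]_n.
Local Notation mu := (lebesgue_row n : {measure set pt -> \bar R}).
Local Notation P := (hsp nu (0 : R)).
Local Notation S := (slab nu (1 : R)).
Local Notation FP := (L2_form mu (measurable_hsp nu 0)).
Local Notation FS := (L2_form mu (measurable_slab nu 1)).
Implicit Types (f g : pt -> R) (phi : R -> R).

Lemma continuous_profile phi f : continuous phi -> continuous f ->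
  continuous (fun y : pt => phi (y ord0 nu) * f y).
Proof.
move=> cp cf x.
have c1 : continuous (fun y : pt => phi (y ord0 nu)).
  move=> y; apply: (@continuous_comp _ _ _ (fun y : pt => y ord0 nu) phi); last exact: cp.
  exact: coord_continuous.
exact: (cvgM (c1 x) (cf x)).
Qed.

Lemma nice_profile phi f : continuous phi -> continuous f -> nice S f ->
  (forall s, 1 <= s -> phi s = 0) -> nice P (fun y => phi (y ord0 nu) * f y).
Proof.
move=> cp cf [mf [C [k h]]] p0; split.
  by apply: continuous_row_measurable; exact: continuous_profile.
have [B B0 hB] : exists2 B, 0 <= B & forall s, 0 <= s -> `|phi s| <= B.
  have cabs : {within `[0, 1], continuous (fun s => `|phi s|)}.
    apply: continuous_subspaceT => s.
    by apply: (@continuous_comp _ _ _ phi (fun x : R => `|x|)); [exact: cp|exact: norm_continuous].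
  have [c _ hc] := @EVT_max R (fun s => `|phi s|) 0 1 ler01 cabs.
  exists `|phi c|; first by [].
  move=> s s0; have [s1|s1] := lerP s 1; first by apply: hc; rewrite in_itv /= s0.
  by rewrite p0 ?normr0// ltW.
exists (B * Num.max C 0), k => x x0.
have [x1|x1] := lerP (x ord0 nu) 1; last first.
  by rewrite (p0 _ (ltW x1)) mul0r normr0; split => //; rewrite mulr_ge0// le_max lexx orbT.
have [h1 h2] := h x ltac:(by rewrite /slab /=; apply/andP; split).
split; last by move=> h'; rewrite h2 ?mulr0.
rewrite normrM ler_pM//; first by apply: hB; exact: ltW.
by rewrite le_max h1.
Qed.

Lemma profile_le phi c q f : continuous phi -> continuous f -> nice S f -> indep nu f ->
  (forall y, 0 <= f y) -> (forall s, 0 <= s -> phi s <= c) ->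
  (forall s, 2 ^- q <= s -> phi s = 0) ->
  \int[mu]_(y in P) (phi (y ord0 nu) * f y) <= c * 2 ^- q * \int[mu]_(y in S) f y.
Proof.
move=> cp cf nf fi f0 pc p0.
have q1 : 2 ^- q <= 1 :> R by rewrite invf_le1 ?exprn_gt0// exprn_ege1// ler1n.
have q0 : 0 < 2 ^- q :> R by rewrite invr_gt0 exprn_gt0.
have p1 s : 1 <= s -> phi s = 0 by move=> s1; apply: p0; exact: le_trans s1.
have nP := nice_profile cp cf nf p1.
have mP t := @measurable_hsp R n nu t; have mS t := @measurable_slab R n nu t.
have PU : P = slab nu (2 ^- q) `|` hsp nu (2 ^- q).
  apply/seteqP; split => x; rewrite /hsp /slab /=.
    by case: (ltP (2 ^- q) (x ord0 nu)) => hx x0; [right|left; apply/andP].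
  by move=> [/andP[]//|]; exact: lt_trans.
have subS : slab nu (2 ^- q) `<=` S.
  by move=> x /andP[h1 h2]; apply/andP; split => //; apply: le_trans h2 _.
have nf' : nice (slab nu (2 ^- q)) f by exact: nice_sub nf.
rewrite PU Rintegral_setU//; last 2 first.
- by rewrite -PU; exact: nice_integrable.
- by apply/disj_setPS => x []; rewrite /slab /hsp /= => /andP[_ h1] h2; lra.
rewrite (_ : \int[mu]_(y in hsp nu (2 ^- q)) _ = 0) ?addr0; last first.
  rewrite (@eq_Rintegral _ _ _ _ _ (fun=> 0)) ?Rintegral_cst ?mul0r//.
  by move=> x /set_mem hx; rewrite p0 ?mul0r// ltW.
rewrite -mulrA -slab_dyadic// -RintegralZl//; last exact: nice_integrable.
apply: le_Rintegral => //.
- apply: nice_integrable => //; apply: nice_sub nP => // x; rewrite PU; by left.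
- by apply: nice_integrable => //; exact: niceZ.
- by move=> x /andP[x0 _]; rewrite ler_wpM2r//; apply: pc; exact: ltW.
Qed.

(** Each [w q] vanishes above height 2^-q, so integrating along e_nu gains 2^-q. The pointwise bound
    by [w] will come from convexity for the partition [scP], and from disjoint supports for the
    derivatives [scX']. *)
Lemma profile_sum (N : nat) (phi w : nat -> R -> R) (c : nat -> R) (g : nat -> pt -> R) :
  (forall q, continuous (phi q)) -> (forall q, continuous (w q)) ->
  (forall q, continuous (g q)) -> (forall q, nice S (g q)) -> (forall q, indep nu (g q)) ->
  (forall q s, 0 <= s -> w q s <= c q) ->
  (forall q s, 2 ^- q <= s -> phi q s = 0) -> (forall q s, 2 ^- q <= s -> w q s = 0) ->
  (forall (x : nat -> R) s, 0 < s ->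
    (\sum_(q < N) phi q s * x q) ^+ 2 <= \sum_(q < N) w q s * x q ^+ 2) ->
  let G := fun y : pt => \sum_(q < N) phi q (y ord0 nu) * g q y in
  L2on mu P G /\
  fip FP G G <= \sum_(q < N) c q * 2 ^- q * fip FS (g q) (g q).
Proof.
move=> cphi cw cg ng gi wc phi0 w0 hpw G.
have mP := @measurable_hsp R n nu 0; have mS := @measurable_slab R n nu 1.
have q1 q : 2 ^- q <= 1 :> R by rewrite invf_le1 ?exprn_gt0// exprn_ege1// ler1n.
have nice_sum (I : Type) (r : seq I) (f : I -> pt -> R) : (forall i, nice P (f i)) ->
    nice P (fun y => \sum_(i <- r) f i y).
  move=> nfi; elim: r => [|i r ih].
    split; first by under eq_fun do rewrite big_nil; exact: measurable_cst.
    by exists 0, 0%N => x _; rewrite big_nil normr0.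
  by under eq_fun do rewrite big_cons; exact: niceD.
have nG : nice P G.
  by apply: nice_sum => q; apply: nice_profile => // s s1; apply: phi0; exact: le_trans s1.
have cg2 q : continuous (fun y => g q y ^+ 2) by move=> y; exact: (cvgM (cg q y) (cg q y)).
have ng2 q : nice S (fun y => g q y ^+ 2) by apply: niceM.
have nw q : nice P (fun y => w q (y ord0 nu) * g q y ^+ 2).
  by apply: nice_profile => // s s1; apply: w0; exact: le_trans s1.
split; first exact: nice_L2on.
rewrite /= /L2_ip; apply: (@le_trans _ _
  (\int[mu]_(y in P) \sum_(q < N) w q (y ord0 nu) * g q y ^+ 2)).
  apply: le_Rintegral => //; try apply: nice_integrable => //.
  - exact: niceM.
  - exact: nice_sum.
  - by move=> y y0; rewrite -expr2; exact: (hpw (fun q => g q y)).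
have -> : \int[mu]_(y in P) (\sum_(q < N) w q (y ord0 nu) * g q y ^+ 2) =
   \sum_(q < N) \int[mu]_(y in P) (w q (y ord0 nu) * g q y ^+ 2).
  elim: (index_enum _) => [|q r ih].
    rewrite big_nil (@eq_Rintegral _ _ _ _ _ (fun=> 0)) ?Rintegral_cst ?mul0r//.
    by move=> x _; rewrite big_nil.
  rewrite big_cons -ih -RintegralD//; try exact: nice_integrable.
    by apply: eq_Rintegral => x _; rewrite big_cons.
  by apply: nice_integrable => //; exact: nice_sum.
apply: ler_sum => q _.
have -> : \int[mu]_(x in S) (g q x * g q x) = \int[mu]_(x in S) (g q x ^+ 2).
  by apply: eq_Rintegral => x _; rewrite expr2.
apply: profile_le => //.
- by move=> y t; rewrite gi.
- by move=> y; rewrite sqr_ge0.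
- exact: wc.
- exact: w0.
Qed.

End profile.

Section scale.
Context {R : realType}.
Implicit Types (s : R) (q : nat).

(** Equal to 1 up to height 2^-(q+1) and to 0 from height 2^-q on, so that all the variation of
    [scX q] takes place in one dyadic band. *)
Definition scX q s : R := plateau (2 ^+ q.+1 * s - 1).
Definition scX' q s : R := 2 ^+ q.+1 * plateau' (2 ^+ q.+1 * s - 1).

Lemma is_derive_affine (c b s : R) : is_derive s 1 (fun s => c * s - b) c.
Proof.
apply/is_deriveP; apply: cvg_near_cst; near=> h.
rewrite /GRing.scale /= mulr1 (_ : _ - _ = h * c); last by ring.
rewrite mulKf//; near: h; exact: nbhs_dnbhs_neq.
Unshelve. all: by end_near. Qed.

Lemma continuous_affine (c b : R) : continuous (fun s => c * s - b).
Proof. by move=> s; apply: cvgB; [apply: cvgM; [exact: cvg_cst|exact: cvg_id]|exact: cvg_cst]. Qed.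

Lemma is_derive_scX q s : is_derive s 1 (scX q) (scX' q s).
Proof.
have h1 := is_derive_affine (2 ^+ q.+1) 1 s; have h2 := is_derive_plateau (2 ^+ q.+1 * s - 1).
have := @is_derive1_comp R plateau (fun s => 2 ^+ q.+1 * s - 1) s _ _ h2 h1.
by rewrite mulrC.
Qed.

Lemma continuous_scX q : continuous (scX q).
Proof.
move=> s; apply: (@continuous_comp _ _ _ (fun s : R => 2 ^+ q.+1 * s - 1) plateau);
  [exact: continuous_affine|exact: continuous_plateau].
Qed.
Lemma continuous_scX' q : continuous (scX' q).
Proof.
move=> s; apply: (@cvgM _ _ _ _ (fun=> 2 ^+ q.+1) (fun s : R => plateau' (2 ^+ q.+1 * s - 1))); first exact: cvg_cst.
apply: (@continuous_comp _ _ _ (fun s : R => 2 ^+ q.+1 * s - 1) plateau');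
  [exact: continuous_affine|exact: continuous_plateau'].
Qed.

Lemma scX0 q s : 2 ^- q <= s -> scX q s = 0.
Proof.
move=> h; apply: plateau0; rewrite lerBrDr exprS -mulrA (_ : 1 + 1 = 2 * 1); last by ring.
by rewrite ler_pM2l// -ler_pdivrMl ?exprn_gt0// mulr1.
Qed.
Lemma scX'0 q s : 2 ^- q <= s -> scX' q s = 0.
Proof.
move=> h; rewrite /scX' plateau'0 ?mulr0// lerBrDr exprS -mulrA (_ : 1 + 1 = 2 * 1); last by ring.
by rewrite ler_pM2l// -ler_pdivrMl ?exprn_gt0// mulr1.
Qed.
Lemma scX'1 q s : s <= 2 ^- q.+1 -> scX' q s = 0.
Proof.
move=> h; rewrite /scX' plateau'1 ?mulr0// subr_le0.
by rewrite -ler_pdivlMl ?exprn_gt0// mulr1.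
Qed.
Lemma scX10 q : scX q 0 = 1.
Proof. by apply: plateau1; rewrite mulr0 sub0r lerN10. Qed.
Lemma scX_mono q s : 0 <= s -> scX q.+1 s <= scX q s.
Proof.
move=> s0; apply: plateau_mono; rewrite lerD2r ler_wpM2r// ler_weXn2l// ler1n//.
Qed.
Lemma scX'_le q s : scX' q s ^+ 2 <= 64 * 4 ^+ q.
Proof.
rewrite /scX' exprMn; have h := plateau'_le (2 ^+ q.+1 * s - 1).
have : plateau' (2 ^+ q.+1 * s - 1) ^+ 2 <= 16.
  by rewrite -(real_normK (num_real _)); have := normr_ge0 (plateau' (2 ^+ q.+1 * s - 1)); nra.
move=> /(ler_wpM2l (sqr_ge0 (2 ^+ q.+1 : R))) h'; apply: le_trans h' _.
rewrite -exprM mulnC exprM (_ : 2 ^+ 2 = 4 :> R); last by ring.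
by rewrite exprS; lra.
Qed.

(** The dyadic bands are disjoint: at a given height at most one term is nonzero, and the square of
    the sum is the sum of the squares. *)
Lemma scX'_disjoint N (x : nat -> R) s :
  (\sum_(q < N) scX' q s * x q) ^+ 2 <= \sum_(q < N) scX' q s ^+ 2 * x q ^+ 2.
Proof.
case: (pickP (fun q : 'I_N => scX' q s != 0)) => [q0 h0|h]; last first.
  rewrite !big1 ?expr0n//= => q _.
    by have /negbFE/eqP -> := h q; rewrite expr0n mul0r.
  by have /negbFE/eqP -> := h q; rewrite mul0r.
have other (q : 'I_N) : q != q0 -> scX' q s = 0.
  move=> qq0; apply/eqP; apply: contraNT qq0 => hq; apply/eqP/val_inj => /=.
  have lt (p r : nat) : scX' p s != 0 -> scX' r s != 0 -> (p < r)%N -> False.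
    move=> hp hr pr.
    have h1 : 2 ^- p.+1 < s by rewrite ltNge; apply: contra hp => /scX'1 ->.
    have h2 : s < 2 ^- r by rewrite ltNge; apply: contra hr => /scX'0 ->.
    have : 2 ^- r <= 2 ^- p.+1 :> R.
      by rewrite lef_pV2 ?posrE ?exprn_gt0// ler_weXn2l// ler1n.
    by lra.
  by case: (ltngtP q q0) => // hlt; [case: (lt _ _ hq h0 hlt)|case: (lt _ _ h0 hq hlt)].
rewrite (bigD1 q0)//= (bigD1 q0 (F := fun q : 'I_N => scX' q s ^+ 2 * _))//= !big1.
- by rewrite !addr0 exprMn.
- by move=> q /other ->; rewrite expr0n mul0r.
- by move=> q /other ->; rewrite mul0r.
Qed.

(* a dyadic partition of [scX 0] *)
Definition scP N q s : R := if q == N then scX N s else scX q s - scX q.+1 s.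
Definition scP' N q s : R := if q == N then scX' N s else scX' q s - scX' q.+1 s.

Lemma is_derive_scP N q s : is_derive s 1 (scP N q) (scP' N q s).
Proof.
rewrite /scP'; have [->|qN] := eqVneq q N.
  rewrite (_ : scP N N = scX N); first exact: is_derive_scX.
  by apply/funext => u; rewrite /scP eqxx.
rewrite (_ : scP N q = scX q - scX q.+1); last by apply/funext => u; rewrite /scP (negbTE qN).
by apply: is_deriveB; exact: is_derive_scX.
Qed.
Lemma continuous_scP N q : continuous (scP N q).
Proof.
rewrite /scP; case: eqP => _; first exact: continuous_scX.
by move=> s; apply: cvgB; exact: continuous_scX.
Qed.
Lemma continuous_scP' N q : continuous (scP' N q).
Proof.
rewrite /scP'; case: eqP => _; first exact: continuous_scX'.
by move=> s; apply: cvgB; exact: continuous_scX'.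
Qed.
Lemma scP_ge0 N q s : 0 <= s -> 0 <= scP N q s.
Proof.
move=> s0; rewrite /scP; case: eqP => _; first exact: plateau_ge0.
by rewrite subr_ge0; exact: scX_mono.
Qed.
Lemma scP0 N q s : 2 ^- q <= s -> scP N q s = 0.
Proof.
move=> h; rewrite /scP; case: eqP => [<-|_]; first exact: scX0.
rewrite (scX0 h) scX0 ?subrr//; apply: le_trans h.
by rewrite lef_pV2 ?posrE ?exprn_gt0// ler_weXn2l// ler1n.
Qed.
Lemma scP_sum N (x : nat -> R) s :
  \sum_(q < N.+1) scP N q s * x q = \sum_(q < N) (scX q s - scX q.+1 s) * x q + scX N s * x N.
Proof.
rewrite big_ord_recr /= /scP eqxx; congr (_ + _); apply: eq_bigr => q _.
by rewrite (ltn_eqF (ltn_ord q)).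
Qed.
Lemma scP'_sum N (x : nat -> R) s :
  \sum_(q < N.+1) scP' N q s * x q = \sum_(q < N) (scX' q s - scX' q.+1 s) * x q + scX' N s * x N.
Proof.
rewrite big_ord_recr /= /scP' eqxx; congr (_ + _); apply: eq_bigr => q _.
by rewrite (ltn_eqF (ltn_ord q)).
Qed.
Lemma scP_total N s : \sum_(q < N.+1) scP N q s = scX 0 s.
Proof.
have := scP_sum N (fun=> 1) s; rewrite (abel_sum (fun q => scX q s)) mulr1.
have -> : \sum_(q < N) scX q.+1 s * (1 - 1) = 0 by apply: big1 => q _; rewrite subrr mulr0.
rewrite addr0 => <-.
by apply: eq_bigr => q _; rewrite mulr1.
Qed.
Lemma scP_le1 N q s : (q <= N)%N -> 0 <= s -> scP N q s <= 1.
Proof.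
move=> qN s0; rewrite /scP; case: eqP => _; first exact: plateau_le1.
have := plateau_le1 (2 ^+ q.+1 * s - 1); have := plateau_ge0 (2 ^+ q.+2 * s - 1).
by rewrite /scX; lra.
Qed.

End scale.

Section flat_extension.
Context {R : realType} (n : nat) (nu : 'I_n).
Local Notation pt := 'rV[R]_n.
Local Notation mu := (lebesgue_row n : {measure set pt -> \bar R}).
Local Notation P := (hsp nu (0 : R)).
Local Notation S := (slab nu (1 : R)).
Local Notation FP := (L2_form mu (measurable_hsp nu 0)).
Local Notation FS := (L2_form mu (measurable_slab nu 1)).
Implicit Types (f g a : pt -> R) (O : (pt -> R) -> pt -> R).

(** Operators built from translations parallel to the boundary: they act on a function and on its
    gradient in the same way, and commute with the trace. *)
Definition tr_op O := (forall f gf, C1c f gf -> C1c (O f) (fun i => O (gf i))) /\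
  (forall f, trc nu (O f) = O (trc nu f)).

Lemma tr_id : tr_op id. Proof. by []. Qed.
Lemma tr_comp O O' : tr_op O -> tr_op O' -> tr_op (O \o O').
Proof. by move=> [h1 h2] [h1' h2']; split => [f gf /h1' /h1//|f] /=; rewrite h2 h2'. Qed.
Lemma tr_add O O' : tr_op O -> tr_op O' -> tr_op (fun f => O f + O' f).
Proof.
move=> [h1 h2] [h1' h2']; split => [f gf hf|f]; first exact: C1cD (h1 _ _ hf) (h1' _ _ hf).
by rewrite -h2 -h2'.
Qed.
Lemma tr_scale c O : tr_op O -> tr_op (fun f => c *: O f).
Proof.
move=> [h1 h2]; split => [f gf hf|f]; last by rewrite -h2.
have := C1cZ c (h1 _ _ hf).
by rewrite (_ : (fun x => c * O f x) = c *: O f)// (_ : (fun i x => c * O (gf i) x) = (fun i => c *: O (gf i))).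
Qed.
Lemma tr_sub O O' : tr_op O -> tr_op O' -> tr_op (fun f => O f - O' f).
Proof.
move=> [h1 h2] [h1' h2']; split => [f gf hf|f]; first exact: C1cB (h1 _ _ hf) (h1' _ _ hf).
by rewrite -h2 -h2'.
Qed.
Lemma tr_sum (I : Type) (r : seq I) (O : I -> (pt -> R) -> pt -> R) : (forall i, tr_op (O i)) ->
  tr_op (fun f => \sum_(i <- r) O i f).
Proof.
move=> h; elim: r => [|i r ih].
  rewrite (_ : (fun _ => _) = (fun f => 0 *: f)); last by apply/funext => f; rewrite big_nil scale0r.
  exact: tr_scale tr_id.
rewrite (_ : (fun _ => _) = (fun f => O i f + \sum_(i <- r) O i f)); first exact: tr_add.
by apply/funext => f; rewrite big_cons.
Qed.
Lemma tr_tau j t : j != nu -> tr_op (tau j t).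
Proof.
move=> jnu; split => [f gf hf|f]; first exact: C1c_translation.
exact: trc_tau.
Qed.

Section op.
Variable t : (pt -> R) -> pt -> R.
Hypothesis ht : tr_op t.
Lemma tr_dyT i : tr_op (dyT t i).
Proof. by elim: i => //= i ih; exact: tr_comp. Qed.
Lemma tr_dyD i : tr_op (dyD t i).
Proof. exact: tr_sub (tr_dyT i) tr_id. Qed.
Lemma tr_dyB i : tr_op (dyB t i).
Proof.
elim: i => [|i ih] /=; first exact: tr_id.
apply: tr_scale; apply: tr_add => //.
exact: (tr_comp (tr_dyT i) ih).
Qed.
End op.

Lemma tr_dyK t t' N : tr_op t -> tr_op t' -> tr_op (dyK t t' N).
Proof.
move=> ht ht'; apply: tr_sum => i.
exact: (tr_comp (tr_dyB ht' i) (tr_comp (tr_dyB ht' i) (tr_comp (tr_dyB ht i) (tr_dyD ht i)))).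
Qed.

Lemma tau_comm i j s t f : tau i s (tau j t f) = tau j t (tau i s f) :> (pt -> R).
Proof. by apply/funext => x; rewrite /tau /= addrAC. Qed.

Variable N : nat.
Let del : R := 2 ^- N.
Let tt (j : 'I_n) := tau j del : (pt -> R) -> pt -> R.
Let tl := [seq j <- enum 'I_n | j != nu].
(** [dyT] doubles the step at each index, so the N scales run from 2^-N to 1/2. *)
Definition fK j : (pt -> R) -> pt -> R := dyK (tau j (2 ^- N)) (tau j (- 2 ^- N)) N.

Lemma tr_fK j : j != nu -> tr_op (fK j).
Proof. by move=> jnu; apply: tr_dyK; exact: tr_tau. Qed.

Let pr := [pred j : 'I_n | j != nu].
Let isoS j : pr j -> isometry_on FS (tt j).
Proof. by move=> jnu; exact: tau_isoS. Qed.
Let tC i j x : tt i (tt j x) = tt j (tt i x).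
Proof. exact: tau_comm. Qed.
Let all_tl : all pr tl. Proof. by apply/allP => j; rewrite mem_filter => /andP[]. Qed.
Let mem_tl j : j != nu -> j \in tl.
Proof. by move=> jnu; rewrite mem_filter jnu mem_enum. Qed.
Let BB k := dyBB tt tl k.

Let tr_BB k : tr_op (BB k).
Proof.
rewrite /BB; elim: tl all_tl => [_|j s ih] /=; first exact: tr_id.
move=> /andP[jnu hs]; have hj := tr_dyB (tr_tau del jnu) k.
exact: (tr_comp hj (tr_comp hj (ih hs))).
Qed.

Variables (a : pt -> R) (ga : 'I_n -> pt -> R).
Hypothesis ha : C1c a ga.
Let al := trc nu a.
Let al' j := trc nu (ga j).
Let dal : fdom FS al. Proof. exact: C1c_trc_L2 ha. Qed.
Let dal' j : fdom FS (al' j). Proof. exact: C1c_trc_L2_grad ha. Qed.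

(* the energy produced by pairing [fK j a] with the derivative of [a] along [j] *)
Definition fQ j := fip FS (trc nu (fK j a)) (dq (2 ^- N) j (trc nu a)).
Definition ferr j := fnrm FS (dq (2 ^- N) j (trc nu a) - trc nu (ga j)).

Let del0 : 0 < del. Proof. by rewrite invr_gt0 exprn_gt0. Qed.

Let ddq j : j != nu -> fdom FS (dq del j al).
Proof. by move=> jnu; rewrite -trc_dq//; apply: C1c_trc_L2 (C1c_dq del j ha). Qed.

(** A dyadic H^(1/2) seminorm of the trace in direction j: the difference of step 2^-(N - k) has its
    square weighted by the inverse of that step. *)
Lemma fQE j : j != nu ->
  fQ j = \sum_(k < N) 2 ^+ (N - k) * fnrm FS (dyD (tt j) k (dyB (tt j) k al)) ^+ 2.
Proof.
move=> jnu; rewrite /fQ (tr_fK jnu).2 -/al /fK /dyK.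
have iso := tau_isoS jnu del; have iso' := tau_isoS jnu (- del).
have tK : cancel (tau j del) (tau j (- del)) by exact: tauK.
have tK' : cancel (tau j (- del)) (tau j del).
  by have := @tauK R n j (- del); rewrite opprK.
rewrite ip_suml//; last 2 first.
- by move=> i; apply: (dyX_dom iso iso').
- exact: ddq.
apply: eq_bigr => k _.
have -> : dq (2 ^- N) j al = (2 ^+ N) *: dyD (tau j del) 0 al by rewrite dqE invrK.
rewrite ipZr; last 2 first.
- exact: (dyD_dom iso).
- by apply: (dyX_dom iso iso').
rewrite (ip_dyX_dyD iso iso')// mulrCA mulrC; congr (_ * _).
by rewrite -expfB// ltn_ord.
Qed.

(** N - q doublings of the step 2^-N give windows of length 2^-q, used at heights below 2^-q. On the
    boundary only q = N remains, where [BB 0] is the identity, so that the trace of a is reproduced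
    exactly. *)
Definition fV (y : pt) : R := \sum_(q < N.+1) scP N q (y ord0 nu) * trc nu (BB (N - q) a) y.
Definition fgV (i : 'I_n) (y : pt) : R :=
  \sum_(q < N.+1) (if i == nu then scP' N q (y ord0 nu) * trc nu (BB (N - q) a) y
    else scP N q (y ord0 nu) * trc nu (BB (N - q) (ga i)) y).

Lemma is_grad_fV : is_grad fV fgV.
Proof.
pose F (q : nat) (y : pt) := scP N q (y ord0 nu) * trc nu (BB (N - q) a) y.
pose F' (q : nat) (i : 'I_n) (y : pt) := if i == nu then scP' N q (y ord0 nu) * trc nu (BB (N - q) a) y
    else scP N q (y ord0 nu) * trc nu (BB (N - q) (ga i)) y.
apply: (@is_grad_sum _ _ 'I_N.+1 (index_enum _) (fun q => F q) (fun q => F' q)) => q.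
have h1 := @is_grad_coord R n _ _ nu (@continuous_scP R N q) (@continuous_scP' R N q) (fun t => is_derive_scP N q t).
have [hB _] := (tr_BB (N - q)).1 _ _ ha.
have h2 := @is_grad_upd R n nu _ _ _ _ hB (@is_grad_cst R n 0).
have := is_gradM h1 h2; congr is_grad; apply/funext => i; apply/funext => y.
by rewrite /F' /trc; case: eqP => _; ring.
Qed.

Lemma fV_trace (y : pt) : y ord0 nu = 0 -> fV y = a y.
Proof.
move=> y0; rewrite /fV y0 (scP_sum N (fun q => trc nu (BB (N - q) a) y)) big1 ?add0r.
  rewrite scX10 mul1r subnn.
  have -> : BB 0 a = a.
    by rewrite /BB; elim: tl => //= j s ->.
  by rewrite /trc; congr a; apply/rowP => i; rewrite mxE; case: eqP => [->|].
by move=> q _; rewrite !scX10 subrr mul0r.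
Qed.

Let G q := trc nu (BB (N - q) a).
Let cBB k f gf : C1c f gf -> continuous (trc nu (BB k f)) .
Proof.
move=> hf y; have [[cf _ _] _] := (tr_BB k).1 _ _ hf.
apply: (@continuous_comp _ _ _ (upd nu (fun=> 0)) (BB k f)); last exact: cf.
by apply: continuous_upd; exact: cst_continuous.
Qed.
Let ip0 f : fdom FS f -> 0 <= fip FS f f. Proof. by move=> _; exact: ip_ge0. Qed.
Let GE q : G q = BB (N - q) al. Proof. exact: (tr_BB _).2. Qed.
Let nG k : fnrm FS (BB k al) <= fnrm FS al. Proof. exact: (nrm_dyBB isoS). Qed.

Lemma fV_L2 : L2on mu P fV /\ fip FP fV fV <= 2 * fip FS al al.
Proof.
have [|||||||||d0 h] := @profile_sum R n nu N.+1 (scP N) (scP N) (fun=> 1) G.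
- exact: continuous_scP.
- exact: continuous_scP.
- by move=> q; exact: cBB ha.
- by move=> q; exact: C1c_nice_trc ((tr_BB _).1 _ _ ha).
- by move=> q; exact: trc_indep.
- move=> q s s0; have [qN|qN] := leqP q N; first exact: scP_le1.
  rewrite /scP gtn_eqF//.
  have := plateau_le1 (2 ^+ q.+1 * s - 1); have := plateau_ge0 (2 ^+ q.+2 * s - 1).
  by rewrite /scX; lra.
- exact: scP0.
- exact: scP0.
- move=> x s s0; pose w q := if 0 <= s then scP N q s else 0.
  apply: (@convex_sqr _ _ _ (fun q : 'I_N.+1 => scP N q s) (fun q : 'I_N.+1 => x q)).
    by move=> q; apply: scP_ge0; exact: ltW.
  rewrite scP_total; exact: plateau_le1.
split => //; apply: le_trans h _.
apply: (@le_trans _ _ (\sum_(q < N.+1) 2 ^- q * fip FS al al)).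
  apply: ler_sum => q _; rewrite mul1r ler_wpM2l ?invr_ge0 ?exprn_ge0// -!sqr_nrm.
  by rewrite ler_pXn2r ?nnegrE ?nrm_ge0// GE.
by rewrite -mulr_suml ler_wpM2r ?ip_ge0// sum_pow2.
Qed.

(** On the boundary, [ga j] is replaced by the difference quotient of step 2^-N, with error [ferr].
    Averaging that quotient over length 2^-q yields the difference of step 2^-q divided by 2^-q, and
    convexity makes the squares add up to terms of [fQ]. *)
Lemma fgV_L2 j : j != nu -> L2on mu P (fgV j) /\
  fip FP (fgV j) (fgV j) <= 8 * fip FS al al + 2 * fQ j + 4 * ferr j ^+ 2.
Proof.
move=> jnu; pose Gj q := trc nu (BB (N - q) (ga j)).
have hgj q : continuous (Gj q) /\ nice S (Gj q).
  have [hB [M sM]] := (tr_BB (N - q)).1 _ _ ha; have [cB cgB _] := hB.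
  have cB' : continuous (BB (N - q) (ga j)) by exact: cgB.
  split; last by apply: nice_trc (is_grad_bsupp j hB sM).
  move=> y; apply: (@continuous_comp _ _ _ (upd nu (fun=> 0)) (BB (N - q) (ga j))); last exact: cB'.
  by apply: continuous_upd; exact: cst_continuous.
have [|||||||||d0 h] := @profile_sum R n nu N.+1 (scP N) (scP N) (fun=> 1) Gj.
- exact: continuous_scP.
- exact: continuous_scP.
- by move=> q; exact: (hgj q).1.
- by move=> q; exact: (hgj q).2.
- by move=> q; exact: trc_indep.
- move=> q s s0; have [qN|qN] := leqP q N; first exact: scP_le1.
  rewrite /scP gtn_eqF//.
  have := plateau_le1 (2 ^+ q.+1 * s - 1); have := plateau_ge0 (2 ^+ q.+2 * s - 1).
  by rewrite /scX; lra.
- exact: scP0.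
- exact: scP0.
- move=> x s s0; apply: (@convex_sqr _ _ _ (fun q : 'I_N.+1 => scP N q s) (fun q : 'I_N.+1 => x q)).
    by move=> q; apply: scP_ge0; exact: ltW.
  rewrite scP_total; exact: plateau_le1.
have E : fgV j = (fun y => \sum_(q < N.+1) scP N q (y ord0 nu) * Gj q y).
  by apply/funext => y; rewrite /fgV (negbTE jnu).
rewrite E; split => //; apply: le_trans h _.
pose D k := fnrm FS (dyD (tt j) k (dyB (tt j) k al)).
have bq (q : nat) : (q <= N)%N -> 1 * 2 ^- q * fip FS (Gj q) (Gj q) <=
    2 * (2 ^+ q * D (N - q)%N ^+ 2) + 2 ^- q * (2 * ferr j ^+ 2).
  move=> qN; rewrite mul1r -sqr_nrm.
  have -> : Gj q = BB (N - q) (dq del j al) - BB (N - q) (dq del j al - al' j).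
    have -> u v : BB (N - q) (u - v) = BB (N - q) u - BB (N - q) v.
      exact: (linearB_of (dyBB_linear isoS _ all_tl)).
    rewrite opprB addrCA subrr addr0.
    exact: (tr_BB _).2.
  have n1 : fnrm FS (BB (N - q) (dq del j al - al' j)) <= ferr j.
    by apply: (nrm_dyBB isoS) => //; apply: domB => //; exact: ddq.
  have n2 : fnrm FS (BB (N - q) (dq del j al)) <= 2 ^+ q * D (N - q)%N.
    apply: le_trans (nrm_dyBB_le isoS tC _ all_tl (mem_tl jnu) (ddq jnu)) _.
    have iso := isoS jnu.
    have -> : dyB2 tt j (N - q) (dq del j al) = 2 ^+ q *: dyD (tt j) (N - q) (dyB (tt j) (N - q) al).
      have -> : dq del j al = (2 ^+ N) *: dyD (tt j) 0 al by rewrite dqE invrK.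
      rewrite (linearZ_of (dyB2_linear isoS _ jnu)) /dyB2 (dyBD iso) -{1}(subnKC qN) exprD -scalerA.
      by rewrite (dyB_dyD0 iso).
    rewrite nrmZ ?ger0_norm ?exprn_ge0//.
    by apply: (dyD_dom iso); apply: (dyB_dom iso).
  have d1 : fdom FS (BB (N - q) (dq del j al)) by apply: (dyBB_dom isoS) => //; exact: ddq.
  have d2 : fdom FS (BB (N - q) (dq del j al - al' j)).
    by apply: (dyBB_dom isoS) => //; apply: domB => //; exact: ddq.
  have n3 := nrmB d1 d2; have n4 := le_trans n3 (lerD n2 n1).
  have D0 : 0 <= D (N - q)%N by exact: nrm_ge0.
  have e0 : 0 <= ferr j by exact: nrm_ge0.
  have p0 : 0 < 2 ^+ q :> R by rewrite exprn_gt0.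
  rewrite ler_pdivrMl//.
  have -> : 2 ^+ q * (2 * (2 ^+ q * D (N - q)%N ^+ 2) + 2 ^- q * (2 * ferr j ^+ 2)) =
    2 * (2 ^+ q * D (N - q)%N) ^+ 2 + 2 * ferr j ^+ 2 by field; rewrite gt_eqF.
  apply: (@le_trans _ _ ((2 ^+ q * D (N - q)%N + ferr j) ^+ 2)).
    by rewrite ler_pXn2r ?nnegrE ?nrm_ge0// addr_ge0// mulr_ge0// ltW.
  by have := sqr_ge0 (2 ^+ q * D (N - q)%N - ferr j); nra.
apply: (@le_trans _ _ (\sum_(q < N.+1) (2 * (2 ^+ q * D (N - q)%N ^+ 2) + 2 ^- q * (2 * ferr j ^+ 2)))).
  by apply: ler_sum => q _; apply: bq; rewrite -ltnS.
rewrite big_split /= -mulr_suml -mulr_sumr.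
have h1 : \sum_(q < N.+1) (2 ^- q : R) * (2 * ferr j ^+ 2) <= 4 * ferr j ^+ 2.
  by rewrite -mulr_suml; have := @sum_pow2 R N.+1; have := sqr_ge0 (ferr j); nra.
rewrite mulr_suml.
(* The index q = 0 involves scale N, which [fQ] does not contain; that term is bounded by the norm
   of the trace and accounts for the 8 in the statement. *)
have -> : \sum_(q < N.+1) 2 ^+ q * D (N - q)%N ^+ 2 = D N ^+ 2 + fQ j.
  rewrite big_ord_recl /= expr0 mul1r subn0 fQE//; congr (_ + _).
  rewrite (reindex_inj rev_ord_inj) /=; apply: eq_bigr => k _.
  by rewrite /bump /= add1n subnSK// subKn// ltnW.
have h2 : D N ^+ 2 <= 4 * fip FS al al.
  have iso := isoS jnu; rewrite -sqr_nrm (_ : 4 = 2 ^+ 2); last by ring.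
  rewrite -exprMn ler_pXn2r ?nnegrE ?nrm_ge0 ?mulr_ge0 ?nrm_ge0//.
  have db := dyB_dom iso N dal.
  have := nrmB (let: And3 _ d _ := dyT_iso iso N in d _ db) db.
  by rewrite (nrmT iso N db) => /le_trans; apply; have := nrm_dyB iso N dal; lra.
by move: h2; rewrite /=; lra.
Qed.

(** Summation by parts moves the derivative of the partition onto consecutive averages: [scX'] at
    index q multiplies the change from window 2^-(q-1) to 2^-q. There 64 * 4^q bounds its square and
    2^-q is the height of the band; [nrm_dyBBS] splits the change by directions, whence the factor
    n. *)
Lemma fgV_nu_L2 : L2on mu P (fgV nu) /\
  fip FP (fgV nu) (fgV nu) <= 64 * fip FS al al + 64 * n%:R * \sum_(j < n | j != nu) fQ j.
Proof.
pose H q := if q is p.+1 then (fun y => G p.+1 y - G p y) else G 0%N.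
have E : fgV nu = (fun y => \sum_(q < N.+1) scX' q (y ord0 nu) * H q y).
  apply/funext => y; rewrite /fgV eqxx (scP'_sum N (fun q => G q y)).
  by rewrite (abel_sum (fun q => scX' q (y ord0 nu)) (fun q => G q y)) big_ord_recl.
have hG q : continuous (G q) /\ nice S (G q).
  by split; [exact: cBB ha|exact: C1c_nice_trc ((tr_BB _).1 _ _ ha)].
have [|||||||||d0 h] := @profile_sum R n nu N.+1 scX' (fun q s => scX' q s ^+ 2) (fun q => 64 * 4 ^+ q) H.
- exact: continuous_scX'.
- by move=> q s; exact: (cvgM (@continuous_scX' R q s) (@continuous_scX' R q s)).
- case=> [|q] /=; first exact: (hG 0%N).1.
  by move=> y; exact: (cvgB ((hG q.+1).1 y) ((hG q).1 y)).
- case=> [|q] /=; first exact: (hG 0%N).2.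
  by apply: niceB; [exact: measurable_slab|exact: (hG _).2|exact: (hG _).2].
- by case=> [|q] y t /=; rewrite /G !trc_indep.
- by move=> q s _; exact: scX'_le.
- exact: scX'0.
- by move=> q s /scX'0 ->; rewrite expr0n.
- by move=> x s _; exact: scX'_disjoint.
rewrite E; split => //; apply: le_trans h _.
rewrite big_ord_recl /= !expr0 invr1 !mulr1; apply: lerD.
  rewrite ler_pM2l//; apply: (@le_trans _ _ (fnrm FS (G 0%N) ^+ 2)); first by rewrite sqr_nrm.
  apply: (@le_trans _ _ (fnrm FS al ^+ 2)); last by rewrite sqr_nrm.
  by rewrite ler_pXn2r ?nnegrE ?nrm_ge0// GE.
pose D j k := fnrm FS (dyD (tt j) k (dyB (tt j) k al)).
have bq (q : 'I_N) : 64 * 4 ^+ q.+1 * 2 ^- q.+1 * fip FS (fun y => G q.+1 y - G q y) (fun y => G q.+1 y - G q y)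
   <= 64 * n%:R * \sum_(j <- tl) (2 ^+ q.+1 * D j (N - q.+1)%N ^+ 2).
  rewrite -mulr_sumr.
  have -> : 64 * 4 ^+ q.+1 * 2 ^- q.+1 = 64 * 2 ^+ q.+1 :> R.
    rewrite -mulrA; congr (_ * _); rewrite (_ : 4 = 2 * 2 :> R); last by ring.
    by rewrite exprMn mulfK// expf_neq0.
  rewrite -sqr_nrm (_ : 64 * n%:R * (2 ^+ q.+1 * _) = 64 * 2 ^+ q.+1 * (n%:R * \sum_(j <- tl) D j (N - q.+1)%N ^+ 2)); last by ring.
  rewrite ler_pM2l ?mulr_gt0 ?exprn_gt0//.
  have nb : fnrm FS (fun y => G q.+1 y - G q y) <= \sum_(j <- tl) D j (N - q.+1)%N.
    have := nrm_dyBBS isoS tC (N - q.+1) all_tl dal; rewrite subnSK//.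
    by rewrite (_ : (fun y => G q.+1 y - G q y) = BB (N - q.+1) al - BB (N - q) al)// -!GE.
  have S0 : 0 <= \sum_(j <- tl) D j (N - q.+1)%N ^+ 2 by apply: sumr_ge0 => j _; exact: sqr_ge0.
  apply: (@le_trans _ _ ((\sum_(j <- tl) D j (N - q.+1)%N) ^+ 2)).
    by rewrite ler_pXn2r ?nnegrE ?nrm_ge0// sumr_ge0// => j _; exact: nrm_ge0.
  apply: le_trans (sqr_sum_le _ _) _; rewrite ler_wpM2r// ler_nat.
  by rewrite size_filter; apply: leq_trans (count_size _ _) _; rewrite size_enum_ord.
apply: le_trans (ler_sum _ (fun q _ => bq q)) _.
rewrite -mulr_sumr ler_wpM2l ?mulr_ge0//.
rewrite exchange_big /= /tl big_filter big_enum_cond /=.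
apply: ler_sum => j jnu; rewrite fQE//.
rewrite (reindex_inj rev_ord_inj) /=; apply: ler_sum => k _.
by rewrite subnSK// subKn// ltnW.
Qed.

(** [flat_I] for the pair [fK j a], a gives the pairing of [fK j a] with the tangential derivative
    of a on the boundary. Its distance to [fQ] is controlled by [ferr] and by [nrm_dyK], uniformly
    in N. *)
Lemma fQ_le j : j != nu -> fQ j <=
  `|fip FP (fK j (ga nu)) (ga j) - fip FP (fK j (ga j)) (ga nu)| + 4 * fnrm FS al * ferr j.
Proof.
move=> jnu; have hK := (tr_fK jnu).1 _ _ ha.
have iso := tau_isoS jnu del; have iso' := tau_isoS jnu (- del).
have E := flat_I jnu hK ha.
have dK : fdom FS (trc nu (fK j a)) by exact: C1c_trc_L2 hK.
have -> : fQ j = - (fip FP (fK j (ga nu)) (ga j) - fip FP (fK j (ga j)) (ga nu)) +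
   fip FS (trc nu (fK j a)) (dq del j al - al' j).
  rewrite E opprK ipBr//; last exact: ddq.
  by rewrite addrC subrK.
apply: lerD; first by rewrite -normrN; exact: ler_norm.
apply: le_trans (ip_le dK _) _; first by apply: domB => //; exact: ddq.
rewrite ler_wpM2r ?nrm_ge0// (tr_fK jnu).2.
have tK : cancel (tau j del) (tau j (- del)) by exact: tauK.
have tK' : cancel (tau j (- del)) (tau j del).
  by have := @tauK R n j (- del); rewrite opprK.
exact: (nrm_dyK iso iso' tK tK').
Qed.

End flat_extension.

(** * Mollification *)

Section smooth_bump.
Context {R : realType}.
Implicit Types (s t : R) (k : nat).

(** The powers of 1/t are included so that the family is closed, up to linear combinations, under
    differentiation: this replaces an analysis of iterated derivatives at 0. *)
Definition flatexp k t : R := if 0 < t then t^-1 ^+ k * expR (- t^-1) else 0.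

Lemma flatexp_ge0 k t : 0 <= flatexp k t.
Proof.
rewrite /flatexp; case: ltP => // t0.
by rewrite mulr_ge0 ?expR_ge0// exprn_ge0// invr_ge0 ltW.
Qed.

(** From exp(1/t) >= t^-(k+1) / (k+1)!. Since dividing by t only raises the index k, this bound also
    gives the derivative 0 at the origin. *)
Lemma flatexp_le k t : 0 <= t -> flatexp k t <= (k.+1)`!%:R * t.
Proof.
move=> t0; rewrite /flatexp; case: ltP => [tp|_]; last by rewrite mulr_ge0.
have i0 : 0 <= t^-1 by rewrite invr_ge0.
have h := expR_ge1Dxn k i0.
have f0 : 0 < (k.+1)`!%:R :> R by rewrite ltr0n fact_gt0.
have {}h : t^-1 ^+ k.+1 <= expR t^-1 * (k.+1)`!%:R.
  by rewrite -ler_pdivrMr//; apply: le_trans h; rewrite lerDr.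
rewrite expRN ler_pdivrMr ?expR_gt0//.
have := ler_wpM2r t0 h; rewrite exprS mulrAC mulVf ?gt_eqF// mul1r => /le_trans; apply.
by rewrite le_eqVlt; apply/orP; left; apply/eqP; ring.
Qed.

Lemma is_derive_near (f g : R -> R) t d : (\forall s \near t, f s = g s) ->
  is_derive t 1 g d -> is_derive t 1 f d.
Proof.
move=> fg /is_deriveP gd; apply/is_deriveP; apply: cvg_trans gd; apply: near_eq_cvg.
have ft : f t = g t by exact: nbhs_singleton fg.
have c : (t + h *: 1) @[h --> (0:R)^'] --> t.
  rewrite -[X in _ --> X]addr0 -[X in _ --> t + X](scale0r (1 : R)).
  by apply: cvgD; [exact: cvg_cst|apply: cvgZr_tmp; exact: nbhs_dnbhs].
near=> h; rewrite ft; congr (_ * (_ - _)); apply/esym; near: h; exact: (c _ fg).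
Unshelve. all: by end_near. Qed.

Lemma is_derive_flatexp k t :
  is_derive t 1 (flatexp k) (- (k%:R * flatexp k.+1 t) + flatexp k.+2 t).
Proof.
have [t0|t0|t0] := ltgtP t 0.
- apply: (@is_derive_near _ (fun=> 0)).
    have : \forall s \near t, s < 0 by exact: lt_nbhsl.
    by apply: filterS => s s0; rewrite /flatexp ltNge (ltW s0).
  rewrite /flatexp !ltNge (ltW t0) /= mulr0 oppr0 addr0; exact: is_derive_cst.
- apply: (@is_derive_near _ (fun t => t^-1 ^+ k * expR (- t^-1))).
    have : \forall s \near t, 0 < s by exact: lt_nbhsr.
    by apply: filterS => s s0; rewrite /flatexp s0.
  have tn0 : t != 0 by rewrite gt_eqF.
  have dV : is_derive t 1 (fun t : R => t^-1) (- (t^-1 ^+ 2)).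
    have := @is_deriveV R id t 1 1 tn0 (is_derive_id t 1).
    by rewrite /GRing.scale /= mulr1 -exprVn; exact.
  have dE : is_derive t 1 (fun t : R => expR (- t^-1)) (expR (- t^-1) * t^-1 ^+ 2).
    have dN : is_derive t 1 (fun t : R => - t^-1) (t^-1 ^+ 2).
      by have := is_deriveN dV; rewrite opprK.
    exact: (@is_derive1_comp R expR (fun t : R => - t^-1) t _ _ (is_derive_expR _) dN).
  have dX : is_derive t 1 (fun t : R => t^-1 ^+ k) (k%:R * t^-1 ^+ k.-1 * - (t^-1 ^+ 2)).
    case: k => [|k]; first by rewrite mul0r mul0r; exact: is_derive_cst.
    have := is_deriveX k.+1 dV; rewrite /GRing.scale /=.
    by rewrite (_ : (fun t : R => t^-1) ^+ k.+1 = (fun t : R => t^-1 ^+ k.+1))// exprfctE.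
  have := is_deriveM dX dE.
  rewrite (_ : _ *: _ + _ *: _ = - (k%:R * flatexp k.+1 t) + flatexp k.+2 t)//.
  rewrite /flatexp t0 /GRing.scale /=; case: k {dX} => [|k] /=.
    by rewrite !mul0r !mulr0 oppr0 add0r expr0 mul1r addr0 mulrC.
  rewrite !exprS; ring.
- rewrite t0 /flatexp ltxx mulr0 oppr0 addr0; apply/is_deriveP/cvgrPdist_le => e e0.
  near=> h; rewrite (_ : 0 + h *: (1 : R) = h); last by rewrite add0r /GRing.scale /= mulr1.
  rewrite /flatexp ltxx subr0 sub0r normrN.
  have h0 : h != 0 by near: h; exact: nbhs_dnbhs_neq.
  case: ltP => hp; last by rewrite mulr0 normr0 ltW.
  have -> : h^-1 * (h^-1 ^+ k * expR (- h^-1)) = flatexp k.+1 h by rewrite /flatexp hp exprS mulrA.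
  rewrite (ger0_norm (flatexp_ge0 _ _)); apply: le_trans (flatexp_le _ (ltW hp)) _.
  have f0 : 0 < (k.+2)`!%:R :> R by rewrite ltr0n fact_gt0.
  rewrite -ler_pdivlMl// -(ger0_norm (ltW hp)); near: h; apply: dnbhs0_le.
  by rewrite mulr_gt0// invr_gt0.
Unshelve. all: by end_near. Qed.

Lemma continuous_flatexp k : continuous (flatexp k).
Proof.
move=> s; have h := is_derive_flatexp k s; apply: differentiable_continuous.
by apply/derivable1_diffP; have [] := h.
Qed.

Lemma flatexp0_mono s t : s <= t -> flatexp 0 s <= flatexp 0 t.
Proof.
move=> st; rewrite /flatexp; case: (ltP 0 s) => s0; last first.
  by case: ifP => // _; rewrite mulr_ge0 ?expR_ge0// expr0.
rewrite (lt_le_trans s0 st) !expr0 !mul1r ler_expR lerN2 lef_pV2// posrE//.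
exact: lt_le_trans st.
Qed.

Variable n : nat.
Local Notation pt := 'rV[R]_n.
Local Notation mu := (lebesgue_row n : {measure set pt -> \bar R}).
Implicit Types (x y p : pt) (f g : pt -> R) (gf gg : 'I_n -> pt -> R).

(** A class of functions containing its own partial derivatives. As [smooth] quantifies over all
    iterated partial derivatives, membership in such a class is what the induction needs. *)
Inductive elem_smooth : (pt -> R) -> Prop :=
| ES_flat k i (c b : R) : elem_smooth (fun x => flatexp k (c * x ord0 i - b))
| ES_cst (c : R) : elem_smooth (fun=> c)
| ES_add f g : elem_smooth f -> elem_smooth g -> elem_smooth (fun x => f x + g x)
| ES_mul f g : elem_smooth f -> elem_smooth g -> elem_smooth (fun x => f x * g x).

Lemma elem_smooth_grad f : elem_smooth f ->
  exists gf, is_grad f gf /\ forall i, elem_smooth (gf i).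
Proof.
elim=> [k j c b|c|u v _ [gu [hu su]] _ [gv [hv sv]]|u v su0 [gu [hu su]] sv0 [gv [hv sv]]].
- pose h' (t : R) := c * (- (k%:R * flatexp k.+1 (c * t - b)) + flatexp k.+2 (c * t - b)).
  exists (fun i x => if i == j then h' (x ord0 j) else 0); split.
    have ca l : continuous (fun t : R => flatexp l (c * t - b)).
      move=> t; apply: (@continuous_comp _ _ _ (fun t : R => c * t - b) (flatexp l));
        [exact: continuous_affine|exact: continuous_flatexp].
    apply: (@is_grad_coord R n (fun t => flatexp k (c * t - b)) h').
    - exact: ca.
    - have cA : continuous (fun t => k%:R * flatexp k.+1 (c * t - b)).
        by move=> t; exact: (cvgM (cvg_cst (k%:R : R)) (ca k.+1 t)).
      move=> t; exact: (cvgM (cvg_cst c) (cvgD (cvgN (cA t)) (ca k.+2 t))).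
    - move=> t; have := @is_derive1_comp R (flatexp k) (fun t => c * t - b) t _ _
        (is_derive_flatexp k _) (is_derive_affine c b t).
      by rewrite mulrC.
  move=> i; case: eqP => _; last exact: ES_cst.
  apply: (@ES_mul (fun=> c) _ (ES_cst c)).
  apply: (@ES_add (fun x => - (k%:R * flatexp k.+1 (c * x ord0 j - b)))
    (fun x => flatexp k.+2 (c * x ord0 j - b))); last exact: ES_flat.
  rewrite (_ : (fun x : pt => _) = (fun x => (- k%:R) * flatexp k.+1 (c * x ord0 j - b))).
    by apply: (@ES_mul (fun=> - k%:R)); [exact: ES_cst|exact: ES_flat].
  by apply/funext => x; rewrite mulNr.
- exists (fun _ _ => 0); split; [exact: is_grad_cst|move=> i; exact: ES_cst].
- exists (fun i x => gu i x + gv i x); split; first exact: is_gradD.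
  by move=> i; exact: ES_add.
- exists (fun i x => u x * gv i x + v x * gu i x); split; first exact: is_gradM.
  by move=> i; apply: ES_add; exact: ES_mul.
Qed.

Lemma elem_smooth_smooth f : elem_smooth f -> smooth f.
Proof.
move=> hf s; have : elem_smooth (foldr (@partial R n) f s).
  elim: s => //= i s /elem_smooth_grad[gf [hg hs]].
  by rewrite (is_grad_partial i hg).
move=> /elem_smooth_grad[gf [[cf cgf df] _]]; split => //.
Qed.

(** One factor vanishes for each face of the cube of centre p and half-side e; the arguments are
    written in the affine form of [ES_flat], and [bumpE] has the readable one. *)
Definition bump p (e : R) x : R :=
  \prod_(i < n) (flatexp 0 (- e^-1 * x ord0 i - (- (1 + p ord0 i / e))) *
                 flatexp 0 (e^-1 * x ord0 i - (p ord0 i / e - 1))).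

Lemma bumpE p e x : bump p e x =
  \prod_(i < n) (flatexp 0 (1 - (x ord0 i - p ord0 i) / e) * flatexp 0 (1 + (x ord0 i - p ord0 i) / e)).
Proof. by apply: eq_bigr => i _; congr (flatexp _ _ * flatexp _ _); ring. Qed.

Lemma bump_smooth p e : smooth (bump p e).
Proof.
apply: elem_smooth_smooth; rewrite /bump; elim: (index_enum _) => [|i r ih].
  by under eq_fun do rewrite big_nil; exact: ES_cst.
under eq_fun do rewrite big_cons.
by apply: ES_mul => //; apply: ES_mul; exact: ES_flat.
Qed.

Lemma bump_ge0 p e x : 0 <= bump p e x.
Proof. by apply: prodr_ge0 => i _; rewrite mulr_ge0 ?flatexp_ge0. Qed.

Lemma bump_translation p e x v : bump p e (x - v) = bump (p + v) e x.
Proof. by rewrite !bumpE; apply: eq_bigr => i _; rewrite !mxE opprD addrA (addrAC _ (- v ord0 i)). Qed.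

Lemma bump_out p e x : 0 < e -> e <= `|x - p| -> bump p e x = 0.
Proof.
move=> e0 h; have [i hi] : exists i, e <= `|x ord0 i - p ord0 i|.
  apply/not_existsP => hx; move: h; apply/negP; rewrite -ltNge.
  by apply: row_norm_lt => // i; rewrite !mxE ltNge; apply/negP/hx.
rewrite bumpE (bigD1 i)//= /flatexp.
move: hi; rewrite ler_normr => /orP[] hi.
  rewrite (_ : 0 < 1 - _ = false) ?mul0r//; apply/negbTE; rewrite -leNgt subr_le0.
  by rewrite ler_pdivlMr// mul1r.
rewrite (_ : 0 < 1 + (x ord0 i - p ord0 i) / e = false) ?mulr0 ?mul0r//; apply/negbTE; rewrite -leNgt.
by rewrite -lerBrDl sub0r ler_pdivrMr// mulN1r lerNr.
Qed.

Lemma bump_in p e x : 0 < e -> `|x - p| <= e / 2 -> flatexp 0 2^-1 ^+ (n * 2) <= bump p e x.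
Proof.
move=> e0 h; rewrite bumpE (_ : _ ^+ _ = \prod_(i < n) (flatexp 0 2^-1 ^+ 2)); last first.
  by rewrite prodr_const card_ord -exprM mulnC.
apply: ler_prod => i _; rewrite sqr_ge0 /= expr2.
have : `|(x ord0 i - p ord0 i) / e| <= 2^-1.
  rewrite normrM normfV (ger0_norm (ltW e0)) ler_pdivrMr//.
  by have := row_coord_le (x - p) i; rewrite !mxE => /le_trans; apply; rewrite mulrC.
rewrite ler_norml => /andP[h1 h2].
by apply: ler_pM; rewrite ?flatexp_ge0//; apply: flatexp0_mono; lra.
Qed.

Lemma bump_support p e (U : set pt) : 0 < e -> (forall x, `|x - p| <= e -> U x) ->
  test_function U (bump p e).
Proof.
move=> e0 hU.
have cl : closed [set x : pt | `|x - p| <= e].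
  apply: (@preimage_closed _ _ (fun x : pt => `|x - p|) [set r | r <= e]); last exact: closed_le.
  move=> x _; apply: (@continuous_comp _ _ _ (fun x : pt => x - p) (fun y : pt => `|y|)); last exact: norm_continuous.
  exact: (cvgB cvg_id (cvg_cst p)).
have sub : closure [set x | bump p e x != 0] `<=` [set x | `|x - p| <= e].
  move/closure_id : (cl) => ->; apply: closureS => x /=; apply: contraNT.
  by rewrite -ltNge => /ltW h; rewrite bump_out.
split; first exact: bump_smooth.
- apply: (@subclosed_compact _ _ [set x : pt | `|x| <= `|p| + e]).
  + exact: closed_closure.
  + exact: compact_row_ball.
  + move=> x /sub /= h; have := ler_normD (x - p) p; rewrite subrK; lra.
- by move=> x /sub; exact: hU.
Qed.

Lemma bump_bsupp e : 0 < e -> bsupp e (bump 0 e).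
Proof. by move=> e0 x /ltW h; rewrite bump_out// subr0. Qed.

Lemma bump_is_grad p e : is_grad (bump p e) (fun i => partial i (bump p e)).
Proof. by apply: smooth_is_grad; exact: bump_smooth. Qed.

Lemma bump_C1c e : 0 < e -> C1c (bump 0 e) (fun i => partial i (bump 0 e)).
Proof. by move=> e0; split; [exact: bump_is_grad|exists e; exact: bump_bsupp]. Qed.

Lemma bump_integral_gt0 e : 0 < e -> 0 < \int[mu]_x bump 0 e x.
Proof.
move=> e0; pose a : pt := const_mx (- (e / 2)); pose b : pt := const_mx (e / 2).
have mB : measurable (row_box a b) by exact: measurable_row_box.
pose c : R := flatexp 0 2^-1 ^+ (n * 2).
have c0 : 0 < c by rewrite exprn_gt0// /flatexp invr_gt0 ltr0n expr0 mul1r expR_gt0.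
have hB x : row_box a b x -> c <= bump 0 e x.
  move=> hx; apply: bump_in => //; rewrite subr0; apply: row_norm_le; first by rewrite divr_ge0// ltW.
  by move=> i; have := hx i; rewrite !mxE ler_norml => /andP[/ltW -> ->].
have nb D : nice D (bump 0 e) by exact: C1c_nice (bump_C1c e0).
have muB : mu (row_box a b) = (e ^+ n)%:E.
  rewrite -[LHS]/(lebesgue_row n _) lebesgue_row_box; congr EFin.
  rewrite /box_vol (eq_bigr (fun=> e)) ?prodr_const ?card_ord// => i _.
  by rewrite !mxE opprK (_ : e / 2 + e / 2 = e) ?max_r//; [exact: ltW|lra].
apply: (@lt_le_trans _ _ (\int[mu]_(x in row_box a b) c)).
  by rewrite Rintegral_cst// muB /= mulr_gt0// exprn_gt0.
apply: (@le_trans _ _ (\int[mu]_(x in row_box a b) bump 0 e x)).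
  apply: le_Rintegral => //; last exact: nice_integrable.
  apply/integrableP; split; first exact: measurable_cst.
  by rewrite integral_cst// muB -EFinM ltry.
rewrite -lee_fin /Rintegral !fineK; last 2 first.
- by apply: integrable_fin_num => //; exact: nice_integrable.
- by apply: integrable_fin_num => //; exact: nice_integrable.
apply: ge0_subset_integral => //.
  by apply/measurable_EFinP; exact: (nb setT).1.
by move=> x _; rewrite lee_fin bump_ge0.
Qed.

End smooth_bump.

(** Discrete layer cake: t is recovered up to e from the number of positive multiples of e that it
    reaches. *)
Lemma layer_sum {R : realType} (e : R) (L : nat) (t : R) : 0 < e -> 0 <= t <= L%:R * e ->
  t - e <= e * \sum_(i < L) ((i.+1%:R * e <= t)%R : nat)%:R <= t.
Proof.
move=> e0; elim: L => [|L ih] /andP[t0 tL].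
  rewrite big_ord0 mulr0 t0 andbT; move: tL; rewrite mul0r; lra.
rewrite big_ord_recr /= mulrDr; have [h|h] := lerP t (L%:R * e).
  have -> : (L.+1%:R * e <= t)%R = false.
    by apply/negbTE; rewrite -ltNge; apply: le_lt_trans h _; rewrite ltr_pM2r// ltr_nat.
  by rewrite mulr0 addr0; apply: ih; rewrite t0.
have -> : \sum_(i < L) ((i.+1%:R * e <= t)%R : nat)%:R = L%:R :> R.
  rewrite (eq_bigr (fun=> 1)) ?sumr_const ?card_ord// => i _.
  rewrite (_ : (_ <= _)%R = true)//; apply: le_trans (ltW h).
  by rewrite ler_pM2r// ler_nat.
have e1 : L.+1%:R * e = L%:R * e + e by rewrite -natr1; ring.
rewrite e1 in tL *; have [h2|h2] := lerP (L%:R * e + e) t; rewrite ?mulr1 ?mulr0; apply/andP; split; lra.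
Qed.

Lemma ereal_cvg0_lt {R : realType} (u : nat -> \bar R) (e : R) : 0 < e ->
  u k @[k --> \oo] --> 0%E -> \forall k \near \oo, (u k < e%:E)%E.
Proof.
move=> e0 h; apply: (h [set x | (x < e%:E)%E]); apply: open_nbhs_nbhs; split.
  exact: open_ereal_lt_ereal.
by rewrite /= lte_fin.
Qed.

(** * Continuity of translations in L2 *)

Section translation_continuity.
Context {R : realType} (n : nat).
Local Notation pt := 'rV[R]_n.
Local Notation mu := (lebesgue_row n : {measure set pt -> \bar R}).
Local Notation F := (L2_form mu (@measurableT _ pt)).
Implicit Types (x y v : pt) (f g : pt -> R) (A B : set pt) (e d : R).

Definition symd A v : set pt := [set x | ~ (A (x + v) <-> A x)].

Lemma measurable_symd A v : measurable A -> measurable (symd A v).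
Proof.
move=> mA; pose A' := (fun x => x + v) @^-1` A.
have mA' : measurable A' by apply: (mpres_measurable (mpres_translation v)).
rewrite (_ : symd A v = (A' `\` A) `|` (A `\` A')).
  by apply: measurableU; exact: measurableD.
apply/seteqP; split => x; rewrite /symd /A' /=; last by tauto.
by have [|] := pselect (A x); have [|] := pselect (A (x + v)); tauto.
Qed.

(** The sets with this property contain the boxes and form a sigma-algebra, so all measurable sets
    have it. The cube keeps the measures finite while leaving the property stable under
    complement. *)
Definition symd_small A := measurable A /\ forall k (e : R), 0 < e -> exists2 d, 0 < d &
  forall v, `|v| < d -> (mu (row_cube k `&` symd A v) <= e%:E)%E.

Lemma symd_smallC A : symd_small A -> symd_small (~` A).
Proof.
move=> [mA h]; split; first exact: measurableC.
move=> k e e0; have [d d0 hd] := h k e e0; exists d => // v vd.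
rewrite (_ : symd (~` A) v = symd A v); first exact: hd.
apply/seteqP; split => x; rewrite /symd /=;
  by have [|] := pselect (A x); have [|] := pselect (A (x + v)); tauto.
Qed.

Lemma mu_le_setU A B C a b : measurable A -> measurable B -> measurable C -> C `<=` A `|` B ->
  (mu A <= a -> mu B <= b -> mu C <= a + b)%E.
Proof.
move=> mA mB mC CAB ha hb; apply: (@le_trans _ _ (mu (A `|` B))).
  by apply: le_measure; [exact: mem_set|apply: mem_set; exact: measurableU|].
apply: le_trans (measureU2 _ _ _) _ => //; exact: leeD.
Qed.

Lemma symd_smallU A B : symd_small A -> symd_small B -> symd_small (A `|` B).
Proof.
move=> [mA hA] [mB hB]; have mAB := measurableU _ _ mA mB; split => // k e e0.
have e2 : 0 < e / 2 by rewrite divr_gt0.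
have [d1 d10 h1] := hA k _ e2; have [d2 d20 h2] := hB k _ e2.
exists (Num.min d1 d2); first by rewrite lt_min d10.
move=> v; rewrite lt_min => /andP[v1 v2].
have mk := @measurable_row_cube R n k.
rewrite (_ : e = e / 2 + e / 2) ?EFinD; last by lra.
have mI X : measurable X -> measurable (row_cube k `&` symd X v).
  by move=> mX; apply: measurableI => //; exact: measurable_symd.
apply: (mu_le_setU (mI _ mA) (mI _ mB) (mI _ mAB)) => //; last exact: h2.
  move=> x [kx]; rewrite /symd /= => hx.
  have [hA'|hA'] := pselect (A (x + v) <-> A x); last by left.
  have [hB'|hB'] := pselect (B (x + v) <-> B x); last by right.
  by exfalso; tauto.
exact: h1.
Qed.

Lemma symd_small0 : symd_small set0.
Proof.
split; first exact: measurable0.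
move=> k e e0; exists 1 => // v _; rewrite (_ : _ `&` _ = set0) ?measure0 ?lee_fin ?ltW//.
by apply/seteqP; split => x // [_]; rewrite /symd /=; tauto.
Qed.

Lemma symd_small_bigcup (A : nat -> set pt) : (forall i, symd_small (A i)) -> symd_small (\bigcup_i A i).
Proof.
move=> h; have mA i : measurable (A i) by have [] := h i.
have mU : measurable (\bigcup_i A i) by exact: bigcupT_measurable.
split => // k e e0.
pose B m := \big[setU/set0]_(i < m) A i.
have sB m : symd_small (B m).
  by rewrite /B; apply: big_ind => //; [exact: symd_small0|exact: symd_smallU].
have mB m : measurable (B m) by have [] := sB m.
have BU m : B m `<=` \bigcup_i A i.
  by rewrite /B => x; rewrite -bigcup_mkord => -[i _ Aix]; exists i.
(* What the first m sets miss. Its measure decreases to 0 because the cube has finite measure; the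
   cube is one unit larger since points of the k-th cube are shifted by less than 1. *)
pose E m := row_cube k.+1 `&` (\bigcup_i A i `\` B m).
have mE m : measurable (E m) by apply: measurableI; [exact: measurable_row_cube|exact: measurableD].
have e3 : 0 < e / 3 by rewrite divr_gt0.
have [m hm] : exists m, (mu (E m) <= (e / 3)%:E)%E.
  have := @nonincreasing_cvg_mu _ _ _ mu E.
  have -> : \bigcap_m E m = set0.
    apply/seteqP; split => // x hx; have [_ [[i _ Aix] _]] := hx 0%N Logic.I.
    have [_ [_]] := hx i.+1 Logic.I; apply; rewrite /B -bigcup_mkord; exists i => //=.
  rewrite measure0 => /(_ _ mE measurable0).
  have fin0 : (mu (E 0%N) < +oo)%E.
    apply: (@le_lt_trans _ _ (mu (@row_cube R n k.+1))); last by rewrite lebesgue_row_cube ltry.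
    by apply: le_measure; [exact: mem_set|apply: mem_set; exact: measurable_row_cube|move=> x []].
  move=> /(_ fin0) hc.
  have {}hc : (mu \o E) x @[x --> \oo] --> 0%E.
    apply: hc => i j ij; apply/subsetPset => x [kx [Ux nB]]; split => //; split => // hB; apply: nB.
    by move: hB; rewrite /B -!bigcup_mkord => -[l /= li Alx]; exists l => //=; exact: leq_trans ij.
  have fz : \forall i \near \oo, (mu (E i) < (e / 3)%:E)%E.
    exact: ereal_cvg0_lt.
  by have [i _ hi] := fz; exists i; apply/ltW/hi => /=.
have [d d0 hd] := (sB m).2 k _ e3.
exists (Num.min d 1); first by rewrite lt_min d0 ltr01.
move=> v; rewrite lt_min => /andP[vd v1].
have tE := mpres_measurable (mpres_translation v) (mE m).
have mk := @measurable_row_cube R n k.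
have mD1 : measurable (row_cube k `&` symd (B m) v) by apply: measurableI => //; exact: measurable_symd.
rewrite (_ : e = e / 3 + (e / 3 + e / 3)) ?EFinD; last by lra.
apply: (mu_le_setU mD1 (measurableU _ _ tE (mE m))).
- by apply: measurableI => //; exact: measurable_symd.
- move=> x [kx hx]; have kx1 : row_cube k.+1 x by apply: row_cube_mono kx.
  have kxv : row_cube k.+1 (x + v).
    move=> i; have := kx i; rewrite !mxE => /andP[h1 h2].
    have := le_lt_trans (row_coord_le v i) v1; rewrite ltr_norml => /andP[h3 h4].
    by rewrite -natr1; apply/andP; split; lra.
  have [hB|hB] := pselect (B m (x + v) <-> B m x); last by left.
  right; have [Ux|nUx] := pselect ((\bigcup_i A i) x).
    have nUxv : ~ (\bigcup_i A i) (x + v) by move=> h'; apply: hx; split.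
    have nBx : ~ B m x by move=> /hB /BU.
    by right; split.
  have Uxv : (\bigcup_i A i) (x + v) by apply: contrapT => h'; apply: hx; split.
  have nBx : ~ B m (x + v) by move=> /hB /BU.
  by left; split.
- exact: hd.
- apply: (mu_le_setU tE (mE m) (measurableU _ _ tE (mE m))) => //.
  apply: le_trans hm; rewrite le_eqVlt; apply/orP; left; apply/eqP; exact: (mpres_translation v).2.
Qed.

Lemma symd_small_half (i : 'I_n) (c : R) : symd_small [set x | x ord0 i <= c].
Proof.
split.
  apply: closed_row_measurable; apply: (@preimage_closed _ _ (fun x : pt => x ord0 i) [set r | r <= c]); last exact: closed_le.
  by move=> x _; exact: coord_continuous.
move=> k e e0; pose W : R := 4 * (2 * k%:R) ^+ n.-1.
have W0 : 0 <= W by rewrite mulr_ge0// exprn_ge0.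
have W1 : 0 < W + 1 by rewrite ltr_wpDl.
exists (e / (W + 1)); first by rewrite divr_gt0.
move=> v hv; pose dd := e / (W + 1).
pose a : pt := \row_l if l == i then c - 2 * dd else - k%:R.
pose b : pt := \row_l if l == i then c + 2 * dd else k%:R.
have d0 : 0 < dd by rewrite divr_gt0.
apply: (@le_trans _ _ (mu (row_box a b))).
  apply: le_measure; [apply: mem_set|apply: mem_set; exact: measurable_row_box|].
    apply: measurableI; first exact: measurable_row_cube.
    apply: measurable_symd; apply: closed_row_measurable.
    apply: (@preimage_closed _ _ (fun x : pt => x ord0 i) [set r | r <= c]); last exact: closed_le.
    by move=> x _; exact: coord_continuous.
  move=> x [kx]; rewrite /symd /= mxE => hx l; rewrite !mxE; case: eqP => [->|_].
    have := le_lt_trans (row_coord_le v i) hv; rewrite -/dd ltr_norml => /andP[h3 h4].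
    have [h5|h5] := lerP (x ord0 i) c.
      have : ~ (x ord0 i + v ord0 i <= c) by move=> h'; apply: hx; split.
      by move=> /negP; rewrite -ltNge => h6; apply/andP; split; lra.
    have h6 : x ord0 i + v ord0 i <= c.
      by rewrite leNgt; apply/negP => h'; apply: hx; split => h''; exfalso; lra.
    by apply/andP; split; lra.
  by have := kx l; rewrite !mxE.
rewrite -[leLHS]/(lebesgue_row n _) lebesgue_row_box lee_fin /box_vol.
rewrite (bigD1 i)//= !mxE eqxx.
have -> : c + 2 * dd - (c - 2 * dd) = 4 * dd by ring.
rewrite max_r; last by rewrite mulr_ge0// ltW.
rewrite (eq_bigr (fun=> 2 * k%:R)); last first.
  by move=> l li; rewrite !mxE (negbTE li) opprK max_r; [ring|rewrite addr_ge0].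
rewrite prodr_const (_ : #|_| = n.-1); last by rewrite cardC1 card_ord.
have -> : 4 * dd * (2 * k%:R) ^+ n.-1 = W * dd by rewrite /W; ring.
rewrite /dd mulrA ler_pdivrMr// mulrC ler_pM2l//; lra.
Qed.

Lemma symd_small_box (a b : pt) : symd_small (row_box a b).
Proof.
pose bad (l : nat) : set pt := if insub l is Some i then
  ~` [set x : pt | x ord0 i <= b ord0 i] `|` [set x : pt | x ord0 i <= a ord0 i] else set0.
have -> : row_box a b = ~` (\bigcup_l bad l).
  apply/seteqP; split => x.
    move=> hx [l _]; rewrite /bad; case: insubP => //= i _ _.
    by have /andP[h1 h2] := hx i => -[/=|h]; [rewrite h2|lra].
  move=> hx i; have : ~ bad i x by move=> h; apply: hx; exists i.
  rewrite /bad; case: insubP => /= [j _ /val_inj ->|]; last by rewrite ltn_ord.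
  by move=> /not_orP[/contrapT h1 /negP]; rewrite -ltNge => ->.
apply: symd_smallC; apply: symd_small_bigcup => l; rewrite /bad.
case: insubP => [i _ _|_]; last exact: symd_small0.
by apply: symd_smallU; [apply: symd_smallC|]; exact: symd_small_half.
Qed.

Lemma measurable_symd_small A : measurable A -> symd_small A.
Proof.
rewrite measurable_rowE; move: A; apply: smallest_sub.
  split; [exact: symd_small0|by move=> A; rewrite setTD; exact: symd_smallC|exact: symd_small_bigcup].
by move=> _ [a [b ->]]; exact: symd_small_box.
Qed.

Definition shift_continuous f := forall e : R, 0 < e -> exists2 d, 0 < d & forall v, `|v| < d ->
  fnrm F ((fun x => f (x + v)) - f) <= e.

Lemma shiftT_isometry v : isometry_on F (fun f => f \o (fun x => x + v)).
Proof. by apply: mpres_isometry (mpres_translation v) _ _ _. Qed.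

Lemma shift_continuous_indic k A : measurable A -> A `<=` row_cube k ->
  fdom F (\1_A : pt -> R) /\ shift_continuous (\1_A : pt -> R).
Proof.
move=> mA Ak; have dA : fdom F (\1_A : pt -> R).
  apply: nice_L2on => //; split; first exact: measurable_indic.
  exists 1, k => x _; rewrite indicE; split; first by case: (_ \in _); rewrite ?normr1 ?normr0.
  by move=> xk; rewrite memNset// => /Ak.
split => // e e0; have [_ h] := measurable_symd_small mA.
have [d d0 hd] := h k.+1 (e ^+ 2) (exprn_gt0 2 e0).
exists (Num.min d 1); first by rewrite lt_min d0 ltr01.
move=> v; rewrite lt_min => /andP[vd v1].
rewrite -(@ler_pXn2r _ 2)// ?nnegrE; [|exact: nrm_ge0|exact: ltW].
rewrite sqr_nrm -lee_fin; apply: le_trans (hd v vd).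
have [_ i1 _] := shiftT_isometry v.
rewrite /= -EFin_L2_ip//; last exact: (@domB _ _ F _ _ (i1 _ dA) dA).
have mD : measurable (row_cube k.+1 `&` symd A v).
  by apply: measurableI; [exact: measurable_row_cube|exact: measurable_symd].
have -> : mu (row_cube k.+1 `&` symd A v) = (\int[mu]_x (\1_(row_cube k.+1 `&` symd A v) x)%:E)%E.
  by rewrite integral_indic// setIT.
apply: ge0_le_integral => //.
- by move=> x _; rewrite lee_fin sqr_ge0.
- apply/measurable_EFinP; apply: measurable_funX; apply: measurable_funB; last exact: measurable_indic.
  by have [] := i1 _ dA.
- by apply/measurable_EFinP; exact: measurable_indic.
- move=> x _; rewrite lee_fin !fctE !indicE.
  have k1 (z : pt) : A z -> row_cube k.+1 z by move=> /Ak; apply: row_cube_mono.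
  have kv z w : `|w| < 1 -> A (z + w) -> row_cube k.+1 z.
    move=> w1 /Ak hz i; have := hz i; rewrite !mxE => /andP[h1 h2].
    have := le_lt_trans (row_coord_le w i) w1; rewrite ltr_norml => /andP[h3 h4].
    by rewrite -natr1; apply/andP; split; lra.
  have [a1|a1] := boolP (x + v \in A); have [a2|a2] := boolP (x \in A);
    rewrite ?subrr ?subr0 ?sub0r ?sqrrN ?expr1n ?expr0n ?ler0n//.
    rewrite mem_set//; split; first by apply: (kv x v) => //; exact: set_mem.
    by rewrite /symd /= => -[h1 _]; move/negP : a2; apply; apply/mem_set/h1; exact: set_mem.
  rewrite mem_set//; split; first by apply: k1; exact: set_mem.
  by rewrite /symd /= => -[_ h1]; move/negP : a1; apply; apply/mem_set/h1; exact: set_mem.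
Qed.

Lemma shift_continuousP c f g : fdom F f -> fdom F g -> shift_continuous f -> shift_continuous g ->
  shift_continuous (c *: f + g).
Proof.
move=> df dg hf hg e e0; pose e' := e / (`|c| + 1).
have c1 : 0 < `|c| + 1 by rewrite ltr_wpDl.
have e'0 : 0 < e' by rewrite divr_gt0.
have [d1 d10 h1] := hf _ e'0; have [d2 d20 h2] := hg _ e'0.
exists (Num.min d1 d2); first by rewrite lt_min d10.
move=> v; rewrite lt_min => /andP[v1 v2]; have [_ i1 _] := shiftT_isometry v.
have -> : (fun x => (c *: f + g) (x + v)) - (c *: f + g) =
   c *: ((f \o (fun x => x + v)) - f) + ((g \o (fun x => x + v)) - g).
  by apply/funext => x; rewrite !fctE /GRing.scale /=; ring.
have d3 : fdom F ((f \o (fun x => x + v)) - f) by apply: domB => //; exact: i1.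
have d4 : fdom F ((g \o (fun x => x + v)) - g) by apply: domB => //; exact: i1.
apply: le_trans (nrmD (domZ c d3) d4) _; rewrite nrmZ//.
have := h2 v v2; have := ler_wpM2l (normr_ge0 c) (h1 v v1).
have : (`|c| + 1) * e' = e by rewrite mulrC divfK// gt_eqF.
rewrite mulrDl mul1r => <- k1 k2; exact: lerD.
Qed.

Lemma shift_continuous_lim f : fdom F f ->
  (forall e, 0 < e -> exists g, [/\ fdom F g, shift_continuous g & fnrm F (f - g) <= e]) ->
  shift_continuous f.
Proof.
move=> df h e e0; have e3 : 0 < e / 3 by rewrite divr_gt0.
have [g [dg hg fg]] := h _ e3; have [d d0 hd] := hg _ e3.
exists d => // v vd; have [l i1 _] := shiftT_isometry v.
have -> : (fun x => f (x + v)) - f =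
   ((f - g) \o (fun x => x + v)) + ((g \o (fun x => x + v)) - g) - (f - g).
  by apply/funext => x; rewrite !fctE /=; ring.
have d1 : fdom F (f - g) by exact: domB.
have d2 : fdom F ((g \o (fun x => x + v)) - g) by apply: domB => //; exact: i1.
apply: le_trans (nrmB (domD (i1 _ d1) d2) d1) _.
apply: le_trans (lerD (nrmD (i1 _ d1) d2) (lexx _)) _.
rewrite (nrmT (shiftT_isometry v) 0 d1); have := hd v vd; rewrite [X in fnrm F X]/(_ - _); lra.
Qed.

Lemma shift_continuous_pos k (L : nat) f : measurable_fun setT f -> (forall x, 0 <= f x <= L%:R) ->
  (forall x, ~ row_cube k x -> f x = 0) -> fdom F f /\ shift_continuous f.
Proof.
move=> mf fL f0.
have df : fdom F f.
  apply: nice_L2on => //; split => //; exists L%:R, k => x _; split; last exact: f0.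
  by have /andP[h1 h2] := fL x; rewrite ger0_norm.
split => //; apply: shift_continuous_lim => // e e0.
have [e' e'0 he'] := @small_nice R n k e e0.
pose M := (Num.truncn (L%:R / e')).+1.
pose A (i : nat) : set pt := [set x | i.+1%:R * e' <= f x].
have mA i : measurable (A i).
  rewrite (_ : A i = f @^-1` `[i.+1%:R * e', +oo[%classic).
    by rewrite -[X in measurable X]setTI; exact: mf.
  by apply/seteqP; split => x; rewrite /A /= in_itv /= andbT.
have Ak i : A i `<=` row_cube k.
  move=> x hx; apply: contrapT => /f0 fx; move: hx; rewrite /A /= fx; apply/negP.
  by rewrite -ltNge mulr_gt0.
pose g (m : nat) : pt -> R := \sum_(i < m) e' *: (\1_(A i) : pt -> R).
have hg m : fdom F (g m) /\ shift_continuous (g m).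
  rewrite /g; elim: m => [|m [ih1 ih2]].
    rewrite big_ord0; split; first exact: dom0.
    move=> e1 e10; exists 1 => // v _; rewrite (_ : _ - _ = 0) ?nrm0 ?ltW//.
    by apply/funext => x; rewrite !fctE subrr.
  have [h1 h2] := shift_continuous_indic (mA m) (@Ak m).
  rewrite big_ord_recr /= addrC; split; first exact: domD (domZ _ h1) ih1.
  exact: shift_continuousP.
exists (g M); split; [exact: (hg M).1|exact: (hg M).2|].
apply: he'; first by apply: measurable_funB => //; have [[]] := hg M.
move=> x _; have -> : (f - g M) x = f x - e' * \sum_(i < M) ((i.+1%:R * e' <= f x)%R : nat)%:R.
  rewrite !fctE /g; congr (_ - _); rewrite mulr_sumr.
  elim: (index_enum _) => [|i r ih]; first by rewrite !big_nil.
  rewrite !big_cons !fctE ih /GRing.scale /=; congr (_ * _ + _); rewrite indicE; congr (_%:R); congr nat_of_bool.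
  by apply/idP/idP => [/set_mem//|h]; exact: mem_set.
have hM : 0 <= f x <= M%:R * e'.
  have /andP[-> h2] := fL x; rewrite /=; apply: le_trans h2 _.
  by rewrite -ler_pdivrMr//; apply/ltW/truncnS_gt.
have /andP[h1 h2] := layer_sum e'0 hM; rewrite indicE; have [xk|xk] := boolP (x \in _).
  by rewrite mulr1 ger0_norm; lra.
have fx : f x = 0 by apply: f0 => h; move/negP : xk; apply; exact: mem_set.
rewrite mulr0 normr_le0 fx sub0r oppr_eq0 mulf_eq0; apply/orP; right; apply/eqP.
apply: big1 => i _; rewrite (_ : (_ <= _)%R = false)//; apply/negbTE; rewrite -ltNge.
by rewrite mulr_gt0.
Qed.

(** Truncations in height and to a cube converge in L2 by domination; their positive and negative
    parts are uniform limits of layer sums of indicators, for which [symd_small] applies. *)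
Lemma shift_continuous_L2 f : fdom F f -> shift_continuous f.
Proof.
move=> df; have [mf f2] := df; apply: shift_continuous_lim => // e e0.
pose tf (k : nat) x := Num.min (Num.max (f x) (- k%:R)) k%:R * \1_(@row_cube R n k) x.
have mtf k : measurable_fun setT (tf k).
  apply: measurable_funM; last by apply: measurable_indic; exact: measurable_row_cube.
  by apply: measurable_minr => //; apply: measurable_maxr.
have tf_le k x : `|f x - tf k x| <= `|f x|.
  rewrite /tf indicE; case: (_ \in _); rewrite ?mulr0 ?subr0// mulr1.
  have k0 : 0 <= k%:R :> R by [].
  case: (lerP (f x) (- k%:R)) => h1; [case: (lerP (- k%:R) k%:R)|case: (lerP (f x) k%:R)] => h2; try lra.
  - by rewrite ler0_norm; [rewrite ler0_norm|]; lra.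
  - by rewrite subrr normr0.
  - by rewrite ger0_norm; [rewrite ger0_norm|]; lra.
have dtf k : fdom F (tf k) /\ shift_continuous (tf k).
  pose gp x := Num.max (tf k x) 0; pose gn x := Num.max (- tf k x) 0.
  have b x : `|tf k x| <= k%:R.
    rewrite /tf indicE; case: (_ \in _); rewrite ?mulr0 ?normr0// mulr1.
    have k0 : 0 <= k%:R :> R by [].
    rewrite ler_norml ge_min lexx orbT andbT le_min le_max lexx orbT /=; lra.
  have z x : ~ row_cube k x -> tf k x = 0 by move=> xk; rewrite /tf indicE memNset// mulr0.
  have hp : fdom F gp /\ shift_continuous gp.
    apply: (@shift_continuous_pos k k).
    - exact: measurable_maxr.
    - move=> x; rewrite le_max lexx orbT /= ge_max ler0n andbT; exact: le_trans (ler_norm _) (b x).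
    - by move=> x xk; rewrite /gp z// maxxx.
  have hn : fdom F gn /\ shift_continuous gn.
    apply: (@shift_continuous_pos k k).
    - by apply: measurable_maxr => //; exact: measurableT_comp.
    - move=> x; rewrite le_max lexx orbT /= ge_max ler0n andbT; apply: le_trans (ler_norm _) _; by rewrite normrN.
    - by move=> x xk; rewrite /gn z// oppr0 maxxx.
  have -> : tf k = (-1) *: gn + gp.
    apply/funext => x; rewrite !fctE /GRing.scale /= /gn /gp.
    by case: (lerP (tf k x) 0) => h; case: (lerP (- tf k x) 0) => h'; lra.
  split; first exact: domD (domZ _ hn.1) hp.1.
  by apply: shift_continuousP; [exact: hn.1|exact: hp.1|exact: hn.2|exact: hp.2].
have tf_cvg x : \forall k \near \oo, tf k x = f x.
  have : (\bigcup_k @row_cube R n k) x by rewrite bigcup_row_cube.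
  move=> [k0 _ hk0]; exists (maxn k0 (Num.truncn `|f x|).+1) => // k /=; rewrite geq_max => /andP[h1 h2].
  rewrite /tf indicE mem_set ?mulr1; last exact: row_cube_mono hk0.
  have : `|f x| <= k%:R.
    apply: le_trans (ltW (truncnS_gt _)) _; by rewrite ler_nat.
  by rewrite ler_norml => /andP[h3 h4]; rewrite (max_l h3) min_l.
have cv : (\int[mu]_(x in setT) ((f x - tf k x) ^+ 2)%:E)%E @[k --> \oo] --> (\int[mu]_(x in setT) (cst 0%E : pt -> \bar R) x)%E.
  apply: (@dominated_cvg _ _ _ mu setT measurableT (fun k x => ((f x - tf k x) ^+ 2)%:E) (cst 0%E) (fun x => (f x ^+ 2)%:E)).
  - by move=> k; apply/measurable_EFinP; apply: measurable_funX; exact: measurable_funB.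
  - move=> x _; apply: cvg_near_cst; have := tf_cvg x; apply: filterS => k ->.
    by rewrite subrr expr0n.
  - by [].
  - exact: L2on_integrable2.
  - move=> k x _; rewrite gee0_abs ?lee_fin ?sqr_ge0//.
    by rewrite -(real_normK (num_real (_ - _))) -(real_normK (num_real (f x))) ler_pXn2r ?nnegrE.
rewrite integral_cst// mul0e in cv.
have fz : \forall k \near \oo, (\int[mu]_(x in setT) ((f x - tf k x) ^+ 2)%:E < (e ^+ 2)%:E)%E.
  by apply: ereal_cvg0_lt => //; rewrite exprn_gt0.
have [k _ hk] := fz; exists (tf k); split; [exact: (dtf k).1|exact: (dtf k).2|].
rewrite -(@ler_pXn2r _ 2)// ?nnegrE; [|exact: nrm_ge0|exact: ltW].
rewrite sqr_nrm -lee_fin /= -EFin_L2_ip//; last exact: (@domB _ _ F _ _ df (dtf k).1).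
by apply/ltW/hk => /=.
Qed.

End translation_continuity.

Lemma L2on_mulb {R : realType} d (T : measurableType d) (mu : {measure set T -> \bar R})
  (D : set T) (mD : measurable D) (g f : T -> R) (C : R) :
  measurable_fun D g -> (forall x, D x -> `|g x| <= C) -> L2on mu D f ->
  L2on mu D (fun x => g x * f x) /\
  fnrm (L2_form mu mD) (fun x => g x * f x) <= C * fnrm (L2_form mu mD) f.
Proof.
move=> mg gC hf; have [mf f2] := hf.
have le x : D x -> (g x * f x) ^+ 2 <= C ^+ 2 * f x ^+ 2.
  move=> Dx; rewrite exprMn ler_wpM2r ?sqr_ge0// -(real_normK (num_real (g x))).
  by rewrite ler_pXn2r ?nnegrE ?gC// (le_trans _ (gC _ Dx)).
have m1 : measurable_fun D (fun x => g x * f x) by exact: measurable_funM.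
have dgf : L2on mu D (fun x => g x * f x).
  split => //; apply: (@le_lt_trans _ _ (\int[mu]_(x in D) ((C ^+ 2)%:E * (f x ^+ 2)%:E))%E).
    apply: ge0_le_integral => //.
    - by move=> x _; rewrite lee_fin sqr_ge0.
    - by apply/measurable_EFinP; exact: measurable_funX.
    - by apply: measurable_funeM; apply/measurable_EFinP; exact: measurable_funX.
  rewrite ge0_integralZl//.
  - by rewrite EFin_L2_ip// -EFinM ltry.
  - by apply/measurable_EFinP; exact: measurable_funX.
  - by move=> x _; rewrite lee_fin sqr_ge0.
  - by rewrite lee_fin sqr_ge0.
(* On an empty D the bound says nothing about the sign of C, and both norms are zero. *)
split => //; have [[x0 Dx0]|D0] := pselect (exists x, D x); last first.
  have D0' : D = set0 by apply/seteqP; split => x // Dx; apply: D0; exists x.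
  have z h : fnrm (L2_form mu mD) h = 0.
    by rewrite /fnrm /= /L2_ip D0' Rintegral_set0 sqrtr0.
  by rewrite !z mulr0.
have C0 : 0 <= C by apply: le_trans (gC _ Dx0).
rewrite -(@ler_pXn2r _ 2)// ?nnegrE ?mulr_ge0 ?nrm_ge0// exprMn !sqr_nrm /= !L2_ipE.
rewrite -RintegralZl//; last exact: L2on_integrable2.
apply: le_Rintegral => //; first exact: L2on_integrable2.
apply: (integrableZl mD (C ^+ 2) (L2on_integrable2 mD hf)).
Qed.

Lemma continuous_distP {R : realType} (T : topologicalType) (f : T -> R) :
  (forall x e, 0 < e -> \forall y \near x, `|f x - f y| <= e) -> continuous f.
Proof. by move=> h x; apply/cvgrPdist_le => e e0; exact: h. Qed.

Lemma continuous_opp {R : realType} (T : topologicalType) (f : T -> R) :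
  continuous f -> continuous (fun x => - f x).
Proof. by move=> cf x; exact: (cvgN (cf x)). Qed.

Lemma frac_le {R : realType} (e a : R) : 0 <= e -> 0 <= a -> e / (a + 1) * a <= e.
Proof.
move=> e0 a0; have a1 : 0 < a + 1 by lra.
rewrite mulrAC ler_pdivrMr//; apply: ler_wpM2l => //; lra.
Qed.

Section mollifier.
Context {R : realType} (n : nat).
Local Notation pt := 'rV[R]_n.
Local Notation mu := (lebesgue_row n : {measure set pt -> \bar R}).
Local Notation F := (L2_form mu (@measurableT _ pt)).
Implicit Types (x y z v : pt) (f g h : pt -> R) (gf gg gh : 'I_n -> pt -> R) (e d : R).

(** Correlation instead of convolution: the translated kernel is itself a test function, so a weak
    derivative can be tested against it directly. Differentiating in x puts the derivative on h with
    a minus sign. *)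
Definition corr h f x := fip F (fun y => h (y - x)) f.

Lemma shift_dom v f : fdom F f -> fdom F (fun y => f (y + v)).
Proof. by have [_ h _] := @shiftT_isometry R n v; move/h. Qed.
Lemma shift_nrm v f : fdom F f -> fnrm F (fun y => f (y + v)) = fnrm F f.
Proof. by move=> df; exact: (nrmT (@shiftT_isometry R n v) 0 df). Qed.

Lemma corr_le h f x : fdom F h -> fdom F f -> `|corr h f x| <= fnrm F h * fnrm F f.
Proof.
move=> dh df; apply: le_trans (cauchy_schwarz _ _) _ => //; first exact: shift_dom.
by rewrite shift_nrm.
Qed.

Lemma corr_sub h h' f x : fdom F h -> fdom F h' -> fdom F f ->
  corr (h - h') f x = corr h f x - corr h' f x.
Proof. by move=> dh dh' df; rewrite /corr -ipBl//; exact: shift_dom. Qed.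

Lemma continuous_corr h f : fdom F h -> fdom F f -> continuous (corr h f).
Proof.
move=> dh df; apply: continuous_distP => x e e0.
pose e' := e / (fnrm F f + 1).
have f1 : 0 < fnrm F f + 1 by rewrite ltr_wpDl ?nrm_ge0.
have [d d0 hd] := shift_continuous_L2 dh (divr_gt0 e0 f1).
have : nbhs x (ball x d) by exact: nbhsx_ballx.
apply: filterS => y; rewrite -ball_normE /ball_ /= => hy.
have -> : corr h f x - corr h f y = - corr ((fun z => h (z + (x - y))) - h) f x.
  rewrite corr_sub//; last exact: shift_dom.
  rewrite opprB; congr (_ - _); rewrite /corr; congr (fip F _ f).
  by apply/funext => z; rewrite addrA subrK.
rewrite normrN; apply: le_trans (corr_le _ _ df) _.
  by apply: domB => //; exact: shift_dom.
have := ler_wpM2r (nrm_ge0 F f) (hd _ hy) => /le_trans; apply.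
exact: (frac_le (ltW e0) (nrm_ge0 F f)).
Qed.

Lemma is_grad_corr h gh f : C1c h gh -> fdom F f ->
  is_grad (corr h f) (fun i x => - corr (gh i) f x).
Proof.
move=> hh df; have dh : fdom F h by exact: C1c_L2 hh.
have dg i : fdom F (gh i) by exact: C1c_L2_grad hh.
split; first exact: continuous_corr.
- by move=> i; apply: continuous_opp; exact: continuous_corr.
move=> i x; apply/is_deriveP/cvgrPdist_le => e e0.
have f1 : 0 < fnrm F f + 1 by rewrite ltr_wpDl ?nrm_ge0.
have [hg [M sM]] := hh.
have [d d0 hd] := dq_L2 i hg sM (divr_gt0 e0 f1).
near=> t.
have t0 : t != 0 by near: t; exact: nbhs_dnbhs_neq.
have td : `|t| < d by near: t; exact: dnbhs0_lt.
have dd : fdom F (dq (- t) i h) by apply: C1c_L2 (C1c_dq (- t) i hh).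
have -> : - corr (gh i) f x - t^-1 * (corr h f (x + t *: 'e_i) - corr h f x) =
   corr (dq (- t) i h - gh i) f x.
  rewrite corr_sub// [RHS]addrC; congr (_ + _).
  have -> : corr (dq (- t) i h) f x = (- t)^-1 * corr ((fun z => h (z + (- t) *: 'e_i)) - h) f x.
    exact: (ipZl _ (shift_dom (- x) (domB (shift_dom ((- t) *: 'e_i) dh) dh)) df).
  have E : corr (fun z => h (z + (- t) *: 'e_i)) f x = corr h f (x + t *: 'e_i).
    by rewrite /corr; congr (fip F _ f); apply/funext => y; rewrite scaleNr opprD addrA.
  by rewrite corr_sub ?E ?invrN ?mulNr//; exact: shift_dom.
apply: le_trans (corr_le _ _ df) _; first exact: domB.
have b : fnrm F (dq (- t) i h - gh i) <= e / (fnrm F f + 1).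
  by apply: hd; rewrite ?oppr_eq0 ?normrN.
have := ler_wpM2r (nrm_ge0 F f) b => /le_trans; apply.
exact: (frac_le (ltW e0) (nrm_ge0 F f)).
Unshelve. all: by end_near. Qed.

Definition rho e z : R := (\int[mu]_x bump 0 e x)^-1 * bump 0 e z.
Definition grho e i z : R := (\int[mu]_x bump 0 e x)^-1 * partial i (bump 0 e) z.
Definition moll e f := corr (rho e) f.

Lemma rho_C1c e : 0 < e -> C1c (rho e) (grho e).
Proof. by move=> e0; apply: C1cZ; exact: bump_C1c. Qed.
Lemma rho_ge0 e z : 0 < e -> 0 <= rho e z.
Proof. by move=> e0; rewrite mulr_ge0 ?bump_ge0// invr_ge0 ltW// bump_integral_gt0. Qed.
Lemma rho_out e z : 0 < e -> e <= `|z| -> rho e z = 0.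
Proof. by move=> e0 h; rewrite /rho bump_out ?mulr0// subr0. Qed.
Lemma rho_nice e D : 0 < e -> nice D (rho e).
Proof. by move=> e0; exact: C1c_nice (rho_C1c e0). Qed.
Lemma rho_integral e : 0 < e -> \int[mu]_z rho e z = 1.
Proof.
move=> e0; have ib : mu.-integrable setT (EFin \o bump 0 e).
  by apply: nice_integrable => //; exact: C1c_nice (@bump_C1c R n e e0).
rewrite RintegralZl//.
by rewrite mulVf// gt_eqF// bump_integral_gt0.
Qed.

Lemma moll_is_grad e f : 0 < e -> fdom F f -> is_grad (moll e f) (fun i x => - corr (grho e i) f x).
Proof. by move=> e0 df; apply: is_grad_corr => //; exact: rho_C1c. Qed.

Lemma mollE e f x : 0 < e -> fdom F f -> moll e f x = \int[mu]_z (rho e z * f (z + x)).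
Proof.
move=> e0 df; rewrite /moll /corr /= /L2_ip.
have mf : measurable_fun setT (fun y => rho e (y - x) * f y).
  apply: measurable_funM; last by have [] := df.
  by have [] := shift_dom (- x) (C1c_L2 measurableT (rho_C1c e0)).
rewrite -(mpres_integral (mpres_translation x) measurableT mf) preimage_setT.
by apply: eq_Rintegral => z _ /=; rewrite addrK.
Qed.

(** Jensen as a variance identity: the integral of rho (f(z + x) - m)^2, with m the mollified value,
    is nonnegative and equals the integral on the right minus (m - f x)^2. *)
Lemma moll_sqr_le e f x : 0 < e -> fdom F f ->
  (((moll e f x - f x) ^+ 2)%:E <= \int[mu]_z (rho e z * (f (z + x) - f x) ^+ 2)%:E)%E.
Proof.
move=> e0 df; have dfx := shift_dom x df.
have nr := rho_nice setT e0; have [mr [C [k hC]]] := nr.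
have rC z : `|rho e z| <= C by have [] := hC z Logic.I.
have irf : mu.-integrable setT (EFin \o (fun z => rho e z * f (z + x))).
  by apply: L2on_integrableM => //; exact: nice_L2on.
have ir : mu.-integrable setT (EFin \o rho e) by exact: nice_integrable.
have irff : mu.-integrable setT (EFin \o (fun z => rho e z * f (z + x) ^+ 2)).
  have h := (L2on_mulb measurableT mr (fun z _ => rC z) dfx).1.
  have := L2on_integrableM measurableT h dfx; congr (_.-integrable _ _).
  by apply/funext => z /=; rewrite expr2 mulrA.
set m := moll e f x.
pose g z := rho e z * (f (z + x) - f x) ^+ 2.
have ig : mu.-integrable setT (EFin \o g).
  rewrite (_ : EFin \o g = ((fun z => (rho e z * f (z + x) ^+ 2)%:E) \+
     ((fun z => (- (2 * f x))%:E * (rho e z * f (z + x))%:E) \+ (fun z => (f x ^+ 2)%:E * (rho e z)%:E)))%E).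
    apply: integrableD => //; apply: integrableD => //; exact: integrableZl.
  by apply/funext => z /=; rewrite -!EFinM -!EFinD /g; congr EFin; ring.
have E : \int[mu]_z (rho e z * (f (z + x) - m) ^+ 2) =
    \int[mu]_z g z - (m - f x) ^+ 2.
  have igm : mu.-integrable setT (EFin \o (fun z => (-2 * (m - f x)) * (rho e z * f (z + x)))).
    by apply: (integrableZl measurableT (-2 * (m - f x)) irf).
  have irm : mu.-integrable setT (EFin \o (fun z => (m ^+ 2 - f x ^+ 2) * rho e z)).
    by apply: (integrableZl measurableT (m ^+ 2 - f x ^+ 2) ir).
  have -> : \int[mu]_z (rho e z * (f (z + x) - m) ^+ 2) =
     \int[mu]_z (g z + (-2 * (m - f x) * (rho e z * f (z + x)) + (m ^+ 2 - f x ^+ 2) * rho e z)).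
    by apply: eq_Rintegral => z _; rewrite /g; ring.
  rewrite RintegralD//; last exact: (integrableD measurableT igm irm).
  rewrite RintegralD// RintegralZl// RintegralZl// rho_integral// -mollE// -/m; ring.
have h0 : 0 <= \int[mu]_z (rho e z * (f (z + x) - m) ^+ 2).
  by apply: Rintegral_ge0 => z _; rewrite mulr_ge0 ?sqr_ge0 ?rho_ge0.
have fing := integrable_fin_num measurableT ig.
rewrite [leRHS](_ : _ = (\int[mu]_z g z)%:E); last by rewrite /Rintegral fineK.
by rewrite lee_fin; move: h0; rewrite E; lra.
Qed.

(** After [moll_sqr_le] the order of integration is exchanged: for fixed z, the inner integral is
    the squared L2 distance of f to its translate by z, small on the support of [rho t]. *)
Lemma moll_approx f : fdom F f -> forall e, 0 < e -> exists2 d, 0 < d & forall t, 0 < t -> t < d ->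
  fdom F (moll t f) /\ fnrm F (moll t f - f) <= e.
Proof.
move=> df e e0; have [mf f2] := df.
have [d d0 hd] := shift_continuous_L2 df e0.
exists d => // t t0 td.
have mm : measurable_fun setT (moll t f).
  by apply: continuous_row_measurable; have [] := moll_is_grad t0 df.
have mr : measurable_fun setT (rho t) by have [] := rho_nice setT t0.
have mB : measurable_fun setT (moll t f - f) by exact: measurable_funB.
pose g (p : pt * pt) : \bar R := (rho t p.2 * (f (p.2 + p.1) - f p.1) ^+ 2)%:E.
have mg : measurable_fun setT g.
  apply/measurable_EFinP; apply: measurable_funM.
    exact: (measurableT_comp mr measurable_snd).
  apply: measurable_funX; apply: measurable_funB; last exact: (measurableT_comp mf measurable_fst).
  apply: (measurableT_comp mf); apply: measurable_row => i.
  under eq_fun do rewrite mxE.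
  apply: measurable_funD.
    exact: (measurableT_comp (measurable_row_coord i) measurable_snd).
  exact: (measurableT_comp (measurable_row_coord i) measurable_fst).
have g0 p : (0 <= g p)%E by rewrite lee_fin mulr_ge0 ?sqr_ge0 ?rho_ge0.
have b : (\int[mu]_x ((moll t f - f) x ^+ 2)%:E <= (e ^+ 2)%:E)%E.
  apply: (@le_trans _ _ (\int[mu]_x \int[mu]_z g (x, z))%E).
    apply: ge0_le_integral => //.
    - by move=> x _; rewrite lee_fin sqr_ge0.
    - by apply/measurable_EFinP; exact: measurable_funX.
    - exact: (@measurable_fun_fubini_tonelli_F _ _ _ _ R (lebesgue_row n) g mg g0).
    - by move=> x _; exact: moll_sqr_le.
  rewrite (@fubini_tonelli _ _ _ _ R (lebesgue_row n) (lebesgue_row n) g mg g0).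
  have inner z : (\int[mu]_x g (x, z) <= (e ^+ 2)%:E * (rho t z)%:E)%E.
    have dz := shift_dom z df; have dB := domB dz df.
    have [tz|tz] := leP t `|z|.
      rewrite /g /= rho_out// mule0 (eq_integral (fun=> 0%E)) ?integral0// => x _.
      by rewrite mul0r.
    have -> : (\int[mu]_x g (x, z) = \int[mu]_x ((rho t z)%:E * (((fun x => f (x + z)) - f) x ^+ 2)%:E))%E.
      by apply: eq_integral => x _; rewrite /g /= -EFinM !fctE (addrC z).
    rewrite ge0_integralZl//; last 3 first.
    - by apply/measurable_EFinP; apply: measurable_funX; have [] := dB.
    - by move=> x _; rewrite lee_fin sqr_ge0.
    - by rewrite lee_fin rho_ge0.
    rewrite EFin_L2_ip// -!EFinM lee_fin mulrC ler_wpM2r ?rho_ge0//.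
    have := hd z (lt_trans tz td) => h1.
    rewrite -[L2_ip _ _ _ _]/(fip F ((fun x => f (x + z)) - f) ((fun x => f (x + z)) - f)) -sqr_nrm.
    by rewrite ler_pXn2r ?nnegrE ?nrm_ge0// ltW.
  apply: (@le_trans _ _ (\int[mu]_z ((e ^+ 2)%:E * (rho t z)%:E))%E).
    apply: ge0_le_integral => //.
    - by move=> z _; apply: integral_ge0.
    - have mg' : measurable_fun setT (fun p : pt * pt => g (p.2, p.1)).
        by apply: (measurableT_comp mg); apply/measurable_fun_pairP; split;
          [exact: measurable_snd|exact: measurable_fst].
      exact: (@measurable_fun_fubini_tonelli_F _ _ _ _ R (lebesgue_row n) _ mg' (fun p => g0 _)).
    - by apply: measurable_funeM; exact/measurable_EFinP.
  rewrite ge0_integralZl//; last 3 first.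
  - exact/measurable_EFinP.
  - by move=> z _; rewrite lee_fin rho_ge0.
  - by rewrite lee_fin sqr_ge0.
  have -> : (\int[mu]_z (rho t z)%:E = 1)%E.
    have ir : mu.-integrable setT (EFin \o rho t) by apply: nice_integrable => //; exact: rho_nice.
    by rewrite -[LHS]fineK ?(integrable_fin_num measurableT ir)// -/(Rintegral _ _ _) rho_integral.
  by rewrite mule1.
have dB : fdom F (moll t f - f) by split => //; exact: le_lt_trans b (ltry _).
split.
  by rewrite -[moll t f](subrK f); exact: domD.
rewrite -(@ler_pXn2r _ 2)// ?nnegrE; [|exact: nrm_ge0|exact: ltW].
by rewrite sqr_nrm -lee_fin /= -EFin_L2_ip.
Qed.

End mollifier.

(** * Weak derivatives and mollification *)

Section weak_derivatives.
Context {R : realType} (n : nat).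
Local Notation pt := 'rV[R]_n.
Local Notation mu := (lebesgue_row n : {measure set pt -> \bar R}).
Local Notation F := (L2_form mu (@measurableT _ pt)).
Implicit Types (x y z v : pt) (f g h : pt -> R) (e d : R) (O : set pt).

Lemma L2on_ext O f : measurable O -> L2on mu O f -> fdom F (f \_ O).
Proof.
move=> mO [mf f2]; split; first exact/(measurable_restrictT _ mO).
rewrite [X in (X < _)%E](_ : _ = \int[mu]_(x in O) (f x ^+ 2)%:E)%E//.
rewrite [RHS]integral_mkcond; apply: eq_integral => x _; rewrite !patchE.
by case: ifP => //; rewrite expr0n.
Qed.

Lemma L2_ip_ext O f g : L2_ip mu O f g = fip F (f \_ O) g.
Proof.
rewrite /= /L2_ip Rintegral_mkcond; apply: eq_Rintegral => x _; rewrite !patchE.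
by case: ifP => //; rewrite mul0r.
Qed.

Lemma rho_test e x O : 0 < e -> (forall y, `|y - x| <= e -> O y) ->
  test_function O (fun y => rho e (y - x)) /\
  forall i, partial i (fun y => rho e (y - x)) = (fun y => grho e i (y - x)).
Proof.
move=> e0 hO; pose c := (\int[mu]_x bump 0 e x)^-1.
have E : (fun y => rho e (y - x)) = (fun y => c * bump x e y).
  by apply/funext => y; rewrite /rho bump_translation add0r.
have c0 : c != 0 by rewrite invr_eq0 gt_eqF// bump_integral_gt0.
have [_ cs sub] := bump_support e0 hO.
split.
  rewrite E; have S : [set y | c * bump x e y != 0] = [set y | bump x e y != 0].
    by apply/seteqP; split => y /=; rewrite mulf_eq0 (negbTE c0).
  split; rewrite ?S//; apply: elem_smooth_smooth; apply: (@ES_mul _ _ (fun=> c)); first exact: ES_cst.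
  rewrite /bump; elim: (index_enum _) => [|i r ih].
    by under eq_fun do rewrite big_nil; exact: ES_cst.
  under eq_fun do rewrite big_cons.
  by apply: ES_mul => //; apply: ES_mul; exact: ES_flat.
move=> i; have := is_grad_translation (- x) (@rho_C1c R n e e0).1 => /is_grad_partial; exact.
Qed.

Lemma moll_weak_partial O i (u w : pt -> R) e x : measurable O -> L2on mu O u -> L2on mu O w ->
  is_weak_partial O i u w -> 0 < e -> (forall y, `|y - x| <= e -> O y) ->
  - corr (grho e i) (u \_ O) x = moll e (w \_ O) x.
Proof.
move=> mO du dw hw e0 hO; have [ht hp] := rho_test e0 hO.
have := hw _ ht; rewrite hp /moll /corr.
rewrite -[X in X = _]/(L2_ip mu O u (fun y => grho e i (y - x))).
rewrite -[X in _ = - X]/(L2_ip mu O w (fun y => rho e (y - x))).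
rewrite !L2_ip_ext !(ipC F (_ \_ O)) => ->; by rewrite opprK.
Qed.

(** The factor 2 leaves room for a closed ball of radius 1 / (k + 1), the largest support of a
    mollifier used at these points. *)
Definition core O (k : nat) : set pt := [set x | forall y, `|y - x| < 2 / k.+1%:R -> O y].

Lemma core_measurable O k : measurable (core O k).
Proof.
apply: closed_row_measurable; rewrite -[core O k]setCK closedC.
rewrite (_ : ~` _ = \bigcup_(y in ~` O) ball y (2 / k.+1%:R)).
  by apply: bigcup_open => y _; apply: ball_open; rewrite divr_gt0.
apply/seteqP; split => x.
  move=> /existsNP[y /not_implyP[h1 h2]]; exists y => //.
  by rewrite -ball_normE.
by move=> [y Oy]; rewrite -ball_normE /ball_ /= => h hx; apply: Oy; exact: hx.
Qed.

Lemma core_mono O k l : (k <= l)%N -> core O k `<=` core O l.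
Proof.
move=> kl x h y hy; apply: h; apply: lt_le_trans hy _.
by rewrite ler_pM2l// lef_pV2 ?posrE// ler_nat ltnS.
Qed.

Lemma core_sub O k : core O k `<=` O.
Proof. by move=> x h; apply: h; rewrite subrr normr0 divr_gt0. Qed.

Lemma bigcup_core O : open O -> \bigcup_k core O k = O.
Proof.
move=> oO; apply/seteqP; split => [x [k _]|x Ox]; first exact: core_sub.
have /nbhs_ballP[d /= d0 hd] : nbhs x O by apply: open_nbhs_nbhs.
have d2 : 0 < d / 2 by rewrite divr_gt0.
have [q hq] := exp2_small d2; exists (2 ^ q)%N => // y hy; apply: hd; rewrite -ball_normE /ball_ /=.
rewrite distrC; apply: lt_trans hy _; rewrite mulrC -ltr_pdivlMr// mulrC mulrC.
apply: le_lt_trans hq; rewrite lef_pV2 ?posrE ?exprn_gt0// -natrX ler_nat; exact: leqnSn.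
Qed.

Lemma L2_null_bigcup (A : nat -> set pt) O f : measurable_fun O f -> measurable O ->
  (forall k, measurable (A k)) -> (forall k l, (k <= l)%N -> A k `<=` A l) ->
  \bigcup_k A k = O -> (forall k, (\int[mu]_(x in A k) (f x ^+ 2)%:E = 0)%E) ->
  (\int[mu]_(x in O) (f x ^+ 2)%:E = 0)%E.
Proof.
move=> mf mO mA ndA AO h.
have AsO k : A k `<=` O by rewrite -AO => x hx; exists k.
have := @ge0_nondecreasing_set_cvg_integral _ _ R A (fun x => (f x ^+ 2)%:E) mu.
have nd : {homo A : k l / (k <= l)%N >-> (k <= l)%O} by move=> k l kl; apply/subsetPset; exact: ndA.
rewrite AO => /(_ nd mA) h1.
have {}h1 : (\int[mu]_(x in A i) (f x ^+ 2)%:E)%E @[i --> \oo] --> (\int[mu]_(x in O) (f x ^+ 2)%:E)%E.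
  apply: h1 => [k|k x _]; last by rewrite lee_fin sqr_ge0.
  by apply/measurable_EFinP; apply: measurable_funX; exact: measurable_funS mf.
apply: (@cvg_unique _ (@ereal_hausdorff R) _ _ _ _ h1).
by apply: cvg_near_cst; apply: nearW => k; exact: h.
Qed.

(** At points of a core the mollifying kernel is a test function of O, so the mollifications of g
    vanish there; since they converge to g in L2, g is null on each core. *)
Lemma test_integral_zero O g : open O -> L2on mu O g ->
  (forall phi, test_function O phi -> \int[mu]_(x in O) (g x * phi x) = 0) ->
  L2_ip mu O g g = 0.
Proof.
move=> oO dg h; have mO := open_row_measurable oO.
suff : (\int[mu]_(x in O) (g x ^+ 2)%:E = 0)%E by rewrite EFin_L2_ip// => -[].
apply: (@L2_null_bigcup (core O)) => //.
- by have [] := dg.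
- exact: core_measurable.
- exact: core_mono.
- exact: bigcup_core.
move=> k; have mk := core_measurable O k; have kO := @core_sub O k.
have dk := L2on_sub mO mk kO dg; rewrite EFin_L2_ip//; congr EFin.
have df := L2on_ext mO dg.
apply/eqP; rewrite eq_le L2_ip_ge0// andbT; apply/ler_addgt0Pr => e e0; rewrite add0r.
have se0 : 0 < Num.sqrt e by rewrite sqrtr_gt0.
have [d d0 hd] := moll_approx df se0.
pose t := Num.min (d / 2) (k.+1%:R^-1).
have t0 : 0 < t by rewrite lt_min divr_gt0//= invr_gt0.
have td : t < d by apply: (@le_lt_trans _ _ (d / 2)); [rewrite ge_min lexx|lra].
have [dm nm] := hd t t0 td.
have dB := domB dm df; have mT := @measurableT _ pt.
have z x : core O k x -> moll t (g \_ O) x = 0.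
  move=> kx; have hx y : `|y - x| <= t -> O y.
    move=> hy; apply: kx; apply: le_lt_trans hy _; apply: (@le_lt_trans _ _ k.+1%:R^-1).
      by rewrite ge_min lexx orbT.
    by rewrite mulrC ltr_pMr ?invr_gt0// ltr1n.
  have [ht _] := rho_test t0 hx; have := h _ ht.
  by rewrite -[X in X = _]/(L2_ip mu O g (fun y => rho t (y - x))) L2_ip_ext ipC.
have -> : L2_ip mu (core O k) g g = L2_ip mu (core O k) (moll t (g \_ O) - g \_ O) (moll t (g \_ O) - g \_ O).
  apply: eq_Rintegral => x /set_mem kx; rewrite !fctE z// sub0r mulrNN patchE mem_set//.
  exact: kO.
apply: le_trans (L2_ip_sub mT mk (@subsetT _ _) dB) _.
rewrite -[L2_ip _ _ _ _]/(fip F (moll t (g \_ O) - g \_ O) (moll t (g \_ O) - g \_ O)) -sqr_nrm.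
by rewrite -(sqr_sqrtr (ltW e0)) ler_pXn2r ?nnegrE ?nrm_ge0// sqrtr_ge0.
Qed.

End weak_derivatives.

(** * Sobolev functions and boundary charts *)

Section jets.
Context {R : realType} (n : nat).
Local Notation pt := 'rV[R]_n.
Local Notation mu := (lebesgue_row n : {measure set pt -> \bar R}).
Implicit Types (x y z v : pt) (f g h u w phi : pt -> R) (gf gg gh : 'I_n -> pt -> R) (O D E : set pt).
(** [None] holds the function and [Some i] its i-th derivative. The gradient is carried along
    because [weak_partial] picks one by [get], a choice that is linear only up to null functions. *)
Definition jets := option 'I_n -> pt -> R.
Implicit Types (G H : jets).

Definition jet f gf : jets := fun k => if k is Some i then gf i else f.

Section form.
Variable D : set pt.
Hypothesis mD : measurable D.
Definition H1dom G := forall k, L2on mu D (G k).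
Definition H1ip G H := \sum_k L2_ip mu D (G k) (H k).
Lemma H1dom0 : H1dom 0. Proof. by move=> k; exact: L2on0. Qed.
Lemma H1domP (a : R) G H : H1dom G -> H1dom H -> H1dom (a *: G + H).
Proof. by move=> hG hH k; exact: (L2onP mD a (hG k) (hH k)). Qed.
Lemma H1ipC G H : H1ip G H = H1ip H G.
Proof. by apply: eq_bigr => k _; exact: L2_ipC. Qed.
Lemma H1ipP (a : R) G H K : H1dom G -> H1dom H -> H1dom K ->
  H1ip (a *: G + H) K = a * H1ip G K + H1ip H K.
Proof.
move=> hG hH hK; rewrite /H1ip mulr_sumr -big_split /=; apply: eq_bigr => k _.
exact: L2_ipP.
Qed.
Lemma H1ip_ge0 G : 0 <= H1ip G G.
Proof. by apply: sumr_ge0 => k _; exact: L2_ip_ge0. Qed.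
Definition H1form : form jets := Form H1dom0 H1domP H1ipC H1ipP H1ip_ge0.

Lemma H1_comp_le G k : fnrm (L2_form mu mD) (G k) <= fnrm H1form G.
Proof.
rewrite /fnrm ler_wsqrtr//= /H1ip (bigD1 k)//= lerDl.
by apply: sumr_ge0 => l _; exact: L2_ip_ge0.
Qed.

Lemma H1_nrm_le G : fnrm H1form G <= \sum_k fnrm (L2_form mu mD) (G k).
Proof.
rewrite -(@ler_pXn2r _ 2)// ?nnegrE ?nrm_ge0//; last by apply: sumr_ge0 => k _; exact: nrm_ge0.
rewrite sqr_nrm /= /H1ip.
have E k : L2_ip mu D (G k) (G k) = fnrm (L2_form mu mD) (G k) ^+ 2 by rewrite sqr_nrm.
rewrite (eq_bigr _ (fun k _ => E k)).
elim: (index_enum _) => [|k r ih]; first by rewrite !big_nil expr0n.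
rewrite !big_cons sqrrD; have s0 : 0 <= \sum_(j <- r) fnrm (L2_form mu mD) (G j).
  by apply: sumr_ge0 => j _; exact: nrm_ge0.
have := mulr_ge0 (nrm_ge0 (L2_form mu mD) (G k)) s0; lra.
Qed.

Lemma H1_nrm_bound G (c : R) : (forall k, fnrm (L2_form mu mD) (G k) <= c) ->
  fnrm H1form G <= n.+1%:R * c.
Proof.
move=> h; apply: le_trans (H1_nrm_le G) _.
apply: le_trans (ler_sum _ (fun k _ => h k)) _.
by rewrite sumr_const card_option card_ord mulr_natl.
Qed.
End form.

Definition wjet O G := H1dom O G /\ forall i, is_weak_partial O i (G None) (G (Some i)).

Lemma test_C1c O phi : test_function O phi -> C1c phi (fun i => partial i phi).
Proof.
move=> [sm /compact_bounded[M [Mr hM]] _]; split; first exact: smooth_is_grad.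
exists (M + 1) => x xM; apply: contrapT => /eqP px.
have := hM (M + 1) ltac:(by rewrite ltrDl) x (@subset_closure _ [set x | phi x != 0] x px).
by rewrite /= leNgt xM.
Qed.

Lemma test_out O phi i x : test_function O phi -> ~ O x -> phi x = 0 /\ partial i phi x = 0.
Proof.
move=> ht Ox; have [sm _ sub] := ht.
have xc : ~ closure [set x | phi x != 0] x by move=> /sub.
have : (~` closure [set x | phi x != 0]) x by [].
have oC : open (~` closure [set x | phi x != 0]) by exact: closed_openC (@closed_closure _ _).
move=> nx; have /nbhs_ballP[d /= d0 hd] : nbhs x (~` closure [set x | phi x != 0]) by exact: open_nbhs_nbhs.
have z y : ball x d y -> phi y = 0.
  by move=> /hd hy; apply: contrapT => /eqP py; apply: hy; exact: subset_closure.
have px : phi x = 0 by apply: z; exact: ballxx.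
split=> //; have [_ _ dp] := smooth_is_grad sm; have /is_deriveP h := dp i x.
apply: (@cvg_unique _ (@Rhausdorff R) _ _ _ _ h); apply: cvg_near_cst.
have : \forall t \near (0:R)^', `|t| < d.
  apply: nbhs_dnbhs; apply/nbhs_ballP; exists d => // t.
  by rewrite -ball_normE /ball_ /= sub0r normrN.
apply: filterS => t td; rewrite px z ?subrr ?mulr0//.
rewrite -ball_normE /ball_ /= opprD addrA subrr add0r normrN.
exact: le_lt_trans (norm_row_e _ _) td.
Qed.

Lemma Rintegral_sub O D f : measurable D -> O `<=` D -> (forall x, D x -> ~ O x -> f x = 0) ->
  \int[mu]_(x in D) f x = \int[mu]_(x in O) f x.
Proof.
move=> mD OD h; rewrite Rintegral_mkcond [RHS]Rintegral_mkcond; apply: eq_Rintegral => x _.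
rewrite !patchE; have [xO|xO] := boolP (x \in O).
  by rewrite mem_set//; apply: OD; exact: set_mem.
case: ifPn => // /set_mem xD; apply: h => // Ox; move/negP : xO; apply; exact: mem_set.
Qed.

Lemma weak_partial_sub O D i u w : measurable D -> O `<=` D ->
  is_weak_partial D i u w -> is_weak_partial O i u w.
Proof.
move=> mD OD h phi tp; have tD : test_function D phi.
  by have [h1 h2 h3] := tp; split => //; exact: subset_trans OD.
have := h _ tD; rewrite !(Rintegral_sub mD OD)//.
- by move=> x _ /(test_out i tp)[-> _]; rewrite mulr0.
- by move=> x _ /(test_out i tp)[_ ->]; rewrite mulr0.
Qed.

Lemma wjet_sub O D G : measurable O -> measurable D -> O `<=` D -> wjet D G -> wjet O G.
Proof.
move=> mO mD OD [h1 h2]; split => [k|i]; first exact: L2on_sub (h1 k).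
exact: weak_partial_sub (h2 i).
Qed.

Lemma C1_wjet O f gf : measurable O -> is_grad f gf -> H1dom O (jet f gf) -> wjet O (jet f gf).
Proof.
move=> mO hf hd; split => // i phi tp /=.
have hp := test_C1c tp; have [hg [M sM]] := C1cM hp hf.
have := int_grad0 i hg sM; have mT := @measurableT _ pt.
have sub1 : \int[mu]_x (phi x * gf i x + f x * partial i phi x) =
   \int[mu]_(x in O) (phi x * gf i x + f x * partial i phi x).
  by apply: Rintegral_sub => // x _ /(test_out i tp)[-> ->]; rewrite mul0r mulr0 addr0.
rewrite sub1 RintegralD//; last 2 first.
- by apply: L2on_integrableM => //; [exact: C1c_L2 hp|exact: (hd (Some i))].
- by apply: L2on_integrableM => //; [exact: (hd None)|exact: (@C1c_L2_grad _ _ _ _ _ i mO hp)].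
rewrite addrC => /eqP; rewrite addr_eq0 => /eqP ->; congr (- _).
by apply: eq_Rintegral => x _; rewrite mulrC.
Qed.

Lemma H1_wjet O u : H1 O u -> exists2 G, wjet O G & G None = u.
Proof.
move=> [h1 h2]; have [w wP] := choice h2.
by exists (jet u w) => //; split => [[i|]|i] //=; have [] := wP i.
Qed.

Lemma wjet_H1 O G : wjet O G -> H1 O (G None).
Proof. by move=> [h1 h2]; split; [exact: h1|move=> i; exists (G (Some i)); split => //; exact: h1]. Qed.

Lemma weak_partial_unique O i u w w' : open O -> L2on mu O u -> L2on mu O w -> L2on mu O w' ->
  is_weak_partial O i u w -> is_weak_partial O i u w' -> L2_ip mu O (w - w') (w - w') = 0.
Proof.
move=> oO du dw dw' h h'; have mO := open_row_measurable oO.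
apply: test_integral_zero => //; first exact: (@domB _ _ (L2_form mu mO) _ _ dw dw').
move=> phi tp; have hp := C1c_L2 mO (test_C1c tp).
rewrite -[LHS]/(fip (L2_form mu mO) (w - w') phi) ipBl//.
have := h _ tp; rewrite h' // => /oppr_inj /= E.
by rewrite /L2_ip -E subrr.
Qed.

Lemma null_nrm D (mD : measurable D) f : L2_ip mu D f f = 0 -> fnrm (L2_form mu mD) f = 0.
Proof. by move=> h; rewrite /fnrm /= h sqrtr0. Qed.

(** The gradient chosen in the norm of [H1] and the one stored in the jet differ by null functions,
    by [weak_partial_unique]. *)
Lemma wjet_snorm O (mO : measurable O) G : open O -> wjet O G ->
  snorm (H1 O) (G None) = fnrm (H1form mO) G.
Proof.
move=> oO [hd hw]; rewrite /= /fnrm /=; congr Num.sqrt.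
rewrite /H1ip.
have -> : \sum_k L2_ip mu O (G k) (G k) = L2_ip mu O (G None) (G None) + \sum_i L2_ip mu O (G (Some i)) (G (Some i)).
  rewrite (bigD1 None)//=; congr (_ + _).
  rewrite (reindex_omap Some id)/=; last by case.
  by apply: eq_bigl => i; rewrite eqxx.
rewrite -L2_ipE; congr (_ + _); apply: eq_bigr => i _.
have [dw ww] : L2 O (weak_partial O i (G None)) /\ is_weak_partial O i (G None) (weak_partial O i (G None)).
  rewrite /weak_partial; have : ([set w | L2 O w /\ is_weak_partial O i (G None) w] !=set0).
    by exists (G (Some i)); split; [exact: (hd (Some i))|exact: hw].
  by move=> [w0 hw0]; exact: (@getI _ _ w0 hw0).
rewrite -L2_ipE; set w := weak_partial O i (G None) in dw ww *.
have z := null_nrm mO (weak_partial_unique oO (hd None) dw (hd (Some i)) ww (hw i)).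
have z' := null_nrm mO (weak_partial_unique oO (hd None) (hd (Some i)) dw (hw i) ww).
have dB := domB (F := L2_form mu mO) dw (hd (Some i)).
have dB' := domB (F := L2_form mu mO) (hd (Some i)) dw.
have e1 := nrmD dB (hd (Some i)); have e2 := nrmD dB' dw.
rewrite subrK z add0r in e1; rewrite subrK z' add0r in e2.
rewrite -[LHS]/(fip (L2_form mu mO) w w) -[RHS]/(fip (L2_form mu mO) (G (Some i)) (G (Some i))).
by rewrite -!sqr_nrm; congr (_ ^+ 2); apply/eqP; rewrite eq_le e1 e2.
Qed.

Lemma wjetP O a G H : measurable O -> wjet O G -> wjet O H -> wjet O (a *: G + H).
Proof.
move=> mO [dG hG] [dH hH]; split => [|i phi tp]; first exact: H1domP.
have hp := C1c_L2 mO (test_C1c tp); have hp' := @C1c_L2_grad _ _ _ _ _ i mO (test_C1c tp).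
rewrite -[LHS]/(L2_ip mu O (a *: G None + H None) (partial i phi)).
rewrite -[X in - X]/(L2_ip mu O (a *: G (Some i) + H (Some i)) phi).
by rewrite !L2_ipP// /L2_ip hG// hH//; ring.
Qed.

Lemma null_L2_ip D (mD : measurable D) f g : L2on mu D f -> L2on mu D g -> L2_ip mu D f f = 0 ->
  L2_ip mu D f g = 0.
Proof.
move=> df dg h; have := @cauchy_schwarz _ _ (L2_form mu mD) f g df dg.
by rewrite null_nrm// mul0r normr_le0 => /eqP.
Qed.

Lemma open_rat_box O x : open O -> O x -> exists q : 'rV[rat]_n * 'rV[rat]_n,
  row_box (map_mx ratr q.1) (map_mx ratr q.2) x /\ row_box (map_mx ratr q.1) (map_mx ratr q.2) `<=` O.
Proof.
move=> oO Ox; have /nbhs_ballP[d /= d0 hd] : nbhs x O by exact: open_nbhs_nbhs.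
have hq (t s : R) : t < s -> exists q : rat, t < ratr q < s.
  by move=> ts; have [q] := rat_in_itvoo ts; rewrite in_itv /= => h; exists q.
have h1 i : exists q : rat, x ord0 i - d / 2 < ratr q < x ord0 i by apply: hq; rewrite ltrBlDr ltrDl divr_gt0.
have h2 i : exists q : rat, x ord0 i < ratr q < x ord0 i + d / 2 by apply: hq; rewrite ltrDl divr_gt0.
have [q1 q1P] := choice h1; have [q2 q2P] := choice h2.
exists (\row_i q1 i, \row_i q2 i); split => [i|y hy].
  by rewrite !mxE; have /andP[_ ->] := q1P i; have /andP[/ltW ->] := q2P i.
apply: hd; rewrite -ball_normE /ball_ /=; apply: row_norm_lt => // i; rewrite !mxE.
have /andP[a1 a2] := q1P i; have /andP[b1 b2] := q2P i; have := hy i; rewrite !mxE => /andP[c1 c2].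
by rewrite ltr_norml; apply/andP; split; lra.
Qed.

Definition off_supp O u : set pt := [set x | O x /\ ~ Supp O u x].

Lemma off_suppP O u x : open O -> off_supp O u x ->
  exists U, [/\ open U, U x, U `<=` off_supp O u & {ae mu, forall y, U y -> u y = 0}].
Proof.
move=> oO [Ox nS]; have [U [oU Ux hU]] : exists U, [/\ open U, U x & {ae mu, forall y, (U `&` O) y -> u y = 0}].
  apply: contrapT => h; apply: nS; split => // U oU Ux hU; apply: h.
  by exists U.
exists (U `&` O); split => //; first exact: openI.
move=> y [Uy Oy]; split => // -[_ /(_ U oU Uy)]; exact.
Qed.

Lemma open_off_supp O u : open O -> open (off_supp O u).
Proof.
move=> oO; rewrite openE => x hx; have [U [oU Ux UO _]] := off_suppP oO hx.
by apply: (filterS UO); exact: open_nbhs_nbhs.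
Qed.

(** Off its support the function is locally zero almost everywhere; countably many rational boxes
    make this one null set. The weak derivatives are then orthogonal to all test functions of this
    open set. *)
Lemma off_supp_null O G : open O -> wjet O G ->
  forall k, L2_ip mu (off_supp O (G None)) (G k) (G k) = 0.
Proof.
move=> oO hG; set W := off_supp O (G None); have oW : open W by exact: open_off_supp.
have mO := open_row_measurable oO; have mW := open_row_measurable oW.
have WO : W `<=` O by move=> x [].
have [hd hw] := wjet_sub mW mO WO hG.
have N0 : L2_ip mu W (G None) (G None) = 0.
  suff : (\int[mu]_(x in W) (G None x ^+ 2)%:E = 0)%E by rewrite EFin_L2_ip// => -[].
  pose bx (q : 'rV[rat]_n * 'rV[rat]_n) : set pt := row_box (map_mx ratr q.1) (map_mx ratr q.2).
  pose good q := {ae mu, forall y, bx q y -> G None y = 0}.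
  pose A (k : nat) : set pt := [set y | if unpickle k is Some q then good q /\ bx q y /\ G None y <> 0 else False].
  have nA : mu.-negligible (\bigcup_k A k).
    apply: negligible_bigcup => k; rewrite /A; case: (unpickle k) => [q|]; last first.
      exact: negligible_set0.
    have [gq|ngq] := pselect (good q); last first.
      apply: negligibleS (negligible_set0 mu) => y /= [/ngq].
      by [].
    apply: negligibleS gq => y /= [_ [by1 by2]] h; apply: by2; exact: h.
  have ae0 : {ae mu, forall y, W y -> (G None y ^+ 2)%:E = 0%E}.
    apply: negligibleS nA => y /= /not_implyP[Wy hy].
    have [U [oU Uy UW aeU]] := off_suppP oO Wy.
    have [q [q1 q2]] := open_rat_box oU Uy.
    exists (pickle q) => //; rewrite /A /= pickleK; split.
      by apply: filterS aeU => z hz bz; apply: hz; exact: q2.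
    by split => // h0; apply: hy; rewrite h0 expr0n.
  rewrite (ae_eq_integral (cst 0%E))//.
  - by rewrite integral0.
  - by apply/measurable_EFinP; apply: measurable_funX; have [] := hd None.
case=> [i|//]; apply: (test_integral_zero oW (hd (Some i))).
move=> phi tp; have := hw i _ tp => /eqP; rewrite -[X in X == _]opprK eqr_opp => /eqP <-.
rewrite -[X in - X]/(L2_ip mu W (G None) (partial i phi)) (null_L2_ip mW)// ?oppr0//.
exact: (@C1c_L2_grad _ _ _ _ _ i mW (test_C1c tp)).
Qed.

End jets.

(** * Cutoff functions *)

Section cutoffs.
Context {R : realType} (n : nat).
Local Notation pt := 'rV[R]_n.
Implicit Types (x y z v : pt) (f g psi : pt -> R) (gf gg gpsi : 'I_n -> pt -> R) (O U : set pt).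

Lemma is_grad_locally_cst f gf x d : is_grad f gf -> 0 < d ->
  (forall y, `|y - x| < d -> f y = f x) -> forall i, gf i x = 0.
Proof.
move=> [_ _ df] d0 h i; have /is_deriveP hd := df i x.
apply: (@cvg_unique _ (@Rhausdorff R) _ _ _ _ hd); apply: cvg_near_cst.
have : \forall t \near (0:R)^', `|t| < d.
  apply: nbhs_dnbhs; apply/nbhs_ballP; exists d => // t.
  by rewrite -ball_normE /ball_ /= sub0r normrN.
apply: filterS => t td; rewrite h ?subrr ?mulr0//.
by rewrite addrAC subrr add0r; exact: le_lt_trans (norm_row_e _ _) td.
Qed.

Definition C1b psi gpsi := is_grad psi gpsi /\
  exists C, forall x, `|psi x| <= C /\ forall i, `|gpsi i x| <= C.

Lemma C1bM f gf g gg : C1b f gf -> C1b g gg ->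
  C1b (fun x => f x * g x) (fun i x => f x * gg i x + g x * gf i x).
Proof.
move=> [hf [C hC]] [hg [C' hC']]; split; first exact: is_gradM.
exists (2 * (C * C')) => x; have [f1 f2] := hC x; have [g1 g2] := hC' x.
have C0 : 0 <= C := le_trans (normr_ge0 _) f1; have C0' : 0 <= C' := le_trans (normr_ge0 _) g1.
have CC := mulr_ge0 C0 C0'.
have m1 : `|f x * g x| <= C * C' by rewrite normrM ler_pM.
split => [|i]; first by lra.
apply: le_trans (ler_normD _ _) _; rewrite !normrM.
have m2 := ler_pM (normr_ge0 _) (normr_ge0 _) f1 (g2 i).
have m3 := ler_pM (normr_ge0 _) (normr_ge0 _) g1 (f2 i).
by lra.
Qed.

Lemma C1b_compl f gf : C1b f gf -> C1b (fun x => 1 - f x) (fun i x => - gf i x).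
Proof.
move=> [hf [C hC]]; split.
  have := is_gradB (@is_grad_cst R n 1) hf; congr is_grad.
  by apply/funext => i; apply/funext => x; rewrite sub0r.
exists (1 + C) => x; have [f1 f2] := hC x; split => [|i].
  by apply: le_trans (ler_normB _ _) _; rewrite normr1 lerD2l.
by rewrite normrN; have := f2 i; lra.
Qed.

Lemma C1b_cst (c : R) : C1b (fun=> c) (fun _ _ => 0).
Proof. by split; [exact: is_grad_cst|exists `|c| => x; rewrite normr0; split]. Qed.

Lemma C1c_C1b f gf : C1c f gf -> C1b f gf.
Proof.
move=> [hf [M sM]]; split => //; have [cf cgf _] := hf.
have [C C0 hC] := bsupp_bounded cf sM.
have h i : exists C, 0 <= C /\ forall x, `|gf i x| <= C.
  by have [C' ? ?] := bsupp_bounded (cgf i) (is_grad_bsupp i hf sM); exists C'.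
have [K hK] := choice h; exists (C + \sum_i K i) => x; split => [|i].
  apply: le_trans (hC x) _; rewrite lerDl; apply: sumr_ge0 => i _; exact: (hK i).1.
apply: le_trans ((hK i).2 x) _; rewrite (bigD1 i)//= addrCA lerDl addr_ge0//.
by apply: sumr_ge0 => j _; exact: (hK j).1.
Qed.

(** With u = (x_i - c_i) / l, the argument 2 u^2 - 1 is negative for |u| <= 1/2 and at least 1 for
    |u| >= 1; the square makes each factor even and differentiable at the centre. *)
Definition cutoff (c : pt) (l : R) x : R :=
  \prod_(i < n) plateau (2 * ((x ord0 i - c ord0 i) / l) ^+ 2 - 1).
Definition gcutoff c l (i : 'I_n) x := partial i (cutoff c l) x.

Lemma cutoff_is_grad c l : is_grad (cutoff c l) (gcutoff c l).
Proof.
suff [gf hf] : exists gf, is_grad (cutoff c l) gf.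
  by rewrite (_ : gcutoff c l = gf)//; apply/funext => i; rewrite -(is_grad_partial i hf).
rewrite /cutoff; elim: (index_enum _) => [|i r [gf hf]].
  by exists (fun _ _ => 0); under eq_fun do rewrite big_nil; exact: is_grad_cst.
pose q (t : R) := 2 * ((t - c ord0 i) / l) ^+ 2 - 1.
pose q' (t : R) := 4 * ((t - c ord0 i) / l) / l.
have dq (t : R) : is_derive t 1 q (q' t).
  apply/is_deriveP; apply/cvgrPdist_le => e e0; near=> h.
  have h0 : h != 0 by near: h; exact: nbhs_dnbhs_neq.
  have -> : q' t - h^-1 * (q (t + h *: 1) - q t) = - (2 * h / l ^+ 2).
    rewrite /q' /q (_ : t + h *: 1 = t + h); last by rewrite /GRing.scale /= mulr1.
    by rewrite -exprVn; move: (l^-1) => il; field.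
  have hc : `|h| <= e / (2 / l ^+ 2 + 1).
    near: h; apply: dnbhs0_le; rewrite divr_gt0//.
    by rewrite ltr_wpDl// divr_ge0// sqr_ge0.
  have p0 : 0 <= 2 / l ^+ 2 by rewrite divr_ge0// sqr_ge0.
  rewrite normrN mulrAC normrM (ger0_norm p0).
  have := ler_wpM2l p0 hc => /le_trans; apply; rewrite mulrC; apply: frac_le => //; exact: ltW.
have cq : continuous q.
  by move=> t; apply: differentiable_continuous; apply/derivable1_diffP; have [] := dq t.
have cq' : continuous q'.
  move=> t; exact: (cvgM (cvgM (cvg_cst (4:R)) (cvgM (cvgB cvg_id (cvg_cst (c ord0 i))) (cvg_cst l^-1))) (cvg_cst l^-1)).
have h1 : is_grad (fun x : pt => plateau (q (x ord0 i)))
    (fun j x => if j == i then plateau' (q (x ord0 i)) * q' (x ord0 i) else 0).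
  apply: (@is_grad_coord R n (fun t => plateau (q t)) (fun t => plateau' (q t) * q' t)).
  - by move=> t; apply: (@continuous_comp _ _ _ q plateau); [exact: cq|exact: continuous_plateau].
  - have c1 : continuous (fun t => plateau' (q t)).
      by move=> t; apply: (@continuous_comp _ _ _ q plateau'); [exact: cq|exact: continuous_plateau'].
    by move=> t; exact: (cvgM (c1 t) (cq' t)).
  - by move=> t; exact: (@is_derive1_comp R plateau q t _ _ (is_derive_plateau _) (dq t)).
eexists; under eq_fun do rewrite big_cons.
exact: is_gradM h1 hf.
Unshelve. all: by end_near. Qed.

Lemma cutoff_bounds c l x : 0 <= cutoff c l x <= 1.
Proof.
apply/andP; split; first by apply: prodr_ge0 => i _; exact: plateau_ge0.
apply: (@le_trans _ _ (\prod_(i < n) (1 : R))); last by rewrite big1.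
by apply: ler_prod => i _; rewrite plateau_ge0 plateau_le1.
Qed.

Lemma cutoff1 c l x : 0 < l -> `|x - c| <= l / 2 -> cutoff c l x = 1.
Proof.
move=> l0 h; rewrite /cutoff big1// => i _; apply: plateau1.
have : `|(x ord0 i - c ord0 i) / l| <= 2^-1.
  rewrite normrM normfV (ger0_norm (ltW l0)) ler_pdivrMr// mulrC.
  by have := row_coord_le (x - c) i; rewrite !mxE => /le_trans; apply.
by rewrite ler_norml => /andP[h1 h2]; nra.
Qed.

Lemma cutoff0 c l x : 0 < l -> l <= `|x - c| -> cutoff c l x = 0.
Proof.
move=> l0 h; have [i hi] : exists i, l <= `|x ord0 i - c ord0 i|.
  apply/not_existsP => hx; move: h; apply/negP; rewrite -ltNge.
  by apply: row_norm_lt => // i; rewrite !mxE ltNge; apply/negP/hx.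
rewrite /cutoff (bigD1 i)//= plateau0 ?mul0r//.
have : 1 <= `|(x ord0 i - c ord0 i) / l|.
  by rewrite normrM normfV (ger0_norm (ltW l0)) ler_pdivlMr// mul1r.
rewrite -(@ler_pXn2r _ 2)// ?nnegrE// expr1n real_normK ?num_real//; lra.
Qed.

Lemma gcutoff1 c l x i : 0 < l -> `|x - c| < l / 2 -> gcutoff c l i x = 0.
Proof.
move=> l0 h; apply: (is_grad_locally_cst (cutoff_is_grad c l) (d := l / 2 - `|x - c|)); first by lra.
move=> y hy; rewrite !cutoff1// ?ltW//.
by have := ler_normD (y - x) (x - c); rewrite subrKA; lra.
Qed.

Lemma gcutoff0 c l x i : 0 < l -> l < `|x - c| -> gcutoff c l i x = 0.
Proof.
move=> l0 h; apply: (is_grad_locally_cst (cutoff_is_grad c l) (d := `|x - c| - l)); first by lra.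
move=> y hy; rewrite !cutoff0// ?ltW//.
by have := ler_normD (x - y) (y - c); rewrite subrKA (distrC x y); lra.
Qed.

Lemma cutoff_C1c c l : 0 < l -> C1c (cutoff c l) (gcutoff c l).
Proof.
move=> l0; split; first exact: cutoff_is_grad.
exists (l + `|c|) => x hx; apply: cutoff0 => //.
by have := ler_normD (x - c) c; rewrite subrK; lra.
Qed.

End cutoffs.

(** * Boundary charts *)

Section charts.
Context {R : realType} (n : nat).
Local Notation pt := 'rV[R]_n.
Implicit Types (x y z v : pt) (Om : set pt).

Record chart := Chart { cpt : pt; crad : R; cdir : 'I_n; csgn : bool; cgraph : pt -> R }.

(** The description by a graph holds up to radius 4 [crad], while functions are localised to radii
    [crad] and 2 [crad]: the margin allows shifts and comparisons near the edge. *)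
Definition good_chart Om (c : chart) :=
  [/\ 0 < crad c, smooth (cgraph c), indep (cdir c) (cgraph c) &
      forall x, `|x - cpt c| < 4 * crad c -> (Om x <-> cgraph c x < flip (csgn c) * x ord0 (cdir c))].

Lemma enorm_le (x : pt) : enorm x <= n%:R * `|x|.
Proof.
rewrite /enorm -(ger0_norm (mulr_ge0 (ler0n R n) (normr_ge0 x))) -sqrtr_sqr.
rewrite ler_wsqrtr// exprMn.
apply: (@le_trans _ _ (\sum_(i < n) `|x| ^+ 2)).
  by apply: ler_sum => i _; rewrite -(real_normK (num_real (x ord0 i))) ler_pXn2r ?nnegrE// row_coord_le.
rewrite sumr_const card_ord -(mulr_natl (`|x| ^+ 2)) ler_wpM2r ?sqr_ge0// -natrX ler_nat.
by case: n => // m; rewrite expnS leq_pmulr// expn1.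
Qed.

Lemma le_enorm (x : pt) : `|x| <= enorm x.
Proof.
apply: row_norm_le; first exact: sqrtr_ge0.
move=> i; rewrite -sqrtr_sqr /enorm ler_wsqrtr// (bigD1 i)//= lerDl.
by apply: sumr_ge0 => j _; exact: sqr_ge0.
Qed.

Lemma flip_norm s (t : R) : `|flip s * t| = `|t|.
Proof. by rewrite /flip normrM normrX normrN1 expr1n mul1r. Qed.

Lemma boundaryE Om x : open Om -> boundary Om x <-> closure Om x /\ ~ Om x.
Proof. by move=> oO; rewrite /boundary (interior_id Om).1. Qed.

Lemma compact_boundary Om : open Om -> bounded_set Om -> compact (closure Om) /\ compact (boundary Om).
Proof.
move=> oO bO; have cO : compact (closure Om).
  apply: bounded_closed_compact; last exact: closed_closure.
  have [M [Mr hM]] := bO; exists M; split => // N MN x hx.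
  have cl : closed [set x : pt | `|x| <= N].
    by apply: compact_closed; [exact: norm_hausdorff|exact: compact_row_ball].
  move/closure_id : (cl) => cl'; have : Om `<=` [set x : pt | `|x| <= N] by move=> y; exact: hM.
  by move/closureS; rewrite -cl' => /(_ x hx).
split => //; apply: (subclosed_compact _ cO); last by move=> x [].
apply: closedI; first exact: closed_closure.
by rewrite -openC setCK; exact: open_interior.
Qed.

Lemma good_charts Om (rr : R) : open Om -> bounded_set Om -> smooth_boundary Om -> 0 < rr ->
  exists cs : seq chart, [/\ forall c, List.In c cs -> good_chart Om c /\ 2 * n.+1%:R * crad c < rr &
    forall x, boundary Om x -> exists2 c, List.In c cs & `|x - cpt c| < crad c / 2].
Proof.
move=> oO bO sO rr0; have [_ cB] := compact_boundary oO bO.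
have hc (p : {x | boundary Om x}) : exists c : chart, [/\ cpt c = sval p, good_chart Om c & 2 * n.+1%:R * crad c < rr].
  case: p => x0 bx0 /=; have [r0 [i [s [ze [r00 sz iz hz]]]]] := sO _ bx0.
  (* The factor n + 1 passes from the sup norm to the Euclidean one. The ball of radius 4 l then
     lies in the Euclidean ball of radius r0, and the diameter of the chart stays below rr. *)
  pose l := Num.min r0 rr / (4 * n.+1%:R).
  have n1 : 1 <= n.+1%:R :> R by rewrite ler1n.
  have m0 : 0 < Num.min r0 rr by rewrite lt_min r00.
  have l0 : 0 < l by rewrite divr_gt0// mulr_gt0.
  have hl : 4 * n.+1%:R * l = Num.min r0 rr.
    by rewrite /l mulrC divfK// gt_eqF// mulr_gt0.
  have ml : Num.min r0 rr <= r0 by rewrite ge_min lexx.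
  have mr : Num.min r0 rr <= rr by rewrite ge_min lexx orbT.
  have nl : 0 < n.+1%:R * l by rewrite mulr_gt0.
  exists (Chart x0 l i s ze); split => //=; last by lra.
  split => //= x hx; apply: hz; rewrite /eball /=.
  apply: le_lt_trans (enorm_le _) _.
  apply: (@le_lt_trans _ _ (n.+1%:R * `|x - x0|)); first by rewrite ler_wpM2r// ler_nat.
  apply: (@lt_le_trans _ _ (n.+1%:R * (4 * l))); first by rewrite ltr_pM2l.
  by lra.
have [f fP] := choice hc.
move: cB; rewrite compact_cover => /(_ _ [set: {classic {x | boundary Om x}}] (fun p => ball (sval p) (crad (f p) / 2))).
case.
- by move=> p _; apply: ball_open; have [_ [h _ _ _] _] := fP p; rewrite divr_gt0.
- move=> x bx; exists (exist _ x bx) => //=; apply: ballxx.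
  by have [_ [h _ _ _] _] := fP (exist _ x bx); rewrite divr_gt0.
move=> D _ hD; exists [seq f p | p <- finmap.enum_fset D]; split.
  move=> c; elim: (finmap.enum_fset D) => //= p s ih [<-|/ih//].
  by have [_ h1 h2] := fP p.
move=> x bx; have [p /= pD] := hD x bx; rewrite -ball_normE /ball_ /= distrC => hx.
exists (f p); last by have [-> _ _] := fP p.
have : p \in finmap.enum_fset D by [].
by elim: (finmap.enum_fset D) => //= q s ih; rewrite inE => /orP[/eqP ->|/ih]; [left|right].
Qed.

(** Compactness of the closure: a cluster point of counterexamples with d = 1 / (k + 1) would lie in
    the open set [Om], or on the boundary, which the half-size charts cover. *)
Lemma interior_gap Om (cs : seq chart) : open Om -> bounded_set Om ->
  (forall x, boundary Om x -> exists2 c, List.In c cs & `|x - cpt c| < crad c / 2) ->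
  exists2 d, 0 < d & forall x, Om x -> (forall y, `|y - x| < d -> Om y) \/
    exists2 c, List.In c cs & `|x - cpt c| < crad c / 2.
Proof.
move=> oO bO hcs; have [cO _] := compact_boundary oO bO.
apply: contrapT => /forall2NP h.
have {}h k : exists x : pt, Om x /\ (exists2 y, `|y - x| < k.+1%:R^-1 & ~ Om y) /\
    ~ (exists2 c, List.In c cs & `|x - cpt c| < crad c / 2).
  have [|/existsNP[x /not_implyP[Ox /not_orP[hx hn]]]] := h k.+1%:R^-1; first by rewrite invr_gt0.
  exists x; split => //; split => //.
  by have /existsNP[y /not_implyP[h1 h2]] := hx; exists y.
have [u uP] := choice h.
have [|p [pM pc]] := cO (u @ \oo) _.
  by exists 0%N => // k _ /=; apply: subset_closure; have [] := uP k.
have near_p d : 0 < d -> forall N, exists k, (N <= k)%N /\ `|p - u k| < d.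
  move=> d0 N; have [] := pc [set u k | k in [set k | (N <= k)%N]] (ball p d) _ _.
  - by exists N => // k /= Nk; exists k.
  - exact: nbhsx_ballx.
  by move=> _ [[k /= Nk <-]]; rewrite -ball_normE /ball_ /= => hk; exists k.
have [Op|nOp] := pselect (Om p).
  have /nbhs_ballP[d /= d0 hd] : nbhs p Om by exact: open_nbhs_nbhs.
  have d2 : 0 < d / 2 by rewrite divr_gt0.
  have [N hN] := exp2_small d2.
  have [k [Nk hk]] := near_p _ d2 (2 ^ N)%N.
  have [_ [[y hy nOy] _]] := uP k; apply: nOy; apply: hd; rewrite -ball_normE /ball_ /=.
  have k1 : k.+1%:R^-1 < d / 2 :> R.
    apply: le_lt_trans hN; rewrite lef_pV2 ?posrE ?exprn_gt0// -natrX ler_nat.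
    exact: leq_trans (leqnSn _).
  rewrite -(subrKA (u k)); apply: le_lt_trans (ler_normD _ _) _.
  by rewrite (splitr d) ltrD// distrC (lt_trans hy).
have [c cin hc] : exists2 c, List.In c cs & `|p - cpt c| < crad c / 2 by apply: hcs; apply/boundaryE.
have d0 : 0 < crad c / 2 - `|p - cpt c| by lra.
have [k [_ hk]] := near_p _ d0 0%N; have [_ [_ []]] := uP k; exists c => //.
by have := ler_normD (u k - p) (p - cpt c); rewrite subrKA (distrC (u k) p); lra.
Qed.

Lemma chart_shift Om c : good_chart Om c -> forall d, 0 < d -> exists v (e : R),
  [/\ `|v| < d, 0 < e, e < d & forall x, Om x -> `|x - cpt c| <= crad c ->
    forall y, `|y - (x + v)| <= e -> Om y].
Proof.
move=> [l0 sz iz hz] d d0; set l := crad c in l0 hz *.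
pose tau := Num.min d l / 2.
have m0 : 0 < Num.min d l by rewrite lt_min d0.
have t0 : 0 < tau by rewrite divr_gt0.
have td : tau < d by apply: (@lt_le_trans _ _ (Num.min d l)); [rewrite /tau; lra|rewrite ge_min lexx].
have tl : tau <= l / 2 by rewrite /tau ler_pM2r// ge_min lexx orbT.
(* The graph function cut off far away: unchanged near the chart and uniformly continuous, so that a
   move of size d1 changes it by less than half of the inward shift [tau]. *)
pose zc x := cgraph c x * cutoff (cpt c) (8 * l) x.
have l8 : 0 < 8 * l by rewrite mulr_gt0.
have [czc _ _] := is_gradM (smooth_is_grad sz) (cutoff_is_grad (cpt c) (8 * l)).
have [_ [M sM]] := @cutoff_C1c R n (cpt c) (8 * l) l8.
have bz : bsupp M zc by move=> x hx; rewrite /zc sM ?mulr0.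
have t2 : 0 < tau / 2 by rewrite divr_gt0.
have [d1 d10 hd1] := unif_continuous_bsupp czc bz t2.
have zcE x : `|x - cpt c| < 3 * l -> zc x = cgraph c x.
  by move=> hx; rewrite /zc cutoff1 ?mulr1//; lra.
pose v : pt := (flip (csgn c) * tau) *: 'e_(cdir c).
have vn : `|v| <= tau by apply: le_trans (norm_row_e _ _) _; rewrite flip_norm ger0_norm// ltW.
pose e := Num.min (d1 / 2) (tau / 2).
have e0 : 0 < e by rewrite lt_min divr_gt0.
have e1 : e <= d1 / 2 by rewrite ge_min lexx.
have e2 : e <= tau / 2 by rewrite ge_min lexx orbT.
exists v, e; split => //; [exact: le_lt_trans vn td|by lra|].
move=> x Ox xl y hy.
have yc : `|y - cpt c| < 2 * l.
  have h1 := ler_normD (y - (x + v)) (x + v - cpt c); rewrite subrKA in h1.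
  have h2 := ler_normD (x - cpt c) v; rewrite addrAC in h2.
  by lra.
have xvc : `|x + v - cpt c| < 3 * l.
  by have h2 := ler_normD (x - cpt c) v; rewrite addrAC in h2; lra.
have xc : `|x - cpt c| < 2 * l by lra.
have yc4 : `|y - cpt c| < 4 * l by lra.
have xc4 : `|x - cpt c| < 4 * l by lra.
apply/(hz y yc4); have zx := (hz x xc4).1 Ox.
have : `|zc y - zc (x + v)| < tau / 2 by apply: hd1; lra.
rewrite !zcE//; last by lra.
have -> : cgraph c (x + v) = cgraph c x by exact: iz.
rewrite ltr_norml => /andP[h3 h4].
have := row_coord_le (y - (x + v)) (cdir c) => /le_trans /(_ hy).
have -> : (y - (x + v)) ord0 (cdir c) = y ord0 (cdir c) - (x ord0 (cdir c) + flip (csgn c) * tau).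
  by rewrite [LHS]mxE; congr (_ + _); rewrite [LHS]mxE [X in - X]mxE row_eE eqxx.
rewrite -(flip_norm (csgn c)) ler_norml => /andP[h5 _].
have e5 : flip (csgn c) * (y ord0 (cdir c) - (x ord0 (cdir c) + flip (csgn c) * tau)) =
   flip (csgn c) * y ord0 (cdir c) - flip (csgn c) * x ord0 (cdir c) - tau.
  by rewrite mulrBr mulrDr flipK; ring.
by rewrite e5 in h5; lra.
Qed.

End charts.

(** * Density of C^1 functions up to the boundary *)

Section density.
Context {R : realType} (n : nat).
Local Notation pt := 'rV[R]_n.
Local Notation mu := (lebesgue_row n : {measure set pt -> \bar R}).
Local Notation F := (L2_form mu (@measurableT _ pt)).
Local Notation chart := (@chart R n).
Local Notation jets := (@jets R n).
Implicit Types (x y z v : pt) (f g u psi : pt -> R) (gf gg gu gpsi : 'I_n -> pt -> R) (O D U : set pt).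
Implicit Types (G H : jets).

Definition mulj psi gpsi G : jets :=
  fun k => if k is Some i then (fun x => psi x * G (Some i) x + gpsi i x * G None x)
           else (fun x => psi x * G None x).

Lemma mulj_jet psi gpsi u gu :
  mulj psi gpsi (jet u gu) = jet (fun x => psi x * u x) (fun i x => psi x * gu i x + u x * gpsi i x).
Proof. by apply/funext => -[i|] //=; apply/funext => x; rewrite (mulrC (u x)). Qed.

Lemma jets_subE G H k x : (G - H) k x = G k x - H k x. Proof. by []. Qed.

Lemma mulj_sub psi gpsi G H : mulj psi gpsi (G - H) = mulj psi gpsi G - mulj psi gpsi H.
Proof. by apply/funext => -[i|]; apply/funext => x; rewrite jets_subE /mulj !jets_subE; ring. Qed.

Section nrm.
Variables (D : set pt) (mD : measurable D).
Local Notation FD := (H1form mD).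

Lemma H1_nrm_eq G H : (forall x, D x -> forall k, G k x = H k x) -> fnrm FD G = fnrm FD H.
Proof.
move=> h; rewrite /fnrm; congr Num.sqrt; apply: eq_bigr => k _.
by apply: eq_Rintegral => x /set_mem Dx; rewrite h.
Qed.

Lemma H1dom_eq G H : (forall x, D x -> forall k, G k x = H k x) -> H1dom D G -> H1dom D H.
Proof.
move=> h hG k; have [mG G2] := hG k; split.
  by apply: eq_measurable_fun mG => x /set_mem Dx; rewrite h.
by rewrite (eq_integral (fun x => (G k x ^+ 2)%:E))// => x /set_mem Dx; rewrite h.
Qed.

Lemma mulj_bound psi gpsi : C1b psi gpsi -> exists2 K, 0 <= K & forall G, H1dom D G ->
  H1dom D (mulj psi gpsi G) /\ fnrm FD (mulj psi gpsi G) <= K * fnrm FD G.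
Proof.
move=> [[cp cg _] [C hC]]; have C0 : 0 <= C by apply: le_trans (hC 0).1.
exists (n.+1%:R * (2 * C)); first by rewrite !mulr_ge0.
move=> G hG.
have m1 : measurable_fun D psi by exact: continuous_row_measurable.
have m2 i : measurable_fun D (gpsi i) by exact: continuous_row_measurable.
have p k : L2on mu D (fun x => psi x * G k x) /\ fnrm (L2_form mu mD) (fun x => psi x * G k x) <= C * fnrm (L2_form mu mD) (G k).
  by apply: L2on_mulb => // x _; exact: (hC x).1.
have q i k : L2on mu D (fun x => gpsi i x * G k x) /\ fnrm (L2_form mu mD) (fun x => gpsi i x * G k x) <= C * fnrm (L2_form mu mD) (G k).
  by apply: L2on_mulb => // x _; exact: (hC x).2.
have d : H1dom D (mulj psi gpsi G).
  by case=> [i|] /=; [exact: (@domD _ _ (L2_form mu mD) _ _ (p _).1 (q _ _).1)|exact: (p _).1].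
split => //; rewrite -mulrA; apply: H1_nrm_bound.
have c0 k : C * fnrm (L2_form mu mD) (G k) <= C * fnrm FD G by rewrite ler_wpM2l// H1_comp_le.
case=> [i|] /=.
  have h := @nrmD _ _ (L2_form mu mD) (fun x => psi x * G (Some i) x) (fun x => gpsi i x * G None x) (p _).1 (q _ _).1.
  apply: le_trans h _.
  have := le_trans (p (Some i)).2 (c0 _); have := le_trans (q i None).2 (c0 _); lra.
apply: le_trans (p None).2 _; apply: le_trans (c0 _) _.
by have := mulr_ge0 C0 (nrm_ge0 FD G); lra.
Qed.
End nrm.

Lemma shift_split f g v :
  (fun x => f (x + v)) - g = (fun x => (f - g) (x + v)) + ((fun x => g (x + v)) - g).
Proof. by apply/funext => x; apply/esym/subrKA. Qed.

Variable Om : set pt.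
Hypothesis oO : open Om.
Let mO : measurable Om := open_row_measurable oO.
Local Notation FO := (H1form (open_row_measurable oO)).

Definition approximable H := forall e, 0 < e -> exists u gu,
  [/\ is_grad u gu, H1dom Om (jet u gu) & fnrm FO (jet u gu - H) <= e].

Lemma approximableD G H : H1dom Om G -> H1dom Om H -> approximable G -> approximable H ->
  approximable (G + H).
Proof.
move=> dG dH hG hH e e0; have e2 : 0 < e / 2 by rewrite divr_gt0.
have [u [gu [hu du nu]]] := hG _ e2; have [w [gw [hw dw nw]]] := hH _ e2.
exists (fun x => u x + w x), (fun i x => gu i x + gw i x).
have E : jet (fun x => u x + w x) (fun i x => gu i x + gw i x) = jet u gu + jet w gw.
  by apply/funext => -[i|].
split; [exact: is_gradD|by rewrite E; exact: (@domD _ _ FO)|].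
have -> : jet (fun x => u x + w x) (fun i x => gu i x + gw i x) - (G + H) = (jet u gu - G) + (jet w gw - H).
  by rewrite E opprD addrACA.
apply: le_trans (nrmD (F := FO) _ _) _; [exact: (@domB _ _ FO)|exact: (@domB _ _ FO)|].
by rewrite (splitr e) lerD.
Qed.

Lemma approximable_eq G H : (forall x, Om x -> forall k, G k x = H k x) -> approximable G -> approximable H.
Proof.
move=> h hG e e0; have [u [gu [hu du nu]]] := hG e e0; exists u, gu; split => //.
apply: le_trans nu; rewrite le_eqVlt; apply/orP; left; apply/eqP; apply: H1_nrm_eq => x Ox k.
by rewrite !fctE h.
Qed.

(* shifting into [Om] before mollifying keeps the weak derivatives of the
   extension by zero, which is not weakly differentiable across the boundary, out of sight *)
Lemma approximable_piece G psi gpsi U : wjet Om G -> C1b psi gpsi ->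
  (forall x, ~ U x -> psi x = 0 /\ forall i, gpsi i x = 0) ->
  (forall d, 0 < d -> exists v (e : R), [/\ `|v| < d, 0 < e, e < d &
     forall x, Om x -> U x -> forall y, `|y - (x + v)| <= e -> Om y]) ->
  approximable (mulj psi gpsi G).
Proof.
move=> [dG hG] hpsi pU shft e e0.
have [K K0 hK] := mulj_bound (open_row_measurable oO) hpsi.
pose e1 := e / (K * n.+1%:R * 2 + 1).
have K1 : 0 < K * n.+1%:R * 2 + 1 by rewrite ltr_wpDl// !mulr_ge0.
have e10 : 0 < e1 by rewrite divr_gt0.
pose f k := G k \_ Om.
have df k : fdom F (f k) by apply: L2on_ext.
have [d1 d1P] : exists d1, 0 < d1 /\ forall k v, `|v| < d1 -> fnrm F ((fun x => f k (x + v)) - f k) <= e1.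
  have h k : exists d, 0 < d /\ forall v, `|v| < d -> fnrm F ((fun x => f k (x + v)) - f k) <= e1.
    by have [d d0 hd] := shift_continuous_L2 (df k) e10; exists d.
  have [dd hdd] := choice h; exists (\big[Num.min/1]_k dd k); split.
    by apply: lt_bigmin => // k _; exact: (hdd k).1.
  by move=> k v hv; apply: (hdd k).2; apply: lt_le_trans hv _; exact: bigmin_le_cond.
have [d2 d2P] : exists d2, 0 < d2 /\ forall k t, 0 < t -> t < d2 -> fdom F (moll t (f k)) /\ fnrm F (moll t (f k) - f k) <= e1.
  have h k : exists d, 0 < d /\ forall t, 0 < t -> t < d -> fdom F (moll t (f k)) /\ fnrm F (moll t (f k) - f k) <= e1.
    by have [d d0 hd] := moll_approx (df k) e10; exists d.
  have [dd hdd] := choice h; exists (\big[Num.min/1]_k dd k); split.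
    by apply: lt_bigmin => // k _; exact: (hdd k).1.
  move=> k t t0 ht; apply: (hdd k).2 => //; apply: lt_le_trans ht _; exact: bigmin_le_cond.
have [d10 hd1] := d1P; have [d20 hd2] := d2P.
have d0 : 0 < Num.min d1 d2 by rewrite lt_min d10.
have [v [t [vd t0 td hsh]]] := shft _ d0.
have vd1 : `|v| < d1 by apply: lt_le_trans vd _; rewrite ge_min lexx.
have td2 : t < d2 by apply: lt_le_trans td _; rewrite ge_min lexx orbT.
pose w x := moll t (f None) (x + v).
pose gw (i : 'I_n) x := - corr (grho t i) (f None) (x + v).
have hw : is_grad w gw by exact: (is_grad_translation v (@moll_is_grad R n t (f None) t0 (df None))).
pose A : jets := fun k x => moll t (f k) (x + v).
have dA k : fdom F (A k) by apply: shift_dom; exact: (hd2 k t t0 td2).1.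
have nA k : fnrm F (A k - f k) <= 2 * e1.
  have -> : A k - f k = (fun x => (moll t (f k) - f k) (x + v)) + ((fun x => f k (x + v)) - f k).
    by exact: shift_split.
  have [dm nm] := hd2 k t t0 td2; have dB := domB dm (df k).
  apply: le_trans (nrmD (shift_dom v dB) _) _; first by apply: domB => //; exact: shift_dom.
  by rewrite shift_nrm//; have := hd1 k v vd1; lra.
have dAO : H1dom Om A by move=> k; apply: L2on_sub (dA k) => //.
have nAO : fnrm FO (A - G) <= n.+1%:R * (2 * e1).
  apply: H1_nrm_bound => k; apply: le_trans (nA k).
  rewrite /fnrm ler_wsqrtr//= (_ : L2_ip mu Om _ _ = L2_ip mu Om (A k - f k) (A k - f k)).
    by apply: L2_ip_sub => //; exact: (@domB _ _ F).
  by apply: eq_Rintegral => x xO; rewrite !fctE /f patchE xO.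
exists (fun x => psi x * w x), (fun i x => psi x * gw i x + w x * gpsi i x).
have E x : Om x -> forall k, (mulj psi gpsi A) k x = jet (fun x => psi x * w x) (fun i x => psi x * gw i x + w x * gpsi i x) k x.
  move=> Ox [i|] //=; rewrite (mulrC (w x)); have [Ux|nUx] := pselect (U x); last first.
    by have [-> hg] := pU x nUx; rewrite !mul0r.
  congr (_ * _ + _).
  exact: (esym (moll_weak_partial (open_row_measurable oO) (dG None) (dG (Some i)) (hG i) t0 (hsh x Ox Ux))).
have [dmA _] := hK A dAO; have [dmG _] := hK G dG.
split.
- by apply: is_gradM => //; have [] := hpsi.
- exact: H1dom_eq E dmA.
have -> : fnrm FO (jet (fun x => psi x * w x) (fun i x => psi x * gw i x + w x * gpsi i x) - mulj psi gpsi G) =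
    fnrm FO (mulj psi gpsi (A - G)).
  by apply: H1_nrm_eq => x Ox k; rewrite mulj_sub !fctE E.
have [_ h] := hK _ (domB (F := FO) dAO dG); apply: le_trans h _.
apply: le_trans (ler_wpM2l K0 nAO) _.
have -> : K * (n.+1%:R * (2 * e1)) = e / (K * n.+1%:R * 2 + 1) * (K * n.+1%:R * 2) by rewrite /e1; ring.
by apply: frac_le; [exact: ltW|rewrite !mulr_ge0].
Qed.

(** The multiplier is split chart by chart into psi th and psi (1 - th). The second factor vanishes
    on the half-size ball of the chart, so the covering hypothesis passes to the remaining charts;
    with none left, psi lives at distance d from the complement and no shift is called for. *)
Lemma approximable_charts G (cs : seq chart) d : wjet Om G -> 0 < d ->
  (forall c, List.In c cs -> good_chart Om c) ->
  forall psi gpsi, C1b psi gpsi ->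
  (forall x, Om x -> (psi x = 0 /\ forall i, gpsi i x = 0) \/ (forall y, `|y - x| < d -> Om y) \/
     exists2 c, List.In c cs & `|x - cpt c| < crad c / 2) ->
  approximable (mulj psi gpsi G).
Proof.
move=> hG d0; elim: cs => [|c cs ih] hcs psi gpsi hpsi h.
  apply: (approximable_piece (U := [set x | Om x -> forall y, `|y - x| < d -> Om y])) => //.
  - move=> x hx; have [Ox|nOx] := pselect (Om x); last by exfalso; apply: hx.
    case: (h x Ox) => [//|[h1|[c []]]] //.
    by exfalso; apply: hx => _; exact: h1.
  - move=> d' d'0; pose t := Num.min d d' / 2.
    have m0 : 0 < Num.min d d' by rewrite lt_min d0.
    exists 0, t; split.
    + by rewrite normr0.
    + by rewrite divr_gt0.
    + by apply: (@lt_le_trans _ _ (Num.min d d')); [rewrite /t; lra|rewrite ge_min lexx orbT].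
    + move=> x Ox Ux y; rewrite addr0 => hy; apply: (Ux Ox); apply: le_lt_trans hy _.
      by apply: (@lt_le_trans _ _ (Num.min d d')); [rewrite /t; lra|rewrite ge_min lexx].
have gc : good_chart Om c by apply: hcs; left.
have [l0 _ _ _] := gc.
have hth := C1c_C1b (@cutoff_C1c R n (cpt c) (crad c) l0).
have h1 := C1bM hpsi hth; have h2 := C1bM hpsi (C1b_compl hth).
have [K1 _ hK1] := mulj_bound (open_row_measurable oO) h1.
have [K2 _ hK2] := mulj_bound (open_row_measurable oO) h2.
apply: (approximable_eq _ (approximableD (hK1 G hG.1).1 (hK2 G hG.1).1 _ _)).
- by move=> x _ [i|]; rewrite !fctE /=; ring.
- apply: (approximable_piece (U := [set x | `|x - cpt c| <= crad c])) => //.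
  + move=> x /negP; rewrite -ltNge => hx.
    by rewrite cutoff0 ?ltW// mulr0; split => // i; rewrite gcutoff0// mulr0 mul0r addr0.
  + move=> d' d'0; have [v [t [v1 t1 t2 hv]]] := chart_shift gc d'0.
    by exists v, t; split.
- apply: ih h2 _; first by move=> c' hc'; apply: hcs; right.
  move=> x Ox; have [xc|xc] := ltP `|x - cpt c| (crad c / 2).
    left; rewrite cutoff1 ?ltW// subrr mulr0; split => // i.
    by rewrite gcutoff1// oppr0 mulr0 mul0r addr0.
  have [[p1 p2]|[p|[c' [<-|c'in] hc']]] := h x Ox.
  + by left; rewrite p1 !mul0r; split => // i; rewrite p2 mul0r mulr0 addr0.
  + by right; left.
  + by move: xc; rewrite leNgt hc'.
  + by right; right; exists c'.
Qed.

Lemma density G : bounded_set Om -> smooth_boundary Om -> wjet Om G -> approximable G.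
Proof.
move=> bO sO hG; have [cs [hcs cov]] := good_charts oO bO sO (@ltr01 R).
have [d d0 hd] := interior_gap oO bO cov.
have := @approximable_charts G cs d hG d0 (fun c hc => (hcs c hc).1) _ _ (@C1b_cst R n 1).
move=> h; apply: approximable_eq (h _) => [x _ [i|] /=|x Ox].
- by rewrite mul1r mul0r addr0.
- by rewrite mul1r.
- by right; exact: hd.
Qed.

End density.

(** * Boundary forms in a chart *)

Section transport.
Context {R : realType} (n : nat).
Local Notation pt := 'rV[R]_n.
Local Notation mu := (lebesgue_row n : {measure set pt -> \bar R}).
Local Notation chart := (@chart R n).
Local Notation jets := (@jets R n).
Variables (Om : set pt) (oO : open Om) (c : chart).
Hypothesis gc : good_chart Om c.
Local Notation nu := (cdir c).
Local Notation s := (csgn c).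
Local Notation ze := (cgraph c).
Local Notation l := (crad c).
Local Notation P := (hsp nu (0 : R)).
Local Notation S := (slab nu (1 : R)).
Local Notation FP := (L2_form mu (measurable_hsp nu 0)).
Local Notation FS := (L2_form mu (measurable_slab nu 1)).
Local Notation mO := (open_row_measurable oO).
Local Notation FO := (H1form mO).
Implicit Types (x y z v : pt) (f g u : pt -> R) (gf gg gu : 'I_n -> pt -> R) (j : 'I_n).

Let l0 : 0 < l. Proof. by case: gc. Qed.
Let sz : smooth ze. Proof. by case: gc. Qed.
Let iz : indep nu ze. Proof. by case: gc. Qed.
Let hz x : `|x - cpt c| < 4 * l -> (Om x <-> ze x < flip s * x ord0 nu).
Proof. by case: gc => _ _ _ h; exact: h. Qed.

Definition cSh := shear nu s ze.
Definition cUn := unshear nu s ze.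
(** The whole side of the graph, which the shear identifies with the half space. [Om] agrees with it
    only near the chart, hence the support condition [insupp] in the transfer of integrals. *)
Definition cQ : set pt := [set x | ze x < flip s * x ord0 nu].
Let mze : measurable_fun setT ze.
Proof. by apply: continuous_row_measurable; have [] := smooth_is_grad sz. Qed.

Lemma cShK : cancel cSh cUn. Proof. exact: shearK. Qed.
Lemma cUnK : cancel cUn cSh. Proof. exact: unshearK. Qed.
Lemma mpres_Sh : mpres cSh. Proof. exact: mpres_shear. Qed.

Lemma cShE : cSh = upd nu (fun y => flip s * (y ord0 nu + ze y)).
Proof. by apply/funext => y; apply/rowP => i; rewrite !mxE. Qed.
Lemma cUnE : cUn = upd nu (fun x => flip s * x ord0 nu - ze x).
Proof. by apply/funext => y; apply/rowP => i; rewrite !mxE. Qed.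
Lemma cUn_nu x : cUn x ord0 nu = flip s * x ord0 nu - ze x.
Proof. by rewrite mxE eqxx. Qed.

Let ghSh j y : R := flip s * ((if j == nu then 1 else 0) + partial j ze y).
Definition ghUn j x : R := flip s * (if j == nu then 1 else 0) - partial j ze x.

Let id_grad : is_grad (fun y : pt => y ord0 nu) (fun i y => if i == nu then 1 else 0).
Proof.
have c1 : continuous (fun t : R => t) by move=> t; exact: cvg_id.
have c2 : continuous (fun _ : R => 1 : R) by exact: cst_continuous.
have d1 (t : R) : is_derive t 1 (fun t : R => t) (1 : R) by exact: is_derive_id.
exact: (is_grad_coord nu c1 c2 d1).
Qed.

Let hSh_grad : is_grad (fun y : pt => flip s * (y ord0 nu + ze y)) ghSh.
Proof. exact: is_gradZ (is_gradD id_grad (smooth_is_grad sz)). Qed.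
Lemma hUn_grad : is_grad (fun x : pt => flip s * x ord0 nu - ze x) ghUn.
Proof. exact: is_gradB (is_gradZ (flip s) id_grad) (smooth_is_grad sz). Qed.

Lemma mpres_Un : mpres cUn.
Proof.
have cU : continuous cUn by rewrite cUnE; apply: continuous_upd; have [] := hUn_grad.
have mU : measurable_fun setT cUn.
  apply: measurable_row => i; apply: continuous_row_measurable => x.
  by apply: (@continuous_comp _ _ _ cUn (fun y : pt => y ord0 i)); [exact: cU|exact: coord_continuous].
split => // A mA; have mUA : measurable (cUn @^-1` A) by rewrite -[X in measurable X]setTI; exact: mU.
rewrite -(mpres_Sh.2 _ mUA); congr (lebesgue_row n _).
by apply/seteqP; split => x /=; rewrite cShK.
Qed.

Lemma preimage_Sh_Q : cSh @^-1` cQ = P.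
Proof.
by apply/seteqP; split => y; have := cUn_nu (cSh y); rewrite /cQ /hsp /= cShK => ->; rewrite subr_gt0.
Qed.
Lemma preimage_Un_P : cUn @^-1` P = cQ.
Proof.
apply/seteqP; split => x; by rewrite /cQ /hsp /= cUn_nu subr_gt0.
Qed.
Lemma measurable_Q : measurable cQ.
Proof. by rewrite -preimage_Un_P; apply: (mpres_measurable mpres_Un); exact: measurable_hsp. Qed.

Lemma partial_indep j : indep nu (partial j ze).
Proof.
move=> y t; have [_ _ h] := is_grad_translation (t *: 'e_nu) (smooth_is_grad sz).
have e : (fun x => ze (x + t *: 'e_nu)) = ze by apply/funext => x; rewrite iz.
by rewrite e in h; rewrite -(@derive_val _ _ _ _ _ _ _ (h j y)).
Qed.
Lemma partial_nu y : partial nu ze y = 0.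
Proof.
have [_ _ h] := smooth_is_grad sz; have /is_deriveP hd := h nu y.
apply: (@cvg_unique _ (@Rhausdorff R) _ _ _ _ hd); apply: cvg_near_cst.
by apply: nearW => t; rewrite iz subrr mulr0.
Qed.
Lemma partial_Sh j y : partial j ze (cSh y) = partial j ze y.
Proof. by apply: indep_eq (@partial_indep j) _ => i inu; rewrite mxE (negbTE inu). Qed.
Definition flat_fun f : pt -> R := f \o cSh.
Local Notation fl := flat_fun.
Definition flat_grad gf j : pt -> R := if j == nu then fl (fun x => flip s * gf nu x)
  else fl (fun x => gf j x + flip s * partial j ze x * gf nu x).
Local Notation flg := flat_grad.

Lemma fl_is_grad f gf : is_grad f gf -> is_grad (fl f) (flg gf).
Proof.
move=> hf; have := is_grad_upd nu hf hSh_grad.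
rewrite -cShE (_ : (fun j x => _) = flg gf)//.
apply/funext => j; apply/funext => y; rewrite /flat_grad /flat_fun /ghSh; case: eqP => [->|_] /=.
  by rewrite partial_nu addr0 mulr1 add0r.
by rewrite partial_Sh add0r.
Qed.

Lemma fl_C1c f gf : C1c f gf -> C1c (fl f) (flg gf).
Proof.
move=> [hf [M sM]]; split; first exact: fl_is_grad.
have [cz _ _] := smooth_is_grad sz.
have [C hC] : exists C, forall x, `|x| <= M -> `|ze x| <= C.
  have /compact_bounded[C [Cr hC]] : compact (ze @` [set x | `|x| <= M]).
    by apply: continuous_compact; [exact: continuous_subspaceT|exact: compact_row_ball].
  exists (C + 1) => x hx; apply: hC; [by rewrite ltrDl|by exists x].
exists (`|M| + `|C|) => y hy; apply: sM; rewrite ltNge; apply/negP => h.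
move: hy; rewrite ltNge => /negP; apply.
have hx := hC _ h; have nM := ler_norm M; have nC := ler_norm C; have MM := le_trans h nM.
rewrite -(cShK y); apply: row_norm_le; first by rewrite addr_ge0.
move=> i; rewrite mxE; case: eqP => _.
  apply: le_trans (ler_normB _ _) _; rewrite flip_norm; apply: lerD.
    exact: le_trans (row_coord_le _ _) MM.
  exact: le_trans hx nC.
apply: le_trans (row_coord_le _ _) _; apply: le_trans MM _; by rewrite lerDl.
Qed.

Definition insupp (f : pt -> R) := forall x, 2 * l < `|x - cpt c| -> f x = 0.

Lemma Q_Om f : insupp f -> \int[mu]_(x in cQ) f x = \int[mu]_(x in Om) f x.
Proof.
move=> sf; rewrite Rintegral_mkcond [RHS]Rintegral_mkcond; apply: eq_Rintegral => x _.
rewrite !patchE; have [h|h] := ltP (2 * l) `|x - cpt c|; first by rewrite sf// !if_same.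
have h4 : `|x - cpt c| < 4 * l by apply: le_lt_trans h _; rewrite ltr_pM2r// ltr_nat.
congr (if _ then _ else _); apply/idP/idP => /set_mem hx; apply/mem_set.
  exact/(hz h4).
exact/(hz h4).
Qed.

Lemma int_fl f : measurable_fun setT f -> insupp f ->
  \int[mu]_(y in P) fl f y = \int[mu]_(x in Om) f x.
Proof.
move=> mf sf; rewrite -Q_Om// -preimage_Sh_Q.
have mf' : measurable_fun cQ f by exact: measurable_funTS.
exact: (mpres_integral mpres_Sh measurable_Q mf').
Qed.

Definition Iform j (F G : jets) := L2_ip mu Om (F (Some nu)) (G (Some j)) - L2_ip mu Om (F (Some j)) (G (Some nu)).
Definition Jform (F G : jets) := L2_ip mu Om (F None) (G (Some nu)) + L2_ip mu Om (G None) (F (Some nu)).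

(** Flattening adds to the j-th derivative a multiple of the slope times the nu-th one, the same
    multiple for f and for g; by antisymmetry these terms cancel and only the sign of the chart is
    left. *)
Lemma I_flat j f gf g gg : j != nu -> C1c f gf -> C1c g gg -> (forall i, insupp (gg i)) ->
  fip FP (flg gf nu) (flg gg j) - fip FP (flg gf j) (flg gg nu) = flip s * Iform j (jet f gf) (jet g gg).
Proof.
move=> jnu hf hg sg; have hf' := fl_C1c hf; have hg' := fl_C1c hg; have mP := @measurable_hsp R n nu 0.
have LP h gh i : C1c h gh -> L2on mu P (gh i) by move=> hh; exact: (@C1c_L2_grad _ _ _ _ _ i mP hh).
have LO h gh i : C1c h gh -> L2on mu Om (gh i) by move=> hh; exact: (@C1c_L2_grad _ _ _ _ _ i mO hh).
have mg (h : pt -> R) gh i : C1c h gh -> measurable_fun setT (gh i).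
  by move=> hh; apply: continuous_row_measurable; have [[_ cg _] _] := hh; exact: cg.
rewrite /= /L2_ip -RintegralB//; last 2 first.
- by apply: L2on_integrableM => //; apply: LP; eassumption.
- by apply: L2on_integrableM => //; apply: LP; eassumption.
rewrite /Iform /= /L2_ip -RintegralB//; last 2 first.
- exact: (L2on_integrableM mO (LO _ _ nu hf) (LO _ _ j hg)).
- exact: (L2on_integrableM mO (LO _ _ j hf) (LO _ _ nu hg)).
have iI : mu.-integrable Om (EFin \o (fun x => gf nu x * gg j x - gf j x * gg nu x)).
  exact: (integrableB mO (L2on_integrableM mO (LO _ _ nu hf) (LO _ _ j hg)) (L2on_integrableM mO (LO _ _ j hf) (LO _ _ nu hg))).
rewrite -(RintegralZl _ mO iI).
pose H x := flip s * (gf nu x * gg j x - gf j x * gg nu x).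
rewrite (_ : \int[mu]_(x in P) _ = \int[mu]_(y in P) fl H y).
  rewrite int_fl//; last by move=> x hx; rewrite /H !sg// !mulr0 subrr mulr0.
  by apply: measurable_funM => //; apply: measurable_funB; apply: measurable_funM; apply: mg; eassumption.
by apply: eq_Rintegral => y _; rewrite /flat_grad eqxx (negbTE jnu) /flat_fun /H /=; ring.
exact: mO.
Qed.

Lemma J_flat f gf g gg : C1c f gf -> C1c g gg -> insupp g -> (forall i, insupp (gg i)) ->
  fip FP (fl f) (flg gg nu) + fip FP (fl g) (flg gf nu) = flip s * Jform (jet f gf) (jet g gg).
Proof.
move=> hf hg sg0 sg; have hf' := fl_C1c hf; have hg' := fl_C1c hg; have mP := @measurable_hsp R n nu 0.
have LP h gh i : C1c h gh -> L2on mu P h /\ L2on mu P (gh i).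
  by move=> hh; split; [exact: C1c_L2 hh|exact: (@C1c_L2_grad _ _ _ _ _ i mP hh)].
have LO h gh i : C1c h gh -> L2on mu Om h /\ L2on mu Om (gh i).
  by move=> hh; split; [exact: (C1c_L2 mO hh)|exact: (@C1c_L2_grad _ _ _ _ _ i mO hh)].
have mg (h : pt -> R) gh i : C1c h gh -> measurable_fun setT h /\ measurable_fun setT (gh i).
  by move=> hh; have [[ch cg _] _] := hh; split; apply: continuous_row_measurable => //; exact: cg.
have [p1 p2] := LP _ _ nu hf'; have [p3 p4] := LP _ _ nu hg'.
have [q1 q2] := LO _ _ nu hf; have [q3 q4] := LO _ _ nu hg.
have [m1 m2] := mg _ _ nu hf; have [m3 m4] := mg _ _ nu hg.
rewrite /= /L2_ip -RintegralD//; try exact: L2on_integrableM.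
rewrite /Jform /= /L2_ip -RintegralD//; try exact: (L2on_integrableM mO).
have iI : mu.-integrable Om (EFin \o (fun x => f x * gg nu x + g x * gf nu x)).
  exact: (integrableD mO (L2on_integrableM mO q1 q4) (L2on_integrableM mO q3 q2)).
rewrite -(RintegralZl _ mO iI).
pose H x := flip s * (f x * gg nu x + g x * gf nu x).
rewrite (_ : \int[mu]_(x in P) _ = \int[mu]_(y in P) fl H y).
  rewrite int_fl//; last by move=> x hx; rewrite /H sg// sg0// mulr0 mul0r addr0 mulr0.
  by apply: measurable_funM => //; apply: measurable_funD; apply: measurable_funM.
by apply: eq_Rintegral => y _; rewrite /flat_grad eqxx /flat_fun /H /=; ring.
exact: mO.
Qed.

Lemma fl_nrm f : measurable_fun setT f -> L2on mu Om f -> insupp f ->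
  fdom FP (fl f) -> fnrm FP (fl f) = fnrm (L2_form mu mO) f.
Proof.
move=> mf df sf dfl; rewrite /fnrm; congr Num.sqrt; rewrite /= /L2_ip.
rewrite -[LHS]/(\int[mu]_(y in P) fl (fun x => f x * f x) y) int_fl//.
- exact: measurable_funM.
- by move=> x hx; rewrite sf// mulr0.
Qed.

Lemma partial_bound : exists2 C, 0 <= C & forall j x, `|x - cpt c| <= 2 * l -> `|partial j ze x| <= C.
Proof.
have h j : exists C, 0 <= C /\ forall x, `|x - cpt c| <= 2 * l -> `|partial j ze x| <= C.
  have [cp _ _] := smooth_is_grad (smooth_partial j sz).
  have l4 : 0 < 4 * l by rewrite mulr_gt0.
  have hc := @cutoff_C1c R n (cpt c) (4 * l) l4.
  have [_ [M sM]] := C1cM hc (smooth_is_grad (smooth_partial j sz)).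
  have [cc _ _] := is_gradM (cutoff_is_grad (cpt c) (4 * l)) (smooth_is_grad (smooth_partial j sz)).
  have [C C0 hC] := bsupp_bounded cc sM; exists C; split => // x hx.
  by have := hC x; rewrite cutoff1 ?mul1r//; lra.
have [K hK] := choice h; exists (\sum_j K j) => [|j x hx]; first by apply: sumr_ge0 => j _; exact: (hK j).1.
apply: le_trans ((hK j).2 x hx) _; rewrite (bigD1 j)//= lerDl; apply: sumr_ge0 => i _; exact: (hK i).1.
Qed.

Lemma flat_bound : exists2 K, 0 <= K & forall f gf, C1c f gf -> insupp f -> (forall i, insupp (gf i)) ->
  fnrm FP (fl f) <= K * fnrm FO (jet f gf) /\ forall j, fnrm FP (flg gf j) <= K * fnrm FO (jet f gf).
Proof.
have [C C0 hC] := partial_bound; exists (1 + C); first by rewrite addr_ge0.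
move=> f gf hf sf sg; have hf' := fl_C1c hf; have mP := @measurable_hsp R n nu 0.
have [[cf cg _] _] := hf; have [[cf' cg' _] _] := hf'.
have mT (h : pt -> R) D : continuous h -> measurable_fun D h by exact: continuous_row_measurable.
have N0 := nrm_ge0 FO (jet f gf).
have b1 k : fnrm (L2_form mu mO) (jet f gf k) <= fnrm FO (jet f gf) by exact: H1_comp_le.
split.
  rewrite fl_nrm//.
  - by apply: le_trans (b1 None) _; rewrite mulrDl mul1r lerDl mulr_ge0.
  - exact: mT.
  - exact: (C1c_L2 mO hf).
  - exact: C1c_L2 hf'.
move=> j; have dj i : L2on mu Om (gf i) by exact: (@C1c_L2_grad _ _ _ _ _ i mO hf).
have dfj : fdom FP (flg gf j) by exact: (@C1c_L2_grad _ _ _ _ _ j mP hf').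
move: dfj; rewrite /flat_grad; case: eqP => [_|_] dfj.
  have d1 := L2on_mulb mO (g := fun=> flip s) (f := gf nu) (C := 1) (measurable_cst _) _ (dj nu).
  have {}d1 : L2on mu Om (fun x => flip s * gf nu x) /\ fnrm (L2_form mu mO) (fun x => flip s * gf nu x) <= 1 * fnrm (L2_form mu mO) (gf nu).
    by apply: d1 => x _; rewrite -[X in `|X|]mulr1 flip_norm normr1.
  rewrite fl_nrm//.
  - apply: le_trans d1.2 _; rewrite mul1r; apply: le_trans (b1 (Some nu)) _.
    by rewrite mulrDl mul1r lerDl mulr_ge0.
  - by apply: measurable_funM => //; exact: mT.
  - exact: d1.1.
  - by move=> x hx; rewrite sg// mulr0.
pose th x := cutoff (cpt c) (4 * l) x * (flip s * partial j ze x).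
have E x : gf j x + flip s * partial j ze x * gf nu x =
    gf j x + (if `|x - cpt c| <= 2 * l then flip s * partial j ze x else 0) * gf nu x.
  by case: ifPn => //; rewrite -ltNge => hx; rewrite !sg// !mulr0.
pose q x : R := if `|x - cpt c| <= 2 * l then flip s * partial j ze x else 0.
have mq D : measurable_fun D q.
  apply: measurable_funTS; apply: measurable_fun_if => //.
  - apply: (measurable_fun_bool true); rewrite setTI (_ : _ @^-1` _ = [set x : pt | `|x - cpt c| <= 2 * l])//.
    apply: closed_row_measurable; apply: (@preimage_closed _ _ (fun x : pt => `|x - cpt c|) [set r | r <= 2 * l]); last exact: closed_le.
    move=> x _; apply: (@continuous_comp _ _ _ (fun x : pt => x - cpt c) (fun y : pt => `|y|)); last exact: norm_continuous.
    exact: (cvgB cvg_id (cvg_cst (cpt c))).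
  - apply: measurable_funTS; apply: measurable_funM => //; apply: mT.
    by have [_ h _] := smooth_is_grad sz; exact: h.
have qC x : `|q x| <= C.
  by rewrite /q; case: ifPn => hx; [rewrite flip_norm hC|rewrite normr0].
have d1 := L2on_mulb mO (mq Om) (fun x _ => qC x) (dj nu).
have Ef : (fun x => gf j x + flip s * partial j ze x * gf nu x) = (fun x => gf j x + q x * gf nu x).
  by apply/funext => x; exact: E.
rewrite Ef in dfj *; rewrite fl_nrm//.
- have := @nrmD _ _ (L2_form mu mO) (gf j) (fun x => q x * gf nu x) (dj j) d1.1 => /le_trans; apply.
  rewrite mulrDl mul1r; apply: lerD; first exact: (b1 (Some j)).
  by apply: le_trans d1.2 _; rewrite ler_wpM2l//; exact: (b1 (Some nu)).
- by apply: measurable_funD; [exact: mT|apply: measurable_funM => //; exact: mT].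
- exact: (@domD _ _ (L2_form mu mO) (gf j) (fun x => q x * gf nu x) (dj j) d1.1).
- by move=> x hx; rewrite !sg// mulr0 addr0.
Qed.

Lemma boundary_graph x : boundary Om x -> `|x - cpt c| < 4 * l -> ze x = flip s * x ord0 nu.
Proof.
move=> /(boundaryE _ oO)[clx nOx] hx.
have h1 : flip s * x ord0 nu <= ze x by rewrite leNgt; apply/negP => h; apply: nOx; exact/(hz hx).
apply/eqP; rewrite eq_le h1 andbT leNgt; apply/negP => h2.
have [cz _ _] := smooth_is_grad sz.
have cB : continuous (fun y : pt => ze y - flip s * y ord0 nu).
  move=> y; exact: (cvgB (cz y) (cvgM (cvg_cst (flip s)) (@coord_continuous _ 1 n ord0 nu y))).
have o1 : open [set y : pt | 0 < ze y - flip s * y ord0 nu].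
  by apply: (@open_comp _ _ (fun y : pt => ze y - flip s * y ord0 nu) [set r | 0 < r]); [move=> y _; exact: cB|exact: open_gt].
have n1 : nbhs x [set y : pt | 0 < ze y - flip s * y ord0 nu].
  by apply: open_nbhs_nbhs; split => //=; rewrite subr_gt0.
have n2 : nbhs x (ball x (4 * l - `|x - cpt c|)) by apply: nbhsx_ballx; rewrite subr_gt0.
have [y [Oy [/= y1]]] := clx _ (filterI n1 n2); rewrite -ball_normE /ball_ /= => y2.
have hy : `|y - cpt c| < 4 * l.
  by rewrite -(subrKA x); apply: le_lt_trans (ler_normD _ _) _; rewrite (distrC y) -ltrBrDr.
by have := (hz hy).1 Oy; lra.
Qed.

Lemma graph_boundary x : `|x - cpt c| < 4 * l -> ze x = flip s * x ord0 nu -> boundary Om x.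
Proof.
move=> hx e; apply/(boundaryE _ oO); split; last by move=> /(hz hx); rewrite e ltxx.
move=> U /nbhs_ballP[d /= d0 hd].
pose t := Num.min d (4 * l - `|x - cpt c|) / 2.
have m0 : 0 < Num.min d (4 * l - `|x - cpt c|) by rewrite lt_min d0 subr_gt0.
have t0 : 0 < t by rewrite divr_gt0.
have td : t < d by apply: (@lt_le_trans _ _ (Num.min d (4 * l - `|x - cpt c|))); [rewrite /t; lra|rewrite ge_min lexx].
have tl : t < 4 * l - `|x - cpt c| by apply: (@lt_le_trans _ _ (Num.min d (4 * l - `|x - cpt c|))); [rewrite /t; lra|rewrite ge_min lexx orbT].
pose y := x + (flip s * t) *: 'e_nu.
have ny : `|y - x| <= t.
  by rewrite /y addrAC subrr add0r; apply: le_trans (norm_row_e _ _) _; rewrite flip_norm ger0_norm// ltW.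
exists y; split; last by apply: hd; rewrite -ball_normE /ball_ /= distrC; exact: le_lt_trans ny td.
apply/hz; first by have := ler_normD (y - x) (x - cpt c); rewrite subrKA; lra.
by rewrite /y iz e mxE row_eE eqxx mulrDr flipK ltrDl.
Qed.

End transport.

Lemma ferr_small {R : realType} (n : nat) (nu : 'I_n) (b : 'rV[R]_n -> R) gb (e : R) :
  C1c b gb -> 0 < e -> exists N, forall j, j != nu -> ferr nu N b gb j <= e.
Proof.
move=> hb e0; have [cb [M sM]] := hb; have mS := measurable_slab nu (1:R).
have [k [_ hk]] := @ex_cube R n (Num.max (M + 1) 1).
have [e' e'0 he'] := @small_nice R n k e e0.
have H j : exists N0 : nat, forall N, (N0 <= N)%N -> j != nu -> ferr nu N b gb j <= e.
  have [d d0 hd] := dq_unif j cb sM e'0; have [N0 hN0] := exp2_small d0.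
  exists N0 => N hN jnu.
  have h0 : 0 < (2 ^- N : R) by rewrite invr_gt0 exprn_gt0.
  have hlt : (2 ^- N : R) < d.
    by apply: le_lt_trans hN0; rewrite lef_pV2 ?posrE ?exprn_gt0// ler_weXn2l// ler1n.
  have h1 : (2 ^- N : R) <= 1 by rewrite invf_le1 ?exprn_gt0// exprn_ege1// ler1n.
  have dqtb : fdom (L2_form (lebesgue_row n) mS) (dq (2 ^- N) j (trc nu b)).
    by rewrite -trc_dq//; apply: C1c_trc_L2 (C1c_dq (2 ^- N) j hb).
  have dtb : fdom (L2_form (lebesgue_row n) mS) (trc nu (gb j)) by exact: C1c_trc_L2_grad hb.
  apply: he'; first by apply: measurable_funB; [have [] := dqtb|have [] := dtb].
  move=> x /andP[x0 x1]; rewrite indicE; have [xk|xk] := boolP (x \in _).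
    rewrite mulr1 -trc_dq//; apply: hd; first by rewrite gt_eqF.
    by rewrite (ger0_norm (ltW h0)).
  have xl : M + 1 < `|upd nu (fun=> 0) x|.
    rewrite ltNge; apply/negP => hx; move/negP : xk; apply; apply/mem_set/hk.
    apply: row_norm_le; first by rewrite le_max ler01 orbT.
    move=> i; have [->|inu] := eqVneq i nu; first by rewrite (ger0_norm (ltW x0)) le_max x1 orbT.
    have := row_coord_le (upd nu (fun=> 0) x) i; rewrite !mxE (negbTE inu) => h'.
    by rewrite le_max (le_trans h').
  rewrite mulr0 -trc_dq// normr_le0 !fctE /trc (bsupp_dq _ _ sM)//; last by rewrite (ger0_norm (ltW h0)).
  by rewrite (is_grad_bsupp j cb sM) ?subrr//; lra.
have [K hK] := choice H; exists (\max_j K j)%N => j jnu.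
by apply: hK => //; exact: leq_bigmax.
Qed.

Section chart_forms.
Context {R : realType} (n : nat).
Local Notation pt := 'rV[R]_n.
Local Notation mu := (lebesgue_row n : {measure set pt -> \bar R}).
Local Notation chart := (@chart R n).
Local Notation jets := (@jets R n).
Variables (Om : set pt) (oO : open Om) (c : chart).
Hypothesis gc : good_chart Om c.
Local Notation nu := (cdir c).
Local Notation s := (csgn c).
Local Notation ze := (cgraph c).
Local Notation l := (crad c).
Local Notation P := (hsp nu (0 : R)).
Local Notation S := (slab nu (1 : R)).
Local Notation FP := (L2_form mu (measurable_hsp nu 0)).
Local Notation FS := (L2_form mu (measurable_slab nu 1)).
Local Notation mO := (open_row_measurable oO).
Local Notation FO := (H1form mO).
Local Notation fl := (flat_fun c).
Local Notation flg := (flat_grad c).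
Local Notation insupp := (insupp c).
Implicit Types (x y z v : pt) (f g u psi : pt -> R) (gf gg gu gpsi : 'I_n -> pt -> R) (j : 'I_n).
Implicit Types (F G B : jets).

Let l0 : 0 < l. Proof. by case: gc. Qed.

(** Both kinds of forms under one finite index. The value j = [cdir c] is included because the form
    is then zero. *)
Definition Bform (k : option 'I_n) F G := if k is Some j then Iform Om c j F G else Jform Om c F G.

Lemma H1_cs F G k k' : H1dom Om F -> H1dom Om G ->
  `|L2_ip mu Om (F k) (G k')| <= fnrm FO F * fnrm FO G.
Proof.
move=> dF dG; apply: le_trans (@cauchy_schwarz _ _ (L2_form mu mO) _ _ (dF k) (dG k')) _.
by apply: ler_pM; rewrite ?nrm_ge0// H1_comp_le.
Qed.

Lemma Bform_bound k F G : H1dom Om F -> H1dom Om G -> `|Bform k F G| <= 2 * (fnrm FO F * fnrm FO G).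
Proof.
move=> dF dG; have h k1 k2 := H1_cs k1 k2 dF dG; have h' k1 k2 := H1_cs k1 k2 dG dF.
rewrite mulr_natl mulr2n; case: k => [j|]; rewrite /Bform ?/Iform ?/Jform.
  exact: le_trans (ler_normB _ _) (lerD (h _ _) (h _ _)).
apply: le_trans (ler_normD _ _) (lerD (h _ _) _); rewrite [X in _ <= X]mulrC; exact: h'.
Qed.

Lemma BformBl k F F' G : H1dom Om F -> H1dom Om F' -> H1dom Om G ->
  Bform k (F - F') G = Bform k F G - Bform k F' G.
Proof.
move=> d1 d2 d3; pose L := L2_form mu mO.
have e i i' : L2_ip mu Om ((F - F') i) (G i') = L2_ip mu Om (F i) (G i') - L2_ip mu Om (F' i) (G i').
  exact: (@ipBl _ _ L _ _ _ (d1 i) (d2 i) (d3 i')).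
have e' i i' : L2_ip mu Om (G i') ((F - F') i) = L2_ip mu Om (G i') (F i) - L2_ip mu Om (G i') (F' i).
  exact: (@ipBr _ _ L _ _ _ (d1 i) (d2 i) (d3 i')).
by case: k => [j|]; rewrite /Bform ?/Iform ?/Jform !e ?e'; ring.
Qed.

Lemma BformBr k F G G' : H1dom Om F -> H1dom Om G -> H1dom Om G' ->
  Bform k F (G - G') = Bform k F G - Bform k F G'.
Proof.
move=> d3 d1 d2; pose L := L2_form mu mO.
have e i i' : L2_ip mu Om ((G - G') i) (F i') = L2_ip mu Om (G i) (F i') - L2_ip mu Om (G' i) (F i').
  exact: (@ipBl _ _ L _ _ _ (d1 i) (d2 i) (d3 i')).
have e' i i' : L2_ip mu Om (F i') ((G - G') i) = L2_ip mu Om (F i') (G i) - L2_ip mu Om (F i') (G' i).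
  exact: (@ipBr _ _ L _ _ _ (d1 i) (d2 i) (d3 i')).
by case: k => [j|]; rewrite /Bform ?/Iform ?/Jform !e' ?e; ring.
Qed.

Lemma Bform_nu F G : Bform (Some nu) F G = 0.
Proof. by rewrite /Bform /Iform subrr. Qed.

Lemma Bform_eq k F F' G : (forall x, Om x -> (forall i, F i x = F' i x) \/ (forall i, G i x = 0)) ->
  Bform k F G = Bform k F' G.
Proof.
move=> h; have e i i' : L2_ip mu Om (F i) (G i') = L2_ip mu Om (F' i) (G i').
  by apply: eq_Rintegral => x /set_mem Ox; have [->|hG] := h _ Ox; rewrite // hG !mulr0.
have e' i i' : L2_ip mu Om (G i) (F i') = L2_ip mu Om (G i) (F' i').
  by rewrite L2_ipC e L2_ipC.
by case: k => [j|]; rewrite /Bform ?/Iform ?/Jform !e ?e'.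
Qed.

(** The gradient of a cutoff is first seen to vanish at distance greater than d; moving radially
    outward and letting the move tend to 0 adds the points at distance exactly d. *)
Lemma vanish_closure (h : pt -> R) x (d : R) : continuous h -> 0 < d ->
  (forall y, d < `|y - cpt c| -> h y = 0) -> d <= `|x - cpt c| -> h x = 0.
Proof.
move=> ch d0 h0; rewrite le_eqVlt => /orP[/eqP e|]; last exact: h0.
pose g (t : R) := h (x + t *: (x - cpt c)).
have cg : g t @[t --> 0^'+] --> h x.
  have ct : {for 0, continuous g}.
    apply: (@continuous_comp _ _ _ (fun t : R => x + t *: (x - cpt c)) h); last exact: ch.
    exact: (cvgD (cvg_cst x) (cvgZ cvg_id (cvg_cst (x - cpt c)))).
  by move: (cvg_at_right_filter ct); rewrite /g scale0r addr0.
apply: (@cvg_unique _ (@Rhausdorff R) _ _ _ _ cg).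
apply: cvg_near_cst; near=> t; rewrite /g h0//.
have t0 : 0 < t by near: t; exact: nbhs_right_gt.
rewrite (_ : x + _ - _ = (1 + t) *: (x - cpt c)); last by rewrite scalerDl scale1r addrAC.
by rewrite normrZ -e ger0_norm ?addr_ge0 ?(ltW t0)// ltr_pMl// ltrDl.
Unshelve. all: by end_near. Qed.

Lemma grad_vanish psi gpsi (d : R) : is_grad psi gpsi -> (forall x, d <= `|x - cpt c| -> psi x = 0) ->
  forall i x, d < `|x - cpt c| -> gpsi i x = 0.
Proof.
move=> hp h0 i x hx; apply: (@is_grad_locally_cst _ _ _ _ x (`|x - cpt c| - d) hp); first by rewrite subr_gt0.
move=> y hy; rewrite !h0 ?(ltW hx)//.
have := ler_normD (x - y) (y - cpt c); rewrite subrKA => h.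
by move: h hy; rewrite (distrC y x); lra.
Qed.

Lemma flgB gf gg j : flg (fun i x => gf i x - gg i x) j = flg gf j - flg gg j.
Proof.
apply/funext => y; rewrite /flat_grad; case: eqP => _; rewrite /flat_fun /= !fctE /=; ring.
Qed.

Lemma mulj_C1c psi gpsi f gf : C1b psi gpsi -> (forall x, 2 * l < `|x - cpt c| -> psi x = 0) -> is_grad f gf ->
  [/\ C1c (fun x => psi x * f x) (fun i x => psi x * gf i x + f x * gpsi i x),
    insupp (fun x => psi x * f x) & forall i, insupp (fun x => psi x * gf i x + f x * gpsi i x)].
Proof.
move=> [hp _] s0 hf.
have hc : C1c psi gpsi.
  split => //; exists (2 * l + `|cpt c|) => x hx; apply: s0.
  by have := lerB_dist x (cpt c); move: hx; lra.
split; first exact: C1cM hc hf.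
  by move=> x hx; rewrite s0// mul0r.
move=> i x hx; rewrite s0// mul0r add0r.
rewrite (_ : gpsi i x = 0) ?mulr0//.
apply: (@is_grad_locally_cst _ _ _ _ x (`|x - cpt c| - 2 * l) hp); first by rewrite subr_gt0.
move=> y hy; rewrite !s0//.
have := ler_normD (x - y) (y - cpt c); rewrite subrKA => h.
by move: h hy; rewrite (distrC y x); lra.
Qed.

(** Turns an approximation in H^1(Om) into the bounds and the Cauchy property that [flat_null] asks
    for in the half space. Multiplication by psi and flattening are bounded, and one constant C
    serves all four estimates. *)
Lemma flat_seq psi gpsi F (f : nat -> pt -> R) (gf : nat -> 'I_n -> pt -> R) : C1b psi gpsi -> (forall x, 2 * l < `|x - cpt c| -> psi x = 0) ->
  H1dom Om F -> (forall m, is_grad (f m) (gf m)) -> (forall m, H1dom Om (jet (f m) (gf m))) ->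
  (forall m : nat, fnrm FO (jet (f m) (gf m) - F) <= m.+1%:R^-1) ->
  let a m : pt -> R := fun x => psi x * f m x in
  let ga m : 'I_n -> pt -> R := fun i x => psi x * gf m i x + f m x * gpsi i x in
  exists2 C, 0 <= C & forall m : nat,
   [/\ fnrm FO (jet (a m) (ga m)) <= C, fnrm FO (jet (a m) (ga m) - mulj psi gpsi F) <= C / m.+1%:R,
     forall i, fnrm FP (flg (ga m) i) <= C &
     forall N, (N <= m)%N -> forall i, fnrm FP (flg (ga m) i - flg (ga N) i) <= C / N.+1%:R].
Proof.
move=> hp s0 dF hf df cv a ga.
have [K K0 hK] := mulj_bound (mO) hp; have [L L0 hL] := flat_bound oO gc.
have E m : jet (a m) (ga m) = mulj psi gpsi (jet (f m) (gf m)) by rewrite mulj_jet.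
have dm m : H1dom Om (jet (a m) (ga m)) by rewrite E; exact: (hK _ (df m)).1.
have dp : H1dom Om (mulj psi gpsi F) by exact: (hK _ dF).1.
have c1 m : C1c (a m) (ga m) /\ insupp (a m) /\ forall i, insupp (ga m i).
  by have [] := mulj_C1c hp s0 (hf m).
have h1 (m : nat) : fnrm FO (jet (a m) (ga m) - mulj psi gpsi F) <= K / m.+1%:R.
  rewrite E -mulj_sub; apply: le_trans (hK _ _).2 _; first exact: (@domB _ _ FO _ _ (df m) dF).
  by rewrite ler_wpM2l.
have i1 (m : nat) : (m.+1%:R^-1 : R) <= 1 by rewrite invf_le1// ler1n.
have h2 m : fnrm FO (jet (a m) (ga m)) <= K + fnrm FO (mulj psi gpsi F).
  have := @nrmD _ _ FO _ _ (@domB _ _ FO _ _ (dm m) dp) dp; rewrite subrK => /le_trans; apply.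
  by rewrite lerD2r; apply: le_trans (h1 m) _; rewrite -[leRHS]mulr1 ler_wpM2l.
have N0 := nrm_ge0 FO (mulj psi gpsi F).
pose C := (K + fnrm FO (mulj psi gpsi F)) * (1 + L) + 2 * K * L + K.
have KK : 0 <= K + fnrm FO (mulj psi gpsi F) by rewrite addr_ge0.
have KL : 0 <= 2 * K * L by rewrite !mulr_ge0.
have KL' : 0 <= (K + fnrm FO (mulj psi gpsi F)) * L by rewrite mulr_ge0.
exists C => [|m]; first by rewrite !addr_ge0// mulr_ge0// addr_ge0.
have [hc [ha hga]] := c1 m; split.
- by apply: le_trans (h2 m) _; rewrite /C mulrDr mulr1; lra.
- by apply: le_trans (h1 m) _; rewrite ler_wpM2r// /C mulrDr mulr1; lra.
- move=> i; have [_ /(_ i) h] := hL _ _ hc ha hga; apply: le_trans h _.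
  apply: le_trans (ler_wpM2l L0 (h2 m)) _; rewrite /C [in leRHS]mulrDr (mulrC L); lra.
move=> N Nm i; have [hcN [haN hgaN]] := c1 N.
have hcc := C1cB hc hcN; rewrite -flgB.
have [||_ h] := hL _ _ hcc; [by move=> x hx; rewrite ha ?haN ?subrr|by move=> k x hx; rewrite hga ?hgaN ?subrr|].
apply: le_trans (h i) _.
rewrite (_ : jet _ _ = jet (a m) (ga m) - jet (a N) (ga N)); last by apply/funext => -[k|].
have h3 := @nrm_subD _ _ FO (jet (a m) (ga m)) (mulj psi gpsi F) (jet (a N) (ga N)) (dm m) dp (dm N).
rewrite (@nrm_distC _ _ FO _ _ dp (dm N)) in h3.
have h4 : fnrm FO (jet (a m) (ga m)) <= fnrm FO (jet (a m) (ga m)) by [].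
have iN : (m.+1%:R^-1 : R) <= N.+1%:R^-1 by rewrite lef_pV2 ?posrE// ler_nat.
have h5 := le_trans (h1 m) (ler_wpM2l K0 iN).
apply: (@le_trans _ _ (L * (2 * K / N.+1%:R))).
  rewrite ler_wpM2l//; apply: le_trans h3 _; rewrite -mulrA mulr_natl mulr2n; apply: lerD; [exact: h5|exact: h1].
rewrite mulrA ler_wpM2r// /C; have : 0 <= (K + fnrm FO (mulj psi gpsi F)) * (1 + L) by rewrite mulr_ge0// addr_ge0.
by rewrite mulrC; lra.
Qed.

Lemma inv_small (C e : R) : 0 <= C -> 0 < e -> exists N, forall m, (N <= m)%N -> C / m.+1%:R <= e.
Proof.
move=> C0 e0; exists (Num.truncn (C / e)) => m hm.
rewrite ler_pdivrMr// mulrC -ler_pdivrMr//; apply/ltW; apply: lt_le_trans (truncnS_gt _) _.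
by rewrite ler_nat.
Qed.

(* The forms only see traces. *)
Lemma Bform_null k F B psi gpsi (f b : nat -> pt -> R) (gf gb : nat -> 'I_n -> pt -> R) :
  H1dom Om F -> H1dom Om B -> C1b psi gpsi -> (forall x, l <= `|x - cpt c| -> psi x = 0) ->
  (forall m, is_grad (f m) (gf m)) -> (forall m, H1dom Om (jet (f m) (gf m))) ->
  (forall m : nat, fnrm FO (jet (f m) (gf m) - F) <= m.+1%:R^-1) ->
  (forall m, is_grad (b m) (gb m)) -> (forall m, H1dom Om (jet (b m) (gb m))) ->
  (forall m : nat, fnrm FO (jet (b m) (gb m) - B) <= m.+1%:R^-1) ->
  (forall e, 0 < e -> exists N, forall m, (N <= m)%N ->
     fip FS (absf (trc nu (fl (fun x => cutoff (cpt c) (2 * l) x * f m x))))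
            (absf (trc nu (fl (fun x => psi x * b m x)))) <= e) ->
  Bform k F (mulj psi gpsi B) = 0.
Proof.
move=> dF dB hp s0 hf df cf hb db cb tr0.
have l2 : 0 < 2 * l by rewrite mulr_gt0.
set th := cutoff (cpt c) (2 * l); set gth := gcutoff (cpt c) (2 * l).
have hth : C1b th gth by apply: C1c_C1b; exact: cutoff_C1c.
have sth x : 2 * l < `|x - cpt c| -> th x = 0 by move=> /ltW; exact: cutoff0.
have s0' x : 2 * l < `|x - cpt c| -> psi x = 0 by move=> h; apply: s0; move: h; have := l0; lra.
pose a m : pt -> R := fun x => th x * f m x.
pose ga m : 'I_n -> pt -> R := fun i x => th x * gf m i x + f m x * gth i x.
pose d m : pt -> R := fun x => psi x * b m x.
pose gd m : 'I_n -> pt -> R := fun i x => psi x * gb m i x + b m x * gpsi i x.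
have [C1 C10 h1] := flat_seq hth sth dF hf df cf; have [C2 C20 h2] := flat_seq hp s0' dB hb db cb.
have ca m : [/\ C1c (a m) (ga m), insupp (a m) & forall i, insupp (ga m i)] by exact: mulj_C1c.
have cd m : [/\ C1c (d m) (gd m), insupp (d m) & forall i, insupp (gd m i)] by exact: mulj_C1c.
have [K1 _ hK1] := mulj_bound (mO) hth; have [K2 _ hK2] := mulj_bound (mO) hp.
have dF' := (hK1 _ dF).1; have dB' := (hK2 _ dB).1.
(* [th] is 1, with zero gradient, where psi lives. It does not change the form, and it gives the
   first argument compact support in the chart, so that it can be flattened. *)
have -> : Bform k F (mulj psi gpsi B) = Bform k (mulj th gth F) (mulj psi gpsi B).
  have gv i x : l <= `|x - cpt c| -> gpsi i x = 0.
    have [[_ cg _] _] := hp; apply: (vanish_closure (cg i) l0); exact: (grad_vanish hp.1 s0).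
  apply: Bform_eq => x Ox; have [h|h] := ltP `|x - cpt c| l.
    left=> i; have t1 : th x = 1 by apply: cutoff1 => //; rewrite mulrAC divff ?mul1r ?ltW.
    case: i => [i|]; rewrite /mulj /= t1 mul1r//.
    rewrite (_ : gth i x = 0) ?mul0r ?addr0//; apply: gcutoff1 => //.
    by rewrite mulrAC divff ?mul1r.
  by right=> -[i|]; rewrite /mulj s0 ?gv// !mul0r ?addr0.
have flat e : 0 < e -> exists N, forall m, (N <= m)%N ->
    `|Bform k (jet (a m) (ga m)) (jet (d m) (gd m))| <= e.
  move=> e0; case: k => [j|]; last first.
    have [N hN] := tr0 _ e0; exists N => m hm; have [q1 q2 q3] := ca m; have [r1 r2 r3] := cd m.
    rewrite -(flip_norm s) -(J_flat oO gc q1 r1 r2 r3) (flat_J nu (fl_C1c gc q1) (fl_C1c gc r1)) normrN.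
    by apply: le_trans (hN _ hm); apply: fip_abs; [exact: C1c_trc_L2 (fl_C1c gc q1)|exact: C1c_trc_L2 (fl_C1c gc r1)].
  have [->|jnu] := eqVneq j nu; first by exists 0%N => m _; rewrite Bform_nu normr0 ltW.
  pose C := C1 + C2.
  have [|||||N hN] := @flat_null _ _ _ _ jnu (fun m => fl (a m)) (fun m => fl (d m))
     (fun m => flg (ga m)) (fun m => flg (gd m)) C _ _ _ _ _ tr0 _ e0.
  - by move=> m; have [q _ _] := ca m; exact: (fl_C1c gc q).
  - by move=> m; have [q _ _] := cd m; exact: (fl_C1c gc q).
  - by move=> m i; have [_ _ h _] := h1 m; apply: le_trans (h i) _; rewrite lerDl.
  - by move=> m i; have [_ _ h _] := h2 m; apply: le_trans (h i) _; rewrite lerDr.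
  - move=> e1 e10; have [N1 hN1] := inv_small C10 e10; have [N2 hN2] := inv_small C20 e10.
    exists (maxn N1 N2) => m hm i; have [_ _ _ q1] := h1 m; have [_ _ _ q2] := h2 m.
    by split; [apply: le_trans (q1 _ hm i) (hN1 _ _)|apply: le_trans (q2 _ hm i) (hN2 _ _)]; rewrite leq_max leqnn ?orbT.
  exists N => m hm; have := hN _ hm; have [q1 q2 q3] := ca m; have [r1 r2 r3] := cd m.
  by rewrite (I_flat oO gc jnu q1 r1 r3) flip_norm.
apply: (@real_le0_small _ _ (1 + 2 * C1 * C2 + 2 * (fnrm FO (mulj th gth F) * C2))).
  by rewrite !addr_ge0 ?mulr_ge0 ?nrm_ge0.
move=> e e0; have [N hN] := flat _ e0; have [N' hN'] := inv_small ler01 e0.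
pose m := maxn N N'; have hm : (N <= m)%N by rewrite leq_maxl.
have hm' : (N' <= m)%N by rewrite leq_maxr.
have := hN _ hm; have := hN' _ hm'; rewrite div1r => im bm.
have [x1 x2 _ _] := h1 m; have [y1 y2 _ _] := h2 m.
set A := jet (a m) (ga m) in bm *; set D := jet (d m) (gd m) in bm *.
have EA : A = mulj th gth (jet (f m) (gf m)) by rewrite mulj_jet.
have ED : D = mulj psi gpsi (jet (b m) (gb m)) by rewrite mulj_jet.
have dA : H1dom Om A by rewrite EA; exact: (hK1 _ (df m)).1.
have dD : H1dom Om D by rewrite ED; exact: (hK2 _ (db m)).1.
have -> : Bform k (mulj th gth F) (mulj psi gpsi B) =
   Bform k A D - Bform k (A - mulj th gth F) D - Bform k (mulj th gth F) (D - mulj psi gpsi B).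
  by rewrite BformBl// BformBr//; ring.
have b1 := Bform_bound k (@domB _ _ FO _ _ dA dF') dD.
have b2 := Bform_bound k dF' (@domB _ _ FO _ _ dD dB').
have n0 := nrm_ge0 FO (mulj th gth F).
have b1' : fnrm FO (A - mulj th gth F) * fnrm FO D <= C1 * e * C2.
  apply: ler_pM; rewrite ?nrm_ge0//; apply: le_trans x2 _; exact: ler_wpM2l.
have b2' : fnrm FO (mulj th gth F) * fnrm FO (D - mulj psi gpsi B) <= fnrm FO (mulj th gth F) * (C2 * e).
  by rewrite ler_wpM2l//; apply: le_trans y2 _; exact: ler_wpM2l.
apply: le_trans (ler_normB _ _) _; apply: le_trans (lerD (ler_normB _ _) b2) _.
apply: le_trans (lerD (lerD bm b1) (lexx _)) _.
have -> : (1 + 2 * C1 * C2 + 2 * (fnrm FO (mulj th gth F) * C2)) * e =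
  e + 2 * (C1 * e * C2) + 2 * (fnrm FO (mulj th gth F) * (C2 * e)) by ring.
by apply: lerD; [apply: lerD => //|]; rewrite ler_wpM2l.
Qed.

End chart_forms.

(** * Energy extension in a boundary chart *)

Section chart_extension.
Context {R : realType} (n : nat).
Local Notation pt := 'rV[R]_n.
Local Notation mu := (lebesgue_row n : {measure set pt -> \bar R}).
Local Notation chart := (@chart R n).
Local Notation jets := (@jets R n).
Variables (Om : set pt) (oO : open Om) (c : chart).
Hypothesis gc : good_chart Om c.
Local Notation nu := (cdir c).
Local Notation s := (csgn c).
Local Notation ze := (cgraph c).
Local Notation l := (crad c).
Local Notation P := (hsp nu (0 : R)).
Local Notation S := (slab nu (1 : R)).
Local Notation FP := (L2_form mu (measurable_hsp nu 0)).
Local Notation FS := (L2_form mu (measurable_slab nu 1)).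
Local Notation mO := (open_row_measurable oO).
Local Notation FO := (H1form mO).
Local Notation fl := (flat_fun c).
Local Notation flg := (flat_grad c).
Local Notation insupp := (insupp c).
Implicit Types (x y z : pt) (f g u v psi m h : pt -> R) (gf gg gu gv gpsi : 'I_n -> pt -> R) (i j : 'I_n).

Let l0 : 0 < l. Proof. by case: gc. Qed.
Let l2 : 0 < 2 * l. Proof. by rewrite mulr_gt0. Qed.
Local Notation th := (cutoff (cpt c) (2 * l)).
Local Notation gth := (gcutoff (cpt c) (2 * l)).

Let cUn_cont : continuous (cUn c).
Proof. by rewrite cUnE; apply: continuous_upd; have [] := hUn_grad gc. Qed.

Let cSh_cont : continuous (cSh c).
Proof.
rewrite cShE; apply: continuous_upd => x.
have [cz _ _] := smooth_is_grad (let: And4 _ h _ _ := gc in h).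
exact: (cvgM (cvg_cst (flip s)) (cvgD (@coord_continuous _ 1 n ord0 nu x) (cz x))).
Qed.

Lemma pull_nrm m : continuous m -> insupp m -> exists2 C, 0 <= C & forall h, continuous h -> L2on mu P h ->
  L2on mu Om (fun x => m x * h (cUn c x)) /\
  fnrm (L2_form mu mO) (fun x => m x * h (cUn c x)) <= C * fnrm FP h.
Proof.
move=> cm sm; have sm' : bsupp (2 * l + `|cpt c|) m.
  move=> x hx; apply: sm; have := lerB_dist x (cpt c); move: hx; lra.
have [C C0 hC] := bsupp_bounded cm sm'; exists C => // h ch dh.
have chU : continuous (h \o cUn c).
  by move=> x; apply: (@continuous_comp _ _ _ (cUn c) h); [exact: cUn_cont|exact: ch].
have cmh : continuous (fun x => m x * h (cUn c x)) by move=> x; exact: (cvgM (cm x) (chU x)).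
have smh : bsupp (2 * l + `|cpt c|) (fun x => m x * h (cUn c x)) by move=> x hx; rewrite sm'// mul0r.
have dmh D : measurable D -> L2on mu D (fun x => m x * h (cUn c x)).
  by move=> mD; apply: nice_L2on => //; exact: bsupp_nice cmh smh.
have mQ : measurable (cQ c) := measurable_Q gc.
split; first exact: (dmh _ mO).
have dQ : L2on mu (cQ c) (h \o cUn c).
  by rewrite -preimage_Un_P; apply: (mpres_L2on (mpres_Un gc)) => //; exact: measurable_hsp.
have mm : measurable_fun (cQ c) m by exact: continuous_row_measurable.
have [_ h1] := L2on_mulb mQ mm (fun x _ => hC x) dQ.
apply: le_trans (le_trans _ h1) _.
  rewrite /fnrm /= ler_wsqrtr// /L2_ip (Q_Om gc)//.
  by move=> x hx; rewrite sm// !mul0r.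
rewrite ler_wpM2l// /fnrm ler_wsqrtr//= -preimage_Un_P.
by rewrite (mpres_L2_ip (mpres_Un gc))//; exact: measurable_hsp.
Qed.

(** Return from the half space to [Om]. The cutoff is 1 on the ball of radius l, where the functions
    to be extended live, and confines the result to the chart. *)
Definition pull v : pt -> R := fun x => th x * v (cUn c x).
Definition gpull v gv i : pt -> R := fun x =>
  th x * ((if i == nu then 0 else gv i (cUn c x)) + ghUn c i x * gv nu (cUn c x)) + v (cUn c x) * gth i x.

Lemma pull_C1c (v : pt -> R) gv : is_grad v gv -> C1c (pull v) (gpull v gv).
Proof.
move=> hv; apply: C1cM; first exact: cutoff_C1c.
by have := is_grad_upd nu hv (hUn_grad gc); rewrite -cUnE.
Qed.

Lemma pull_bound : exists2 C, 0 <= C & forall (v : pt -> R) gv, is_grad v gv -> L2on mu P v ->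
  (forall i, L2on mu P (gv i)) ->
  fnrm FO (jet (pull v) (gpull v gv)) <= C * (fnrm FP v + \sum_i fnrm FP (gv i)).
Proof.
have [ct cgt _] := cutoff_is_grad (cpt c) (2 * l).
have [_ cgU _] := hUn_grad gc.
have st : insupp th by move=> x /ltW; exact: cutoff0.
have [C0 C00 h0] := pull_nrm ct st.
have /choice[C1 hC1] : forall i, exists C1 : R, 0 <= C1 /\ forall h, continuous h -> L2on mu P h ->
    L2on mu Om (fun x => (th x * ghUn c i x) * h (cUn c x)) /\
    fnrm (L2_form mu mO) (fun x => (th x * ghUn c i x) * h (cUn c x)) <= C1 * fnrm FP h.
  move=> i.
  have cc : continuous (fun x => th x * ghUn c i x) by move=> x; exact: (cvgM (ct x) (cgU i x)).
  by have [|C q1 q2] := pull_nrm cc; [move=> x hx; rewrite st// mul0r|exists C].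
have /choice[C2 hC2] : forall i, exists C2 : R, 0 <= C2 /\ forall h, continuous h -> L2on mu P h ->
    L2on mu Om (fun x => gth i x * h (cUn c x)) /\
    fnrm (L2_form mu mO) (fun x => gth i x * h (cUn c x)) <= C2 * fnrm FP h.
  move=> i.
  by have [|C q1 q2] := pull_nrm (cgt i); [move=> x hx; exact: gcutoff0|exists C].
pose C := C0 + \sum_i (C1 i + C2 i).
have pC i : 0 <= C1 i + C2 i by rewrite addr_ge0 ?(hC1 i).1 ?(hC2 i).1.
have C0' : 0 <= C by rewrite addr_ge0// sumr_ge0.
have Ci i : C0 + (C1 i + C2 i) <= C.
  by rewrite /C lerD2l (bigD1 i)//= lerDl sumr_ge0.
exists (n.+1%:R * C); first by rewrite mulr_ge0.
move=> v gv hv dv dgv; rewrite -mulrA; apply: H1_nrm_bound.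
have [cv cgv _] := hv.
set X := fnrm FP v + _.
have X0 : 0 <= \sum_i fnrm FP (gv i) by rewrite sumr_ge0// => i _; exact: nrm_ge0.
have Xv : fnrm FP v <= X by rewrite lerDl.
have Xi i : fnrm FP (gv i) <= X.
  rewrite /X (bigD1 i)//= addrCA lerDl addr_ge0 ?nrm_ge0// sumr_ge0// => k _; exact: nrm_ge0.
have X00 : 0 <= X by rewrite addr_ge0// nrm_ge0.
move=> [i|] /=; last first.
  apply: le_trans (h0 _ cv dv).2 _; apply: ler_pM => //; first exact: nrm_ge0.
  by rewrite lerDl sumr_ge0.
have [a1 a2] := h0 _ (cgv i) (dgv i); have [b1 b2] := (hC1 i).2 _ (cgv nu) (dgv nu).
have [d1 d2] := (hC2 i).2 _ cv dv.
have p1 := (hC1 i).1; have p2 := (hC2 i).1.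
apply: (@le_trans _ _ ((C0 + (C1 i + C2 i)) * X)); last by rewrite ler_wpM2r.
have q0 := le_trans a2 (ler_wpM2l C00 (Xi i)); have q1 := le_trans b2 (ler_wpM2l p1 (Xi nu)).
have q2 := le_trans d2 (ler_wpM2l p2 Xv).
have F2 : fnrm (L2_form mu mO) ((fun x => (th x * ghUn c i x) * gv nu (cUn c x)) + (fun x => gth i x * v (cUn c x))) <= (C1 i + C2 i) * X.
  by apply: le_trans (@nrmD _ _ (L2_form mu mO) _ _ b1 d1) _; rewrite [leRHS]mulrDl; apply: lerD.
have [inu|inu] := eqVneq i nu.
  rewrite (_ : gpull v gv i = (fun x => (th x * ghUn c i x) * gv nu (cUn c x)) + (fun x => gth i x * v (cUn c x))).
    by apply: le_trans F2 _; rewrite ler_wpM2r// lerDr.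
  by apply/funext => x; rewrite /gpull inu eqxx add0r !fctE; ring.
rewrite (_ : gpull v gv i = (fun x => th x * gv i (cUn c x)) +
   ((fun x => (th x * ghUn c i x) * gv nu (cUn c x)) + (fun x => gth i x * v (cUn c x)))).
  apply: le_trans (@nrmD _ _ (L2_form mu mO) _ _ a1 (@domD _ _ (L2_form mu mO) _ _ b1 d1)) _.
  by rewrite [leRHS]mulrDl lerD.
by apply/funext => x; rewrite /gpull (negbTE inu) !fctE; ring.
Qed.

Lemma flg_pull (v : pt -> R) gv y i : is_grad v gv -> `|cSh c y - cpt c| < l ->
  flg (gpull v gv) i y = gv i y.
Proof.
move=> hv hy; apply/eqP; rewrite -subr_eq0; apply/eqP.
have hg := is_gradB (fl_is_grad gc (pull_C1c hv).1) hv.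
pose N := [set z : pt | `|cSh c z - cpt c| < l].
have oN : open N.
  apply: (@open_comp _ _ (fun z : pt => `|cSh c z - cpt c|) [set r | r < l]); last exact: open_lt.
  move=> z _; apply: (@continuous_comp _ _ _ (fun z : pt => cSh c z - cpt c) (fun z : pt => `|z|)); last exact: norm_continuous.
  exact: (cvgB (@cSh_cont z) (cvg_cst (cpt c))).
have zN z : N z -> fl (pull v) z - v z = 0.
  move=> hz; rewrite /flat_fun /pull /= (cShK gc) cutoff1 ?mul1r ?subrr//.
  by rewrite mulrAC divff ?mul1r ?ltW.
have /nbhs_ballP[d /= d0 hd] : nbhs y N by exact: open_nbhs_nbhs.
apply: (@is_grad_locally_cst _ _ _ _ y d hg d0) => z hz.
by rewrite !zN//; apply: hd; rewrite -ball_normE /ball_ /= distrC.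
Qed.

Let FPC v gv : C1c v gv -> L2on mu P v /\ forall i, L2on mu P (gv i).
Proof.
move=> hv; have mP := measurable_hsp nu (0 : R); split; first exact: C1c_L2 hv.
by move=> i; exact: (@C1c_L2_grad _ _ _ _ _ i mP hv).
Qed.

Lemma fK_nrm N j f : L2on mu P f -> j != nu -> fnrm FP (fK N j f) <= 4 * fnrm FP f.
Proof.
move=> df jnu; have i1 (t : R) := tau_isoP jnu t.
apply: (nrm_dyK (F := FP) (i1 _) (i1 _)) => //; first exact: tauK.
by have := @tauK R n j (- 2 ^- N); rewrite opprK.
Qed.

(* [M0] bounds the forms against [a]; choosing the test jet [fK N j a] turns them into
   the energy controlling an extension of the trace of [a]. *)
Lemma chart_extension : exists2 K, 0 <= K & forall a ga M0 e, C1c a ga ->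
  (forall x, l <= `|x - cpt c| -> a x = 0) -> 0 <= M0 ->
  (forall k A gA, C1c A gA -> `|Bform Om c k (jet A gA) (jet a ga)| <= M0 * fnrm FO (jet A gA)) ->
  0 < e -> exists V gV, [/\ C1c V gV, forall x, boundary Om x -> V x = a x &
    fnrm FO (jet V gV) ^+ 2 <= K * (M0 * fnrm FO (jet a ga)) + e].
Proof.
have [C C0 hC] := pull_bound; have [L L0 hL] := flat_bound oO gc.
pose nn : R := 64 * n%:R * n%:R + 2.
have nn0 : 0 <= nn by rewrite addr_ge0// !mulr_ge0.
pose D0 : R := C ^+ 2 * n.+1%:R ^+ 2.
have D00 : 0 <= D0 by rewrite mulr_ge0// ?sqr_ge0// exprn_ge0.
pose K3 : R := 4 * C * (n.+1%:R * L).
have K30 : 0 <= K3 by rewrite !mulr_ge0.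
exists (D0 * (64 + nn * K3)); first by rewrite mulr_ge0// addr_ge0// mulr_ge0.
move=> a ga M0 e ha sa M00 hM e0.
have sa2 : insupp a by move=> x hx; apply: sa; move: hx; have := l0; lra.
have sga i x : l <= `|x - cpt c| -> ga i x = 0.
  by have [[_ cg _] _] := ha; apply: (vanish_closure (cg i) l0); exact: (grad_vanish ha.1 sa).
have sga2 i : insupp (ga i) by move=> x hx; apply: sga; move: hx; have := l0; lra.
pose b := fl a; pose gb := flg ga; have hb : C1c b gb := fl_C1c gc ha.
have [db dgb] := FPC hb.
set na := fnrm FO (jet a ga); have na0 : 0 <= na by exact: nrm_ge0.
have [nb ngb] := hL _ _ ha sa2 sga2; rewrite -/na -/b -/gb in nb ngb.
set al := fip FS (trc nu b) (trc nu b).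
have al0 : 0 <= al by exact: (ip_ge0 FS).
(* The hypothesis on J tested with A = a: this form is then, up to sign, the squared L2 norm of the
   trace. *)
have alE : al <= M0 * na.
  have := hM None _ _ ha; rewrite -(flip_norm s) /Bform -(J_flat oO gc ha ha sa2 sga2).
  by rewrite (flat_J nu hb hb) normrN ger0_norm.
set na' := fnrm FS (trc nu b).
have na'0 : 0 <= na' by exact: nrm_ge0.
(* The total coefficient of e1 in the final bound; with e1 = e / (D + e) it contributes at most e,
   and e1 <= 1. The scale N is then chosen so that every [ferr] is at most e1. *)
pose D := D0 * (nn * 4 * na' + 4).
have D1 : 0 <= D by rewrite mulr_ge0// addr_ge0// !mulr_ge0.
pose e1 := e / (D + e).
have De : 0 < D + e by rewrite ltr_wpDl.
have e10 : 0 < e1 by rewrite divr_gt0.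
have e1l : e1 <= 1 by rewrite ler_pdivrMr// mul1r lerDr.
have e1D : D * e1 <= e by rewrite /e1 mulrA ler_pdivrMr// mulrC ler_wpM2l ?(ltW e0)// lerDl ltW.
have [N hN] := ferr_small nu hb e10.
pose X := M0 * na * K3 + 4 * na' * e1.
have X0 : 0 <= X.
  apply: addr_ge0; first exact: mulr_ge0 (mulr_ge0 M00 na0) K30.
  exact: mulr_ge0 (mulr_ge0 (ler0n _ 4) na'0) (ltW e10).
have QX j : j != nu -> fQ nu N b j <= X.
  move=> jnu; apply: le_trans (fQ_le N hb jnu) _; apply: lerD; last first.
    by apply: ler_wpM2l; [rewrite mulr_ge0|exact: hN].
  have hK := (tr_fK N jnu).1 _ _ hb; have [dK dgK] := FPC hK.
  pose v := fK N j b; pose gv := fun i => fK N j (gb i).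
  have hA : C1c (pull v) (gpull v gv) := pull_C1c hK.1.
  (* [fK] spreads a beyond its support and its pull-back is cut off; but the cutoff is 1 wherever
     [ga] is nonzero, so the pairing does not see it. *)
  have E i k : fip FP (fK N j (gb i)) (gb k) = fip FP (flg (gpull v gv) i) (flg ga k).
    apply: eq_Rintegral => y _; have [hy|hy] := ltP `|cSh c y - cpt c| l.
      by rewrite (flg_pull _ hK.1).
    have g0 : flg ga k y = 0.
      by rewrite /flat_grad; case: eqP => _; rewrite /flat_fun /= !sga// ?mulr0 ?addr0.
    by rewrite /gb g0 !mulr0.
  rewrite !E (I_flat oO gc jnu hA ha sga2) flip_norm.
  apply: le_trans (hM (Some j) _ _ hA) _; rewrite -/(Bform Om c (Some j)) -mulrA ler_wpM2l//.
  apply: le_trans (hC _ _ hK.1 dK dgK) _.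
  rewrite /K3; have -> : na * (4 * C * (n.+1%:R * L)) = C * (n.+1%:R * (4 * (L * na))) by ring.
  rewrite ler_wpM2l//.
  have k1 : fnrm FP v <= 4 * (L * na).
    by apply: le_trans (fK_nrm N db jnu) _; rewrite ler_wpM2l.
  have k2 i : fnrm FP (gv i) <= 4 * (L * na).
    by apply: le_trans (fK_nrm N (dgb i) jnu) _; rewrite ler_wpM2l.
  rewrite mulrSr mulrDl mul1r addrC; apply: lerD => //.
  by apply: le_trans (ler_sum _ (fun i _ => k2 i)) _; rewrite sumr_const card_ord -[leLHS]mulr_natl.
pose V := pull (fV nu N b); pose gV := gpull (fV nu N b) (fgV nu N b gb).
have hfV := is_grad_fV nu N hb.
have hV : C1c V gV := pull_C1c hfV.
exists V, gV; split => //.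
  move=> x bx; rewrite /V /pull; have [hx|hx] := ltP `|x - cpt c| (2 * l); last first.
    by rewrite cutoff0// mul0r sa//; move: hx; have := l0; lra.
  have hx4 : `|x - cpt c| < 4 * l by move: hx; have := l0; lra.
  have xnu : cUn c x ord0 nu = 0 by rewrite cUn_nu (boundary_graph oO gc bx hx4) subrr.
  rewrite (fV_trace N b xnu) /b /flat_fun /= (cUnK gc).
  have [hxl|hxl] := ltP `|x - cpt c| l; last by rewrite sa// mulr0.
  by rewrite cutoff1 ?mul1r// mulrAC divff ?mul1r ?ltW.
pose Y := 64 * al + nn * X + 4 * e1.
have e12 : e1 ^+ 2 <= e1 by rewrite expr2 -[leRHS]mulr1 ler_wpM2l// ltW.
have nX : 0 <= 64 * n%:R * n%:R * X by rewrite !mulr_ge0.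
have nXE : nn * X = 64 * n%:R * n%:R * X + 2 * X by rewrite /nn mulrDl.
have Y0 : fnrm FP (fV nu N b) ^+ 2 <= Y.
  rewrite sqr_nrm; apply: le_trans (fV_L2 nu N hb).2 _; rewrite -/al /Y nXE; lra.
have Yi i : fnrm FP (fgV nu N b gb i) ^+ 2 <= Y.
  rewrite sqr_nrm; have [->|inu] := eqVneq i nu.
    apply: le_trans (fgV_nu_L2 nu N hb).2 _; rewrite -/al.
    have h : \sum_(j < n | j != nu) fQ nu N b j <= n%:R * X.
      apply: (@le_trans _ _ (\sum_(j < n | j != nu) X)); first by apply: ler_sum => j; exact: QX.
      rewrite big_mkcond /=; apply: (@le_trans _ _ (\sum_(j < n) X)).
        by apply: ler_sum => j _; case: ifP.
      by rewrite sumr_const card_ord mulr_natl.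
    have n0 : 0 <= 64 * n%:R :> R by rewrite mulr_ge0.
    by have := ler_wpM2l n0 h; rewrite /Y nXE mulrA; lra.
  apply: le_trans (fgV_L2 N hb inu).2 _; rewrite -/al.
  have q := QX _ inu; have q' := hN _ inu.
  have q2 : ferr nu N b gb i ^+ 2 <= e1.
    by apply: le_trans e12; rewrite lerXn2r// nnegrE ?(ltW e10)//; exact: nrm_ge0.
  by rewrite /Y nXE; lra.
have [dV1 _] := fV_L2 nu N hb.
have dV2 i : L2on mu P (fgV nu N b gb i).
  by have [->|inu] := eqVneq i nu; [have [] := fgV_nu_L2 nu N hb|have [] := fgV_L2 N hb inu].
have b1 := hC _ _ hfV dV1 dV2; rewrite -/V -/gV in b1.
have YY : 0 <= Y by apply: le_trans Y0; exact: sqr_ge0.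
have sq t : 0 <= t -> t ^+ 2 <= Y -> t <= Num.sqrt Y.
  by move=> t0 h; rewrite -(ger0_norm t0) -sqrtr_sqr ler_wsqrtr.
have b2 : fnrm FO (jet V gV) <= C * (n.+1%:R * Num.sqrt Y).
  apply: le_trans b1 _; rewrite ler_wpM2l// mulrSr mulrDl mul1r addrC; apply: lerD.
    apply: (@le_trans _ _ (\sum_(i < n) Num.sqrt Y)).
      by apply: ler_sum => i _; apply: sq => //; exact: nrm_ge0.
    by rewrite sumr_const card_ord mulr_natl.
  by apply: sq => //; exact: nrm_ge0.
have b3 : fnrm FO (jet V gV) ^+ 2 <= D0 * Y.
  have -> : D0 * Y = (C * (n.+1%:R * Num.sqrt Y)) ^+ 2 by rewrite !exprMn sqr_sqrtr// /D0 mulrA.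
  by rewrite lerXn2r// nnegrE ?nrm_ge0// !mulr_ge0// sqrtr_ge0.
apply: le_trans b3 _.
apply: (@le_trans _ _ (D0 * (64 * (M0 * na) + nn * X + 4 * e1))).
  by rewrite ler_wpM2l// /Y !lerD2r ler_wpM2l.
have -> : D0 * (64 * (M0 * na) + nn * X + 4 * e1) = D0 * (64 + nn * K3) * (M0 * na) + D * e1.
  by rewrite /X /D; ring.
by rewrite lerD2l.
Qed.

End chart_extension.

(** * Surface measure and traces *)

Section gamma.
Context {R : realType}.
Local Notation leb := (@lebesgue_measure R).

Lemma powR_half_le (s : nat) (t : R) : 0 <= t ->
  t `^ (s%:R / 2) <= (1 + 2 ^+ s.+1 * (s.+1)`!%:R) * expR (t / 2).
Proof.
move=> t0; have f0 : 0 < (s.+1)`!%:R :> R by rewrite ltr0n fact_gt0.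
have h1 : t `^ (s%:R / 2) <= 1 + t ^+ s.+1.
  have [t1|t1] := leP t 1.
    apply: (@le_trans _ _ 1); last by rewrite lerDl exprn_ge0.
    have := @ge0_ler_powR _ (s%:R / 2 : R) (divr_ge0 (ler0n _ _) (ler0n _ _)) t 1.
    by rewrite powR1; apply; rewrite ?nnegrE.
  apply: (@le_trans _ _ (t ^+ s.+1)); last by rewrite lerDr.
  rewrite -powR_mulrn//; apply: ler_powR; first exact: ltW.
  by rewrite ler_pdivrMr// (le_trans (_ : _ <= s.+1%:R)) ?ler_nat// ler_peMr// ler1n.
apply: le_trans h1 _; have t2 : 0 <= t / 2 by rewrite divr_ge0.
have := expR_ge1Dxn s t2; set E := expR _ => hE.
have E1 : 1 <= E by apply: le_trans hE; rewrite lerDl divr_ge0// exprn_ge0.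
rewrite mulrDl mul1r; apply: lerD => //.
have : (t / 2) ^+ s.+1 / (s.+1)`!%:R <= E by apply: le_trans hE; rewrite lerDr.
rewrite ler_pdivrMr// expr_div_n ler_pdivrMr ?exprn_gt0// => /le_trans; apply.
by rewrite -mulrA mulrC (mulrC (s.+1)`!%:R).
Qed.

(** Finiteness matters as much as positivity, since a divergent integral would be read as 0. The
    integrand is dominated by a multiple of the exponential density of rate 1/2. *)
Lemma gamma_fun_gt0 (s : nat) : 0 < @gamma_fun R (s%:R / 2 + 1).
Proof.
rewrite /gamma_fun addrK /Rintegral; set p : R := s%:R / 2.
pose f (t : R) := t `^ p * expR (- t).
have f0 t : 0 <= f t by rewrite mulr_ge0 ?powR_ge0 ?expR_ge0.
have mf D : measurable_fun D (fun t => (f t)%:E).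
  apply: measurable_funTS; apply/measurable_EFinP; apply: measurable_funM; first exact: measurable_powR.
  by apply: measurableT_comp; [exact: measurable_expR|exact: oppr_measurable].
apply: fine_gt0; apply/andP; split.
  apply: (@lt_le_trans _ _ (\int[leb]_(t in `[1%R, 2%R]) (f t)%:E)%E); last first.
    apply: ge0_subset_integral => //; first exact: mf.
      by move=> t _; rewrite lee_fin.
    by move=> t /=; rewrite !in_itv /= andbT => /andP[h _]; apply: lt_le_trans h.
  apply: (@lt_le_trans _ _ (\int[leb]_(t in `[1%R, 2%R]) (expR (- 2))%:E)%E).
    have L : (leb `[1%R, 2%R]%classic = 1)%E.
      rewrite lebesgue_measure_itv /= lte_fin ltr1n -EFinB; congr EFin; lra.
    rewrite integral_cst; last exact: measurable_itv.
    by rewrite [X in (_ * X)%E]L mule1 lte_fin expR_gt0.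
  apply: ge0_le_integral; [exact: measurable_itv|by move=> t _; rewrite lee_fin expR_ge0|
    exact: measurable_cst|exact: mf|].
  move=> t /=; rewrite in_itv /= => /andP[t1 t2]; rewrite lee_fin /f -[leLHS]mul1r.
  apply: ler_pM => //; rewrite ?expR_ge0// ?ler_expR ?lerN2//.
  by have := ler_powR t1 (divr_ge0 (ler0n R s) (ler0n R 2)); rewrite powRr0.
set C : R := 1 + 2 ^+ s.+1 * (s.+1)`!%:R.
have C0 : 0 <= C by rewrite addr_ge0// mulr_ge0// exprn_ge0.
have h2 : 0 < 2^-1 :> R by rewrite invr_gt0.
have hi := integrableZl measurableT (2 * C) (integrable_exponential_pdf h2).
have /integrableP[mg] := hi; apply: le_lt_trans.
apply: (@le_trans _ _ (\int[leb]_(t in `]0%R, +oo[) `|((2 * C)%:E * (exponential_pdf 2^-1 t)%:E)|)%E).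
  apply: ge0_le_integral => //.
  - by move=> t _; rewrite lee_fin; exact: f0.
  - exact: mf.
  - by apply: measurable_funTS; exact: measurableT_comp.
  move=> t /=; rewrite in_itv /= andbT => t0.
  rewrite lee_fin ger0_norm; last exact: mulr_ge0 (mulr_ge0 (ler0n _ 2) C0) (exponential_pdf_ge0 (ltW h2) _).
  rewrite exponential_pdfE ?(ltW t0)// /f.
  have E2 : expR (- t) = expR (- (t / 2)) * expR (- (t / 2)) by rewrite -expRD -opprD -splitr.
  rewrite (_ : - 2^-1 * t = - (t / 2)); last by rewrite mulNr mulrC.
  have -> : 2 * C * (2^-1 * expR (- (t / 2))) = C * expR (- (t / 2)).
    by field.
  rewrite E2 mulrA ler_wpM2r ?expR_ge0//.
  have := powR_half_le s (ltW t0); rewrite -/C -/p => h.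
  by rewrite expRN ler_pdivrMr ?expR_gt0.
by apply: ge0_subset_integral => //; first by exact: measurableT_comp.
Qed.

Lemma hausdorff_const_gt0 (s : nat) : 0 < @hausdorff_const R s.
Proof. by rewrite /hausdorff_const divr_gt0 ?gamma_fun_gt0// powR_gt0// pi_gt0. Qed.

End gamma.

(** * Borel sets are measurable for the surface measure *)

Section caratheodory.
Context {R : realType} (n : nat).
Local Notation pt := 'rV[R]_n.
Implicit Types (A B X : set pt) (d e c : R) (s : nat) (i : 'I_n).
Local Notation cov s e := (cover_outer (@hausdorff_cost R n s e)).
Local Open Scope ereal_scope.

Let cge s e A : 0 <= @hausdorff_cost R n s e A := @hausdorff_cost_ge0 R n s e A.

Lemma le_cov s e e' A : (e <= e')%R -> cov s e' A <= cov s e A.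
Proof.
move=> ee; apply: le_ereal_inf_tmp => _ [F cF <-].
apply: (@le_trans _ _ (\sum_(k <oo) hausdorff_cost s e' (F k))).
  by apply: ereal_inf_lbound; exists F.
apply: lee_nneseries => // k _; rewrite /hausdorff_cost; case: ifP => // F0.
case: ifPn => h; case: ifPn => h'; rewrite ?leey//.
by exfalso; move/negP: h; apply; apply: le_trans h' _; rewrite lee_fin.
Qed.

Lemma cov_hausdorff s e A : (0 < e)%R -> cov s e A <= hausdorff s A.
Proof. by move=> e0; apply: ereal_sup_ubound; exists e. Qed.

(** A set of finite cost has diameter at most e < d, so it cannot meet both A and B: a cover of the
    union splits into a cover of A and one of B. *)
Lemma cov_sep s A B d e : (e < d)%R -> (forall x y, A x -> B y -> (d <= enorm (x - y))%R) ->
  cov s e A + cov s e B <= cov s e (A `|` B).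
Proof.
move=> ed hAB; apply: le_ereal_inf_tmp => _ [F cF <-].
pose meet X k := if `[< F k `&` X !=set0 >] then F k else set0.
have cm X : X `<=` A `|` B -> cov s e X <= \sum_(k <oo) hausdorff_cost s e (meet X k).
  move=> XAB; apply: ereal_inf_lbound; exists (meet X) => // x Xx.
  have [k _ Fk] := cF _ (XAB _ Xx); exists k => //; rewrite /meet asboolT//.
  by exists x.
apply: le_trans (leeD (cm A _) (cm B _)) _; [by move=> x; left|by move=> x; right|].
rewrite -nneseriesD//; apply: lee_nneseries => [k _ _|k _]; first by rewrite adde_ge0.
rewrite /meet; case: asboolP => [[x [Fx Ax]]|_]; case: asboolP => [[y [Fy By]]|_];
  rewrite ?hausdorff_cost0 ?adde0 ?add0e//.
suff -> : hausdorff_cost s e (F k) = +oo by rewrite leey.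
rewrite /hausdorff_cost ifF; last by apply/negbTE/set0P; exists x.
rewrite ifF//; apply/negbTE; rewrite -ltNge; apply: (@lt_le_trans _ _ d%:E); first by rewrite lte_fin.
apply: (@le_trans _ _ (enorm (x - y))%:E); first by rewrite lee_fin hAB.
by apply: ereal_sup_ubound; exists x => //; exists y.
Qed.

Lemma hausdorff_sep s A B d : (0 < d)%R -> (forall x y, A x -> B y -> (d <= enorm (x - y))%R) ->
  hausdorff s A + hausdorff s B <= hausdorff s (A `|` B).
Proof.
move=> d0 hAB; set M := hausdorff s (A `|` B).
have [->|Mo] := eqVneq M +oo; first by rewrite leey.
have hA : hausdorff s A <= M by apply: le_outer_measure => x; left.
have hB : hausdorff s B <= M by apply: le_outer_measure => x; right.
have h0 X : 0 <= hausdorff s X by exact: outer_measure_ge0.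
have fin x : 0 <= x -> x <= M -> x \is a fin_num.
  by move=> x0 xM; rewrite ge0_fin_numE//; apply: le_lt_trans xM _; rewrite ltey.
rewrite -leeBrDr ?fin//; apply: ge_ereal_sup => _ [e1 /= e10 <-].
have c1 : cov s e1 A <= M by apply: le_trans hA; exact: cov_hausdorff.
have c0 e X : 0 <= cov s e X by apply: cover_outer_ge0.
rewrite leeBrDr ?fin// addeC -leeBrDr ?fin//; apply: ge_ereal_sup => _ [e2 /= e20 <-].
rewrite leeBrDr ?fin//.
pose e : R := Num.min (Num.min e1 e2) (d / 2)%R.
have e0 : (0 < e)%R by rewrite !lt_min e10 e20 divr_gt0.
have ed : (e < d)%R by rewrite /e gt_min ltr_pdivrMr// ltr_pMr// ltr1n orbT.
apply: le_trans (cov_hausdorff s _ e0); rewrite addeC.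
apply: le_trans (cov_sep _ ed hAB); apply: leeD; apply: le_cov.
  by rewrite /e !ge_min lexx.
by rewrite /e !ge_min lexx orbT.
Qed.

(* the rings [c + 1 / (k + 2) < x_i <= c + 1 / (k + 1)] of the same parity are
   separated, so that their measures are summable *)
Lemma half_space_caratheodory s i c :
  (@hausdorff R n s).-caratheodory [set x | (x ord0 i <= c)%R].
Proof.
pose K := [set x : pt | (x ord0 i <= c)%R].
apply: (le_caratheodory_measurable (A := K)) => X.
change (hausdorff s (X `&` K) + hausdorff s (X `&` ~` K) <= hausdorff s X); set M := hausdorff s X.
have [->|Mo] := eqVneq M +oo; first by rewrite leey.
have h0 A : 0 <= hausdorff s A by exact: outer_measure_ge0.
have mono A B : A `<=` B -> hausdorff s A <= hausdorff s B by exact: le_outer_measure.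
pose t (k : nat) : R := (k.+1%:R^-1)%R.
have t0 k : (0 < t k)%R by rewrite invr_gt0.
have tS k l : (k < l)%N -> (t l < t k)%R by move=> kl; rewrite ltf_pV2 ?posrE// ltr_nat.
have tS' k l : (k <= l)%N -> (t l <= t k)%R by move=> kl; rewrite lef_pV2 ?posrE// ler_nat.
pose E k : set pt := X `&` [set x | (t k < x ord0 i - c)%R].
pose Q k : set pt := X `&` [set x | (t k.+1 < x ord0 i - c <= t k)%R].
have sep A B (p q : R) : (p < q)%R -> (forall x, A x -> (x ord0 i - c <= p)%R) ->
    (forall x, B x -> (q <= x ord0 i - c)%R) -> hausdorff s A + hausdorff s B <= hausdorff s (A `|` B).
  move=> pq hA hB; apply: (@hausdorff_sep _ _ _ (q - p)); first by rewrite subr_gt0.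
  move=> x y /hA xp /hB yq; apply: le_trans (le_enorm _); apply: le_trans (row_coord_le _ i).
  rewrite !mxE -normrN; apply: le_trans (ler_norm _); lra.
(* [E N] stays at distance at least t N from the half space; letting N grow is what remains, that
   is, showing that the rings between them have small measure. *)
have a N : hausdorff s (X `&` K) + hausdorff s (E N) <= M.
  apply: (@le_trans _ _ (hausdorff s ((X `&` K) `|` E N))); last by apply: mono => x [[]|[]].
  apply: (sep _ _ _ _ (t0 N)) => x [_] /=; first by rewrite subr_le0.
  exact: ltW.
have b r N : (0 < r)%N -> \sum_(k < N) hausdorff s (Q (k.*2 + r)%N) <= hausdorff s (E (N.*2 + r).-1).
  move=> r0; elim: N => [|N ih]; first by rewrite big_ord0.
  rewrite big_ord_recr /=; apply: le_trans (leeD ih (lexx _)) _; rewrite addeC.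
  have lt : ((N.*2 + r).-1 < N.*2 + r)%N by rewrite prednK// addn_gt0 r0 orbT.
  apply: le_trans (sep _ _ _ _ (tS _ _ lt) _ _) _.
  - by move=> x [_ /andP[]].
  - by move=> x [_ /ltW].
  apply: mono => x [[Xx /andP[h _]]|[Xx h]]; split => //=.
  by apply: le_lt_trans h; apply: tS'; rewrite ?doubleS; lia.
have cv r : (0 < r)%N -> \sum_(N <= k <oo) hausdorff s (Q (k.*2 + r)%N) @[N --> \oo] --> 0.
  move=> r0; apply: nneseries_tail_cvg => //; apply: (@le_lt_trans _ _ M); last by rewrite ltey.
  apply: lime_le; first exact: is_cvg_nneseries.
  by apply: nearW => N; rewrite big_mkord; apply: le_trans (b _ _ r0) _; apply: mono => x [].
apply/lee_addgt0Pr => e e0; have e20 : (0 < e / 2)%R by rewrite divr_gt0.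
have [N [h1 h2]] : exists N, \sum_(N <= k <oo) hausdorff s (Q (k.*2 + 1)%N) < (e / 2)%:E /\
    \sum_(N <= k <oo) hausdorff s (Q (k.*2 + 2)%N) < (e / 2)%:E.
  have [N1 _ n1] := ereal_cvg0_lt e20 (cv 1%N isT).
  have [N2 _ n2] := ereal_cvg0_lt e20 (cv 2%N isT).
  by exists (maxn N1 N2); split; [apply: n1|apply: n2]; rewrite /= leq_max leqnn ?orbT.
(* A point outside K and not in [E] lies in a ring of index at least 2 N + 1; the parity of the
   index puts it in the tail of one of the two series. *)
have cover : X `&` ~` K `<=` E N.*2.+1 `|` ((\bigcup_(k in ~` `I_N) Q (k.*2 + 1)%N) `|`
    (\bigcup_(k in ~` `I_N) Q (k.*2 + 2)%N)).
  move=> x [Xx /= /negP]; rewrite -ltNge -subr_gt0 => y0.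
  have [hE|hE] := ltP (t N.*2.+1) (x ord0 i - c)%R; first by left.
  right; have ex : exists m, (t m < x ord0 i - c)%R.
    exists (Num.truncn (x ord0 i - c)^-1); rewrite -[ltRHS]invrK ltf_pV2 ?posrE ?invr_gt0//.
    exact: truncnS_gt.
  have [m hm min] := ex_minnP ex.
  have Nm : (N.*2.+1 < m)%N.
    by rewrite ltnNge; apply/negP => h; have := tS' _ _ h; move: hm hE; lra.
  case: m hm min Nm => // m hm min Nm.
  have mQ : Q m x.
    split => //; apply/andP; split => //; rewrite leNgt; apply/negP => h.
    by have := min _ h; rewrite ltnn.
  have := odd_double_half m; case: (odd m) => /= me.
    left; exists m./2 => /=; first by apply/negP; rewrite -leqNgt; clear -Nm me; lia.
    by rewrite addn1 -add1n me.
  right; exists (m./2).-1 => /=; first by apply/negP; rewrite -leqNgt; clear -Nm me; lia.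
  by rewrite (_ : (_.*2 + 2)%N = m)//; clear -Nm me; lia.
apply: (@le_trans _ _ (hausdorff s (X `&` K) + (hausdorff s (E N.*2.+1) +
   ((e / 2)%:E + (e / 2)%:E)))).
  rewrite leeD2l//; apply: le_trans (mono _ _ cover) _.
  apply: le_trans (outer_measureU2 _ _ _) _; rewrite leeD2l//.
  apply: le_trans (outer_measureU2 _ _ _) _; apply: leeD.
    apply: le_trans (ltW h1); exact: outer_measure_sigma_subadditive_tail.
  apply: le_trans (ltW h2); exact: outer_measure_sigma_subadditive_tail.
by rewrite addeA leeD// -EFinD -splitr.
Qed.

(** Boxes are finite intersections of differences of half spaces, and they generate the
    sigma-algebra of R^n. *)
Lemma borel_surface (A : set pt) : measurable A -> measurable (A : set (@surface_space R n)).
Proof.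
rewrite measurable_rowE => mA.
suff : <<s @row_boxes R n >> `<=` (measurable : set (set (@surface_space R n))) by apply.
apply: smallest_sub; first exact: sigma_algebra_measurable.
have mh i c : measurable ([set x : pt | (x ord0 i <= c)%R] : set (@surface_space R n)).
  exact: half_space_caratheodory.
move=> _ [a [b ->]].
rewrite (_ : row_box a b = \bigcap_(i in [set: 'I_n])
    ([set x : pt | (x ord0 i <= b ord0 i)%R] `\` [set x : pt | (x ord0 i <= a ord0 i)%R])).
  apply: fin_bigcap_measurable; first exact: finite_finset.
  by move=> i _; apply: measurableD.
apply/seteqP; split => x h i.
  by move=> _; have /andP[h1 h2] := h i; split => //=; apply/negP; rewrite -ltNge.
by have [h1 /= /negP] := h i I; rewrite -ltNge => ->.
Qed.

End caratheodory.

(** * Surface integrals in a chart *)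

Section surface_chart.
Context {R : realType} (n : nat).
Local Notation pt := 'rV[R]_n.
Local Notation mu := (lebesgue_row n : {measure set pt -> \bar R}).
Local Notation chart := (@chart R n).
Local Notation sigma := (@surface_measure R n).
Variables (Om : set pt) (oO : open Om) (c : chart).
Hypothesis gc : good_chart Om c.
Local Notation nu := (cdir c).
Local Notation ze := (cgraph c).
Local Notation l := (crad c).
Local Notation S := (slab nu (1 : R)).
Implicit Types (x y z : pt) (q : pt -> R) (A D E F : set pt).
Let pr : pt -> pt := upd nu (fun=> 0).

Let pr_cont : continuous pr.
Proof. by apply: continuous_upd; exact: cst_continuous. Qed.

Let slab_box x0 (d : R) : 0 <= d -> let B := S `&` [set y | `|pr y - pr x0| <= d] in
  measurable B /\ (mu B <= ((4 * d) ^+ n.-1)%:E)%E.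
Proof.
move=> d0 B; have mB : measurable B.
  apply: measurableI; first exact: measurable_slab.
  apply: closed_row_measurable; apply: (@preimage_closed _ _ (fun y : pt => `|pr y - pr x0|) [set r | r <= d]); last exact: closed_le.
  move=> y _; apply: (@continuous_comp _ _ _ (fun y : pt => pr y - pr x0) (fun z : pt => `|z|)); last exact: norm_continuous.
  exact: (cvgB (@pr_cont y) (cvg_cst (pr x0))).
split=> //.
have H d' : d < d' -> (mu B <= ((2 * d') ^+ n.-1)%:E)%E.
  move=> dd'; have d'0 : 0 < d' by apply: le_lt_trans dd'.
  pose a : pt := \row_i if i == nu then 0 else x0 ord0 i - d'.
  pose b : pt := \row_i if i == nu then 1 else x0 ord0 i + d'.
  apply: (@le_trans _ _ (mu (row_box a b))).
    apply: (le_measure mu (mem_set mB) (mem_set (measurable_row_box a b))).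
    move=> y [yS hy] i; rewrite !mxE; case: eqP => [->//|/eqP inu].
    have := le_trans (row_coord_le _ i) hy; rewrite !mxE (negbTE inu) ler_norml => /andP[h1 h2].
    apply/andP; split; lra.
  rewrite [X in (X <= _)%E]lebesgue_row_box lee_fin /box_vol (bigD1 nu)//= !mxE eqxx subr0 max_r// mul1r.
  rewrite (eq_bigr (fun=> 2 * d')); last first.
    move=> i inu; rewrite !mxE (negbTE inu) max_r; last lra.
    by ring.
  by rewrite prodr_const cardC1 card_ord.
(* The boxes are half open, so the bound is known for every d' > d. For d = 0 a limit is taken,
   unless the exponent is 0 and the bound is 1. *)
have [d00|dn0] := eqVneq d 0; last first.
  have dp : 0 < d by rewrite lt_def dn0.
  have := H (2 * d); rewrite mulrA -natrM; apply; rewrite ltr_pMl// ltr1n//.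
rewrite d00 mulr0; case: (n.-1) H => [|m] H; first by have := H 1; rewrite !expr0 d00; apply.
rewrite expr0n /=; apply/lee_addgt0Pr => e e0; rewrite add0e.
pose d' := Num.min (e / 2) (1 / 2).
have d'0 : 0 < d' by rewrite lt_min !divr_gt0.
apply: le_trans (H d' _) _; rewrite ?d00// lee_fin exprS.
have h1 : 2 * d' <= e by rewrite mulrC -ler_pdivlMr// ge_min lexx.
have h2 : 2 * d' <= 1 by rewrite mulrC -ler_pdivlMr// ge_min lexx orbT.
have h0 : 0 <= 2 * d' by rewrite mulr_ge0// ltW.
by rewrite -[leRHS]mulr1; apply: ler_pM => //; rewrite ?exprn_ge0// exprn_ile1.
Qed.

(** The point of the graph over the projection of y to y_nu = 0: it carries boundary functions to
    functions on the slab that are constant along e_nu. *)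
Definition cpi y : pt := cSh c (pr y).

Lemma cpi_coord y i : i != nu -> cpi y ord0 i = y ord0 i.
Proof. by move=> inu; rewrite /cpi !mxE (negbTE inu). Qed.

Let cSh_cont : continuous (cSh c).
Proof.
rewrite cShE; apply: continuous_upd => x.
have [cz _ _] := smooth_is_grad (let: And4 _ h _ _ := gc in h).
exact: (cvgM (cvg_cst (flip (csgn c))) (cvgD (@coord_continuous _ 1 n ord0 nu x) (cz x))).
Qed.

Lemma cpi_cont : continuous cpi.
Proof. by move=> y; apply: (@continuous_comp _ _ _ pr (cSh c)); [exact: pr_cont|exact: cSh_cont]. Qed.

Lemma measurable_cpi : measurable_fun setT cpi.
Proof.
apply: measurable_row => i; apply: continuous_row_measurable => x.
by apply: (@continuous_comp _ _ _ cpi (fun y : pt => y ord0 i)); [exact: cpi_cont|exact: coord_continuous].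
Qed.

Lemma cpi_boundary y : `|cpi y - cpt c| <= 2 * l -> boundary Om (cpi y).
Proof.
move=> h; have l0 : 0 < l by case: gc.
apply: (graph_boundary oO gc); first by move: h; lra.
have iz : indep nu ze by case: gc.
rewrite [in RHS]mxE eqxx mxE eqxx add0r flipK.
apply: (indep_eq iz) => i inu; by rewrite cpi_coord// mxE (negbTE inu).
Qed.

(** Projecting the graph along e_nu does not increase distances. A piece of diameter d of a cover is
    seen in the slab inside a set of measure at most (4 d)^(n-1), against the cost of (d/2)^(n-1)
    times the normalising constant, which gives C. *)
Lemma slab_hausdorff : exists2 C, 0 < C & forall E, measurable (S `&` cpi @^-1` E) ->
  (mu (S `&` cpi @^-1` E) <= C%:E * hausdorff n.-1 E)%E.
Proof.
set hc := @hausdorff_const R n.-1; have hc0 : 0 < hc := hausdorff_const_gt0 n.-1.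
exists (8 ^+ n.-1 / hc); first by rewrite divr_gt0// exprn_gt0.
move=> E mE; set C := _ / _; have C0 : 0 < C by rewrite divr_gt0// exprn_gt0.
apply: (@le_trans _ _ (C%:E * cover_outer (hausdorff_cost n.-1 1) E)%E); last first.
  by rewrite lee_pmul2l// cov_hausdorff.
rewrite -lee_pdivrMl//; apply: le_ereal_inf_tmp => _ [F cF <-]; rewrite lee_pdivrMl//.
have H k : exists B, [/\ measurable B, S `&` cpi @^-1` (F k) `<=` B &
    (mu B <= C%:E * hausdorff_cost n.-1 1 (F k))%E].
  rewrite /hausdorff_cost; have [F0|/set0P[x0 Fx0]] := eqVneq (F k) set0.
    by exists set0; split; [exact: measurable0|rewrite F0 preimage_set0 setI0|rewrite measure0 mule0].
  case: ifPn => [hd|_]; last first.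
    by exists setT; split => //; rewrite mulry gtr0_sg// mul1e leey.
  set d := fine (ediam (F k)).
  have e0 x y : F k x -> F k y -> enorm (x - y) <= d.
    move=> Fx Fy; rewrite -lee_fin fineK.
      by apply: ereal_sup_ubound; exists x => //; exists y.
    rewrite ge0_fin_numE; first by apply: le_lt_trans hd _; exact: ltry.
    apply: le_trans (_ : (enorm (x - y))%:E <= _)%E; first by rewrite lee_fin sqrtr_ge0.
    by apply: ereal_sup_ubound; exists x => //; exists y.
  have d0 : 0 <= d by apply: le_trans (e0 _ _ Fx0 Fx0); exact: sqrtr_ge0.
  have [mB bB] := slab_box x0 d0.
  exists (S `&` [set y | `|pr y - pr x0| <= d]); split => //.
    move=> y [Sy /= Fy]; split => //=; apply: row_norm_le => // i.
    rewrite !mxE; case: eqP => [_|/eqP inu]; first by rewrite subrr normr0.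
    apply: le_trans (e0 _ _ Fy Fx0); apply: le_trans (le_enorm _); apply: le_trans (row_coord_le _ i).
    by rewrite [X in _ <= `|X|]mxE [X in _ <= `|_ + X|]mxE cpi_coord.
  apply: le_trans bB _; rewrite -EFinM lee_fin.
  rewrite /C mulrA mulfVK ?gt_eqF// -exprMn.
  by rewrite (_ : 8 * (d / 2) = 4 * d)//; lra.
have [B hB] := choice H.
rewrite -nneseriesZl; last by move=> k _; exact: hausdorff_cost_ge0.
apply: (@le_trans _ _ (\sum_(k <oo) mu (B k))%E); last first.
  by apply: lee_nneseries => // k _; have [] := hB k.
apply: measure_sigma_subadditive => //; first by move=> k; have [] := hB k.
by move=> y [Sy /cF[k _ Fk]]; exists k => //; have [_ h _] := hB k; exact: h.
Qed.

Lemma measurable_boundary : measurable (boundary Om).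
Proof.
apply: closed_row_measurable; rewrite /boundary setDE; apply: closedI; first exact: closed_closure.
exact/open_closedC/open_interior.
Qed.

Lemma measurable_surface_id :
  measurable_fun setT ((fun x : @surface_space R n => x) : @surface_space R n -> pt).
Proof. by move=> _ A mA; rewrite setTI; exact: borel_surface. Qed.

(** A one-sided comparison of measures takes the place of the area formula: q will be a product of
    absolute values of traces, to be shown small in the slab when it is small on the surface. *)
Lemma surface_integral : exists2 C, 0 < C & forall q, continuous q -> (forall x, 0 <= q x) -> insupp c q ->
  (\int[mu]_(y in S) (q (cpi y))%:E <= C%:E * \int[sigma]_(x in boundary Om) (q x)%:E)%E.
Proof.
have [C C0 hC] := slab_hausdorff; exists C => // q cq q0 sq.
pose D := boundary Om `&` [set x | `|x - cpt c| <= 2 * l].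
have mD : measurable D.
  apply: measurableI; first exact: measurable_boundary.
  apply: closed_row_measurable; apply: (@preimage_closed _ _ (fun y : pt => `|y - cpt c|) [set r | r <= 2 * l]); last exact: closed_le.
  move=> y _; apply: (@continuous_comp _ _ _ (fun y : pt => y - cpt c) (fun z : pt => `|z|)); last exact: norm_continuous.
  exact: (cvgB cvg_id (cvg_cst (cpt c))).
have mS := measurable_slab nu (1 : R).
have mq A : measurable_fun A (fun x => (q x)%:E) by apply/measurable_EFinP; exact: continuous_row_measurable.
have mpD : measurable (cpi @^-1` D) by rewrite -[X in measurable X]setTI; exact: measurable_cpi.
have mqp A : measurable A -> measurable_fun A (fun y => (q (cpi y))%:E).
  by move=> mA; apply: measurable_funTS; apply: (measurableT_comp (mq setT)); exact: measurable_cpi.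
pose m0 : {measure set pt -> \bar R} := mrestr mu mS.
pose m1f : {measure set pt -> \bar R} := pushforward m0 cpi.
pose m1 := m1f measurable_cpi.
pose m1' : {measure set pt -> \bar R} := mrestr m1 mD.
pose m2f : {measure set pt -> \bar R} := pushforward sigma (fun x : @surface_space R n => x : pt).
pose m2 := m2f measurable_surface_id.
pose m2' : {measure set pt -> \bar R} := mscale (NngNum (ltW C0)) m2.
have e1 : (\int[mu]_(y in S) (q (cpi y))%:E = \int[mu]_(y in S `&` cpi @^-1` D) (q (cpi y))%:E)%E.
  rewrite integral_mkcond [RHS]integral_mkcond; apply: eq_integral => y _; rewrite !patchE.
  have [hS|hS] := boolP (y \in S); last by rewrite [in RHS]in_setI (negbTE hS).
  have [hp|hp] := boolP (y \in cpi @^-1` D); first by rewrite in_setI hS hp.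
  rewrite in_setI (negbTE hp) andbF sq//.
  rewrite ltNge; apply/negP => h; move/negP: hp; apply; apply/mem_set; split => //.
  exact: cpi_boundary.
have e2 : (\int[mu]_(y in S `&` cpi @^-1` D) (q (cpi y))%:E = \int[m0]_(y in S `&` cpi @^-1` D) (q (cpi y))%:E)%E.
  apply: eq_measure_integral => A mA AS; rewrite /m0 /= /mrestr setIidl//.
  by move=> y /AS[].
have e3 : (\int[m0]_(y in S `&` cpi @^-1` D) (q (cpi y))%:E <= \int[m0]_(y in cpi @^-1` D) (q (cpi y))%:E)%E.
  apply: ge0_subset_integral => //; first exact: measurableI.
    exact: mqp.
  by move=> y _; rewrite lee_fin.
have e4 : (\int[m1]_(x in D) (q x)%:E = \int[m0]_(y in cpi @^-1` D) (q (cpi y))%:E)%E.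
  by rewrite (ge0_integral_pushforward measurable_cpi)// => y _; rewrite lee_fin.
have e5 : (\int[m1]_(x in D) (q x)%:E = \int[m1']_(x in D) (q x)%:E)%E.
  by apply: eq_measure_integral => A mA AD; rewrite /m1' /= /mrestr setIidl.
have e6 : (\int[m1']_(x in D) (q x)%:E <= \int[m2']_(x in D) (q x)%:E)%E.
  apply: ge0_le_measure_integral => // A mA.
  rewrite /m1' /= /mrestr /m1 /= /pushforward /m0 /= /mrestr setIC.
  have mAD : measurable (S `&` cpi @^-1` (A `&` D)).
    apply: measurableI => //; rewrite -[X in measurable X]setTI; apply: measurable_cpi => //; exact: measurableI.
  apply: le_trans (hC _ mAD) _; rewrite /mscale /= lee_pmul2l//.
  by apply: le_outer_measure => x [].
have e7 : (\int[m2']_(x in D) (q x)%:E = C%:E * \int[m2]_(x in D) (q x)%:E)%E.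
  by rewrite ge0_integral_mscale// => x _; rewrite lee_fin.
have e8 : (\int[m2]_(x in D) (q x)%:E = \int[sigma]_(x in D) (q x)%:E)%E.
  by rewrite (ge0_integral_pushforward measurable_surface_id)// => y _; rewrite lee_fin.
rewrite e1 e2; apply: le_trans e3 _; rewrite -e4 e5; apply: le_trans e6 _.
rewrite e7 e8; apply: lee_wpmul2l; first by rewrite lee_fin ltW.
apply: ge0_subset_integral.
- exact: borel_surface.
- exact: (borel_surface measurable_boundary).
- apply: measurable_funTS; exact: (measurableT_comp (mq setT) measurable_surface_id).
- by move=> x _; rewrite lee_fin.
- by move=> x [].
Qed.

End surface_chart.

Section abs_products.
Context {R : realType} (disp : measure_display) (T : measurableType disp) (m : {measure set T -> \bar R}) (D : set T) (mD : measurable D).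
Local Notation F := (L2_form m mD).
Implicit Types (a b : T -> R).
Local Notation "'absp' a" := ((fun x => `|a x|) : T -> R) (at level 10).

Lemma absdiff_nrm a b : fdom F a -> fdom F b -> fnrm F (absp a - absp b) <= fnrm F (a - b).
Proof.
move=> da db; have da' := L2on_abs da; have db' := L2on_abs db.
have d1 := @domB _ _ F _ _ da db; have d2 := @domB _ _ F _ _ da' db'.
rewrite /fnrm ler_wsqrtr//; apply: fip_le => // x _.
rewrite !fctE -!expr2 -[leLHS]real_normK ?num_real// -[leRHS]real_normK ?num_real//.
by rewrite lerXn2r ?nnegrE// ler_dist_dist.
Qed.

Lemma fip_abs_perturb a b a' b' : fdom F a -> fdom F b -> fdom F a' -> fdom F b' ->
  fip F (absp a) (absp b) <= fip F (absp a') (absp b') + fnrm F (a - a') * fnrm F b + fnrm F a' * fnrm F (b - b').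
Proof.
move=> da db da' db'.
have ea := L2on_abs da; have eb := L2on_abs db; have ea' := L2on_abs da'; have eb' := L2on_abs db'.
have dda := @domB _ _ F _ _ ea ea'; have ddb := @domB _ _ F _ _ eb eb'.
have -> : fip F (absp a) (absp b) = fip F (absp a') (absp b') + fip F (absp a - absp a') (absp b) + fip F (absp a') (absp b - absp b').
  by rewrite (@ipBl _ _ F _ _ _ ea ea' eb) (@ipBr _ _ F _ _ _ eb eb' ea'); ring.
rewrite -!addrA lerD2l; apply: lerD.
  apply: le_trans (@ip_le _ _ F _ _ dda eb) _; rewrite (absf_nrm m mD b).
  by rewrite ler_wpM2r ?nrm_ge0// absdiff_nrm.
apply: le_trans (@ip_le _ _ F _ _ ea' ddb) _; rewrite (absf_nrm m mD a').
by rewrite ler_wpM2l ?nrm_ge0// absdiff_nrm.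
Qed.

Lemma fip_EFin a b : fdom F a -> fdom F b -> (\int[m]_(x in D) (a x * b x)%:E)%E = (fip F a b)%:E.
Proof.
move=> da db; rewrite /= /L2_ip /Rintegral fineK//.
exact: (integrable_fin_num mD (L2on_integrableM mD da db)).
Qed.

End abs_products.

(** * Traces and the boundary forms *)

Section trace_forms.
Context {R : realType} (n : nat).
Local Notation pt := 'rV[R]_n.
Local Notation mu := (lebesgue_row n : {measure set pt -> \bar R}).
Local Notation sigma := (@surface_measure R n).
Local Notation chart := (@chart R n).
Local Notation jets := (@jets R n).
Variables (Om : set pt) (oO : open Om) (bO : bounded_set Om) (sO : smooth_boundary Om).
Variable gamma : (pt -> R) -> pt -> R.
Hypothesis htr : is_trace Om gamma.
Local Notation mO := (open_row_measurable oO).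
Local Notation FO := (H1form mO).
Local Notation mB := (borel_surface (@measurable_boundary R n Om)).
Local Notation FB := (L2_form sigma mB).
Implicit Types (x y z : pt) (f g u v psi : pt -> R) (gf gg gpsi : 'I_n -> pt -> R) (F G B : jets).

Lemma Hhalf_L2on E g : Hhalf E g -> L2on sigma E g.
Proof. by case. Qed.

Lemma Hhalf_snorm E (mE : measurable (E : set (@surface_space R n))) g : Hhalf E g ->
  fnrm (L2_form sigma mE) g <= snorm (Hhalf E) g.
Proof.
move=> hg; rewrite /fnrm /= ler_wsqrtr// L2_ipE lerDl; apply: fine_ge0.
by apply: integral_ge0 => x _; apply: integral_ge0 => y _; rewrite lee_fin divr_ge0 ?exprn_ge0// sqrtr_ge0.
Qed.

Lemma eqn_nrm f g : eqn (Hhalf (boundary Om)) f g -> L2on sigma (boundary Om) (f - g) /\ fnrm FB (f - g) = 0.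
Proof.
move=> [h1 h2]; split; first exact: Hhalf_L2on.
by apply/eqP; rewrite eq_le nrm_ge0 andbT -h2; exact: (Hhalf_snorm mB).
Qed.

Lemma H1_lincomb a u v : H1 Om u -> H1 Om v -> H1 Om (a *: u + v).
Proof.
move=> /H1_wjet[G hG <-] /H1_wjet[G' hG' <-].
exact: (wjet_H1 (wjetP a (mO) hG hG')).
Qed.

Lemma trace_diff u v : H1 Om u -> H1 Om v ->
  [/\ fdom FB (gamma u), fdom FB (gamma v), fdom FB (gamma (u - v)) & fnrm FB (gamma u - gamma v) <= fnrm FB (gamma (u - v))].
Proof.
move=> hu hv; have [[[h1 h2] _] _ _] := htr.
have huv : H1 Om (u - v) by have := H1_lincomb (-1) hv hu; rewrite scaleN1r addrC.
have d1 := Hhalf_L2on (h1 _ hu); have d2 := Hhalf_L2on (h1 _ hv); have d3 := Hhalf_L2on (h1 _ huv).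
split=> //; have := h2 (-1) _ _ hv hu; rewrite !scaleN1r addrC [- gamma v + _]addrC => /eqn_nrm[d4 n4].
have d5 := @domB _ _ FB _ _ d1 d2.
have := @nrmB _ _ FB _ _ d3 d4; rewrite n4 addr0.
by rewrite subKr.
Qed.

Lemma trace_bound : exists2 C, 0 <= C & forall G, wjet Om G ->
  snorm (Hhalf (boundary Om)) (gamma (G None)) <= C * fnrm FO G.
Proof.
have [[_ [C hC]] _ _] := htr; exists `|C| => // G hG.
apply: le_trans (hC _ (wjet_H1 hG)) _; rewrite (wjet_snorm (mO) oO hG).
by rewrite ler_wpM2r ?nrm_ge0// ler_norm.
Qed.

Lemma trace_C1 f gf : is_grad f gf -> H1dom Om (jet f gf) ->
  fdom FB f /\ fdom FB (gamma f) /\ fnrm FB (gamma f - f) = 0.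
Proof.
move=> hf df; have [[[h1 _] _] _ h3] := htr.
have hw := wjet_H1 (C1_wjet (mO) hf df); have [cf _ _] := hf.
have [d1 n1] := eqn_nrm (h3 _ hw (continuous_subspaceT cf)).
have d2 := Hhalf_L2on (h1 _ hw); split=> //.
by have := @domB _ _ FB _ _ d2 d1; rewrite opprB addrC subrK.
Qed.

(** The trace of a C^1 function is its restriction and the trace is continuous, so boundary values
    of H^1 approximations converge in L2 of the surface. All identities for [gamma] hold up to
    functions of seminorm zero. *)
Lemma trace_approx : exists2 C, 0 <= C & forall G f gf, wjet Om G -> is_grad f gf -> H1dom Om (jet f gf) ->
  [/\ fdom FB f, fdom FB (gamma (G None)) & fnrm FB (f - gamma (G None)) <= C * fnrm FO (jet f gf - G)].
Proof.
have [C C0 hC] := trace_bound; exists C => // G f gf hG hf df.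
have [d1 [d2 n2]] := trace_C1 hf df; have hw := C1_wjet (mO) hf df.
have [_ d3 d4 n4] := trace_diff (wjet_H1 hw) (wjet_H1 hG).
split=> //; have d5 := @domB _ _ FB _ _ d2 d1; have d6 := @domB _ _ FB _ _ d2 d3.
have := @nrmB _ _ FB _ _ d6 d5; rewrite n2 addr0.
have -> : gamma f - gamma (G None) - (gamma f - f) = f - gamma (G None).
  by apply/funext => x; rewrite !fctE; ring.
move=> /le_trans; apply; apply: le_trans n4 _.
have hd : wjet Om (jet f gf - G).
  by have := wjetP (-1) (mO) hG hw; rewrite scaleN1r addrC.
have [[[h1 _] _] _ _] := htr.
apply: le_trans (Hhalf_snorm mB (h1 _ (wjet_H1 hd))) (hC _ hd).
Qed.

Lemma surface_continuous (f : pt -> R) D : continuous f -> measurable_fun (D : set (@surface_space R n)) f.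
Proof.
move=> cf; apply: measurable_funTS; apply: (measurableT_comp _ (@measurable_surface_id R n)).
exact: continuous_row_measurable.
Qed.

(** For C^1 approximations of F and B, the product of the boundary values weighted by psi tends to 0
    in L1 of the surface. [surface_integral] transfers this to the slab of the chart, where
    [Bform_null] concludes. *)
Lemma trace_null (c : chart) k F B psi gpsi : good_chart Om c -> wjet Om F -> wjet Om B -> C1b psi gpsi ->
  (forall x, crad c <= `|x - cpt c| -> psi x = 0) ->
  fip FB (fun x => `|psi x * gamma (F None) x|) (fun x => `|gamma (B None) x|) = 0 ->
  Bform Om c k F (mulj psi gpsi B) = 0.
Proof.
move=> gc hF hB hp s0 hz.
have l0 : 0 < crad c by case: gc.
have app G (hG : wjet Om G) (m : nat) : exists fg : (pt -> R) * ('I_n -> pt -> R),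
    [/\ is_grad fg.1 fg.2, H1dom Om (jet fg.1 fg.2) & fnrm FO (jet fg.1 fg.2 - G) <= m.+1%:R^-1].
  have [|u [gu h]] := density oO bO sO hG (e := m.+1%:R^-1); first by rewrite invr_gt0.
  by exists (u, gu).
have [f hf] := choice (app _ hF); have [b hb] := choice (app _ hB).
have f1 m : is_grad (f m).1 (f m).2 by case: (hf m).
have f2 m : H1dom Om (jet (f m).1 (f m).2) by case: (hf m).
have f3 m : fnrm FO (jet (f m).1 (f m).2 - F) <= m.+1%:R^-1 by case: (hf m).
have b1 m : is_grad (b m).1 (b m).2 by case: (hb m).
have b2 m : H1dom Om (jet (b m).1 (b m).2) by case: (hb m).
have b3 m : fnrm FO (jet (b m).1 (b m).2 - B) <= m.+1%:R^-1 by case: (hb m).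
apply: (@Bform_null _ _ _ oO _ gc k F B psi gpsi (fun m => (f m).1) (fun m => (b m).1)
  (fun m => (f m).2) (fun m => (b m).2) hF.1 hB.1 hp s0 f1 f2 f3 b1 b2 b3) => e e0.
have [C C0 hC] := trace_approx; have [L L0 hL] := surface_integral oO gc.
have [[cp _ _] [K hK]] := hp; have K0 : 0 <= K by apply: le_trans (normr_ge0 _) (hK 0).1.
set gF := gamma (F None); set gB := gamma (B None).
have NF := nrm_ge0 FB gF; have NB := nrm_ge0 FB gB.
pose C' := L * (K * C * (fnrm FB gB + C) + K * fnrm FB gF * C).
have C'0 : 0 <= C'.
  by rewrite /C'; apply: mulr_ge0; [exact: ltW|apply: addr_ge0; rewrite !mulr_ge0// addr_ge0].
have [N hN] := inv_small C'0 e0; exists N => m hm; apply: le_trans (hN _ hm).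
have [d1 d2 n1] := hC _ _ _ hF (f1 m) (f2 m); have [d3 d4 n2] := hC _ _ _ hB (b1 m) (b2 m).
rewrite -/gF in d2 n1; rewrite -/gB in d4 n2.
have im : m.+1%:R^-1 <= 1 :> R by rewrite invf_le1// ler1n.
have n1' := le_trans n1 (ler_wpM2l C0 (f3 m)); have n2' := le_trans n2 (ler_wpM2l C0 (b3 m)).
have mp : measurable_fun (boundary Om : set (@surface_space R n)) psi by exact: surface_continuous.
have Kp x : boundary Om x -> `|psi x| <= K by move=> _; exact: (hK x).1.
have [p1 _] := L2on_mulb mB mp Kp d1; have [p2 p2n] := L2on_mulb mB mp Kp d2.
have [p3 p3n] := L2on_mulb mB mp Kp (@domB _ _ FB _ _ d1 d2).
have nb : fnrm FB (b m).1 <= fnrm FB gB + C.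
  have := @nrmD _ _ FB _ _ d4 (@domB _ _ FB _ _ d3 d4); rewrite addrC subrK => /le_trans; apply.
  by rewrite lerD2l; apply: le_trans n2' _; rewrite -[leRHS]mulr1 ler_wpM2l.
have key : fip FB (fun x => `|psi x * (f m).1 x|) (fun x => `|(b m).1 x|) <=
    (K * C * (fnrm FB gB + C) + K * fnrm FB gF * C) / m.+1%:R.
  apply: le_trans (fip_abs_perturb p1 d3 p2 d4) _; rewrite hz add0r mulrDl; apply: lerD.
    rewrite (_ : K * C * (fnrm FB gB + C) / m.+1%:R = (K * (C / m.+1%:R)) * (fnrm FB gB + C)); last by ring.
    apply: ler_pM; rewrite ?nrm_ge0//.
    rewrite (_ : _ - _ = (fun x => psi x * ((f m).1 - gF) x)); last by apply/funext => x; rewrite !fctE mulrBr.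
    by apply: le_trans p3n _; rewrite ler_wpM2l.
  by rewrite -!mulrA mulrA; apply: ler_pM; rewrite ?nrm_ge0.
pose th := cutoff (cpt c) (2 * crad c).
pose q x := `|th x * (f m).1 x| * `|psi x * (b m).1 x|.
have l2 : 0 < 2 * crad c by rewrite mulr_gt0.
have ct : continuous th by have [] := cutoff_is_grad (cpt c) (2 * crad c).
have cf : continuous (f m).1 by case: (f1 m).
have cb : continuous (b m).1 by case: (b1 m).
have cabs (g h : pt -> R) : continuous g -> continuous h -> continuous (fun x => `|g x * h x|).
  move=> cg ch x; apply: (@continuous_comp _ _ _ (fun x => g x * h x) (fun r : R => `|r|)); last exact: norm_continuous.
  exact: (cvgM (cg x) (ch x)).
have cq : continuous q by move=> x; exact: (cvgM (cabs _ _ ct cf x) (cabs _ _ cp cb x)).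
have q0 x : 0 <= q x by rewrite mulr_ge0.
have sq : insupp c q.
  by move=> x hx; rewrite /q /th cutoff0 ?(ltW hx)// !mul0r normr0 mul0r.
have hS := hL _ cq q0 sq.
have dabs1 := L2on_abs p1; have dabs2 := L2on_abs d3.
have qle : (\int[sigma]_(x in boundary Om) (q x)%:E <= (fip FB (fun x => `|psi x * (f m).1 x|) (fun x => `|(b m).1 x|))%:E)%E.
  rewrite -(fip_EFin dabs1 dabs2); apply: ge0_le_integral; [exact: mB|by move=> x _; rewrite lee_fin| | |].
  - by apply/measurable_EFinP; exact: surface_continuous.
  - by apply/measurable_EFinP; apply: measurable_funM; [have [] := dabs1|have [] := dabs2].
  move=> x _; rewrite lee_fin /q !normrM mulrA ler_wpM2r// mulrAC ler_wpM2r// -[leRHS]mul1r.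
  by rewrite ler_wpM2r// ger0_norm; have /andP[] := cutoff_bounds (cpt c) (2 * crad c) x.
have L0' : (0 <= L%:E)%E by rewrite lee_fin ltW.
have hS2 := le_trans hS (lee_wpmul2l L0' qle).
apply: (le_trans _ (_ : L * _ <= C' / m.+1%:R)); last first.
  by rewrite /C' -[leRHS]mulrA; exact: (ler_wpM2l (ltW L0) key).
rewrite -lee_fin EFinM; apply: le_trans hS2.
rewrite /= /L2_ip /Rintegral fineK//.
rewrite ge0_fin_numE; last by apply: integral_ge0 => x _; rewrite lee_fin mulr_ge0// normr_ge0.
apply: le_lt_trans hS _; apply: le_lt_trans (lee_wpmul2l L0' qle) _.
by rewrite -EFinM ltry.
Qed.

End trace_forms.

(** * Uniform boundedness *)

Section L2_complete.
Context {R : realType} (disp : measure_display) (T : measurableType disp) (m : {measure set T -> \bar R}) (D : set T) (mD : measurable D).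
Hypothesis finD : (m D < +oo)%E.
Local Notation F := (L2_form m mD).
Implicit Types (f g : T -> R).

Lemma geometric_cauchy (V : lmodType R) (Q : form V) (x : nat -> V) (d : R) : 0 <= d -> (forall k, fdom Q (x k)) ->
  (forall k, fnrm Q (x k.+1 - x k) <= d / 2 ^+ k) -> forall k j, fnrm Q (x (k + j)%N - x k) <= 2 * d / 2 ^+ k.
Proof.
move=> d0 dx hx k j.
suff h : fnrm Q (x (k + j)%N - x k) <= 2 * d / 2 ^+ k * (1 - 2 ^- j).
  apply: le_trans h _; apply: ler_piMr; first by rewrite divr_ge0 ?mulr_ge0 ?exprn_ge0.
  by rewrite lerBlDr lerDl invr_ge0 exprn_ge0.
elim: j => [|j ih]; first by rewrite addn0 subrr nrm0 expr0 invr1 subrr mulr0.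
apply: le_trans (@nrm_subD _ _ Q _ (x (k + j)%N) _ (dx _) (dx _) (dx _)) _.
rewrite addnS; apply: le_trans (lerD (hx _) ih) _.
rewrite exprD exprS !invfM le_eqVlt; apply/orP; left; apply/eqP; field.
by rewrite !expf_neq0.
Qed.

Variables (x : nat -> T -> R) (d : R).
Hypothesis dx : forall k, fdom F (x k).
Hypothesis hx : forall k, fnrm F (x k.+1 - x k) <= d / 2 ^+ k.

Let d0 : 0 <= d.
Proof. by have := le_trans (nrm_ge0 _ _) (hx 0); rewrite expr0 divr1. Qed.

Let one : T -> R := fun=> 1.
Let done1 : fdom F one.
Proof.
split; first exact: measurable_cst.
by under eq_integral do rewrite expr1n; rewrite integral_cst// mul1e.
Qed.
Let h k : T -> R := fun t => `|(x k.+1 - x k) t|.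
Let dh k : fdom F (h k).
Proof. by apply: L2on_abs; exact: (@domB _ _ F _ _ (dx _) (dx _)). Qed.
Let h0 k t : 0 <= h k t. Proof. exact: normr_ge0. Qed.
Let G (t : T) : \bar R := (\sum_(k <oo) (h k t)%:E)%E.

Let Gint : m.-integrable D G.
Proof.
have mh k : measurable_fun D (fun t => (h k t)%:E) by apply/measurable_EFinP; have [] := dh k.
apply/integrableP; split; first by apply: ge0_emeasurable_sum => // k t _ _; rewrite lee_fin.
rewrite (eq_integral G); last first.
  by move=> t _; rewrite gee0_abs//; apply: nneseries_ge0 => k _ _; rewrite lee_fin.
rewrite integral_nneseries//; last by move=> k t _; rewrite lee_fin.
apply: (@le_lt_trans _ _ (2 * d * fnrm F one)%:E); last exact: ltry.
apply: lime_le; first by apply: is_cvg_nneseries => k _ _; apply: integral_ge0 => t _; rewrite lee_fin.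
apply: nearW => N.
apply: (@le_trans _ _ (\sum_(0 <= k < N) (d * fnrm F one / 2 ^+ k)%:E)%E).
  apply: lee_sum => k _.
  under eq_integral do rewrite -[h k _]mulr1.
  rewrite (fip_EFin (dh k) done1) lee_fin; apply: le_trans (@ip_le _ _ F _ _ (dh k) done1) _.
  by rewrite mulrAC ler_wpM2r ?nrm_ge0// (absf_nrm m mD).
rewrite sumEFin lee_fin.
suff -> : \sum_(0 <= k < N) d * fnrm F one / 2 ^+ k = 2 * d * fnrm F one * (1 - 2 ^- N).
  apply: ler_piMr; first by rewrite !mulr_ge0 ?nrm_ge0.
  by rewrite lerBlDr lerDl invr_ge0 exprn_ge0.
elim: N => [|N ih]; first by rewrite big_geq// expr0 invr1 subrr mulr0.
rewrite big_nat_recr//= ih exprS invfM; field; by rewrite expf_neq0.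
Qed.

Let xcvg : {ae m, forall t, D t -> cvgn (fun k => x k t)}.
Proof.
apply: filterS (integrable_ae mD Gint) => t ht Dt.
have Gf := ht Dt; pose u k := x k.+1 t - x k t.
have cu : cvgn (series u).
  apply: normed_cvg; apply: nondecreasing_is_cvgn.
    by apply/nondecreasing_seqP => N; rewrite /= /series /= big_nat_recr//= lerDl.
  exists (fine (G t)) => _ [N _ <-] /=; rewrite -lee_fin fineK// /series /= -sumEFin.
  by apply: nneseries_lim_ge => k _ _; rewrite lee_fin.
have E : (fun k => x k t) = (fun k => x 0%N t + series u k).
  by apply/funext => k; rewrite /series /= telescope_sumr// addrC subrK.
by rewrite E; apply: is_cvgD => //; exact: is_cvg_cst.
Qed.

(** Riesz-Fischer: on a set of finite measure the increments are summable in L1, so the sequence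
    converges almost everywhere, and Fatou's lemma gives the rate. Taking an upper limit makes g
    measurable without reference to the null set. *)
Lemma L2_complete : exists2 g, fdom F g & forall k, fnrm F (g - x k) <= 2 * d / 2 ^+ k.
Proof.
pose g t := fine (limn_esup (fun k => (x k t)%:E)).
have mx k : measurable_fun D (x k) by have [] := dx k.
have mg : measurable_fun D g.
  apply: (measurableT_comp (@fine_measurable R setT measurableT)).
  by apply: measurable_fun_limn_esup => k; exact/measurable_EFinP.
have gE : {ae m, forall t, D t -> x k t @[k --> \oo] --> g t}.
  apply: filterS xcvg => t ht Dt; have /cvg_ex[r hr] := ht Dt.
  have hr' : (x k t)%:E @[k --> \oo] --> r%:E by apply: cvg_EFin => //; exact: nearW.
  by rewrite /g (cvg_limn_einf_sup hr').2.
pose b k : R := 2 * d / 2 ^+ k.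
have b0 k : 0 <= b k by rewrite divr_ge0 ?mulr_ge0 ?exprn_ge0.
have key k : (\int[m]_(t in D) (((g - x k) t) ^+ 2)%:E <= (b k ^+ 2)%:E)%E.
  pose f i t := (((x i - x k) t) ^+ 2)%:E.
  have mf i : measurable_fun D (f i).
    by apply/measurable_EFinP; apply: measurable_funX; apply: measurable_funB.
  have f0 i t : D t -> (0 <= f i t)%E by move=> _; rewrite lee_fin sqr_ge0.
  rewrite (@ge0_ae_eq_integral _ _ _ m D _ (fun t => limn_einf (f^~ t)))//.
  - apply: le_trans (fatou m mD mf f0) _; rewrite limn_einf_lim.
    apply: lime_le; first exact: is_cvg_einfs.
    apply: nearW => i; apply: le_trans (_ : \int[m]_(t in D) f (k + i)%N t <= _)%E.
      by apply: ereal_inf_lbound; exists (k + i)%N => //=; rewrite leq_addl.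
    have dd := @domB _ _ F _ _ (dx (k + i)%N) (dx k).
    under eq_integral do rewrite /f expr2.
    rewrite (fip_EFin dd dd) lee_fin -sqr_nrm lerXn2r ?nnegrE ?nrm_ge0//.
    exact: geometric_cauchy.
  - by apply/measurable_EFinP; apply: measurable_funX; apply: measurable_funB.
  - have mN i : measurable_fun D (fun t => (- f i t)%E) by exact: measurableT_comp.
    apply: (measurableT_comp (@oppe_measurable R setT)).
    exact: (measurable_fun_limn_esup mN).
  - by move=> t _; rewrite lee_fin sqr_ge0.
  - move=> t Dt; rewrite limn_einf_lim; apply: lime_ge; first exact: is_cvg_einfs.
    by apply: nearW => i; apply: le_ereal_inf_tmp => _ [j _ <-]; exact: f0.
  apply: filterS gE => t ht Dt; apply/esym; apply: (cvg_limn_einf_sup _).1.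
  apply: cvg_EFin; first exact: nearW.
  have hk : (fun i => x i t - x k t) @ \oo --> g t - x k t by exact: (cvgB (ht Dt) (cvg_cst _)).
  have hh : (fun i => (x i t - x k t) * (x i t - x k t)) @ \oo --> (g t - x k t) * (g t - x k t) by exact: (cvgM hk hk).
  exact: hh.
have dgk k : fdom F (g - x k).
  split; first by apply: measurable_funB.
  by apply: le_lt_trans (key k) _; exact: ltry.
have dg : fdom F g by have := @domD _ _ F _ _ (dgk 0%N) (dx 0%N); rewrite subrK.
exists g => // k; have := key k.
under eq_integral do rewrite expr2.
rewrite (fip_EFin (dgk k) (dgk k)) lee_fin -sqr_nrm => hk.
change (fnrm F (g - x k) <= b k).
by rewrite -(ger0_norm (nrm_ge0 F (g - x k))) -(ger0_norm (b0 k)) -!sqrtr_sqr ler_wsqrtr.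
Qed.
End L2_complete.

Section uniform_boundedness.
Context {R : realType} (V : lmodType R) (Q : form V) (M : R).
Local Notation nrm := (fnrm Q).
Variable dm : V -> Prop.
Hypothesis dmQ : forall x, dm x -> fdom Q x.
Hypothesis dmP : forall a x y, dm x -> dm y -> dm (a *: x + y).
Hypothesis dm0 : dm 0.
Hypothesis complete : forall (x : nat -> V) (d : R), (forall k, dm (x k)) ->
  (forall k, nrm (x k.+1 - x k) <= d / 2 ^+ k) -> exists2 y, dm y & forall k, nrm (y - x k) <= M * d / 2 ^+ k.
Variables (W : Type) (N : W -> R) (L : W -> V -> R).
Hypothesis N0 : forall w, 0 <= N w.
Hypothesis LP : forall w a x y, dm x -> dm y -> L w (a *: x + y) = a * L w x + L w y.
Hypothesis Lb : forall w, exists2 c, 0 <= c & forall x, dm x -> `|L w x| <= c * nrm x.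
Hypothesis Lp : forall x, dm x -> exists2 c, 0 <= c & forall w, `|L w x| <= c * N w.

Let dmB x y : dm x -> dm y -> dm (x - y).
Proof. by move=> hx hy; rewrite addrC -scaleN1r; exact: dmP. Qed.
Let dmZ a x : dm x -> dm (a *: x).
Proof. by move=> hx; rewrite -[_ *: _]addr0; exact: dmP. Qed.
Let LB w x y : dm x -> dm y -> L w (x - y) = L w x - L w y.
Proof. by move=> hx hy; rewrite addrC -scaleN1r LP// mulN1r addrC. Qed.

(* the gliding hump *)
Lemma uniform_boundedness : exists2 C, 0 <= C & forall w x, dm x -> `|L w x| <= C * nrm x * N w.
Proof.
apply: contrapT => nC.
have H C : 0 <= C -> exists w x, dm x /\ C * nrm x * N w < `|L w x|.
  move=> C0; apply: contrapT => nH; apply: nC; exists C => // w x hx.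
  by rewrite leNgt; apply/negP => h; apply: nH; exists w, x.
pose good (k : nat) (s s' : V * R) := [/\ dm s'.1, 0 < s'.2, nrm (s'.1 - s.1) <= s.2, s'.2 <= s.2 / 2 &
  exists w c, [/\ 0 < N w, 0 <= c, forall x, dm x -> `|L w x| <= c * nrm x, k.+1%:R * N w <= `|L w s'.1| &
    3 * c * s'.2 <= N w]].
have step (ks : nat * (V * R)) : exists s', dm ks.2.1 -> 0 < ks.2.2 -> good ks.1 ks.2 s'.
  case: ks => k [x d] /=; have [hx|] := pselect (dm x); last by exists (x, d).
  have [d0|] := pselect (0 < d); last by exists (x, d).
  have C0 : 0 <= k.+1%:R / d by rewrite divr_ge0// ltW.
  (* A vector violating the bound with constant (k + 1) / d: rescaled to norm d it becomes a hump
     [xi] on which the functional is at least (k + 1) [N w]. *)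
  have [w [a [ha hL]]] := H _ C0; have [c c0 hc] := Lb w; have [c' c'0 hc'] := Lp ha.
  have na0 : 0 <= nrm a := nrm_ge0 _ _.
  have L0 : 0 < `|L w a| by apply: le_lt_trans hL; rewrite mulr_ge0// mulr_ge0.
  have na : 0 < nrm a.
    by rewrite lt_def na0 andbT; apply/eqP => e; have := hc _ ha; rewrite e mulr0 leNgt L0.
  have nw : 0 < N w.
    by rewrite lt_def N0 andbT; apply/eqP => e; have := hc' w; rewrite e mulr0 leNgt L0.
  pose xi := (d / nrm a) *: a; have dxi : dm xi by exact: dmZ.
  have nxi : nrm xi = d.
    by rewrite /xi (nrmZ _ (dmQ ha)) ger0_norm ?divr_ge0 ?(ltW d0)// mulfVK// gt_eqF.
  have Lxi : k.+1%:R * N w <= `|L w xi|.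
    rewrite /xi -[_ *: _]addr0 LP// (_ : L w 0 = 0); last by rewrite -(subrr a) LB// subrr.
    rewrite addr0 normrM (ger0_norm (divr_ge0 (ltW d0) na0)) mulrAC ler_pdivlMr// mulrC.
    rewrite -ler_pdivrMl// mulrC; apply: le_trans (ltW hL); rewrite le_eqVlt; apply/orP; left.
    by apply/eqP; ring.
  (* All later moves together have size at most 3 d', and so change the value of this functional by
     at most [N w]. *)
  pose d' := Num.min (d / 2) (N w / (3 * c + 1)).
  have c1 : 0 < 3 * c + 1 by rewrite ltr_wpDl// mulr_ge0.
  have d'0 : 0 < d' by rewrite lt_min !divr_gt0.
  have hd' : 3 * c * d' <= N w.
    apply: (@le_trans _ _ ((3 * c + 1) * (N w / (3 * c + 1)))); last by rewrite mulrC divfK// gt_eqF.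
    by apply: ler_pM => //; rewrite ?mulr_ge0// ?(ltW d'0)// ?lerDl// ge_min lexx orbT.
  (* The value at [xi] is half the difference of the values at x + xi and x - xi, so one of these
     two is large as well, whatever the value at x. *)
  have [x' [hx' nx' Lx']] : exists x', [/\ dm x', nrm (x' - x) <= d & k.+1%:R * N w <= `|L w x'|].
    have dp : dm (x + xi) by have := dmP 1 hx dxi; rewrite scale1r.
    have dn : dm (x - xi) by exact: dmB.
    have [h|h] := leP (k.+1%:R * N w) `|L w (x + xi)|.
      by exists (x + xi); split => //; rewrite addrAC subrr add0r nxi.
    exists (x - xi); split => //; first by rewrite addrAC subrr add0r (nrmN (dmQ dxi)) nxi.
    rewrite leNgt; apply/negP => h'; move: Lxi; rewrite leNgt => /negP; apply.
    have e : L w xi = 2^-1 * (L w (x + xi) - L w (x - xi)).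
      have := LP w 1 hx dxi; rewrite scale1r mul1r => ->; rewrite LB//.
      by field.
    rewrite e normrM ger0_norm ?invr_ge0//; apply: (@le_lt_trans _ _ (2^-1 * (`|L w (x + xi)| + `|L w (x - xi)|))).
      by rewrite ler_wpM2l ?invr_ge0// ler_normB.
    move: h h'; lra.
  exists (x', d') => _ _; split => //=; first by rewrite ge_min lexx.
  by exists w, c.
have [f hf] := choice step.
pose s := fix s k := if k is k'.+1 then f (k', s k') else (0 : V, 1 : R).
have sP k : dm (s k).1 /\ 0 < (s k).2.
  elim: k => [|k [ih1 ih2]]; first by split=> //=; exact: ltr01.
  by have [] := hf (k, s k) ih1 ih2.
have sG k : good k (s k) (s k.+1) by have [h1 h2] := sP k; exact: (hf (k, s k) h1 h2).
pose x k := (s k).1; pose e k := (s k).2.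
have dx k : dm (x k) := (sP k).1.
have e0 k : 0 < e k := (sP k).2.
have eS k j : e (k + j)%N <= e k / 2 ^+ j.
  elim: j => [|j ih]; first by rewrite addn0 expr0 divr1.
  rewrite addnS; have [_ _ _ h _] := sG (k + j)%N; apply: le_trans h _.
  by rewrite exprSr invfM mulrA ler_wpM2r ?invr_ge0.
have xS k : nrm (x k.+1 - x k) <= e k by have [_ _ h _ _] := sG k.
have [y dy hy] : exists2 y, dm y & forall k, nrm (y - x k) <= M * 1 / 2 ^+ k.
  apply: complete => // k; apply: le_trans (xS k) _.
  by have := eS 0%N k; rewrite add0n.
(* The constant M drops out: y is compared with a later term, for which M / 2^(k + K) is below
   [e k], and the steps in between add up to at most 2 [e k]. *)
have tail k : nrm (y - x k) <= 3 * e k.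
  have [K [_ hK]] : exists K, (0 <= K)%N /\ forall i, (K <= i)%N -> M * 1 / 2 ^+ i <= e k.
    have c0 : 0 <= `|M| by [].
    have [q hq] := exp2_small (divr_gt0 (e0 k) (ltr_wpDl c0 ltr01)).
    exists q; split => // i qi; rewrite mulr1; apply: (@le_trans _ _ ((`|M| + 1) / 2 ^+ i)).
      by rewrite ler_wpM2r ?invr_ge0 ?exprn_ge0// (le_trans (ler_norm _))// lerDl.
    rewrite mulrC -ler_pdivlMr ?ltr_wpDl//; apply: le_trans (ltW hq).
    by rewrite lef_pV2 ?posrE ?exprn_gt0// ler_weXn2l// ler1n.
  have h1 := hK (k + K)%N (leq_addl _ _).
  have h2 := @geometric_cauchy _ _ Q (fun j => x (k + j)%N) (e k) (ltW (e0 k)) (fun j => dmQ (dx _)) _ 0%N K.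
  have h3 : nrm (x (k + K)%N - x k) <= 2 * e k.
    have := h2 _; rewrite add0n addn0 expr0 divr1; apply => j.
    by rewrite addnS; exact: le_trans (xS _) (eS _ _).
  have := @nrm_subD _ _ Q _ (x (k + K)%N) _ (dmQ dy) (dmQ (dx _)) (dmQ (dx k)).
  by have := le_trans (hy _) h1; move: h3; lra.
have [c c0 hc] := Lp dy.
pose k := (Num.truncn c).+1; have kc : c < k%:R := truncnS_gt c.
have [_ _ _ _ [w [b [nw b0 hb hLk hbk]]]] := sG k.
have h1 : `|L w (s k.+1).1| <= `|L w y| + N w.
  have -> : L w (s k.+1).1 = L w y - L w (y - x k.+1) by rewrite LB// opprB addrC subrK.
  apply: le_trans (ler_normB _ _) _; rewrite lerD2l.
  apply: le_trans (hb _ (dmB dy (dx _))) _; apply: le_trans (ler_wpM2l b0 (tail _)) _.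
  by apply: le_trans hbk; rewrite mulrA (mulrC b).
have h2 := le_trans hLk (le_trans h1 (lerD (hc w) (lexx _))).
have h3 : (k.+1%:R : R) <= c + 1 by rewrite -(ler_pM2r nw) [leRHS]mulrDl mul1r.
by move: h3; rewrite -natr1 lerD2r leNgt kc.
Qed.
End uniform_boundedness.

Section H1_complete.
Context {R : realType} (n : nat).
Local Notation pt := 'rV[R]_n.
Local Notation mu := (lebesgue_row n : {measure set pt -> \bar R}).
Local Notation jets := (@jets R n).
Variables (Om : set pt) (mO : measurable Om).
Hypothesis finO : (mu Om < +oo)%E.
Local Notation FO := (H1form mO).

(** Each component converges in L2, and the integration by parts formula passes to the limit against
    a fixed test function. The constant counts the n + 1 components, with the factor 2 of
    [L2_complete]. *)
Lemma H1_complete (x : nat -> jets) (d : R) : (forall k, wjet Om (x k)) ->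
  (forall k, fnrm FO (x k.+1 - x k) <= d / 2 ^+ k) ->
  exists2 y, wjet Om y & forall k, fnrm FO (y - x k) <= (n.+1%:R * 2) * d / 2 ^+ k.
Proof.
move=> wx hx; have dx k : H1dom Om (x k) by case: (wx k).
have comp i : exists g, L2on mu Om g /\ forall k, fnrm (L2_form mu mO) (g - x k i) <= 2 * d / 2 ^+ k.
  have [||g dg hg] := @L2_complete _ _ _ mu Om mO finO (fun k => x k i) d.
  - by move=> k; exact: dx.
  - by move=> k; apply: le_trans (hx k); exact: (H1_comp_le mO (x k.+1 - x k) i).
  by exists g.
have [y hy] := choice comp.
have dy : H1dom Om y by move=> i; exact: (hy i).1.
have b k : fnrm FO (y - x k) <= n.+1%:R * 2 * d / 2 ^+ k.
  by rewrite -!mulrA; apply: H1_nrm_bound => i; rewrite mulrA; exact: (hy i).2.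
exists y => //; split => // i phi hphi.
have hC := test_C1c hphi.
have d1 : L2on mu Om phi := C1c_L2 mO hC.
have d2 : L2on mu Om (partial i phi) := @C1c_L2_grad _ _ _ _ _ i mO hC.
pose L := L2_form mu mO.
apply/eqP; rewrite -subr_eq0 opprK; apply/eqP.
have d00 : 0 <= d by have := le_trans (nrm_ge0 _ _) (hx 0%N); rewrite expr0 divr1.
apply: (@real_le0_small _ _ (fnrm L (partial i phi) + fnrm L phi)); first by rewrite addr_ge0 ?nrm_ge0.
move=> e e0.
have C0 : 0 < 2 * d + 1 by rewrite ltr_wpDl// mulr_ge0.
have [k hk] := exp2_small (divr_gt0 e0 C0).
have be : 2 * d / 2 ^+ k <= e.
  apply: (@le_trans _ _ ((2 * d + 1) / 2 ^+ k)); first by rewrite ler_wpM2r ?invr_ge0 ?exprn_ge0// lerDl.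
  by rewrite mulrC -ler_pdivlMr// ltW.
have wk := (wx k).2 i phi hphi.
have e1 : \int[mu]_(z in Om) (y None z * partial i phi z) = fip L (y None - x k None) (partial i phi) + fip L (x k None) (partial i phi).
  by rewrite -ipDl ?subrK//; [exact: (@domB _ _ L _ _ (dy _) (dx _ _))|exact: dx].
have e2 : \int[mu]_(z in Om) (y (Some i) z * phi z) = fip L (y (Some i) - x k (Some i)) phi + fip L (x k (Some i)) phi.
  by rewrite -ipDl ?subrK//; [exact: (@domB _ _ L _ _ (dy _) (dx _ _))|exact: dx].
have -> : \int[mu]_(z in Om) (y None z * partial i phi z) + \int[mu]_(z in Om) (y (Some i) z * phi z) =
   fip L (y None - x k None) (partial i phi) + fip L (y (Some i) - x k (Some i)) phi.
  by rewrite e1 e2 [fip L (x k None) _]wk /= /L2_ip; ring.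
apply: le_trans (ler_normD _ _) _; rewrite mulrDl; apply: lerD.
  apply: le_trans (@cauchy_schwarz _ _ L _ _ (@domB _ _ L _ _ (dy _) (dx k _)) d2) _.
  by rewrite mulrC ler_wpM2l ?nrm_ge0// (le_trans ((hy None).2 k)).
apply: le_trans (@cauchy_schwarz _ _ L _ _ (@domB _ _ L _ _ (dy _) (dx k _)) d1) _.
by rewrite mulrC ler_wpM2l ?nrm_ge0// (le_trans ((hy (Some i)).2 k)).
Qed.
End H1_complete.

Section raw_integrals.
Context {R : realType} (disp : measure_display) (T : measurableType disp) (m : {measure set T -> \bar R}).
Local Open Scope ereal_scope.
Import HBNNSimple.

(* no measurability of the integrands is assumed: this is monotonicity of the
   supremum over simple functions *)
Lemma ge0_le_integral_raw (E E' N : set T) (f g : T -> \bar R) : measurable N -> m N = 0 ->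
  (forall x, 0 <= f x) -> (forall x, 0 <= g x) -> (forall x, E x -> ~ N x -> E' x /\ f x <= g x) ->
  \int[m]_(x in E) f x <= \int[m]_(x in E') g x.
Proof.
move=> mN N0 f0 g0 fg; rewrite !ge0_integralE//; apply: ge_ereal_sup => _ [h hf <-].
pose h' := mul_nnsfun h (indic_nnsfun R (measurableC mN)).
have iE (k : {nnsfun T >-> R}) : sintegral m k = \int[m]_x (k x)%:E.
  by rewrite integral_nnsfun// patch_setT.
have -> : sintegral m h = sintegral m h'.
  rewrite !iE; apply: ae_eq_integral => //.
  - by apply/measurable_EFinP.
  - by apply/measurable_EFinP.
  exists N; split => // x /= /not_implyP[_ hx]; apply: contrapT => nN; apply: hx.
  by rewrite /h' /= /mindic indicE mem_set// mulr1.
apply: ereal_sup_ubound; exists h' => // x.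
have p0 : 0 <= (g \_ E') x by rewrite patchE; case: ifP.
have [Nx|nNx] := pselect (N x).
  by rewrite /h' /= /mindic indicE memNset ?mulr0//; exact.
rewrite /h' /= /mindic indicE mem_set// mulr1; apply: le_trans (hf x) _.
rewrite patchE; case: ifPn => // /set_mem Ex; have [E'x fgx] := fg _ Ex nNx.
by rewrite patchE mem_set.
Qed.
End raw_integrals.

(** * Boundary functions up to null sets *)

Section trace_ae.
Context {R : realType} (n : nat).
Local Notation pt := 'rV[R]_n.
Local Notation mu := (lebesgue_row n : {measure set pt -> \bar R}).
Local Notation sigma := (@surface_measure R n).
Local Notation jets := (@jets R n).
Implicit Types (x y z : pt) (f g u v psi : pt -> R) (F G B : jets) (E : set pt).

(** Covers restriction to a smaller set and modification on a null set at once. The inner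
    Slobodeckij integral comes with no measurability in its parameter, so monotonicity is taken from
    [ge0_le_integral_raw]. *)
Lemma Hhalf_snorm_le (E E' N : set (@surface_space R n)) g g' : measurable N -> sigma N = 0%E ->
  E `<=` E' -> measurable E -> measurable_fun E g' -> Hhalf E' g ->
  (forall x, E x -> ~ N x -> g' x = g x) -> Hhalf E g' /\ snorm (Hhalf E) g' <= snorm (Hhalf E') g.
Proof.
move=> mN N0 EE' mE mg' [mg g2 gs] e.
have i2 : (\int[sigma]_(x in E) (g' x ^+ 2)%:E <= \int[sigma]_(x in E') (g x ^+ 2)%:E)%E.
  apply: (ge0_le_integral_raw mN N0) => [x|x|x Ex Nx]; rewrite ?lee_fin ?sqr_ge0//.
  by split; [exact: EE'|rewrite e].
have q0 h x y : 0 <= `|h x - h y : R| ^+ 2 / enorm (x - y) ^+ n.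
  by rewrite divr_ge0 ?exprn_ge0// sqrtr_ge0.
have is' : (slobodeckij E g' <= slobodeckij E' g)%E.
  apply: (ge0_le_integral_raw mN N0) => [x|x|x Ex Nx].
  - by apply: integral_ge0 => y _; rewrite lee_fin.
  - by apply: integral_ge0 => y _; rewrite lee_fin.
  split; first exact: EE'.
  apply: (ge0_le_integral_raw mN N0) => [y|y|y Ey Ny]; rewrite ?lee_fin//.
  by split; [exact: EE'|rewrite !e].
have f2 := le_lt_trans i2 g2; have fs := le_lt_trans is' gs.
have p2 (D : set (@surface_space R n)) (h : pt -> R) : (0 <= \int[sigma]_(x in D) (h x ^+ 2)%:E)%E by apply: integral_ge0 => x _; rewrite lee_fin sqr_ge0.
have ps (D : set pt) (h : pt -> R) : (0 <= slobodeckij D h)%E.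
  by apply: integral_ge0 => x _; apply: integral_ge0 => y _; rewrite lee_fin.
split; first by split.
have fn (a : \bar R) : (0 <= a)%E -> (a < +oo)%E -> a \is a fin_num by move=> a0 af; rewrite ge0_fin_numE.
apply: ler_wsqrtr; apply: lerD.
  exact: (fine_le (fn _ (p2 E g') f2) (fn _ (p2 E' g) g2) i2).
exact: (fine_le (fn _ (ps E g') fs) (fn _ (ps E' g) gs) is').
Qed.

Variables (Om : set pt) (oO : open Om).
Variable gamma : (pt -> R) -> pt -> R.
Hypothesis htr : is_trace Om gamma.
Local Notation mB := (borel_surface (@measurable_boundary R n Om)).
Local Notation FB := (L2_form sigma mB).

Definition bae (P : pt -> Prop) := exists N : set (@surface_space R n),
  [/\ measurable N, sigma N = 0%E & forall x, boundary Om x -> ~ N x -> P x].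

Lemma bae_and (P Q S : pt -> Prop) : bae P -> bae Q -> (forall x, boundary Om x -> P x -> Q x -> S x) -> bae S.
Proof.
move=> [N [mN N0 hN]] [N' [mN' N0' hN']] h; exists (N `|` N'); split; first exact: measurableU.
  by rewrite (measureU0 mN mN' N0').
by move=> x bx nx; apply: h => //; [apply: hN|apply: hN'] => // hx; apply: nx; [left|right].
Qed.

Lemma bae_imp (P S : pt -> Prop) : bae P -> (forall x, boundary Om x -> P x -> S x) -> bae S.
Proof. by move=> hP h; apply: (bae_and hP (hP)) => x bx hx _; exact: h. Qed.

Lemma nrm0_ae f : fdom FB f -> fnrm FB f = 0 -> bae (fun x => f x = 0).
Proof.
move=> df n0.
have h : (\int[sigma]_(x in boundary Om) `|(f x ^+ 2)%:E| = 0)%E.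
  have -> : (\int[sigma]_(x in boundary Om) `|(f x ^+ 2)%:E| = \int[sigma]_(x in boundary Om) (f x ^+ 2)%:E)%E.
    by apply: eq_integral => x _; rewrite gee0_abs// lee_fin sqr_ge0.
  by rewrite (EFin_L2_ip mB df) -[L2_ip _ _ _ _]/(fip FB f f) ip_nrm2 n0 expr0n.
have mf : measurable_fun (boundary Om : set (@surface_space R n)) (fun x => (f x ^+ 2)%:E).
  by apply/measurable_EFinP; apply: measurable_funX; have [] := df.
have [N [mN N0 hN]] := (ae_eq_integral_abs sigma mB mf).1 h; exists N; split => // x bx nx.
apply: contrapT => fx; apply: nx; apply: hN => /= hx.
by have /eqP := hx bx; rewrite eqe sqrf_eq0 => /eqP.
Qed.

Lemma ae_fip0 psi f g : continuous psi -> (exists C, forall x, `|psi x| <= C) -> fdom FB f -> fdom FB g ->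
  bae (fun x => psi x * (f x * g x) = 0) ->
  fip FB (fun x => `|psi x * f x|) (fun x => `|g x|) = 0.
Proof.
move=> cp [C hC] df dg [N [mN N0 hN]].
have mp : measurable_fun (boundary Om : set (@surface_space R n)) psi by exact: surface_continuous.
have [dpf _] := L2on_mulb mB mp (fun x _ => hC x) df.
have a1 := L2on_abs dpf; have a2 := L2on_abs dg.
have mf : measurable_fun (boundary Om : set (@surface_space R n)) (fun x => (`|psi x * f x| * `|g x|)%:E).
  by apply/measurable_EFinP; apply: measurable_funM; [have [] := a1|have [] := a2].
have hae : ae_eq sigma (boundary Om) (fun x => (`|psi x * f x| * `|g x|)%:E) (cst 0%E).
  exists N; split => // x /= /not_implyP[bx hx]; apply: contrapT => nx; apply: hx.
  by have := hN _ bx nx; rewrite -normrM -mulrA => ->; rewrite normr0.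
have := fip_EFin (mD := mB) a1 a2.
by rewrite (@ae_eq_integral _ _ _ sigma (boundary Om) (cst 0%E) _ mB mf (measurable_cst _) hae) integral0 => -[].
Qed.

Lemma eqn_ae f g : eqn (Hhalf (boundary Om)) f g -> bae (fun x => f x = g x).
Proof.
move=> /eqn_nrm[d0 n0]; apply: bae_imp (nrm0_ae d0 n0) _ => x bx h.
by apply/eqP; rewrite -subr_eq0; apply/eqP.
Qed.

Lemma traceB_ae u v : H1 Om u -> H1 Om v -> bae (fun x => gamma (u - v) x = gamma u x - gamma v x).
Proof.
move=> hu hv; have [[[h1 h2] _] _ _] := htr.
have := h2 (-1) _ _ hv hu; rewrite !scaleN1r addrC [- gamma v + _]addrC => /eqn_ae h.
by apply: bae_imp h _ => x bx ->.
Qed.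

Lemma trace_C1_ae f gf : is_grad f gf -> H1dom Om (jet f gf) -> bae (fun x => gamma f x = f x).
Proof.
move=> hf df; have [_ _ h3] := htr.
have hw := wjet_H1 (C1_wjet (open_row_measurable oO) hf df); have [cf _ _] := hf.
exact: eqn_ae (h3 _ hw (continuous_subspaceT cf)).
Qed.

End trace_ae.

(** On O the function a is null, and off O and E the function b is zero, so only E contributes. O
    will be the complement of the support of a lifting and E the region [omega_r]. *)
Lemma L2_local {R : realType} d (T : measurableType d) (m : {measure set T -> \bar R}) (D O E : set T)
  (mD : measurable D) (mO : measurable O) (mE : measurable E) (a b : T -> R) : O `<=` D -> E `<=` D ->
  L2on m D a -> L2on m D b -> L2_ip m O a a = 0 -> (forall x, D x -> ~ O x -> ~ E x -> b x = 0) ->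
  `|L2_ip m D a b| <= fnrm (L2_form m mD) a * fnrm (L2_form m mE) b.
Proof.
move=> OD ED da db a0 b0; pose L := L2_form m mD.
have mi (A : set T) : measurable A -> measurable_fun D (\1_A : T -> R) by move=> mA; exact: measurable_indic.
have i1 (A : set T) x : D x -> `|\1_A x : R| <= 1 by rewrite indicE; case: (x \in A); rewrite ?normr1 ?normr0.
have [d1 _] := L2on_mulb mD (mi _ mE) (@i1 E) db.
have [d2 _] := L2on_mulb mD (mi _ (measurableC mE)) (@i1 (~` E)) db.
have sub (A : set T) (f : T -> R) : measurable A -> A `<=` D -> (forall x, D x -> ~ A x -> f x = 0) ->
    \int[m]_(x in D) f x = \int[m]_(x in A) f x.
  move=> mA AD f0; rewrite Rintegral_mkcond [RHS]Rintegral_mkcond; apply: eq_Rintegral => x _; rewrite !patchE.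
  have [Ax|nAx] := pselect (A x); first by rewrite !mem_set//; exact: AD.
  rewrite [in RHS]memNset//; case: ifPn => // /set_mem Dx; exact: f0.
have -> : b = (fun x => \1_E x * b x) + (fun x => \1_(~` E) x * b x).
  apply/funext => x; rewrite !fctE -mulrDl !indicE in_setC.
  by case: (x \in E); rewrite /= ?addr0 ?add0r mul1r.
rewrite -[L2_ip _ _ _ _]/(fip L a _) (@ipDr _ _ L _ _ _ d1 d2 da).
have -> : fip L a (fun x => \1_(~` E) x * b x) = 0.
  rewrite /= /L2_ip (sub O)//; last first.
    move=> x Dx nO; rewrite indicE in_setC; have [Ex|nE] := boolP (x \in E); first by rewrite mul0r mulr0.
    by rewrite b0 ?mulr0// => /mem_set h; rewrite h in nE.
  have := @cauchy_schwarz _ _ (L2_form m mO) _ _ (L2on_sub mD mO OD da) (L2on_sub mD mO OD d2).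
  by rewrite [X in _ <= X * _]/fnrm [X in Num.sqrt X]a0 sqrtr0 mul0r normr_le0 => /eqP.
rewrite addr0 /= /L2_ip (sub E)//; last by move=> x Dx nE; rewrite indicE memNset// mul0r mulr0.
have -> : \int[m]_(x in E) (a x * (\1_E x * b x)) = fip (L2_form m mE) a b.
  by apply: eq_Rintegral => x Ex; rewrite indicE Ex mul1r.
have dbE : L2on m E b := L2on_sub mD mE ED db; have daE : L2on m E a := L2on_sub mD mE ED da.
have -> : fnrm (L2_form m mE) ((fun x => \1_E x * b x) + (fun x => \1_(~` E) x * b x)) = fnrm (L2_form m mE) b.
  rewrite /fnrm; congr Num.sqrt; apply: eq_Rintegral => x Ex; rewrite !fctE !indicE in_setC Ex /=.
  by rewrite !mul0r !addr0 !mul1r.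
apply: le_trans (@cauchy_schwarz _ _ (L2_form m mE) _ _ daE dbE) _.
by rewrite ler_wpM2r ?nrm_ge0// /fnrm ler_wsqrtr// L2_ip_sub.
Qed.

(** * The regional estimate *)

Section estimate.
Context {R : realType} (n : nat).
Local Notation pt := 'rV[R]_n.
Local Notation mu := (lebesgue_row n : {measure set pt -> \bar R}).
Local Notation sigma := (@surface_measure R n).
Local Notation chart := (@chart R n).
Local Notation jets := (@jets R n).
Implicit Types (x y z : pt) (f g u v psi : pt -> R) (gf gg gpsi : 'I_n -> pt -> R) (A B F G : jets).
Variables (Om Gam : set pt) (r : R) (gamma T : (pt -> R) -> pt -> R).
Hypotheses (oO : open Om) (bO : bounded_set Om) (sO : smooth_boundary Om).
Hypotheses (htr : is_trace Om gamma) (hT : is_trace_lifting Om gamma T).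
Hypotheses (GB : Gam `<=` boundary Om) (mG : measurable (Gam : set (@surface_space R n))).
Hypothesis hext : forall zb, Hhalf Gam zb -> Hhalf (boundary Om) (p_ext0 Gam zb).
Hypothesis r0 : 0 < r.
Local Notation om := (omega_r Om Gam T r).
Hypotheses (oom : open om) (som : om `<=` Om).
Local Notation mO := (open_row_measurable oO).
Local Notation mo := (open_row_measurable oom).
Local Notation FO := (H1form mO).
Local Notation Fo := (H1form mo).
Local Notation mB := (borel_surface (@measurable_boundary R n Om)).
Local Notation bae := (bae Om).

Let finO : (mu Om < +oo)%E.
Proof.
have [M [_ hM]] := bO; have [k [_ hk]] := @ex_cube R n (`|M| + 1).
apply: (@le_lt_trans _ _ (mu (@row_cube R n k))); last by rewrite lebesgue_row_cube ltry.
apply: (le_measure mu (mem_set (mO)) (mem_set (@measurable_row_cube R n k))) => x Ox; apply: hk.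
by apply: hM Ox; apply: le_lt_trans (ler_norm _) _; rewrite ltrDl.
Qed.

Lemma p_ext0E g x : p_ext0 Gam g x = if x \in Gam then g x else 0.
Proof. by rewrite /p_ext0 patchE. Qed.

Lemma trace_restr u : H1 Om u -> Hhalf Gam (gamma u) /\ Hhalf (boundary Om) (p_ext0 Gam (gamma u)).
Proof.
move=> hu; have [[[h1 _] _] _ _] := htr; have h := h1 _ hu.
have mg : measurable_fun (Gam : set (@surface_space R n)) (gamma u).
  by apply: (measurable_funS mB GB); case: h.
have [||h' _] := @Hhalf_snorm_le _ _ Gam (boundary Om) set0 (gamma u) (gamma u) measurable0 _ GB mG mg h.
  exact: measure0.
  by [].
exact: (conj h' (hext h')).
Qed.

(* [p.2] is a lifting of the trace of [p.1] cut off outside [Gam] *)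
Definition cut_pair (p : jets * jets) :=
  [/\ wjet Om p.1, wjet Om p.2 & p.2 None = T (p_ext0 Gam (gamma (p.1 None)))].

Lemma cut_pair_ex B : wjet Om B -> exists B', cut_pair (B, B').
Proof.
move=> hB; have [_ h] := trace_restr (wjet_H1 hB); have [[[h1 _] _] _] := hT.
by have [B' hB' e] := H1_wjet (h1 _ h); exists B'.
Qed.

Lemma cut_pair_trace p : cut_pair p -> bae (fun x => gamma (p.2 None) x = p_ext0 Gam (gamma (p.1 None)) x).
Proof.
move=> [h1 h2 e]; have [_ h] := trace_restr (wjet_H1 h1); rewrite e.
exact: eqn_ae (hT.2 _ h).
Qed.

Lemma Bform_null_ae c k F B psi gpsi : good_chart Om c -> wjet Om F -> wjet Om B -> C1b psi gpsi ->
  (forall x, crad c <= `|x - cpt c| -> psi x = 0) ->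
  bae (fun x => psi x * (gamma (F None) x * gamma (B None) x) = 0) -> Bform Om c k F (mulj psi gpsi B) = 0.
Proof.
move=> gc hF hB hp s0 h; have [[[h1 _] _] _ _] := htr.
apply: (trace_null oO bO sO htr k gc hF hB hp s0).
apply: ae_fip0 h; first by have [[]] := hp.
- by have [_ [C hC]] := hp; exists C => x; exact: (hC x).1.
- exact: Hhalf_L2on (h1 _ (wjet_H1 hF)).
- exact: Hhalf_L2on (h1 _ (wjet_H1 hB)).
Qed.

Let wB A B : wjet Om A -> wjet Om B -> wjet Om (A - B).
Proof. by move=> hA hB; have := wjetP (-1) (mO) hB hA; rewrite scaleN1r addrC. Qed.

(** The trace of A - A' vanishes on [Gam] and that of B' off it, while A' has trace zero off [Gam]
    and B' - B on it. Both products of traces vanish, so A may be replaced by A', and then B' by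
    B. *)
Lemma Bform_transfer c k A A' B B' psi gpsi : good_chart Om c -> C1b psi gpsi ->
  (forall x, crad c <= `|x - cpt c| -> psi x = 0) -> cut_pair (A, A') -> cut_pair (B, B') ->
  Bform Om c k A (mulj psi gpsi B') = Bform Om c k A' (mulj psi gpsi B).
Proof.
move=> gc hp s0 hA hB; have [/= wA wA' _] := hA; have [/= wB1 wB' _] := hB.
have tA := cut_pair_trace hA; have tB := cut_pair_trace hB.
have dA := traceB_ae htr (wjet_H1 wA) (wjet_H1 wA'); have dB := traceB_ae htr (wjet_H1 wB') (wjet_H1 wB1).
have [K K0 hK] := mulj_bound (mO) hp.
have e1 : Bform Om c k (A - A') (mulj psi gpsi B') = 0.
  apply: (Bform_null_ae k gc (wB wA wA') wB' hp s0).
  apply: bae_and tB (bae_and tA dA (fun x bx h1 h2 => conj h1 h2)) _ => x bx /= -> [h1 h2].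
  by rewrite [gamma _ x]h2 h1 !p_ext0E; case: ifP => _; rewrite ?subrr ?mulr0 ?mul0r ?mulr0.
have e2 : Bform Om c k A' (mulj psi gpsi (B' - B)) = 0.
  apply: (Bform_null_ae k gc wA' (wB wB' wB1) hp s0).
  apply: bae_and tA (bae_and tB dB (fun x bx h1 h2 => conj h1 h2)) _ => x bx /= -> [h1 h2].
  by rewrite [gamma ((B' - B) None) x]h2 h1 !p_ext0E; case: ifP => _; rewrite ?subrr ?mulr0 ?mul0r ?mulr0.
move: e1; rewrite (BformBl oO)//; [|exact: wA.1|exact: wA'.1|exact: (hK _ wB'.1).1].
move=> /eqP; rewrite subr_eq0 => /eqP ->.
move: e2; rewrite mulj_sub (BformBr oO)//; [|exact: wA'.1|exact: (hK _ wB'.1).1|exact: (hK _ wB1.1).1].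
by move=> /eqP; rewrite subr_eq0 => /eqP ->.
Qed.

(** A' is a lifting of the kind that defines [Omega_2], so it and its gradient are null off
    [Omega_2]; G lives in [D_r]. What is left is the intersection, that is, the region. *)
Lemma Bform_local c k A A' G : cut_pair (A, A') -> H1dom Om G ->
  (forall x i, ~ D_r Gam r x -> G i x = 0) -> `|Bform Om c k A' G| <= 2 * (fnrm FO A' * fnrm Fo G).
Proof.
move=> hA dG G0; have [/= wA wA' e] := hA.
have oS : open (off_supp Om (A' None)) by exact: open_off_supp.
have mS := open_row_measurable oS.
have h i j : `|L2_ip mu Om (A' i) (G j)| <= fnrm FO A' * fnrm Fo G.
  apply: le_trans (@L2_local _ _ _ mu Om (off_supp Om (A' None)) om mO mS mo (A' i) (G j) _ som (wA'.1 i) (dG j) (off_supp_null oO wA' i) _) _.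
  - by move=> x [].
  - move=> x Ox nS nom; apply: G0 => Dr; apply: nom; split => //.
    exists (gamma (A None)); first by have [] := trace_restr (wjet_H1 wA).
    by rewrite -e; apply: contrapT => nSx; apply: nS.
  by apply: ler_pM; rewrite ?nrm_ge0// H1_comp_le.
rewrite mulr_natl mulr2n; case: k => [j|]; rewrite /Bform ?/Iform ?/Jform.
  exact: le_trans (ler_normB _ _) (lerD (h _ _) (h _ _)).
by apply: le_trans (ler_normD _ _) (lerD (h _ _) _); rewrite L2_ipC.
Qed.

Lemma BformP c k (a : R) F F' G : H1dom Om F -> H1dom Om F' -> H1dom Om G ->
  Bform Om c k (a *: F + F') G = a * Bform Om c k F G + Bform Om c k F' G.
Proof.
move=> d1 d2 d3.
have e i i' : L2_ip mu Om ((a *: F + F') i) (G i') = a * L2_ip mu Om (F i) (G i') + L2_ip mu Om (F' i) (G i').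
  exact: (L2_ipP (mO) a (d1 i) (d2 i) (d3 i')).
by case: k => [j|]; rewrite /Bform ?/Iform ?/Jform !e ?(L2_ipC _ _ (G None)) ?e; ring.
Qed.

Lemma chart_uniform c psi gpsi : good_chart Om c -> 2 * n.+1%:R * crad c < r -> C1b psi gpsi ->
  (forall x, crad c <= `|x - cpt c| -> psi x = 0) ->
  exists2 C, 0 <= C & forall k A p, wjet Om A -> cut_pair p ->
    `|Bform Om c k A (mulj psi gpsi p.2)| <= C * fnrm FO A * fnrm Fo p.1.
Proof.
move=> gc cr hp s0; have l0 : 0 < crad c by case: gc.
have [K K0 hK] := mulj_bound (mO) hp; have [K' K'0 hK'] := mulj_bound (mo) hp.
(* If the chart misses [Gam], the trace of the lifting is zero where psi lives and the form
   vanishes. Otherwise the whole ball of the chart is within r of the point y of [Gam]. *)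
have [[y Gy hy]|nG] := pselect (exists2 y, Gam y & `|y - cpt c| < crad c); last first.
  exists 0 => // k A [B B'] hA hB /=; rewrite (Bform_null_ae k gc hA _ hp s0) ?normr0 ?mul0r//; first by case: hB.
  apply: bae_imp (cut_pair_trace hB) _ => x bx /= ->; rewrite p_ext0E; case: ifPn => [/set_mem Gx|_]; last by rewrite !mulr0.
  by rewrite s0 ?mul0r// leNgt; apply/negP => h; apply: nG; exists x.
have gv i x : crad c <= `|x - cpt c| -> gpsi i x = 0.
  have [[_ cg _] _] := hp; apply: (vanish_closure (cg i) l0); exact: (grad_vanish hp.1 s0).
have Dr x : `|x - cpt c| < crad c -> D_r Gam r x.
  move=> hx; exists y => //; apply: le_lt_trans (enorm_le _) _; apply: le_lt_trans cr.
  have h : `|x - y| <= 2 * crad c.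
    have := ler_normD (x - cpt c) (cpt c - y); rewrite subrKA (distrC (cpt c)); move: hx hy; lra.
  rewrite [in leRHS]mulrAC [leRHS]mulrC; apply: ler_pM => //; by rewrite ler_nat.
suff H k : exists C, 0 <= C /\ forall A p, wjet Om A -> cut_pair p ->
    `|Bform Om c k A (mulj psi gpsi p.2)| <= C * fnrm FO A * fnrm Fo p.1.
  have [C hC] := choice H; exists (\sum_k C k); first by apply: sumr_ge0 => k _; exact: (hC k).1.
  move=> k A p hA hB; apply: le_trans ((hC k).2 A p hA hB) _.
  rewrite ler_wpM2r ?nrm_ge0// ler_wpM2r ?nrm_ge0// (bigD1 k)//= lerDl.
  by apply: sumr_ge0 => i _; exact: (hC i).1.
pose W := {p : jets * jets | cut_pair p}.
have dp (w : W) : H1dom Om (mulj psi gpsi (sval w).2) by have [_ h _] := svalP w; exact: (hK _ h.1).1.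
have [||||||||C C0 hC] := @uniform_boundedness R jets FO (n.+1%:R * 2) (wjet Om) _ _ _ _ W
   (fun w => fnrm Fo (sval w).1) (fun w A => Bform Om c k A (mulj psi gpsi (sval w).2)).
- by move=> A [].
- by move=> a A A' hA hA'; exact: (wjetP a (mO) hA hA').
- split; first exact: (dom0 FO).
  move=> i phi _; rewrite /=; have z (h : pt -> R) : \int[mu]_(x in Om) (0 * h x) = 0.
    by under eq_Rintegral do rewrite mul0r; rewrite Rintegral_cst// ?mul0r//; exact: (mO).
  by rewrite (z (partial i phi)) (z phi) oppr0.
- by move=> A d wA hA; exact: (H1_complete finO wA hA).
- by move=> w; exact: nrm_ge0.
- by move=> w a A A' hA hA'; apply: BformP; [exact: hA.1|exact: hA'.1|exact: dp].
- move=> w; exists (2 * fnrm FO (mulj psi gpsi (sval w).2)); first by rewrite mulr_ge0// nrm_ge0.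
  by move=> A hA; rewrite -mulrA [X in 2 * X]mulrC; apply: (Bform_bound oO c k hA.1 (dp w)).
(* The pointwise bound: S is moved onto A. The constant involves the norm of A', for which no
   estimate in terms of A is available at this stage. *)
- move=> A hA; have [A' hA'] := cut_pair_ex hA.
  exists (2 * (fnrm FO A' * K')); first by rewrite mulr_ge0// mulr_ge0// nrm_ge0.
  move=> [[B B'] hB] /=; have [/= wB1 _ _] := hB.
  rewrite (Bform_transfer k gc hp s0 hA' hB).
  apply: le_trans (Bform_local c k hA' (hK _ wB1.1).1 _) _.
    move=> x i nD; have hx : crad c <= `|x - cpt c| by rewrite leNgt; apply/negP => /Dr.
    by case: i => [i|] /=; rewrite s0// ?gv// !mul0r ?addr0.
  rewrite -!mulrA ler_wpM2l// ler_wpM2l ?nrm_ge0//.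
  by apply: (hK' _ _).2 => i; exact: (L2on_sub (mO) (mo) som (wB1.1 i)).
exists C; split => // A p hA hB; exact: (hC (exist _ p hB) A hA).
Qed.

End estimate.

Section regional_estimate.
Context {R : realType} (n : nat).
Local Notation pt := 'rV[R]_n.
Local Notation mu := (lebesgue_row n : {measure set pt -> \bar R}).
Local Notation sigma := (@surface_measure R n).
Local Notation chart := (@chart R n).
Local Notation jets := (@jets R n).
Implicit Types (x y z : pt) (f g u v psi : pt -> R) (gf gg gpsi : 'I_n -> pt -> R) (A B F G : jets).
Variables (Om Gam : set pt) (r : R) (gamma T : (pt -> R) -> pt -> R).
Hypotheses (oO : open Om) (bO : bounded_set Om) (sO : smooth_boundary Om).
Hypotheses (htr : is_trace Om gamma) (hT : is_trace_lifting Om gamma T).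
Hypotheses (GB : Gam `<=` boundary Om) (mG : measurable (Gam : set (@surface_space R n))).
Hypothesis hext : forall zb, Hhalf Gam zb -> Hhalf (boundary Om) (p_ext0 Gam zb).
Hypothesis r0 : 0 < r.
Local Notation om := (omega_r Om Gam T r).
Hypotheses (oom : open om) (som : om `<=` Om).
Local Notation mO := (open_row_measurable oO).
Local Notation mo := (open_row_measurable oom).
Local Notation FO := (H1form mO).
Local Notation Fo := (H1form mo).
Local Notation cut_pair := (cut_pair Om Gam gamma T).

(** What the cutoffs of the charts leave of the constant 1. In product form it is peeled chart by
    chart, and it vanishes wherever the half-size charts reach. *)
Definition rem (cs : seq chart) x : R := foldr (fun c t => (1 - cutoff (cpt c) (crad c) x) * t) 1 cs.

Lemma rem0 cs x : (exists2 c, List.In c cs & `|x - cpt c| < crad c / 2) -> (forall c, List.In c cs -> 0 < crad c) -> rem cs x = 0.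
Proof.
elim: cs => [|c cs ih] [c' /= hc' h] pc //; case: hc' => [e|hc'].
  by rewrite e cutoff1 ?ltW ?subrr ?mul0r//; apply: pc; left.
rewrite ih ?mulr0//; first by exists c'.
by move=> d hd; apply: pc; right.
Qed.

(* summing the chart extensions over a partition of unity *)
Lemma chart_sum cs : (forall c, List.In c cs -> good_chart Om c /\ 2 * n.+1%:R * crad c < r) ->
  forall psi gpsi, C1b psi gpsi -> exists2 C, 0 <= C & forall p e, cut_pair p -> 0 < e ->
  exists2 d, 0 < d & forall f gf, is_grad f gf -> H1dom Om (jet f gf) -> fnrm FO (jet f gf - p.2) <= d ->
  exists V gV, [/\ is_grad V gV, H1dom Om (jet V gV),
    forall x, boundary Om x -> V x = (psi x - psi x * rem cs x) * f x &
    fnrm FO (jet V gV) <= C * Num.sqrt (fnrm FO p.2 * fnrm Fo p.1) + e].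
Proof.
elim: cs => [|c cs ih] hcs psi gpsi hp.
  exists 0 => // p e hP e0; exists 1 => // f gf _ _ _; exists (fun=> 0), (fun _ _ => 0).
  have z : jet (fun=> 0 : R) (fun _ _ => 0) = (0 : jets) by apply/funext => -[i|].
  split; [exact: is_grad_cst|by rewrite z; exact: (dom0 FO)|by move=> x _; rewrite /rem /= mulr1 subrr mul0r|].
  by rewrite z nrm0 mul0r add0r ltW.
have [gc cr] := hcs c (or_introl erefl); have l0 : 0 < crad c by case: gc.
set th := cutoff (cpt c) (crad c); set gth := gcutoff (cpt c) (crad c).
have hth : C1b th gth by apply: C1c_C1b; exact: cutoff_C1c.
have [C2 C20 hC2] := ih (fun d hd => hcs d (or_intror hd)) _ _ (C1bM hp (C1b_compl hth)).
pose eta x := psi x * th x; pose geta : 'I_n -> pt -> R := fun i x => psi x * gth i x + th x * gpsi i x.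
have heta : C1b eta geta := C1bM hp hth.
have s0 x : crad c <= `|x - cpt c| -> eta x = 0 by move=> h; rewrite /eta /th cutoff0 ?mulr0.
have s0' x : 2 * crad c < `|x - cpt c| -> eta x = 0 by move=> h; apply: s0; move: h l0; lra.
have [C1 C10 hC1] := chart_uniform oO bO sO htr hT GB mG hext oom som gc cr heta s0.
have [K K0 hK] := chart_extension oO gc; have [K' K'0 hK'] := mulj_bound (mO) heta.
have C0 : 0 <= K * C1 * K' by rewrite !mulr_ge0.
exists (C2 + Num.sqrt (K * C1 * K')); first by rewrite addr_ge0// sqrtr_ge0.
move=> p e hP e0; have [wp1 wp2 _] := hP.
set sn := fnrm FO p.2; set b := fnrm Fo p.1.
have sn0 : 0 <= sn := nrm_ge0 _ _; have b0 : 0 <= b := nrm_ge0 _ _.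
have e2 : 0 < e / 2 by rewrite divr_gt0.
have [d2 d20 hd2] := hC2 p _ hP e2.
pose e1 := e / 4; have e10 : 0 < e1 by rewrite divr_gt0.
(* Coefficient of the approximation error d1 in the energy of the present chart, for d1 <= 1; the
   choice of d1 keeps the total error below e1^2. *)
pose D0 := K * (2 * K' * (K' * (sn + 1)) + C1 * b * K').
have D00 : 0 <= D0.
  by apply: mulr_ge0 => //; apply: addr_ge0; rewrite !mulr_ge0// addr_ge0.
have D01 : 0 < D0 + 1 by rewrite ltr_wpDl.
have e1q : 0 < e1 ^+ 2 by rewrite exprn_gt0.
pose d1 := Num.min 1 (e1 ^+ 2 / (D0 + 1)).
have d10 : 0 < d1 by rewrite lt_min ltr01 divr_gt0.
have d11 : d1 <= 1 by rewrite ge_min lexx.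
have d1D : d1 * D0 <= e1 ^+ 2.
  apply: (@le_trans _ _ (e1 ^+ 2 / (D0 + 1) * D0)); first by rewrite ler_wpM2r// ge_min lexx orbT.
  by apply: frac_le => //; exact: ltW.
exists (Num.min d1 d2); first by rewrite lt_min d10.
move=> f gf hf df; rewrite le_min => /andP[h1 h2].
have [V2 [gV2 [g2 dV2 bV2 nV2]]] := hd2 f gf hf df h2.
pose a x := eta x * f x; pose ga : 'I_n -> pt -> R := fun i x => eta x * gf i x + f x * geta i x.
have [ha _ _] : [/\ C1c a ga, insupp c a & forall i, insupp c (ga i)] by exact: (mulj_C1c heta s0' hf).
have ja : jet a ga = mulj eta geta (jet f gf) by rewrite mulj_jet.
have dd := @domB _ _ FO _ _ df wp2.1.
have [dmf nmf] := hK' _ df; have [dmp nmp] := hK' _ wp2.1; have [dmd nmd] := hK' _ dd.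
have M00 : 0 <= C1 * b + 2 * K' * d1 by rewrite addr_ge0 ?mulr_ge0// ltW.
have hM k (A : pt -> R) gA : C1c A gA -> `|Bform Om c k (jet A gA) (jet a ga)| <= (C1 * b + 2 * K' * d1) * fnrm FO (jet A gA).
  move=> hA; have dA : H1dom Om (jet A gA).
    by move=> [i|]; [exact: (@C1c_L2_grad _ _ _ _ _ i (mO) hA)|exact: (C1c_L2 (mO) hA)].
  have wA := C1_wjet (mO) hA.1 dA.
  have -> : Bform Om c k (jet A gA) (jet a ga) = Bform Om c k (jet A gA) (mulj eta geta p.2) +
      Bform Om c k (jet A gA) (mulj eta geta (jet f gf - p.2)).
    by rewrite ja mulj_sub (BformBr oO)//; ring.
  apply: le_trans (ler_normD _ _) _; rewrite mulrDl; apply: lerD.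
    by apply: le_trans (hC1 k _ _ wA hP) _; rewrite -/b mulrAC.
  apply: le_trans (Bform_bound oO c k dA dmd) _; rewrite -!mulrA ler_wpM2l// mulrCA [leRHS]mulrA mulrC.
  by rewrite ler_wpM2r ?nrm_ge0//; apply: le_trans nmd _; rewrite mulrC ler_wpM2r.
have sa x : crad c <= `|x - cpt c| -> a x = 0 by move=> h; rewrite /a s0// mul0r.
have [V1 [gV1 [hV1 bV1 nV1]]] := hK a ga _ _ ha sa M00 hM e1q.
have dV1 : H1dom Om (jet V1 gV1).
  by move=> [i|]; [exact: (@C1c_L2_grad _ _ _ _ _ i (mO) hV1)|exact: (C1c_L2 (mO) hV1)].
exists (fun x => V1 x + V2 x), (fun i x => gV1 i x + gV2 i x).
have E : jet (fun x => V1 x + V2 x) (fun i x => gV1 i x + gV2 i x) = jet V1 gV1 + jet V2 gV2.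
  by apply/funext => -[i|].
split; first exact: is_gradD hV1.1 g2.
- by rewrite E; exact: (@domD _ _ FO _ _ dV1 dV2).
- by move=> x bx; rewrite bV1// bV2// /a /eta /rem /= -/(rem cs x) -/th; ring.
rewrite E; apply: le_trans (@nrmD _ _ FO _ _ dV1 dV2) _.
set q := Num.sqrt (sn * b).
have q0 : 0 <= q := sqrtr_ge0 _.
pose X := Num.sqrt (K * C1 * K') * q.
have X0 : 0 <= X by rewrite mulr_ge0// sqrtr_ge0.
have XX : X ^+ 2 = K * C1 * K' * (sn * b).
  by rewrite exprMn !sqr_sqrtr// mulr_ge0.
have nf : fnrm FO (jet a ga) <= K' * (sn + d1).
  rewrite ja; apply: le_trans nmf _; rewrite ler_wpM2l//.
  have := @nrmD _ _ FO _ _ wp2.1 dd; rewrite addrC subrK => /le_trans; apply.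
  by rewrite lerD2l.
have n1 : fnrm FO (jet V1 gV1) ^+ 2 <= X ^+ 2 + 2 * e1 ^+ 2.
  apply: le_trans nV1 _; rewrite XX.
  have h3 : (C1 * b + 2 * K' * d1) * fnrm FO (jet a ga) <= (C1 * b + 2 * K' * d1) * (K' * (sn + d1)) by rewrite ler_wpM2l.
  have h4 : K * ((C1 * b + 2 * K' * d1) * (K' * (sn + d1))) <= K * C1 * K' * (sn * b) + d1 * D0.
    have -> : K * ((C1 * b + 2 * K' * d1) * (K' * (sn + d1))) =
       K * C1 * K' * (sn * b) + d1 * (K * (2 * K' * (K' * (sn + d1)) + C1 * b * K')) by ring.
    rewrite lerD2l ler_wpM2l ?(ltW d10)// /D0 ler_wpM2l// lerD2r ler_wpM2l ?mulr_ge0// ler_wpM2l//.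
    by rewrite lerD2l.
  by have := ler_wpM2l K0 h3; move: h4 d1D; lra.
have n1' : fnrm FO (jet V1 gV1) <= X + e / 2.
  have e1h : e / 2 = 2 * e1 by rewrite /e1; lra.
  have h5 : 0 <= X + e / 2 by rewrite addr_ge0// ltW.
  have := nrm_ge0 FO (jet V1 gV1) => h6.
  rewrite -(ger0_norm h6) -(ger0_norm h5) -!sqrtr_sqr ler_wsqrtr//; apply: le_trans n1 _.
  rewrite sqrrD e1h exprMn; have : 0 <= X * (2 * e1) *+ 2 by rewrite mulrn_wge0// mulr_ge0// mulr_ge0// ltW.
  move: e1q; lra.
have := lerD n1' nV2; rewrite -/sn -/b -/q => /le_trans; apply.
rewrite /X mulrDl; have := splitr e; lra.
Qed.

Lemma regional_trace_bound : exists2 C, 0 <= C & forall B, wjet Om B ->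
  snorm (Hhalf Gam) (gamma (B None)) <= C * fnrm Fo B.
Proof.
have [cs [hcs cover]] := good_charts oO bO sO r0.
have [C C0 hC] := chart_sum hcs (@C1b_cst R n 1).
have [Cg Cg0 hCg] := trace_bound oO htr.
have [[_ [CT hCT]] _] := hT.
pose D := (Cg * C) ^+ 2 * `|CT|.
have D0 : 0 <= D by rewrite mulr_ge0// exprn_ge0// mulr_ge0.
exists D => // B hB; have [B' hp] := cut_pair_ex htr hT GB mG hext hB.
have [/= _ wB' eB'] := hp.
have [hG hE] := trace_restr htr GB mG hext (wjet_H1 hB).
set gB := p_ext0 Gam (gamma (B None)) in eB' hE.
have mBd : measurable (boundary Om : set (@surface_space R n)) := borel_surface (@measurable_boundary R n Om).
pose N := snorm (Hhalf (boundary Om)) gB.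
have N0 : 0 <= N by exact: sqrtr_ge0.
have NG : snorm (Hhalf Gam) (gamma (B None)) <= N.
  have mg : measurable_fun (Gam : set (@surface_space R n)) (gamma (B None)) by case: hG.
  apply: (@Hhalf_snorm_le _ _ Gam (boundary Om) set0 gB (gamma (B None)) measurable0 _ GB mG mg hE _).2; first exact: measure0.
  by move=> x Gx _; rewrite /gB p_ext0E mem_set.
apply: le_trans NG _.
set s := fnrm FO B'; set b := fnrm Fo B.
have s0 : 0 <= s := nrm_ge0 _ _; have b0 : 0 <= b := nrm_ge0 _ _.
have sN : s <= `|CT| * N.
  rewrite /s -(wjet_snorm (mO) oO wB') eB'; apply: le_trans (hCT _ hE) _.
  by rewrite ler_wpM2r// ler_norm.
have key : N <= Cg * (C * Num.sqrt (s * b)).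
  apply/ler_addgt0Pr => e e0.
  have C1 : 0 < Cg + 1 by rewrite ltr_wpDl.
  pose e1 := e / (Cg + 1) / 2.
  have e10 : 0 < e1 by rewrite !divr_gt0.
  have [d d0 hd] := hC _ _ hp e10.
  have m0 : 0 < Num.min d e1 by rewrite lt_min d0.
  have [f [gf [hf df]]] := density oO bO sO wB' m0; rewrite le_min => /andP[nf1 nf2].
  have [V [gV [hV dV bV nV]]] := hd f gf hf df nf1.
  have wf := C1_wjet (mO) hf df; have wV := C1_wjet (mO) hV dV.
  pose h x := f x - V x; pose gh : 'I_n -> pt -> R := fun i x => gf i x - gV i x.
  have hh : is_grad h gh := is_gradB hf hV.
  have jh : jet h gh = jet f gf - jet V gV by apply/funext => -[i|].
  have dh : H1dom Om (jet h gh) by rewrite jh; exact: (@domB _ _ FO _ _ df dV).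
  have wh := C1_wjet (mO) hh dh.
  (* h = f - V is C^1 and zero on the boundary, so U keeps the trace of B'. As f is close to B', the
     norm of U is close to that of V, and hence bounded by the energy estimate. *)
  pose U := B' - jet h gh.
  have wU : wjet Om U by have := wjetP (-1) (mO) wh wB'; rewrite scaleN1r addrC.
  have h0 x : boundary Om x -> h x = 0.
    move=> bx; rewrite /h bV// rem0 ?mulr0 ?subr0 ?mul1r ?subrr//; first exact: cover.
    by move=> c /hcs[[]].
  have nU : fnrm FO U <= C * Num.sqrt (s * b) + 2 * e1.
    have -> : U = (B' - jet f gf) + jet V gV by rewrite /U jh opprB addrA addrAC.
    apply: le_trans (@nrmD _ _ FO _ _ (@domB _ _ FO _ _ wB'.1 df) dV) _.
    by rewrite (@nrm_distC _ _ FO _ _ wB'.1 df); move: nf2 nV; rewrite -/s -/b /=; lra.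
  have [N1 [mN1 zN1 hN1]] : bae Om (fun x => gB x = gamma (U None) x).
    apply: bae_and (cut_pair_trace htr hT GB mG hext hp) (bae_and (traceB_ae htr (wjet_H1 wB') (wjet_H1 wh))
      (trace_C1_ae oO htr hh dh) (fun x bx h1 h2 => conj h1 h2)) _ => x bx /= h1 [h2 h3].
    by rewrite [RHS]h2 h1 [gamma h x]h3 h0// subr0.
  have [[[hg _] _] _ _] := htr.
  have mgB : measurable_fun (boundary Om : set (@surface_space R n)) gB by case: hE.
  have [_ le1] := @Hhalf_snorm_le _ _ (boundary Om) (boundary Om) N1 (gamma (U None)) gB mN1 zN1
     (@subset_refl _ _) mBd mgB (hg _ (wjet_H1 wU)) hN1.
  apply: le_trans le1 _; apply: le_trans (hCg _ wU) _.
  apply: le_trans (ler_wpM2l Cg0 nU) _; rewrite mulrDr lerD2l.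
  rewrite /e1 [2 * _]mulrC divfK// mulrC; apply: frac_le => //; exact: ltW.
have sq0 : 0 <= s * b by rewrite mulr_ge0.
have N2 : N ^+ 2 <= (Cg * C) ^+ 2 * (s * b).
  rewrite -(sqr_sqrtr sq0) -exprMn -mulrA lerXn2r// nnegrE !mulr_ge0// sqrtr_ge0.
have N3 : N * N <= D * b * N.
  rewrite -expr2; apply: le_trans N2 _.
  have -> : D * b * N = (Cg * C) ^+ 2 * (`|CT| * N * b) by rewrite /D; ring.
  by rewrite ler_wpM2l ?exprn_ge0 ?mulr_ge0// ler_wpM2r.
(* The estimate is quadratic in N, since the norm of the lifting B' is itself bounded by N; a factor
   N is cancelled. *)
have [N00|Nn0] := eqVneq N 0; first by rewrite N00 mulr_ge0.
by move: N3; rewrite ler_pM2r// lt_def Nn0.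
Qed.

End regional_estimate.

(** The estimate for z minus the lifting of zb, brought to the representatives used in the
    definitions of controllability: [gamma] and [T] are linear only up to null functions, so the
    boundary values agree off a null set of the surface. *)
Lemma boundary_state {R : realType} (n : nat) (Om Gam : set 'rV[R]_n) (r : R)
    (gamma T : ('rV[R]_n -> R) -> 'rV[R]_n -> R) :
  open Om -> bounded_set Om -> smooth_boundary Om -> is_trace Om gamma -> is_trace_lifting Om gamma T ->
  Gam `<=` boundary Om -> measurable (Gam : set (@surface_space R n)) ->
  (forall zb, Hhalf Gam zb -> Hhalf (boundary Om) (p_ext0 Gam zb)) -> 0 < r ->
  open (omega_r Om Gam T r) -> omega_r Om Gam T r `<=` Om ->
  exists2 C, 0 <= C & forall zb, Hhalf Gam zb -> H1 (omega_r Om Gam T r) (T (p_ext0 Gam zb)) /\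
    forall z, H1 Om z -> Hhalf Gam (p_restr Gam (gamma z) - zb) /\
      snorm (Hhalf Gam) (p_restr Gam (gamma z) - zb) <=
      C * snorm (H1 (omega_r Om Gam T r)) (p_restr (omega_r Om Gam T r) z - T (p_ext0 Gam zb)).
Proof.
move=> oO bO sO htr hT GB mG hext r0 oom som; set om := omega_r _ _ _ _ in oom som *.
have [C C0 hC] := regional_trace_bound oO bO sO htr hT GB mG hext r0 oom som.
have mO := open_row_measurable oO; have mo := open_row_measurable oom.
exists C => // zb hzb; have hg := hext _ hzb.
have [[[hT1 _] _] hT2] := hT; have [V wV eV] := H1_wjet (hT1 _ hg).
have wVo := wjet_sub mo mO som wV.
split=> [|z hz]; first by rewrite -eV; exact: wjet_H1.
have [Z wZ eZ] := H1_wjet hz.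
have wW : wjet Om (Z - V) by have := wjetP (-1) mO wV wZ; rewrite scaleN1r addrC.
have wWo := wjet_sub mo mO som wW.
have mB := borel_surface (@measurable_boundary R n Om).
pose g := gamma ((Z - V) None).
have [[[hg1 _] _] _ _] := htr.
have [hgG hgE] := trace_restr htr GB mG hext (wjet_H1 wW).
have [hzG _] := trace_restr htr GB mG hext hz.
have mg' : measurable_fun (Gam : set (@surface_space R n)) (p_restr Gam (gamma z) - zb).
  apply: measurable_funB; last by case: hzb.
  have h : measurable_fun (Gam : set (@surface_space R n)) (gamma z) by case: hzG.
  by apply: eq_measurable_fun h => x Gx; rewrite /p_restr patchE Gx.
have [N [mN zN hN]] : bae Om (fun x => g x = gamma z x - p_ext0 Gam zb x).
  apply: bae_and (traceB_ae htr (wjet_H1 wZ) (wjet_H1 wV)) (eqn_ae (hT2 _ hg)) _ => x bx h1 h2.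
  by rewrite -h2 -eV -eZ.
have gE (x : 'rV[R]_n) : Gam x -> ~ N x -> (p_restr Gam (gamma z) - zb) x = g x.
  move=> Gx nN; have bx : boundary Om x := GB x Gx.
  by rewrite (hN x bx nN) p_ext0E mem_set// !fctE /p_restr patchE mem_set.
have [|h1 h2] := @Hhalf_snorm_le _ _ Gam Gam N g (p_restr Gam (gamma z) - zb) mN zN (@subset_refl _ _) mG mg' hgG.
  by move=> x Gx nN; exact: gE.
split=> //; apply: le_trans h2 _; apply: le_trans (hC _ wW) _; rewrite ler_wpM2l//.
(* [p_restr om z] is zero off the region, so it is no Sobolev function of [Om]; this jet agrees with
   Z - V on the region, and the norm sees nothing else. *)
pose W' : @jets R n := fun k => if k is Some i then (Z - V) (Some i) else p_restr om z - T (p_ext0 Gam zb).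
have eW x : om x -> forall k, W' k x = (Z - V) k x.
  by move=> ox [i|] //=; rewrite !fctE /p_restr patchE mem_set// -eZ -eV.
have wW' : wjet om W'.
  split; first by apply: H1dom_eq wWo.1 => x ox k; rewrite eW.
  move=> i phi hphi; have := wWo.2 i phi hphi => /= h.
  by rewrite -h; apply: eq_Rintegral => x /set_mem ox; congr (_ * _); exact: (eW x ox None).
rewrite (_ : p_restr om z - _ = W' None)// (wjet_snorm mo oom wW').
by rewrite (_ : fnrm _ W' = fnrm (H1form mo) (Z - V))//; apply: H1_nrm_eq => x ox k; exact: eW.
Qed.

Theorem theorem5p1 (R : realType) (n p : nat) (Om Gam : set 'rV[R]_n)
    (b alpha r : R)
    (domA : set ('rV[R]_n -> R)) (A : ('rV[R]_n -> R) -> 'rV[R]_n -> R)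
    (Phi K : R -> ('rV[R]_n -> R) -> 'rV[R]_n -> R)
    (B : 'rV[R]_p -> 'rV[R]_n -> R) (z0 : 'rV[R]_n -> R)
    (z : R -> (R -> 'rV[R]_p) -> 'rV[R]_n -> R)
    (gamma T : ('rV[R]_n -> R) -> 'rV[R]_n -> R) :
  (0 < n)%N ->
  open Om -> bounded_set Om -> smooth_boundary Om ->
  0 < b -> 0 < alpha <= 1 ->
  c0_semigroup (H1 Om) Phi ->
  is_generator (H1 Om) domA A Phi ->
  is_fractional_family (H1 Om) alpha Phi K ->
  H1 Om z0 ->
  linear_op (euclidean p) (H1 Om) B ->
  (forall u, L2_control b u -> mild_state (H1 Om) alpha K B z0 u b (z b u)) ->
  is_trace Om gamma ->
  is_trace_lifting Om gamma T ->
  Gam `<=` boundary Om ->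
  measurable (Gam : set (@surface_space R n)) ->
  (forall zb, Hhalf Gam zb -> Hhalf (boundary Om) (p_ext0 Gam zb)) ->
  0 < r ->
  is_region Om (omega_r Om Gam T r) ->
  (exactly_regionally_controllable b z (omega_r Om Gam T r) ->
   exactly_boundary_controllable b z gamma Gam) /\
  (approximately_regionally_controllable b z (omega_r Om Gam T r) ->
   approximately_boundary_controllable b z gamma Gam).
Proof.
move=> _ oO bO sO _ _ _ _ _ _ _ hz htr hT GB mG hext r0 [oom som _].
have [C C0 hC] := boundary_state oO bO sO htr hT GB mG hext r0 oom som.
split=> ctrl zb hzb; have [hyb hB] := hC _ hzb.
  have [u hu [_ e0]] := ctrl _ hyb; exists u => //.
  have [hzu _] := hz _ hu; have [h1 h2] := hB _ hzu; split => //.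
  by apply/eqP; rewrite eq_le sqrtr_ge0 andbT; move: h2; rewrite e0 mulr0.
(* C may be zero, so the tolerance asked of the region is eps / (C + 1). *)
move=> eps eps0; have C1 : 0 < C + 1 by rewrite ltr_wpDl.
have [u hu e0] := ctrl _ hyb _ (divr_gt0 eps0 C1); exists u => //.
have [hzu _] := hz _ hu; have [_ h2] := hB _ hzu; apply: le_trans h2 _.
apply: le_trans (ler_wpM2l C0 e0) _; rewrite mulrC; apply: frac_le => //; exact: ltW.
Qed.
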